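(* Let $T>0$, let $\Omega\subset\mathbb{R}^N$, $N=2,3$, be a bounded smooth domain, and let $\mu>0$, $\eta\ge 0$. Suppose the pressure $p$ satisfies $$p\in C[0,\infty)\cap C^2(0,\infty),\quad p(0)=0,\quad p'(\varrho)>0 \text{ for } \varrho>0,\quad \liminf_{\varrho\to\infty}p'(\varrho)>0,\quad \liminf_{\varrho\to\infty}\frac{P(\varrho)}{p(\varrho)}>0,$$ where $P(\varrho)=\varrho\int_1^\varrho \frac{p(z)}{z^2}\,dz$. Let $\{\nu_{t,x},\mathcal{D}\}$ be a dissipative measure-valued solution (as defined in the context) of the barotropic Navier-Stokes system in $(0,T)\times\Omega$ with initial state $\nu_0=\{\nu_{0,x}\}_{x\in\Omega}$ and dissipation defect $\mathcal{D}$, and write $\mathbf{u}(t,x)=\langle\nu_{t,x};\mathbf{v}\rangle$. Let $[r,\mathbf{U}]$ be a strong solution of the barotropic Navier-Stokes system $$\partial_t r+\mathrm{div}_x(r\mathbf{U})=0,\qquad \partial_t(r\mathbf{U})+\mathrm{div}_x(r\mathbf{U}\otimes\mathbf{U})+\nabla_x p(r)=\mathrm{div}_x\mathbb{S}(\nabla_x\mathbf{U}),\qquad \mathbf{U}|_{\partial\Omega}=0$$ in $(0,T)\times\Omega$ belonging to the class $$r,\ \nabla_x r,\ \mathbf{U},\ \nabla_x\mathbf{U}\in C([0,T]\times\overline{\Omega}),\quad \partial_t\mathbf{U}\in L^2(0,T;C(\overline{\Omega};\mathbb{R}^N)),\quad r>0,\quad \mathbf{U}|_{\partial\Omega}=0.$$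 Then there is a constant $\Lambda=\Lambda(T)$, depending (for the fixed data $\Omega$, $p$, $\mu$, $\eta$ and the constant $c_P$ in the definition of dissipative measure-valued solution) only on the norms of $r$, $r^{-1}$, $\mathbf{U}$ in the aforementioned spaces and on the $L^1(0,T)$ norms of the functions $\chi$ and $\xi$ from the definition of dissipative measure-valued solution, such that $$\int_\Omega\Big\langle\nu_{\tau,x};\tfrac12 s|\mathbf{v}-\mathbf{U}(\tau,x)|^2+P(s)-P'(r(\tau,x))(s-r(\tau,x))-P(r(\tau,x))\Big\rangle dx+\int_0^\tau\int_\Omega|\nabla_x\mathbf{u}-\nabla_x\mathbf{U}|^2\,dx\,dt+\mathcal{D}(\tau)$$ $$\le\Lambda(T)\int_\Omega\Big\langle\nu_{0,x};\tfrac12 s|\mathbf{v}-\mathbf{U}(0,x)|^2+P(s)-P'(r(0,x))(s-r(0,x))-P(r(0,x))\Big\rangle dx$$ for a.a. $\tau\in(0,T)$. In particular, if the initial states coincide, i.e. $\nu_{0,x}=\delta_{[r(0,x),\mathbf{U}(0,x)]}$ for a.a. $x\in\Omega$, then $\mathcal{D}=0$ and $$\nu_{\tau,x}=\delta_{[r(\tau,x),\mathbf{U}(\tau,x)]}\quad\text{for a.a. }\tau\in(0,T),\ x\in\Omega.$$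
   Context: The Newtonian viscous stress is $\mathbb{S}(\nabla_x\mathbf{u})=\mu\left(\nabla_x\mathbf{u}+\nabla_x^t\mathbf{u}-\frac23\mathrm{div}_x\mathbf{u}\,\mathbb{I}\right)+\eta\,\mathrm{div}_x\mathbf{u}\,\mathbb{I}$ with $\mu>0$, $\eta\ge0$. The barotropic Navier-Stokes system is $\partial_t\varrho+\mathrm{div}_x(\varrho\mathbf{u})=0$, $\partial_t(\varrho\mathbf{u})+\mathrm{div}_x(\varrho\mathbf{u}\otimes\mathbf{u})+\nabla_xp(\varrho)=\mathrm{div}_x\mathbb{S}(\nabla_x\mathbf{u})$, $\mathbf{u}|_{\partial\Omega}=0$. Notation: $\mathcal{P}(X)$ denotes probability measures on $X$, $\mathcal{M}(\overline\Omega)$ denotes (signed, possibly vector- or matrix-valued) Radon measures on $\overline\Omega$, $L^\infty_{\rm weak}$ denotes weakly-( * ) measurable, essentially bounded maps. Points of $[0,\infty)\times\mathbb{R}^N$ are written $(s,\mathbf{v})$ ($s$ is the dummy variable for density, $\mathbf{v}$ for velocity), and $\langle\nu;F(s,\mathbf{v})\rangle=\int F\,d\nu$. $P(0)$ is understood as $0$. Definition (dissipative measure-valued solution). A parameterized measure $\nu=\{\nu_{t,x}\}_{(t,x)\in(0,T)\times\Omega}\in L^\infty_{\rm weak}((0,T)\times\Omega;\mathcal{P}([0,\infty)\times\mathbb{R}^N))$, with $\varrho:=\langle\nu_{t,x};s\rangle$, $\mathbf{u}:=\langle\nu_{t,x};\mathbf{v}\rangle$, is a dissipative measure-valued solution of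 the barotropic Navier-Stokes system in $(0,T)\times\Omega$ with initial condition $\nu_0=\{\nu_{0,x}\}_{x\in\Omega}$ (a parameterized probability measure on $[0,\infty)\times\mathbb{R}^N$) and dissipation defect $\mathcal{D}\in L^\infty(0,T)$, $\mathcal{D}\ge0$, if the following hold (all integrands being tacitly assumed measurable and integrable): (1) Continuity equation: there exist a measure $r^C\in L^1([0,T];\mathcal{M}(\overline\Omega))$ ($\mathbb{R}^N$-valued) and $\chi\in L^1(0,T)$ such that for a.a. $\tau\in(0,T)$ and every $\psi\in C^1([0,T]\times\overline\Omega)$, $|\langle r^C(\tau);\nabla_x\psi\rangle|\le\chi(\tau)\mathcal{D}(\tau)\|\psi\|_{C^1(\overline\Omega)}$ and $$\int_\Omega\langle\nu_{\tau,x};s\rangle\psi(\tau,\cdot)dx-\int_\Omega\langle\nu_{0,x};s\rangle\psi(0,\cdot)dx=\int_0^\tau\int_\Omega\big[\langle\nu_{t,x};s\rangle\partial_t\psi+\langle\nu_{t,x};s\mathbf{v}\rangle\cdot\nabla_x\psi\big]dx\,dt+\int_0^\tau\langle r^C;\nabla_x\psi\rangle dt.$$ (2) Momentum equation: $\mathbf{u}\in L^2(0,T;W^{1,2}_0(\Omega;\mathbb{R}^N))$, and there exist a measure $r^M\in L^1([0,T];\mathcal{M}(\overline\Omega))$ ($\mathbb{R}^{N\times N}$-valued) and $\xi\in L^1(0,T)$ such that for a.a. $\tau\in(0,T)$ and every $\varphi\in C^1([0,T]\times\overline\Omega;\mathbb{R}^N)$ with $\varphi|_{\partial\Omega}=0$,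 $|\langle r^M(\tau);\nabla_x\varphi\rangle|\le\xi(\tau)\mathcal{D}(\tau)\|\varphi\|_{C^1(\overline\Omega)}$ and $$\int_\Omega\langle\nu_{\tau,x};s\mathbf{v}\rangle\cdot\varphi(\tau,\cdot)dx-\int_\Omega\langle\nu_{0,x};s\mathbf{v}\rangle\cdot\varphi(0,\cdot)dx=\int_0^\tau\int_\Omega\big[\langle\nu_{t,x};s\mathbf{v}\rangle\cdot\partial_t\varphi+\langle\nu_{t,x};s(\mathbf{v}\otimes\mathbf{v})\rangle:\nabla_x\varphi+\langle\nu_{t,x};p(s)\rangle\mathrm{div}_x\varphi\big]dx\,dt-\int_0^\tau\int_\Omega\mathbb{S}(\nabla_x\mathbf{u}):\nabla_x\varphi\,dx\,dt+\int_0^\tau\langle r^M;\nabla_x\varphi\rangle dt.$$ (3) Energy inequality: for a.a. $\tau\in(0,T)$, $$\int_\Omega\Big\langle\nu_{\tau,x};\tfrac12s|\mathbf{v}|^2+P(s)\Big\rangle dx+\int_0^\tau\int_\Omega\mathbb{S}(\nabla_x\mathbf{u}):\nabla_x\mathbf{u}\,dx\,dt+\mathcal{D}(\tau)\le\int_\Omega\Big\langle\nu_{0,x};\tfrac12s|\mathbf{v}|^2+P(s)\Big\rangle dx.$$ (4) Poincaré-type inequality: there is a constant $c_P$ such that for a.a. $\tau\in(0,T)$, $\int_0^\tau\int_\Omega\langle\nu_{t,x};|\mathbf{v}-\mathbf{u}(t,x)|^2\rangle dx\,dt\le c_P\mathcal{D}(\tau)$. *)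

(* Defs.v *)
From HB Require Import structures.
From mathcomp Require Import all_boot all_order all_algebra.
From mathcomp Require Import all_classical all_reals all_analysis.
Set Implicit Arguments.
Unset Strict Implicit.
Unset Printing Implicit Defensive.
Import Order.TTheory GRing.Theory Num.Theory.
Import numFieldNormedType.Exports.
Local Open Scope classical_set_scope.
Local Open Scope ring_scope.

Section measurable_rV.
Context {d} {T : sigmaRingType d}.
Variable n : nat.

Let coord : 'I_n -> 'rV[T]_n -> T := fun i x => x ord0 i.

Let rV_set0 : g_sigma_preimage coord set0.
Proof. exact: sigma_algebra0. Qed.

Let rV_setC A : g_sigma_preimage coord A -> g_sigma_preimage coord (~` A).
Proof. exact: sigma_algebraC. Qed.

Let rV_bigcup (F : (set 'rV[T]_n)^nat) :
  (forall i, g_sigma_preimage coord (F i)) ->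
  g_sigma_preimage coord (\bigcup_i (F i)).
Proof. exact: sigma_algebra_bigcup. Qed.

HB.instance Definition _ := @isMeasurable.Build (measure_tuple_display d)
  'rV[T]_n (g_sigma_preimage coord) rV_set0 rV_setC rV_bigcup.

End measurable_rV.

Section measurable_rV_theory.
Context d1 d2 (T1 : measurableType d1) (T2 : measurableType d2).

Lemma measurable_fun_rVP n (f : T1 -> 'rV[T2]_n) :
  measurable_fun [set: T1] f <->
  forall i, measurable_fun [set: T1] (fun x => f x ord0 i).
Proof.
apply: (@iff_trans _ (g_sigma_preimage
    (fun (i : 'I_n) x => f x ord0 i) `<=` measurable)).
  rewrite (@g_sigma_preimage_comp _ _ _ _ (fun i (x : 'rV[T2]_n) => x ord0 i)).
  split=> [mf A [/= C preC <-]|prefS].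
    exact: mf.
  by move=> _ A mA; apply: prefS; exists A.
split=> [fS i|mf].
- move=> _ A mA.
  apply: fS; apply: sub_sigma_algebra.
  case: n i => [[] []//|n i] in f *.
  rewrite -bigcup_mkord_ord.
  exists i; first exact: ltn_ord.
  by exists A => //; rewrite inord_val.
- apply: smallest_sub; first exact: sigma_algebra_measurable.
  case: n => [|n] in f mf *; first by rewrite big_ord0.
  rewrite -bigcup_mkord_ord; apply: bigcup_sub => i Ii.
  by move=> A [B mB <-]; exact: mf.
Qed.

End measurable_rV_theory.

Section rV_cons.
Context (R : realType) (n : nat).

Definition rV_cons (z : R * 'rV[R]_n) : 'rV[R]_n.+1 :=
  \row_i oapp (fun j => z.2 ord0 j) z.1 (unlift ord0 i).

Definition rV_uncons (x : 'rV[R]_n.+1) : R * 'rV[R]_n :=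
  (x ord0 ord0, \row_j x ord0 (lift ord0 j)).

Lemma rV_consK : cancel rV_cons rV_uncons.
Proof.
move=> [a x]; rewrite /rV_uncons mxE unlift_none /=; congr pair.
by apply/rowP => j; rewrite !mxE liftK.
Qed.

Lemma measurable_coord (i : 'I_n) :
  measurable_fun [set: 'rV[R]_n] (fun x : 'rV[R]_n => x ord0 i).
Proof.
exact: (measurable_fun_rVP (@idfun 'rV[R]_n)).1 (@measurable_id _ _ _) i.
Qed.

End rV_cons.

Lemma measurable_rV_cons (R : realType) n :
  measurable_fun [set: (R * 'rV[R]_n)%type] (@rV_cons R n).
Proof.
apply/measurable_fun_rVP => i.
under eq_fun do rewrite mxE.
case: unliftP => [j _|_] /=; last exact: measurable_fst.
exact: (measurableT_comp (measurable_coord j) measurable_snd).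
Qed.

Lemma measurable_rV_uncons (R : realType) n :
  measurable_fun [set: 'rV[R]_n.+1] (@rV_uncons R n).
Proof.
apply/measurable_fun_pairP; split; first exact: measurable_coord.
apply/measurable_fun_rVP => i /=.
under eq_fun do rewrite mxE.
exact: measurable_coord.
Qed.

Section lebesgue_rV_step.
Context (R : realType) (n : nat).
Variable m : {sigma_finite_measure set 'rV[R]_n -> \bar R}.

Definition lebesgue_rV_step : set 'rV[R]_n.+1 -> \bar R :=
  pushforward (lebesgue_measure \x m)%E (@rV_cons R n).

Let step0 : lebesgue_rV_step set0 = 0%E.
Proof. by rewrite /lebesgue_rV_step /pushforward preimage_set0
  (measure0 (lebesgue_measure \x m)%E). Qed.

Let step_ge0 A : (0 <= lebesgue_rV_step A)%E.
Proof. exact: (measure_ge0 (lebesgue_measure \x m)%E). Qed.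

Let step_sigma_additive : semi_sigma_additive lebesgue_rV_step.
Proof.
have mf := @measurable_rV_cons R n.
move=> F mF tF mUF; rewrite /lebesgue_rV_step /pushforward preimage_bigcup.
apply: (@measure_semi_sigma_additive _ _ _ (lebesgue_measure \x m)%E).
- by move=> k; rewrite -[X in measurable X]setTI; exact: mf.
- apply/trivIsetP => /= i j _ _ ij; rewrite -preimage_setI.
  by move/trivIsetP : tF => /(_ _ _ _ _ ij) ->//; rewrite preimage_set0.
- by rewrite -preimage_bigcup -[X in measurable X]setTI; exact: mf.
Qed.

HB.instance Definition _ := isMeasure.Build _ _ _
  lebesgue_rV_step step0 step_ge0 step_sigma_additive.

Let step_sigma_finite : sigma_finite setT lebesgue_rV_step.
Proof.
have /sigma_finiteP[F [TF ndF Foo]] :=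
  sigma_finiteT (@lebesgue_measure R : {sigma_finite_measure set _ -> \bar R}).
have /sigma_finiteP[G [TG ndG Goo]] := sigma_finiteT m.
exists (fun k => @rV_uncons R n @^-1` (F k `*` G k)).
  rewrite -preimage_bigcup [X in _ @^-1` X](_ : _ = setT) ?preimage_setT//.
  apply/seteqP; split=> // -[x y] _.
  have [k _ Fx] : (\bigcup_i F i) x by rewrite -TF.
  have [l _ Gy] : (\bigcup_i G i) y by rewrite -TG.
  exists (maxn k l) => //; split => /=.
    by move: x Fx; exact/subsetPset/ndF/leq_maxl.
  by move: y Gy; exact/subsetPset/ndG/leq_maxr.
move=> k; have [mF Fk] := Foo k; have [mG Gk] := Goo k; split.
  rewrite -[X in measurable X]setTI; apply: measurable_rV_uncons => //.
  exact: measurableX.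
rewrite /lebesgue_rV_step /pushforward -comp_preimage.
rewrite (_ : _ \o _ = id) ?preimage_id; last first.
  by apply/funext => z; exact: rV_consK.
by rewrite product_measure1E// lte_mul_pinfty// ge0_fin_numE.
Qed.

HB.instance Definition _ := Measure_isSigmaFinite.Build _ _ _
  lebesgue_rV_step step_sigma_finite.

End lebesgue_rV_step.

(* Lebesgue measure on R^n, as the n-fold product of the one-dimensional one *)
Fixpoint lebesgue_rV (R : realType) (n : nat) :
    {sigma_finite_measure set 'rV[R]_n -> \bar R} :=
  match n with
  | 0 => \d_(0 : 'rV[R]_0)
  | n'.+1 => lebesgue_rV_step (lebesgue_rV R n')
  end.

Section euclidean.
Context {R : realType}.

(* Euclidean product of vectors (row matrices) and A : B of matrices; the
   norm `|A| of the library is the sup norm *)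
Definition inner {m n} (A B : 'M[R]_(m, n)) : R :=
  \sum_(i < m) \sum_(j < n) A i j * B i j.

Definition enorm {m n} (A : 'M[R]_(m, n)) : R := Num.sqrt (inner A A).

Definition tensor {n} (v w : 'rV[R]_n) : 'M[R]_n := v^T *m w.

Definition sup_on {X : Type} (K : set X) (g : X -> R) : R := sup (g @` K).

End euclidean.

Section calculus.
Context {R : realType} {N : nat}.
Implicit Types (Omega : set 'rV[R]_N) (f : 'rV[R]_N -> R).

Definition e_ (i : 'I_N) : 'rV[R]_N := delta_mx ord0 i.

Definition grad f (x : 'rV[R]_N) : 'rV[R]_N := \row_j 'D_(e_ j) f x.

Definition divergence (F : 'rV[R]_N -> 'rV[R]_N) (x : 'rV[R]_N) : R :=
  \sum_(j < N) 'D_(e_ j) (fun y => F y ord0 j) x.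

Definition divergence_mx (F : 'rV[R]_N -> 'M[R]_N) (x : 'rV[R]_N) : 'rV[R]_N :=
  \row_i divergence (fun y => row i (F y)) x.

Fixpoint Ck (k : nat) f : Prop :=
  match k with
  | 0 => continuous f
  | k'.+1 => continuous f /\
      forall i, (forall x, derivable f x (e_ i)) /\ Ck k' ('D_(e_ i) f)
  end.

Definition smooth f : Prop := forall k, Ck k f.

Definition test_function Omega f : Prop :=
  smooth f /\ exists K, [/\ compact K, K `<=` Omega & forall x, ~ K x -> f x = 0].

End calculus.

Section domain.
Context {R : realType} {N : nat}.

(* Near each boundary point, after relabelling (i) and reorienting (b) the
   axes, Omega is the set above the graph of a smooth function of the remaining
   coordinates *)
Definition smooth_boundary (Omega : set 'rV[R]_N) : Prop :=
  forall x0, (closure Omega `\` Omega) x0 ->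
  exists (i : 'I_N) (b : bool) (gamma : 'rV[R]_N.-1 -> R) (e : R),
    [/\ 0 < e, smooth gamma &
      forall x, ball x0 e x ->
        (Omega x <-> gamma (col' i x) < (-1) ^+ b * x ord0 i)].

Definition bounded_smooth_domain (Omega : set 'rV[R]_N) : Prop :=
  [/\ Omega !=set0, open Omega, connected Omega,
      bounded_set Omega & smooth_boundary Omega].

End domain.

Section sobolev.
Context {R : realType} {N : nat}.
Local Notation lebN := (lebesgue_rV R N).

(* f belongs to W^{1,2}_0(Omega), the closure of the test functions in
   W^{1,2}(Omega), and g is its weak gradient *)
Definition W12_0 (Omega : set 'rV[R]_N) (f : 'rV[R]_N -> R)
    (g : 'rV[R]_N -> 'rV[R]_N) : Prop :=
  [/\ measurable_fun Omega f,
      forall j, measurable_fun Omega (fun x => g x ord0 j) &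
      exists phi : nat -> 'rV[R]_N -> R,
        (forall k, test_function Omega (phi k)) /\
        (fun k => \int[lebN]_(x in Omega)
           ((phi k x - f x) ^+ 2 + enorm (grad (phi k) x - g x) ^+ 2)%:E)%E
          @ \oo --> 0%E].

(* u in L^2(0,T; W^{1,2}_0(Omega; R^N)) with (gu t x) i j = d_j u_i *)
Definition L2_W12_0 (T : R) (Omega : set 'rV[R]_N)
    (u : R -> 'rV[R]_N -> 'rV[R]_N) (gu : R -> 'rV[R]_N -> 'M[R]_N) : Prop :=
  [/\ forall i, measurable_fun (`]0, T[%classic `*` Omega)
        (fun z => u z.1 z.2 ord0 i),
      forall i j, measurable_fun (`]0, T[%classic `*` Omega)
        (fun z => gu z.1 z.2 i j),
      {ae lebesgue_measure, forall t, 0 < t < T -> forall i,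
        W12_0 Omega (fun x => u t x ord0 i) (fun x => row i (gu t x))} &
      (\int[lebesgue_measure]_(t in `]0%R, T[) \int[lebN]_(x in Omega)
         (enorm (u t x) ^+ 2 + enorm (gu t x) ^+ 2)%:E < +oo)%E].

(* f is locally integrable on Omega and is the distributional divergence of A *)
Definition weak_divergence (Omega : set 'rV[R]_N) (A : 'rV[R]_N -> 'M[R]_N)
    (f : 'rV[R]_N -> 'rV[R]_N) : Prop :=
  (forall K i, compact K -> K `<=` Omega ->
     lebN.-integrable K (EFin \o (fun x => f x ord0 i))) /\
  (forall phi i, test_function Omega phi ->
     \int[lebN]_(x in Omega) inner (row i (A x)) (grad phi x) =
     - \int[lebN]_(x in Omega) (f x ord0 i * phi x)).

End sobolev.

Section signed_measures.
Context d (X : measurableType d) (R : realType).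
Variable m : {charge set X -> \bar R}.

Definition hahn_pos : set X := sval (cid (Hahn_decomposition m)).

Definition hahn_neg : set X :=
  sval (cid (svalP (cid (Hahn_decomposition m)))).

Lemma hahn_posneg : hahn_decomposition m hahn_pos hahn_neg.
Proof. exact: svalP (cid (svalP (cid (Hahn_decomposition m)))). Qed.

Definition charge_integral (A : set X) (f : X -> R) : R :=
  \int[jordan_pos hahn_posneg]_(x in A) f x -
  \int[jordan_neg hahn_posneg]_(x in A) f x.

Definition charge_total_variation (A : set X) : \bar R :=
  charge_variation hahn_posneg A.

End signed_measures.

Section measure_valued_in_time.
Context {R : realType} {N : nat}.

(* t |-> m t (restricted to the closure of Omega) belongs to
   L^1(0,T; M(closure Omega)); only weak-* measurability in time is required.
   On the compact set closure Omega, finite Borel measures are Radon *)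
Definition L1_measure (T : R) (Omega : set 'rV[R]_N)
    (m : R -> {charge set 'rV[R]_N -> \bar R}) : Prop :=
  (forall f : 'rV[R]_N -> R, {within closure Omega, continuous f} ->
     measurable_fun `[0, T] (fun t => charge_integral (m t) (closure Omega) f)) /\
  (\int[lebesgue_measure]_(t in `[0%R, T])
     charge_total_variation (m t) (closure Omega) < +oo)%E.

End measure_valued_in_time.

Section smooth_up_to_the_boundary.
Context {R : realType} {N : nat}.
Implicit Types (T : R) (Omega : set 'rV[R]_N).

Definition closed_cylinder T Omega : set (R * 'rV[R]_N) :=
  `[0, T]%classic `*` closure Omega.

Definition continuous_cylinder T Omega (f : R -> 'rV[R]_N -> R) : Prop :=
  {within closed_cylinder T Omega, continuous (fun z => f z.1 z.2)}.

(* f and its spatial gradient g are continuous on [0,T] x closure Omega; on the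
   boundary g is the continuous extension of the classical gradient *)
Definition C_C1 T Omega (f : R -> 'rV[R]_N -> R)
    (g : R -> 'rV[R]_N -> 'rV[R]_N) : Prop :=
  [/\ continuous_cylinder T Omega f,
      forall j, continuous_cylinder T Omega (fun t x => g t x ord0 j) &
      forall t x j, 0 < t < T -> Omega x ->
        is_derive x (e_ j) (f t) (g t x ord0 j)].

(* f is of class C^1 on [0,T] x closure Omega, with time derivative ft and
   spatial gradient g, extended to the boundary by continuity *)
Definition C1_cylinder T Omega (f ft : R -> 'rV[R]_N -> R)
    (g : R -> 'rV[R]_N -> 'rV[R]_N) : Prop :=
  [/\ C_C1 T Omega f g, continuous_cylinder T Omega ft &
      forall t x, 0 < t < T -> Omega x ->
        is_derive t 1 (f ^~ x) (ft t x)].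

Definition vC_C1 T Omega (f : R -> 'rV[R]_N -> 'rV[R]_N)
    (g : R -> 'rV[R]_N -> 'M[R]_N) : Prop :=
  forall i, C_C1 T Omega (fun t x => f t x ord0 i) (fun t x => row i (g t x)).

Definition vC1_cylinder T Omega (f ft : R -> 'rV[R]_N -> 'rV[R]_N)
    (g : R -> 'rV[R]_N -> 'M[R]_N) : Prop :=
  forall i, C1_cylinder T Omega (fun t x => f t x ord0 i)
    (fun t x => ft t x ord0 i) (fun t x => row i (g t x)).

Definition zero_on_boundary T Omega (f : R -> 'rV[R]_N -> 'rV[R]_N) : Prop :=
  forall t x, 0 <= t <= T -> (closure Omega `\` Omega) x -> f t x = 0.

End smooth_up_to_the_boundary.

Section navier_stokes.
Context {R : realType}.

(* A i j stands for d_j u_i, so that \tr A is the divergence of u *)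
Definition viscous_stress {N} (mu eta : R) (A : 'M[R]_N) : 'M[R]_N :=
  mu *: (A + A^T - (2 / 3 * \tr A)%:M) + (eta * \tr A)%:M.

(* P(rho) = rho * int_1^rho p(z)/z^2 dz, with an oriented integral; the value at
   0 is 0 because of the factor rho *)
Definition pressure_potential (p : R -> R) (rho : R) : R :=
  rho * (if 1 <= rho
         then \int[lebesgue_measure]_(z in `[1, rho]) (p z / z ^+ 2)
         else - \int[lebesgue_measure]_(z in `[rho, 1]) (p z / z ^+ 2)).

Record pressure_law (p : R -> R) : Prop := PressureLaw {
  pressure_continuous : {within `[0, +oo[, continuous p} ;
  pressure_derivable : forall rho, 0 < rho ->
    derivable p rho 1 /\ derivable (derive1 p) rho 1 ;
  pressure_C2 : {within `]0, +oo[, continuous (derive1n 2 p)} ;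
  pressure0 : p 0 = 0 ;
  pressure_increasing : forall rho, 0 < rho -> 0 < derive1 p rho ;
  pressure_liminf_derive :
    (0 < limf_einf (fun rho => (derive1 p rho)%:E) (pinfty_nbhs R))%E ;
  pressure_liminf_potential :
    (0 < limf_einf (fun rho => (pressure_potential p rho / p rho)%:E)
           (pinfty_nbhs R))%E }.

End navier_stokes.

Section dissipative_measure_valued_solutions.
Context {R : realType} {N : nat}.
Local Notation space := 'rV[R]_N.
Local Notation state := (R * 'rV[R]_N)%type.
Local Notation lebN := (lebesgue_rV R N).

(* [0, +oo) x R^N, with points (s, v) *)
Definition state_space : set state := [set y | 0 <= y.1].

Definition bracket (k : {measure set state -> \bar R}) (F : state -> R) : R :=
  \int[k]_(y in state_space) F y.

Definition bracket_mx {m n} (k : {measure set state -> \bar R})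
    (F : state -> 'M[R]_(m, n)) : 'M[R]_(m, n) :=
  \matrix_(i, j) bracket k (fun y => F y i j).

(* F is integrable for almost every measure k x, and x |-> <k x; F> is
   measurable and integrable over A *)
Definition mv_integrable d (X : measurableType d)
    (m : {measure set X -> \bar R}) (A : set X)
    (k : X -> {measure set state -> \bar R}) (F : state -> R) : Prop :=
  {ae m, forall x, A x -> (k x).-integrable state_space (EFin \o F)} /\
  m.-integrable A (EFin \o (fun x => bracket (k x) F)).

Definition energy (p : R -> R) (y : state) : R :=
  2^-1 * y.1 * enorm y.2 ^+ 2 + pressure_potential p y.1.

Definition momentum (y : state) : space := y.1 *: y.2.

Definition convection (y : state) : 'M[R]_N := y.1 *: tensor y.2 y.2.

Definition velocity (nu : R.-pker (R * 'rV[R]_N) ~> (R * 'rV[R]_N)%type) (t : R)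
    (x : space) : space :=
  bracket_mx (nu (t, x)) snd.

(* <m; g> for a vector- or matrix-valued measure m on closure Omega *)
Definition pairing (Omega : set space) {a b : nat}
    (m : 'I_a -> 'I_b -> {charge set space -> \bar R})
    (g : space -> 'M[R]_(a, b)) : R :=
  \sum_(i < a) \sum_(j < b)
    charge_integral (m i j) (closure Omega) (fun x => g x i j).

(* Parameterized measures are probability kernels, of which only the values over
   (0,T) x Omega, resp. Omega, matter.  gu is the gradient of the velocity; rC
   and chi, resp. rM and xi, are the defect measure and the integrable function
   in the continuity, resp. momentum, equation. *)
Record dissipative_mv_solution (T : R) (Omega : set space) (mu eta : R)
    (p : R -> R) (cP : R)
    (nu : R.-pker (R * 'rV[R]_N) ~> (R * 'rV[R]_N)%type)
    (nu0 : R.-pker 'rV[R]_N ~> (R * 'rV[R]_N)%type)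
    (D : R -> R) (gu : R -> space -> 'M[R]_N)
    (rC : R -> 'I_1 -> 'I_N -> {charge set space -> \bar R}) (chi : R -> R)
    (rM : R -> 'I_N -> 'I_N -> {charge set space -> \bar R}) (xi : R -> R)
    : Prop := DissipativeMVSolution {
  mv_carried : {ae (lebesgue_measure \x lebN)%E, forall z,
    (`]0, T[%classic `*` Omega) z -> nu z (~` state_space) = 0%E} ;
  mv_carried0 : {ae lebN, forall x, Omega x -> nu0 x (~` state_space) = 0%E} ;

  mv_density_int : mv_integrable (lebesgue_measure \x lebN)%E
    (`]0, T[%classic `*` Omega) nu fst ;
  mv_velocity_int : forall i, mv_integrable (lebesgue_measure \x lebN)%E
    (`]0, T[%classic `*` Omega) nu (fun y => y.2 ord0 i) ;
  mv_momentum_int : forall i, mv_integrable (lebesgue_measure \x lebN)%E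
    (`]0, T[%classic `*` Omega) nu (fun y => momentum y ord0 i) ;
  mv_convection_int : forall i j, mv_integrable (lebesgue_measure \x lebN)%E
    (`]0, T[%classic `*` Omega) nu (fun y => convection y i j) ;
  mv_pressure_int : mv_integrable (lebesgue_measure \x lebN)%E
    (`]0, T[%classic `*` Omega) nu (fun y => p y.1) ;
  mv_energy_int : mv_integrable (lebesgue_measure \x lebN)%E
    (`]0, T[%classic `*` Omega) nu (energy p) ;
  mv_density_int0 : mv_integrable lebN Omega nu0 fst ;
  mv_momentum_int0 : forall i,
    mv_integrable lebN Omega nu0 (fun y => momentum y ord0 i) ;
  mv_energy_int0 : mv_integrable lebN Omega nu0 (energy p) ;

  defect_measurable : measurable_fun `]0, T[ D ;
  defect_bounded :
    exists M, {ae lebesgue_measure, forall t, 0 < t < T -> D t <= M} ;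
  defect_ge0 : {ae lebesgue_measure, forall t, 0 < t < T -> 0 <= D t} ;

  mv_rC : forall i j, L1_measure T Omega (fun t => rC t i j) ;
  mv_chi : lebesgue_measure.-integrable `]0, T[ (EFin \o chi) ;
  mv_continuity : {ae lebesgue_measure, forall tau, 0 < tau < T ->
    forall psi psit gpsi, C1_cylinder T Omega psi psit gpsi ->
    `|pairing Omega (rC tau) (gpsi tau)| <=
      chi tau * D tau *
      (sup_on (closure Omega) (fun x => `|psi tau x|) +
       sup_on (closure Omega) (fun x => enorm (gpsi tau x))) /\
    \int[lebN]_(x in Omega) (bracket (nu (tau, x)) fst * psi tau x) -
    \int[lebN]_(x in Omega) (bracket (nu0 x) fst * psi 0 x) =
    \int[lebesgue_measure]_(t in `[0, tau]) \int[lebN]_(x in Omega)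
      (bracket (nu (t, x)) fst * psit t x +
       inner (bracket_mx (nu (t, x)) momentum) (gpsi t x)) +
    \int[lebesgue_measure]_(t in `[0, tau]) pairing Omega (rC t) (gpsi t)} ;

  mv_velocity : L2_W12_0 T Omega (velocity nu) gu ;
  mv_rM : forall i j, L1_measure T Omega (fun t => rM t i j) ;
  mv_xi : lebesgue_measure.-integrable `]0, T[ (EFin \o xi) ;
  mv_momentum : {ae lebesgue_measure, forall tau, 0 < tau < T ->
    forall phi phit gphi, vC1_cylinder T Omega phi phit gphi ->
    zero_on_boundary T Omega phi ->
    `|pairing Omega (rM tau) (gphi tau)| <=
      xi tau * D tau *
      (sup_on (closure Omega) (fun x => enorm (phi tau x)) +
       sup_on (closure Omega) (fun x => enorm (gphi tau x))) /\
    \int[lebN]_(x in Omega)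
      inner (bracket_mx (nu (tau, x)) momentum) (phi tau x) -
    \int[lebN]_(x in Omega) inner (bracket_mx (nu0 x) momentum) (phi 0 x) =
    \int[lebesgue_measure]_(t in `[0, tau]) \int[lebN]_(x in Omega)
      (inner (bracket_mx (nu (t, x)) momentum) (phit t x) +
       inner (bracket_mx (nu (t, x)) convection) (gphi t x) +
       bracket (nu (t, x)) (fun y => p y.1) * \tr (gphi t x)) -
    \int[lebesgue_measure]_(t in `[0, tau]) \int[lebN]_(x in Omega)
      inner (viscous_stress mu eta (gu t x)) (gphi t x) +
    \int[lebesgue_measure]_(t in `[0, tau]) pairing Omega (rM t) (gphi t)} ;

  mv_energy : {ae lebesgue_measure, forall tau, 0 < tau < T ->
    \int[lebN]_(x in Omega) bracket (nu (tau, x)) (energy p) +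
    \int[lebesgue_measure]_(t in `[0, tau]) \int[lebN]_(x in Omega)
      inner (viscous_stress mu eta (gu t x)) (gu t x) +
    D tau <=
    \int[lebN]_(x in Omega) bracket (nu0 x) (energy p)} ;

  mv_poincare : {ae lebesgue_measure, forall tau, 0 < tau < T ->
    (\int[lebesgue_measure]_(t in `[0%R, tau]) \int[lebN]_(x in Omega)
       \int[nu (t, x)]_(y in state_space)
         (enorm (y.2 - velocity nu t x) ^+ 2)%:E <= (cP * D tau)%:E)%E} }.

End dissipative_measure_valued_solutions.

Section strong_solutions.
Context {R : realType} {N : nat}.
Local Notation space := 'rV[R]_N.
Local Notation lebN := (lebesgue_rV R N).

(* gr, gU are the spatial gradients of r, U.  Ut in L^2(0,T; C(closure Omega)) is
   the time derivative of U as a C(closure Omega)-valued function: increments of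
   U are integrals of Ut.  Only the first order spatial derivatives of U being
   continuous, div S(grad U) is the distributional divergence, a function for
   almost every time; the other derivatives in the equations are classical
   (that of r U in time exists almost everywhere). *)
Record strong_solution (T : R) (Omega : set space) (mu eta : R) (p : R -> R)
    (r : R -> space -> R) (U : R -> space -> space)
    (gr : R -> space -> space) (gU : R -> space -> 'M[R]_N)
    (Ut : R -> space -> space) : Prop := StrongSolution {
  strong_r : C_C1 T Omega r gr ;
  strong_U : vC_C1 T Omega U gU ;
  strong_Ut_continuous : {ae lebesgue_measure, forall t, 0 < t < T ->
    forall i, {within closure Omega, continuous (fun x => Ut t x ord0 i)}} ;
  strong_Ut_measurable : forall x i, closure Omega x ->
    measurable_fun `[0, T] (fun t => Ut t x ord0 i) ;
  strong_Ut_L2 : (\int[lebesgue_measure]_(t in `[0%R, T])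
    (sup_on (closure Omega) (fun x => enorm (Ut t x)) ^+ 2)%:E < +oo)%E ;
  strong_Ut : forall t1 t2 x i, 0 <= t1 -> t1 <= t2 -> t2 <= T ->
    closure Omega x ->
    U t2 x ord0 i - U t1 x ord0 i =
    \int[lebesgue_measure]_(t in `[t1, t2]) Ut t x ord0 i ;
  strong_r_gt0 : forall t x, 0 <= t <= T -> closure Omega x -> 0 < r t x ;
  strong_boundary : zero_on_boundary T Omega U ;
  strong_continuity : forall t x, 0 < t < T -> Omega x ->
    derivable (r ^~ x) t 1 /\
    'D_1 (r ^~ x) t + divergence (fun y => r t y *: U t y) x = 0 ;
  strong_momentum : exists divS : R -> space -> space,
    {ae lebesgue_measure, forall t, 0 < t < T ->
      weak_divergence Omega (fun x => viscous_stress mu eta (gU t x))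
        (divS t)} /\
    {ae (lebesgue_measure \x lebN)%E, forall z,
      (`]0, T[%classic `*` Omega) z ->
      let: (t, x) := z in
      'D_1 (fun s => r s x *: U s x) t +
      divergence_mx (fun y => r t y *: tensor (U t y) (U t y)) x +
      grad (fun y => p (r t y)) x = divS t x} }.

Definition relative_energy_density (p : R -> R) (r : R) (U : space)
    (y : R * space) : R :=
  2^-1 * y.1 * enorm (y.2 - U) ^+ 2 + pressure_potential p y.1 -
  derive1 (pressure_potential p) r * (y.1 - r) - pressure_potential p r.

(* The integrand is nonnegative, so that the integral makes sense in [0, +oo] *)
Definition relative_energy (p : R -> R) (Omega : set space)
    (k : space -> {measure set (R * space) -> \bar R})
    (r : space -> R) (U : space -> space) : \bar R :=
  (\int[lebN]_(x in Omega) \int[k x]_(y in state_space)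
     (relative_energy_density p (r x) (U x) y)%:E)%E.

Definition cylinder_norm {m n} (T : R) (Omega : set space)
    (f : R -> space -> 'M[R]_(m, n)) : R :=
  sup_on (closed_cylinder T Omega) (fun z => enorm (f z.1 z.2)).

Definition cylinder_normr (T : R) (Omega : set space) (f : R -> space -> R) : R :=
  sup_on (closed_cylinder T Omega) (fun z => `|f z.1 z.2|).

Definition L2C_norm (T : R) (Omega : set space) (f : R -> space -> space) : R :=
  Num.sqrt (\int[lebesgue_measure]_(t in `[0, T])
    (sup_on (closure Omega) (fun x => enorm (f t x)) ^+ 2)).

Definition L1_norm (T : R) (f : R -> R) : R :=
  \int[lebesgue_measure]_(t in `[0, T]) `|f t|.

Definition is_dirac (k : {measure set (R * space) -> \bar R}) (y : R * space) :
    Prop :=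
  forall A, measurable A -> k A = \d_y A.

End strong_solutions.

(* Main.v *)
Require Import Defs.
From HB Require Import structures.
From mathcomp Require Import all_boot all_order all_algebra.
From mathcomp Require Import all_classical all_reals all_analysis.
From mathcomp Require Import measurable_realfun.
From mathcomp Require Import ring lra.
Set Implicit Arguments.
Unset Strict Implicit.
Unset Printing Implicit Defensive.
Import Order.TTheory GRing.Theory Num.Theory.
Import numFieldNormedType.Exports.
Local Open Scope classical_set_scope.
Local Open Scope ring_scope.


(* The relative energy
     E(tau) = int <nu; 1/2 s |v - U|^2 + P(s) - P'(r) (s - r) - P(r)> dx
   is estimated by adding to the energy inequality the momentum equation tested with U and the
   continuity equation tested with 1/2 |U|^2 and with P'(r).  Since U is merely absolutely
   continuous in time, the test functions are spline averages of U in time, and the limit is taken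
   by dominated convergence, with Pratt's lemma for the term containing the time derivative of U.
   At a fixed time the equations of the strong solution turn the remainder into terms that are
   quadratic near (r, U), bounded by E through the convexity of P, plus terms linear in v - U where
   s is far from r.  There |v - U| is split by Young's inequality into a multiple of E and a small
   multiple of |v - u|^2 + |u - U|^2, absorbed by the Poincare-type inequality of the measure-valued
   solution (hence by D) and by the inequalities of Poincare and Korn for u - U.
   Gronwall's inequality, iterated over intervals on which the integral of the rate is at most 1/2,
   concludes.  If E(0) = 0 then E = 0, and the relative energy density vanishes only at
   (r, U).

   Korn and Poincare for u - U need U(t) in W^{1,2}_0: a C^1 function vanishing on the boundary is
   the W^{1,2} limit of finite combinations of smooth bumps centered at grid points whose neighbourhood lies
   in the domain, whatever the regularity of the boundary. *)

(** * Real-valued integrals *)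

(** Three points resist the formal computation. (a) Tested with the averages of U, the term with the
    time derivative is bounded only by difference quotients of a primitive of a bound for U_t. No
    common integrable majorant is at hand, but these quotients converge almost everywhere and their
    integrals do not exceed that of the limit asymptotically, as Pratt's lemma asks. Its one-sided
    conclusion suffices, since the term enters an inequality. (b) With x fixed, U_t is a classical
    derivative for almost every t; one null set for all x comes from countably many points together
    with their oscillation functions. (c) The variance of the parameterized measure is controlled
    only through an iterated integral, so it is compared from below with measurable functions.
    Young's constant is fixed first, from c_P, mu and the size of the domain, so that half of D and
    half of the viscous term survive. The constants depending on the norms then go into the Gronwall
    rate. The defect measures enter the same rate through |chi| + |xi|, because D is part of the
    quantity to be estimated. *)

Section toolkit.
Import HBNNSimple.
Context {d} {X : measurableType d} {R : realType}.
Variable mu : {measure set X -> \bar R}.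
Implicit Types (D : set X) (f g : X -> R).

Definition intg D f := mu.-integrable D (EFin \o f).

Lemma nnint_le D (f g : X -> \bar R) :
  (forall x, D x -> 0 <= f x)%E -> (forall x, D x -> f x <= g x)%E ->
  (\int[mu]_(x in D) f x <= \int[mu]_(x in D) g x)%E.
Proof.
move=> f0 fg; rewrite ge0_integralE// ge0_integralE; last first.
  by move=> x Dx; exact: le_trans (f0 _ Dx) (fg _ Dx).
apply: ereal_sup_le => _ [h /= hf <-]; exists h => //= x.
apply: (le_trans (hf x)); rewrite /patch; case: ifPn => // xD.
by apply: fg; rewrite inE in xD.
Qed.

(** The integral of a nonnegative function is a supremum over simple functions, whether or not the
    function is measurable, so only the simple function below [f] has to be changed on the null set.
    Iterated integrals whose inner integral is not known to be measurable are compared in this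
    way. *)
Lemma ae_nnint_le D (f g : X -> \bar R) :
  (forall x, D x -> 0 <= f x)%E -> (forall x, D x -> 0 <= g x)%E ->
  {ae mu, forall x, D x -> f x <= g x}%E ->
  (\int[mu]_(x in D) f x <= \int[mu]_(x in D) g x)%E.
Proof.
move=> f0 g0 [N [mN N0 fgN]].
rewrite [leLHS]ge0_integralE//; apply: ge_ereal_sup => _ [h /= hf <-].
rewrite -integralT_nnsfun.
rewrite (@ge0_negligible_integral _ _ _ mu setT N)//; last first.
  by move=> x _; rewrite lee_fin; exact: fun_ge0.
  exact/measurable_EFinP.
rewrite [leRHS]ge0_integralE// -ge0_integralTE; last first.
  by move=> x; rewrite /patch; case: ifPn => // xD; apply: g0; rewrite inE in xD.
rewrite integral_mkcond; apply: nnint_le => x _.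
  rewrite /patch; case: ifPn => // _; rewrite lee_fin; exact: fun_ge0.
rewrite [leLHS]/patch; case: ifPn => [|_]; last first.
  by rewrite /patch; case: ifPn => // xD; apply: g0; rewrite inE in xD.
rewrite inE => -[_ Nx]; apply: (le_trans (hf x)).
rewrite /patch; case: ifPn => // xD; rewrite inE in xD.
apply: contrapT => fgx; apply: Nx; apply: fgN => /= /(_ xD); exact.
Qed.

Lemma intg_meas D f : intg D f -> measurable_fun D f.
Proof. by move=> /measurable_int /measurable_EFinP. Qed.

Lemma intgP D f : measurable_fun D f ->
  (\int[mu]_(x in D) `|f x|%:E < +oo)%E -> intg D f.
Proof.
move=> mf oo; apply/integrableP; split; first exact/measurable_EFinP.
exact: oo.
Qed.

Lemma intg_lty D f : intg D f -> (\int[mu]_(x in D) `|f x|%:E < +oo)%E.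
Proof. by move=> /integrableP[]. Qed.

Lemma le_intg D f g : measurable D -> measurable_fun D f ->
  (forall x, D x -> `|f x| <= `|g x|) -> intg D g -> intg D f.
Proof.
move=> mD mf fg ig; apply: (le_integrable mD _ _ ig); first exact/measurable_EFinP.
by move=> x Dx /=; rewrite lee_fin fg.
Qed.

Lemma ae_le_intg D f g : measurable D -> measurable_fun D f ->
  {ae mu, forall x, D x -> `|f x| <= `|g x|} -> intg D g -> intg D f.
Proof.
move=> mD mf fg ig; apply: intgP => //; apply: le_lt_trans (intg_lty ig).
by apply: ae_nnint_le => //; apply: filterS fg => x + Dx; rewrite lee_fin; exact.
Qed.

Lemma intgD D f g : measurable D -> intg D f -> intg D g ->
  intg D (fun x => f x + g x).
Proof. by move=> mD If Ig; have := (integrableD mD If Ig); apply: eq_integrable. Qed.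

Lemma intgB D f g : measurable D -> intg D f -> intg D g ->
  intg D (fun x => f x - g x).
Proof. by move=> mD If Ig; have := (integrableB mD If Ig); apply: eq_integrable. Qed.

Lemma intgN D f : measurable D -> intg D f -> intg D (fun x => - f x).
Proof. by move=> mD If; have := (integrableN If); apply: eq_integrable. Qed.

Lemma intgZ D f (c : R) : measurable D -> intg D f -> intg D (fun x => c * f x).
Proof. by move=> mD If; have := (integrableZl mD c If); apply: eq_integrable. Qed.

Lemma intg0 D : intg D (fun=> 0).
Proof. exact: integrable0. Qed.

Lemma intg_sum D (I : Type) (s : seq I) (P : pred I) (F : I -> X -> R) :
  measurable D -> (forall i, P i -> intg D (F i)) ->
  intg D (fun x => \sum_(i <- s | P i) F i x).
Proof.
move=> mD IF; elim: s => [|a s IH].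
  by under [X in intg _ X]eq_fun do rewrite big_nil; exact: intg0.
under [X in intg _ X]eq_fun do rewrite big_cons.
case Pa : (P a) => //; apply: intgD => //; exact: IF.
Qed.

Lemma intg_norm D f : intg D f -> intg D (fun x => `|f x|).
Proof. by move=> If; have := integrable_abse If. Qed.

Lemma intg_bdM D f g (C : R) : measurable D -> measurable_fun D g ->
  (forall x, D x -> `|g x| <= C) -> intg D f -> intg D (fun x => f x * g x).
Proof.
move=> mD mg gC If; apply: (@le_intg D _ (fun x => C * f x)) => //.
- by apply: measurable_funM => //; exact: intg_meas If.
- move=> x Dx; rewrite !normrM mulrC ler_wpM2r//.
  exact: le_trans (gC _ Dx) (ler_norm _).
- exact: intgZ.
Qed.

Lemma intg_bd D g (C : R) : measurable D -> (mu D < +oo)%E ->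
  measurable_fun D g -> (forall x, D x -> `|g x| <= C) -> intg D g.
Proof.
move=> mD Doo mg gC; apply: (@le_intg D _ (fun=> C)) => //.
  by move=> x /gC /le_trans; apply; exact: ler_norm.
apply: intgP => //; rewrite integral_cst//.
by rewrite lte_mul_pinfty// lee_fin.
Qed.

Lemma intgS (D E : set X) f : measurable D -> measurable E -> E `<=` D ->
  intg D f -> intg E f.
Proof. by move=> mD mE ED; exact: integrableS. Qed.

Lemma eq_intg D f g : measurable D -> (forall x, D x -> f x = g x) ->
  intg D f -> intg D g.
Proof.
move=> mD fg; apply: eq_integrable => // x; rewrite inE => Dx /=.
by rewrite fg.
Qed.

Lemma RintD D f g : measurable D -> intg D f -> intg D g ->
  \int[mu]_(x in D) (f x + g x) = \int[mu]_(x in D) f x + \int[mu]_(x in D) g x.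
Proof. exact: RintegralD. Qed.

Lemma RintB D f g : measurable D -> intg D f -> intg D g ->
  \int[mu]_(x in D) (f x - g x) = \int[mu]_(x in D) f x - \int[mu]_(x in D) g x.
Proof. exact: RintegralB. Qed.

Lemma RintZ D f (c : R) : measurable D -> intg D f ->
  \int[mu]_(x in D) (c * f x) = c * \int[mu]_(x in D) f x.
Proof. by move=> mD If; exact: RintegralZl. Qed.

Lemma RintN D f : measurable D -> intg D f ->
  \int[mu]_(x in D) (- f x) = - \int[mu]_(x in D) f x.
Proof.
move=> mD If; rewrite -[RHS]mulN1r -RintZ//.
by apply: eq_Rintegral => x _; rewrite mulN1r.
Qed.

Lemma Rint_sum D (I : Type) (s : seq I) (P : pred I) (F : I -> X -> R) :
  measurable D -> (forall i, P i -> intg D (F i)) ->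
  \int[mu]_(x in D) (\sum_(i <- s | P i) F i x) =
  \sum_(i <- s | P i) \int[mu]_(x in D) F i x.
Proof.
move=> mD IF; elim: s => [|a s IH].
  rewrite big_nil (@eq_Rintegral _ _ _ mu D (fun=> 0)).
    by rewrite /Rintegral integral0.
  by move=> x _; rewrite big_nil.
rewrite big_cons -IH; case Pa : (P a).
  rewrite -RintD//; [|exact: IF|exact: intg_sum].
  by apply: eq_Rintegral => x _; rewrite big_cons Pa.
by apply: eq_Rintegral => x _; rewrite big_cons Pa.
Qed.

Lemma Rint_fin D f : measurable D -> intg D f ->
  (\int[mu]_(x in D) (f x)%:E = (\int[mu]_(x in D) f x)%:E)%E.
Proof. by move=> mD If; rewrite /Rintegral fineK//; exact: integrable_fin_num If. Qed.

Lemma ae_le_Rint D f g : measurable D -> intg D f -> intg D g ->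
  {ae mu, forall x, D x -> f x <= g x} ->
  \int[mu]_(x in D) f x <= \int[mu]_(x in D) g x.
Proof.
move=> mD If Ig fg; rewrite -subr_ge0 -RintB//; rewrite /Rintegral.
rewrite (ae_eq_integral (fun x => `|g x - f x|%:E)) //.
- by apply: fine_ge0; apply: integral_ge0.
- by have /intg_meas/measurable_EFinP := intgB mD Ig If.
- have /intg_meas mm := intgB mD Ig If.
  by apply/measurable_EFinP; exact: measurableT_comp.
- by apply: filterS fg => x fg Dx; rewrite ger0_norm// subr_ge0 fg.
Qed.

Lemma ae_eq_Rint D f g : measurable D -> measurable_fun D f -> measurable_fun D g ->
  {ae mu, forall x, D x -> f x = g x} ->
  \int[mu]_(x in D) f x = \int[mu]_(x in D) g x.
Proof.
move=> mD mf mg fg; rewrite /Rintegral; congr fine; apply: ae_eq_integral => //.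
- exact/measurable_EFinP.
- exact/measurable_EFinP.
- by apply: filterS fg => x fg Dx; rewrite fg.
Qed.

(** For a possibly nonmeasurable [f], the positive and the negative part both have an integral
    between 0 and that of [g], and two numbers of [0, G] differ by at most G. *)
Lemma Rint_bound D f g : measurable D -> intg D g ->
  {ae mu, forall x, D x -> `|f x| <= g x} ->
  `|\int[mu]_(x in D) f x| <= \int[mu]_(x in D) g x.
Proof.
move=> mD Ig fg.
have g0 : {ae mu, forall x, D x -> 0 <= g x}.
  by apply: filterS fg => x fg Dx; exact: le_trans (fg Dx).
have IG : (\int[mu]_(x in D) `|g x|%:E = (\int[mu]_(x in D) g x)%:E)%E.
  rewrite -Rint_fin//; apply: ae_eq_integral => //.
  - by apply/measurable_EFinP; apply: measurableT_comp => //; exact: intg_meas.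
  - by apply/measurable_EFinP; exact: intg_meas.
  - by apply: filterS g0 => x g0 Dx; rewrite ger0_norm ?g0.
have Hp : (\int[mu]_(x in D) ((EFin \o f)^\+ x) <= (\int[mu]_(x in D) g x)%:E)%E.
  rewrite -IG; apply: ae_nnint_le => //; apply: filterS fg => x fg Dx.
  rewrite funeposE /= -EFin_max lee_fin ge_max normr_ge0 andbT.
  apply: (le_trans (ler_norm _)); apply: (le_trans (fg Dx)); exact: ler_norm.
have Hn : (\int[mu]_(x in D) ((EFin \o f)^\- x) <= (\int[mu]_(x in D) g x)%:E)%E.
  rewrite -IG; apply: ae_nnint_le => //; apply: filterS fg => x fg Dx.
  rewrite funenegE /= -EFin_max lee_fin ge_max normr_ge0 andbT.
  apply: (le_trans (ler_norm _)); rewrite normrN.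
  apply: (le_trans (fg Dx)); exact: ler_norm.
rewrite /Rintegral integralE.
have p0 : (0 <= \int[mu]_(x in D) ((EFin \o f)^\+ x))%E by exact: integral_ge0.
have n0 : (0 <= \int[mu]_(x in D) ((EFin \o f)^\- x))%E by exact: integral_ge0.
have G0 := le_trans p0 Hp.
move: Hp Hn p0 n0; rewrite -/(Rintegral mu D g).
case: (\int[mu]_(x in D) ((EFin \o f)^\+ x))%E => [a||] //.
case: (\int[mu]_(x in D) ((EFin \o f)^\- x))%E => [b||] // Ha Hb a0 b0.
move: Ha Hb a0 b0; rewrite !lee_fin => Ha Hb a0 b0.
by rewrite /= ler_norml; apply/andP; split; lra.
Qed.

Lemma intg_sq D f g : measurable D -> measurable_fun D f -> measurable_fun D g ->
  intg D (fun x => f x ^+ 2) -> intg D (fun x => g x ^+ 2) ->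
  intg D (fun x => f x * g x).
Proof.
move=> mD mf mg If Ig; apply: (@le_intg D _ (fun x => f x ^+ 2 + g x ^+ 2)) => //.
- exact: measurable_funM.
- move=> x _; rewrite [leRHS]ger0_norm ?addr_ge0 ?sqr_ge0// normrM.
  rewrite -(real_normK (num_real (f x))) -(real_normK (num_real (g x))).
  have := sqr_ge0 (`|f x| - `|g x|); have := normr_ge0 (f x); have := normr_ge0 (g x).
  by nra.
- exact: intgD.
Qed.

Lemma ge0_Rint_eq0 D f : measurable D -> intg D f ->
  {ae mu, forall x, D x -> 0 <= f x} -> \int[mu]_(x in D) f x <= 0 ->
  {ae mu, forall x, D x -> f x = 0}.
Proof.
move=> mD If f0 fle.
have IG : (\int[mu]_(x in D) `|(f x)%:E| = 0)%E.
  apply/eqP; rewrite eq_le integral_ge0// andbT.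
  have -> : (\int[mu]_(x in D) `|(f x)%:E| = \int[mu]_(x in D) (f x)%:E)%E.
    apply: ae_eq_integral => //.
    - by apply: measurableT_comp => //; apply/measurable_EFinP; exact: intg_meas.
    - by apply/measurable_EFinP; exact: intg_meas.
    - by apply: filterS f0 => x f0 Dx /=; rewrite ger0_norm ?f0.
  by rewrite Rint_fin// lee_fin.
have mf : measurable_fun D (EFin \o f) by apply/measurable_EFinP; exact: intg_meas.
have := (ae_eq_integral_abs mu mD mf).1 IG.
by apply: filterS => x + Dx => /(_ Dx) [].
Qed.

End toolkit.

Lemma intgT_restrict d (X : measurableType d) (R : realType)
  (mu : {measure set X -> \bar R}) (D : set X) (f : X -> R) : measurable D ->
  intg mu D f -> mu.-integrable setT ((EFin \o f) \_ D).
Proof. by move=> mD If; apply/(integrable_mkcond _ mD). Qed.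

Section fubini_toolkit.
Context d1 d2 (T1 : measurableType d1) (T2 : measurableType d2) (R : realType).
Variable m1 : {sigma_finite_measure set T1 -> \bar R}.
Variable m2 : {sigma_finite_measure set T2 -> \bar R}.
Implicit Types (A : set T1) (B : set T2) (f : T1 * T2 -> R).

Lemma ae_prodP (P : T1 -> T2 -> Prop) :
  {ae (m1 \x m2)%E, forall z, P z.1 z.2} ->
  {ae m1, forall x, {ae m2, forall y, P x y}}.
Proof.
move=> [N [mN N0 PN]].
have mF : measurable_fun setT (m2 \o xsection N) by exact: measurable_fun_xsection.
have : (\int[m1]_x (m2 (xsection N x)) = 0)%E by [].
move=> I0.
have := (ae_eq_integral_abs m1 measurableT mF).1.
have -> : (\int[m1]_x `|(m2 \o xsection N) x| = \int[m1]_x m2 (xsection N x))%E.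
  by apply: eq_integral => x _ /=; rewrite gee0_abs.
move=> /(_ I0); apply: filterS => x /= /(_ I) h.
exists (xsection N x); split => //; first exact: measurable_xsection.
by move=> y /= nP; rewrite /xsection /=; apply/mem_set/PN.
Qed.

Lemma fub_ae A B f : measurable A -> measurable B -> intg (m1 \x m2)%E (A `*` B) f ->
  {ae m1, forall x, A x -> intg m2 B (fun y => f (x, y))}.
Proof.
move=> mA mB If; have mAB : measurable (A `*` B) by exact: measurableX.
have /ae_integrable1 := intgT_restrict mAB If.
apply: filterS => x h Ax.
apply/(integrable_mkcond _ mB); apply: eq_integrable h => // y _.
by rewrite /patch; congr (if _ then _ else _); apply/idP/idP; rewrite !inE => //= -[].
Qed.

Lemma fub_intg A B f : measurable A -> measurable B -> intg (m1 \x m2)%E (A `*` B) f ->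
  intg m1 A (fun x => \int[m2]_(y in B) f (x, y)).
Proof.
move=> mA mB If; have mAB : measurable (A `*` B) by exact: measurableX.
have iF := integrable_fubini_F (intgT_restrict mAB If).
have mF : measurable_fun A (fun x => \int[m2]_(y in B) f (x, y)).
  apply: measurableT_comp => //.
  apply: (@eq_measurable_fun _ _ _ _ _ (fubini_F m2 ((EFin \o f) \_ (A `*` B)))).
    move=> x; rewrite inE => Ax; rewrite /fubini_F [in RHS]integral_mkcond.
    apply: eq_integral => y _; rewrite /patch.
    by congr (if _ then _ else _); apply/idP/idP; rewrite !inE => //= -[].
  exact: measurable_funS (measurable_int _ iF).
apply: intgP => //.
have iA := integrableS measurableT mA (@subsetT _ _) iF.
move: iA => /integrableP[_]; apply: le_lt_trans; apply: nnint_le => //= x Ax.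
rewrite /fubini_F; set e := (\int[m2]_y _)%E.
have -> : (\int[m2]_(y in B) f (x, y)) = fine e.
  rewrite /Rintegral /e [in LHS]integral_mkcond; congr fine.
  apply: eq_integral => y _; rewrite /patch.
  by congr (if _ then _ else _); apply/idP/idP; rewrite !inE => //= -[].
(* [fine] sends an infinite value to 0, so the bound also holds at the exceptional [x] whose section
   is not integrable. *)
by case: e => [s||] //=; rewrite normr0 leey.
Qed.

Lemma fub_Rint A B f : measurable A -> measurable B -> intg (m1 \x m2)%E (A `*` B) f ->
  \int[m1]_(x in A) \int[m2]_(y in B) f (x, y) = \int[(m1 \x m2)%E]_(z in A `*` B) f z.
Proof.
move=> mA mB If; have mAB : measurable (A `*` B) by exact: measurableX.
have iR := intgT_restrict mAB If.
have iF := integrable_fubini_F iR.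
rewrite [in RHS]/Rintegral [in RHS]integral_mkcond -(integral12_prod_meas1 iR).
rewrite /Rintegral; congr fine; rewrite [in LHS]integral_mkcond.
apply: ae_eq_integral => //.
- apply/(measurable_restrictT _ mA)/measurable_EFinP/intg_meas.
  exact: (fub_intg mA mB If).
- exact: measurable_int iF.
- have := integrable_ae measurableT iF; apply: filterS => x + _ => /(_ I).
  rewrite /fubini_F patchE; case: (boolP (x \in A)) => xA.
    rewrite [in X in _ -> X = _]integral_mkcond => h.
    have E : (\int[m2]_x0 ((EFin \o (fun y => f (x, y))) \_ B) x0 =
      \int[m2]_y ((EFin \o f) \_ (A `*` B)) (x, y))%E.
      apply: eq_integral => y _; rewrite /patch; rewrite inE in xA.
      by congr (if _ then _ else _); apply/idP/idP; rewrite !inE => //= -[].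
    by rewrite E fineK.
  move=> _; apply/esym; rewrite (_ : point = 0%E)//; apply: integral0_eq => y _; rewrite patchE.
  case: (boolP ((x, y) \in _)) => //; rewrite inE => -[/= Ax]; move: xA; rewrite notin_setE => /(_ Ax) [].
Qed.

Lemma tonelli A B (f : T1 * T2 -> \bar R) : measurable A -> measurable B ->
  measurable_fun (A `*` B) f -> (forall z, (A `*` B) z -> 0 <= f z)%E ->
  measurable_fun A (fun x => \int[m2]_(y in B) f (x, y))%E /\
  (\int[(m1 \x m2)]_(z in A `*` B) f z =
   \int[m1]_(x in A) \int[m2]_(y in B) f (x, y))%E.
Proof.
move=> mA mB mf f0; have mAB : measurable (A `*` B) by exact: measurableX.
have mg : measurable_fun setT (f \_ (A `*` B)) by apply/(measurable_restrictT _ mAB).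
have g0 : forall z, (0 <= (f \_ (A `*` B)) z)%E.
  by move=> z; rewrite /patch; case: ifPn => //; rewrite inE => /f0.
have E x : A x -> (\int[m2]_(y in B) f (x, y) =
    \int[m2]_y (f \_ (A `*` B)) (x, y))%E.
  move=> Ax; rewrite integral_mkcond; apply: eq_integral => y _; rewrite /patch.
  by congr (if _ then _ else _); apply/idP/idP; rewrite !inE => //= -[].
split.
  apply: (@eq_measurable_fun _ _ _ _ _ (fubini_F m2 (f \_ (A `*` B)))).
    by move=> x; rewrite inE => Ax; rewrite E.
  apply: measurable_funS (measurable_fun_fubini_tonelli_F _ mg g0) => //.
rewrite integral_mkcond fubini_tonelli1// [in RHS]integral_mkcond.
apply: eq_integral => x _; rewrite /fubini_F [in RHS]/patch; case: ifPn => xA.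
  by rewrite E//; rewrite inE in xA.
rewrite integral0_eq// => y _; rewrite patchE.
case: (boolP ((x, y) \in _)) => //; rewrite inE => -[/= Ax]; move: xA; rewrite notin_setE => /(_ Ax) [].
Qed.

End fubini_toolkit.

(** * Lebesgue measure on row vectors *)

Section row_vectors.
Context {R : realType}.

Lemma coord_le_norm n (x : 'rV[R]_n) i : `|x ord0 i| <= `|x|.
Proof.
rewrite [leRHS]/Num.norm /= mx_normrE; apply/bigmax_geP; right => /=.
by exists (ord0, i).
Qed.

Lemma norm_le_coord n (x : 'rV[R]_n) c : 0 <= c ->
  (forall i, `|x ord0 i| <= c) -> `|x| <= c.
Proof.
move=> c0 xc; rewrite [leLHS]/Num.norm /= mx_normrE; apply/bigmax_leP.
by split=> // -[i j] _ /=; rewrite (ord1 i).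
Qed.

Lemma ball_rVE n (x : 'rV[R]_n) e : 0 < e ->
  ball x e = [set y | forall i, `|x ord0 i - y ord0 i| < e].
Proof.
move=> e0; apply/seteqP; split => [y [_ h] i|y h]; first exact: (h ord0 i).
by split => // i j; rewrite (ord1 i); exact: h.
Qed.

Lemma measurable_ball_rV n (x : 'rV[R]_n) e : measurable (ball x e).
Proof.
have [e0|e0] := leP e 0.
  by rewrite (_ : ball x e = set0)//; apply/seteqP; split => // y [] /(le_lt_trans e0); rewrite ltxx.
have -> : ball x e = ~` \bigcup_(i : 'I_n) [set y : 'rV[R]_n | ~ `|x ord0 i - y ord0 i| < e].
  rewrite ball_rVE//; apply/seteqP; split => [y h [i _]|y h i]; first exact.
  by apply: contrapT => ?; apply: h; exists i.
apply: measurableC; apply: countable_bigcupT_measurable; first exact/finite_set_countable.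
move=> i; have -> : [set y : 'rV[R]_n | ~ `|x ord0 i - y ord0 i| < e] =
    ~` ((fun y : 'rV[R]_n => y ord0 i) @^-1` ball (x ord0 i) e) by [].
apply: measurableC; rewrite -[X in measurable X]setTI.
by apply: measurable_coord => //; exact: measurable_ball.
Qed.

Definition rat_rV n (q : 'rV[rat]_n) : 'rV[R]_n := map_mx ratr q.

Lemma rV_rat_dense n (x : 'rV[R]_n) e : 0 < e ->
  exists q : 'rV[rat]_n, ball (rat_rV q) e x.
Proof.
move=> e0; have h i : exists q : rat, `|ratr q - x ord0 i| < e.
  have /rat_in_itvoo[q] : x ord0 i - e < x ord0 i + e by rewrite ltrBlDr -addrA ltrDl addr_gt0.
  rewrite in_itv /= => /andP[q1 q2]; exists q.
  by rewrite ltr_norml; apply/andP; split; lra.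
exists (\row_i (sval (cid (h i)))); rewrite ball_rVE// => i /=.
by rewrite !mxE; case: (cid (h i)).
Qed.

Lemma invS_small (e : R) : 0 < e -> exists k : nat, k.+1%:R^-1 < e.
Proof.
move=> e0; exists (Num.truncn e^-1); rewrite invf_plt ?posrE//.
by have := truncnS_gt e^-1.
Qed.

(** The sigma-algebra on row vectors is generated by the coordinates, not by the topology. Balls of
    the sup norm are boxes, hence measurable, and an open set is the countable union of those with
    rational centre and radius 1/(k+1) that it contains. *)
Lemma open_measurable_rV n (O : set 'rV[R]_n) : open O -> measurable O.
Proof.
move=> oO.
pose F (p : 'rV[rat]_n * nat) : set 'rV[R]_n :=
  if `[< ball (rat_rV p.1) (p.2.+1%:R^-1 : R) `<=` O >]
  then ball (rat_rV p.1) p.2.+1%:R^-1 else set0.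
rewrite (_ : O = \bigcup_p F p).
  apply: countable_bigcupT_measurable; first exact: countableP.
  by move=> p; rewrite /F; case: ifPn => // _; exact: measurable_ball_rV.
apply/seteqP; split => [x Ox|x [p _]]; last first.
  by rewrite /F; case: ifPn => // /asboolP h; exact: h.
have /nbhs_ballP[e /= e0 eO] := oO _ Ox.
have [k ke] := invS_small (divr_gt0 e0 (ltr0n R 2)).
have k0 : (0 : R) < k.+1%:R^-1 by rewrite invr_gt0.
have [q qx] := rV_rat_dense x k0.
exists (q, k) => //; rewrite /F /= ifT//; apply/asboolP => y qy; apply: eO.
rewrite [e]splitr; apply: (@ball_triangle _ _ (rat_rV q)).
  by apply: ball_sym; apply: le_ball qx; exact: ltW.
by apply: le_ball qy; exact: ltW.
Qed.

Lemma closed_measurable_rV n (A : set 'rV[R]_n) : closed A -> measurable A.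
Proof. by move/closed_openC/open_measurable_rV/measurableC; rewrite setCK. Qed.

Lemma open_measurable_prod n (O : set (R * 'rV[R]_n)) : open O -> measurable O.
Proof.
move=> oO.
pose F (p : (rat * 'rV[rat]_n) * nat) : set (R * 'rV[R]_n) :=
  let B := ball (ratr p.1.1 : R) p.2.+1%:R^-1 `*` ball (rat_rV p.1.2) (p.2.+1%:R^-1 : R) in
  if `[< B `<=` O >] then B else set0.
rewrite (_ : O = \bigcup_p F p).
  apply: countable_bigcupT_measurable; first exact: countableP.
  move=> p; rewrite /F; case: ifPn => // _; apply: measurableX.
    exact: measurable_ball.
  exact: measurable_ball_rV.
apply/seteqP; split => [[t x] Ox|x [p _]]; last first.
  by rewrite /F; case: ifPn => // /asboolP h; exact: h.
have /nbhs_ballP[e /= e0 eO] := oO _ Ox.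
have [k ke] := invS_small (divr_gt0 e0 (ltr0n R 2)).
have k0 : (0 : R) < k.+1%:R^-1 by rewrite invr_gt0.
have [q qx] := rV_rat_dense x k0.
have /rat_in_itvoo[q0] : t - k.+1%:R^-1 < t + k.+1%:R^-1.
  by rewrite ltrBlDr -addrA ltrDl addr_gt0.
rewrite in_itv /= => /andP[q1 q2].
have q0t : ball (ratr q0 : R) k.+1%:R^-1 t.
  move: q1 q2; rewrite /ball /=; move: (k.+1%:R^-1 : R) => h q1 q2.
  by rewrite ltr_norml; apply/andP; split; lra.
exists ((q0, q), k) => //; rewrite /F /= ifT//.
apply/asboolP => -[s y] [/= sq yq]; apply: eO.
rewrite [e]splitr; split => /=.
  apply: (@ball_triangle _ _ (ratr q0 : R)).
    by apply: ball_sym; apply: le_ball q0t; exact: ltW.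
  by apply: le_ball sq; exact: ltW.
apply: (@ball_triangle _ _ (rat_rV q)).
  by apply: ball_sym; apply: le_ball qx; exact: ltW.
by apply: le_ball yq; exact: ltW.
Qed.

Lemma within_continuous_measurable_rV n (D : set 'rV[R]_n) (f : 'rV[R]_n -> R) :
  measurable D -> {within D, continuous f} -> measurable_fun D f.
Proof.
move=> mD /continuousP cf; apply: (measurability _ (RGenOpens.measurableE R)).
move=> _ [_ [a [b ->] <-]].
have /cf : open `]a, b[%classic by exact: interval_open.
move=> /open_subspaceP[V oV VD].
by rewrite setIC -VD; apply: measurableI => //; exact: open_measurable_rV.
Qed.

Lemma within_continuous_measurable_prod n (D : set (R * 'rV[R]_n)) (f : R * 'rV[R]_n -> R) :
  measurable D -> {within D, continuous f} -> measurable_fun D f.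
Proof.
move=> mD /continuousP cf; apply: (measurability _ (RGenOpens.measurableE R)).
move=> _ [_ [a [b ->] <-]].
have /cf : open `]a, b[%classic by exact: interval_open.
move=> /open_subspaceP[V oV VD].
by rewrite setIC -VD; apply: measurableI => //; exact: open_measurable_prod.
Qed.

End row_vectors.

Section lebesgue_rV_theory.
Context {R : realType}.
Local Notation leb := (@lebesgue_measure R).

(** The image of Lebesgue measure under a translation gives half-open intervals their length, and
    Lebesgue measure is the only measure that does so. *)
Lemma integral_translation (a : R) (f : R -> \bar R) :
  measurable_fun setT f -> (forall x, 0 <= f x)%E ->
  (\int[leb]_x f (x + a)%R = \int[leb]_x f x)%E.
Proof.
move=> mf f0.
have mphi : measurable_fun setT (fun x : R => x + a : measurableTypeR R).
  exact: measurable_funD.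
pose mixin := isMeasurableFun.Build _ _ _ _ _ mphi.
pose phi : {mfun _ >-> _} := HB.pack (fun x : R => x + a : measurableTypeR R) mixin.
transitivity (\int[leb]_(x in phi @^-1` setT) (f \o phi) x)%E; first by rewrite preimage_setT.
rewrite -ge0_integral_pushforward//.
apply: eq_measure_integral => A mA _; symmetry.
apply: (@lebesgue_measure_unique R (pushforward leb phi)) => // _ [[x y] _ <-] /=.
rewrite /pushforward (_ : _ @^-1` _ = `]x - a, y - a]%classic).
  by rewrite !lebesgue_measure_itv/= !lte_fin ltrD2r -!EFinB; case: ifPn => // _; congr EFin; ring.
by apply/seteqP; split => z /=; rewrite !in_itv /= => /andP[h1 h2]; apply/andP; split; lra.
Qed.

Lemma rV_consD n (s : R) (y : 'rV[R]_n) (a : 'rV[R]_n.+1) :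
  rV_cons (s, y) + a = rV_cons (s + (rV_uncons a).1, y + (rV_uncons a).2).
Proof.
apply/rowP => i; rewrite !mxE /=; case: unliftP => [j ->|->] /=; rewrite ?mxE//.
Qed.

Lemma integral_rV_cons n (f : 'rV[R]_n.+1 -> \bar R) :
  measurable_fun setT f -> (forall x, 0 <= f x)%E ->
  (\int[lebesgue_rV R n.+1]_x f x =
   \int[leb]_s \int[lebesgue_rV R n]_y f (rV_cons (s, y)))%E.
Proof.
move=> mf f0.
transitivity (\int[pushforward (leb \x lebesgue_rV R n)%E (@rV_cons R n)]_(x in setT) f x)%E.
  by [].
rewrite ge0_integral_pushforward//; last exact: measurable_rV_cons.
rewrite preimage_setT fubini_tonelli1// => [|z]; last exact: f0.
by apply: measurableT_comp => //; exact: measurable_rV_cons.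
Qed.

Lemma measurable_translation n (a : 'rV[R]_n) :
  measurable_fun setT (fun x : 'rV[R]_n => x + a).
Proof.
apply/measurable_fun_rVP => i; under eq_fun do rewrite mxE.
by apply: measurable_funD => //; exact: measurable_coord.
Qed.

Lemma integral_rV_translation n (a : 'rV[R]_n) (f : 'rV[R]_n -> \bar R) :
  measurable_fun setT f -> (forall x, 0 <= f x)%E ->
  (\int[lebesgue_rV R n]_x f (x + a)%R = \int[lebesgue_rV R n]_x f x)%E.
Proof.
elim: n a f => [|n IH] a f mf f0.
  by apply: eq_integral => x _; congr f; apply/rowP => -[].
rewrite !integral_rV_cons//; last first.
  by apply: measurableT_comp => //; exact: measurable_translation.
have mfc : measurable_fun setT (fun z => f (rV_cons z)).
  by apply: measurableT_comp => //; exact: measurable_rV_cons.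
rewrite -[RHS](@integral_translation (rV_uncons a).1); last 2 first.
- exact: (measurable_fun_fubini_tonelli_F (fun z => f (rV_cons z))).
- by move=> s; exact: integral_ge0.
apply: eq_integral => s _.
rewrite -(IH (rV_uncons a).2 (fun y => f (rV_cons (s + (rV_uncons a).1, y))))//.
  by apply: eq_integral => y _; rewrite rV_consD.
exact: (measurableT_comp mfc).
Qed.

Definition cube n (M : R) : set 'rV[R]_n := [set x | forall i, `|x ord0 i| <= M].

Arguments cube n M : clear implicits.

Lemma measurable_cube n (M : R) : measurable (cube n M).
Proof.
have -> : cube n M = ~` \bigcup_(i : 'I_n) ((fun y : 'rV[R]_n => y ord0 i) @^-1` (~` `[- M, M]%classic)).
  apply/seteqP; split => [y h [i _]|y h i].
    by apply; rewrite /= in_itv /= -ler_norml; exact: h.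
  by apply: contrapT => nM; apply: h; exists i => //=; rewrite in_itv /= -ler_norml.
apply: measurableC; apply: countable_bigcupT_measurable; first exact/finite_set_countable.
move=> i; rewrite -[X in measurable X]setTI; apply: measurable_coord => //.
exact: measurableC.
Qed.

Lemma lebesgue_rV_cube n (M : R) : (lebesgue_rV R n (cube n M) < +oo)%E.
Proof.
elim: n => [|n IH].
  by rewrite /= diracE ltry.
have -> : lebesgue_rV R n.+1 (cube n.+1 M) =
    (leb \x lebesgue_rV R n)%E (`[- M, M]%classic `*` cube n M).
  transitivity (pushforward (leb \x lebesgue_rV R n)%E (@rV_cons R n) (cube n.+1 M)) => //.
  rewrite /pushforward; congr (_ _); apply/seteqP; split => -[s y] /=.
    move=> h; split.
      by have := h ord0; rewrite mxE unlift_none /= in_itv /= ler_norml.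
    by move=> i; have := h (lift ord0 i); rewrite mxE liftK.
  move=> [hs hy] i; rewrite mxE; case: unliftP => [j _|_].
    exact: (hy j).
  by move: hs; rewrite in_itv /= ler_norml.
rewrite product_measure1E//; last exact: measurable_cube.
have h : (leb `[(- M)%R, M]%classic < +oo)%E.
  by rewrite lebesgue_measure_itv/=; case: ifP; rewrite ?ltry.
by rewrite lte_mul_pinfty// ge0_fin_numE.
Qed.

Lemma Rint_rV_translation n (a : 'rV[R]_n) (f : 'rV[R]_n -> R) :
  measurable_fun setT f ->
  \int[lebesgue_rV R n]_x f (x + a) = \int[lebesgue_rV R n]_x f x.
Proof.
move=> mf; rewrite /Rintegral integralE [in RHS]integralE; congr (fine (_ - _)).
  transitivity (\int[lebesgue_rV R n]_x ((EFin \o f)^\+ (x + a)%R))%E.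
    by apply: eq_integral => x _; rewrite !funeposE.
  apply: integral_rV_translation => //.
  exact/measurable_funepos/measurable_EFinP.
transitivity (\int[lebesgue_rV R n]_x ((EFin \o f)^\- (x + a)%R))%E.
  by apply: eq_integral => x _; rewrite !funenegE.
apply: integral_rV_translation => //.
exact/measurable_funeneg/measurable_EFinP.
Qed.

End lebesgue_rV_theory.

Arguments cube {R} n M.

(** * Calculus on the line and a smooth step *)

Section calculus.
Context {R : realType} {V : normedModType R}.
Implicit Types (f g : V -> R) (x v : V).

Lemma Dcst (c : R) x v : is_derive x v (fun=> c : R) 0.
Proof. exact: is_derive_cst. Qed.

Lemma DD f g x v (a b : R) : is_derive x v f a -> is_derive x v g b ->
  is_derive x v (fun y => f y + g y) (a + b).
Proof. by move=> ? ?; exact: is_deriveD. Qed.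

Lemma DB f g x v (a b : R) : is_derive x v f a -> is_derive x v g b ->
  is_derive x v (fun y => f y - g y) (a - b).
Proof. by move=> ? ?; exact: is_deriveB. Qed.

Lemma DM f g x v (a b : R) : is_derive x v f a -> is_derive x v g b ->
  is_derive x v (fun y => f y * g y) (a * g x + f x * b).
Proof.
move=> fa gb; have h := is_deriveM fa gb.
by apply: (is_derive_eq h); rewrite /GRing.scale /= addrC mulrC.
Qed.

Lemma DZ (c : R) f x v (a : R) : is_derive x v f a ->
  is_derive x v (fun y => c * f y) (c * a).
Proof. by move=> ?; exact: is_deriveZ. Qed.

Lemma Dsum (I : Type) (s : seq I) (F : I -> V -> R) (a : I -> R) x v :
  (forall i, is_derive x v (F i) (a i)) ->
  is_derive x v (fun y => \sum_(i <- s) F i y) (\sum_(i <- s) a i).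
Proof.
move=> h; elim: s => [|i s IH].
  by rewrite big_nil; under eq_fun do rewrite big_nil; exact: Dcst.
by rewrite big_cons; under eq_fun do rewrite big_cons; exact: DD.
Qed.

(** Both difference quotients are the same function of [h]. Partial derivatives are thereby handled
    by one-variable calculus along lines. *)
Lemma is_derive_line f x v (a : R) t :
  is_derive (t : R) 1 (fun h : R => f (x + h *: v)) a <->
  is_derive (x + t *: v) v f a.
Proof.
have E : (fun h : R => h^-1 *: (((fun h : R => f (x + h *: v)) \o shift t) (h *: 1) - f (x + t *: v))) =
    (fun h => h^-1 *: ((f \o shift (x + t *: v)) (h *: v) - f (x + t *: v))).
  apply/funext => h /=; congr (_ *: (f _ - _)).
  by rewrite [h *: 1]mulr1 scalerDl addrCA.
split=> -[h1 h2]; split.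
- by move: h1; rewrite /derivable E.
- by move: h2; rewrite /derive E.
- by rewrite /derivable E.
- by rewrite /derive E.
Qed.

Lemma Dcomp (g : R -> R) f x v (a b : R) : is_derive (f x) 1 g b ->
  is_derive x v f a -> is_derive x v (fun y => g (f y)) (b * a).
Proof.
move=> gb fa.
have fa0 : is_derive (0 : R) 1 (fun h : R => f (x + h *: v)) a.
  by apply/is_derive_line; rewrite scale0r addr0.
have gb0 : is_derive (f (x + 0 *: v)) 1 g b by rewrite scale0r addr0.
have := is_derive1_comp gb0 fa0.
rewrite (_ : g \o _ = (fun h : R => g (f (x + h *: v))))//.
by move/(is_derive_line (fun y => g (f y)) x v (b * a) 0); rewrite scale0r addr0.
Qed.

End calculus.

Section calculus1.
Context {R : realType}.
Implicit Types (f g : R -> R) (x : R).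

Lemma is_derive1P f x (L : R) : is_derive x 1 f L <->
  forall e : R, 0 < e -> exists2 d : R, 0 < d &
    forall y, `|y - x| < d -> `|f y - f x - L * (y - x)| <= e * `|y - x|.
Proof.
have E : (fun h : R => h^-1 *: ((f \o shift x) (h *: 1) - f x)) =
  (fun h : R => h^-1 * (f (h + x) - f x)).
  by apply/funext => h /=; rewrite [h *: 1]mulr1.
split=> [[df <-] e e0|h].
  have : (fun h : R => h^-1 *: ((f \o shift x) (h *: 1) - f x)) @ 0^' --> 'D_1 f x.
    by apply: df.
  move=> /cvgrPdist_le /(_ e e0) [d /= d0 hd]; exists d => // y yd.
  have [->|yx] := eqVneq y x; first by rewrite !subrr mulr0 subrr normr0 mulr0.
  have yx0 : y - x != 0 by rewrite subr_eq0.
  have := hd (y - x); rewrite /ball /= sub0r normrN => /(_ yd yx0).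
  rewrite [(y - x) *: 1]mulr1 subrK => h; change (is_true (`|'D_1 f x - (y - x)^-1 * (f y - f x)| <= e)) in h.
  have -> : f y - f x - 'D_1 f x * (y - x) = - ('D_1 f x - (y - x)^-1 * (f y - f x)) * (y - x).
    by field.
  by rewrite normrM normrN ler_wpM2r.
have cv : (fun h : R => h^-1 *: ((f \o shift x) (h *: 1) - f x)) @ 0^' --> L.
  rewrite E; apply/cvgrPdist_le => e e0; have [d d0 hd] := h e e0.
  exists d => //= t; rewrite /ball /= sub0r normrN => td t0.
  have := hd (t + x); rewrite addrK => /(_ td).
  have -> : f (t + x) - f x - L * t = - (L - t^-1 * (f (t + x) - f x)) * t.
    by field.
  by rewrite normrM normrN ler_pM2r// normr_gt0.
split; first by apply/cvg_ex; exists L.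
exact/cvg_lim.
Qed.

Lemma is_derive1_cont f x (L : R) : is_derive x 1 f L -> {for x, continuous f}.
Proof. by move=> [h _]; apply: differentiable_continuous; exact/derivable1_diffP. Qed.

Lemma MVT_le f (f' : R -> R) (a b C : R) : a <= b ->
  (forall x, a < x < b -> is_derive x 1 f (f' x)) ->
  (forall x, a < x < b -> `|f' x| <= C) ->
  {within `[a, b], continuous f} -> `|f b - f a| <= C * (b - a).
Proof.
rewrite le_eqVlt => /predU1P[->|ab] df fC cf; first by rewrite !subrr normr0 mulr0.
have df' x : x \in `]a, b[ -> is_derive x 1 f (f' x).
  by rewrite in_itv; exact: df.
have [c cab ->] := MVT ab df' cf.
have ba : 0 <= b - a by rewrite subr_ge0 ltW.
rewrite normrM (ger0_norm ba) ler_wpM2r//.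
by apply: fC; rewrite in_itv in cab.
Qed.

Lemma derive0_cst f (a b : R) : a <= b ->
  (forall x, a < x < b -> is_derive x 1 f 0) ->
  {within `[a, b], continuous f} -> f b = f a.
Proof.
move=> ab df cf; have := @MVT_le f (fun=> 0) a b 0 ab df _ cf.
rewrite mul0r => h; apply/eqP; rewrite -subr_eq0 -normr_le0; apply: h => x _.
by rewrite normr0.
Qed.

Lemma derive_ge0_nd f (f' : R -> R) (a b : R) : a <= b ->
  (forall x, a < x < b -> is_derive x 1 f (f' x)) ->
  (forall x, a < x < b -> 0 <= f' x) ->
  {within `[a, b], continuous f} -> f a <= f b.
Proof.
rewrite le_eqVlt => /predU1P[->//|ab] df f0 cf.
have df' x : x \in `]a, b[ -> is_derive x 1 f (f' x).
  by rewrite in_itv; exact: df.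
have [c cab E] := MVT ab df' cf; rewrite -subr_ge0 E mulr_ge0 ?subr_ge0 ?(ltW ab)//.
by apply: f0; rewrite in_itv in cab.
Qed.

Lemma cont_within f (A : set R) : continuous f -> {within A, continuous f}.
Proof. exact: continuous_subspaceT. Qed.

Lemma antiderivative (g : R -> R) : continuous g -> (forall x, x <= 0 -> g x = 0) ->
  exists2 G : R -> R, (forall x, is_derive x 1 G (g x)) & forall x, x <= 0 -> G x = 0.
Proof.
move=> cg g0.
pose G x := \int[lebesgue_measure]_(t in `[-1, x]) g t.
have G0 x : x <= 0 -> G x = 0.
  move=> x0; rewrite /G (@eq_Rintegral _ _ _ _ _ (cst 0)).
    by rewrite /Rintegral integral0.
  move=> t; rewrite inE /= in_itv /= => /andP[_ tx]; rewrite g0//.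
  exact: le_trans x0.
(* Up to -1/2 the primitive vanishes near [x]; beyond it [x] is interior to [-1, x + 1], where the
   fundamental theorem applies. *)
exists G => // x; have [x0|x0] := leP x (- 2^-1).
  have xn : x < 0 by apply: le_lt_trans x0 _; rewrite oppr_lt0 invr_gt0.
  rewrite g0 ?(ltW xn)//; apply: (@near_eq_is_derive R R R (fun=> 0)).
  near=> y; rewrite G0//; apply: ltW; near: y; exact: lt_nbhsl.
have x1 : -1 < x by apply: lt_trans x0; rewrite ltrN2; rewrite invf_lt1// ltr1n.
have ig : lebesgue_measure.-integrable [set` Interval (BLeft (-1)) (BRight (x + 1))] (EFin \o g).
  apply: continuous_compact_integrable; first exact: segment_compact.
  exact: cont_within.
have x2 : x < x + 1 by rewrite ltrDl.
have x3 : (BLeft (-1)%R < BRight x)%E by rewrite /= lte_fin.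
have [h1 h2] := @continuous_FTC1 R g (BLeft (-1)) x (x + 1) x2 ig x3 (cg x).
by split => //; rewrite -derive1E.
Unshelve. all: by end_near. Qed.

End calculus1.

(** * A smooth step built from exp(-1/x) *)

Section flat_function.
Context {R : realType}.

(** The powers of 1/x are included to make the family closed under differentiation up to linear
    combinations, which is what yields smoothness of all orders. *)
Definition flat (n : nat) (x : R) : R := if 0 < x then x^-1 ^+ n * expR (- x^-1) else 0.

Lemma flat_ge0 n x : 0 <= flat n x.
Proof.
rewrite /flat; case: ifPn => // x0.
by rewrite mulr_ge0 ?expR_ge0// exprn_ge0// invr_ge0 ltW.
Qed.

(** One term of the exponential series, y^(n+2)/(n+2)! <= exp y with y = 1/x. The quadratic decay
    gives derivative 0 at the origin. *)
Lemma flat_le n x : 0 < x -> flat n x <= n.+2`!%:R * x ^+ 2.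
Proof.
move=> x0; rewrite /flat x0; set y := x^-1.
have y0 : 0 < y by rewrite invr_gt0.
rewrite expRN ler_pdivrMr ?expR_gt0//.
have h := @expR_ge1Dxn R y n.+1 (ltW y0).
have {}h : y ^+ n.+2 / n.+2`!%:R <= expR y by apply: le_trans h; rewrite lerDr.
have f0 : (0 : R) < n.+2`!%:R by rewrite ltr0n fact_gt0.
rewrite ler_pdivrMr// in h.
have -> : x = y^-1 by rewrite invrK.
rewrite (exprVn y) mulrAC ler_pdivlMr ?exprn_gt0// -exprD addn2.
by rewrite mulrC.
Qed.

Lemma flat_derive n (x : R) : is_derive x 1 (flat n) (flat n.+2 x - n%:R * flat n.+1 x).
Proof.
have [x0|x0|->] := ltgtP x 0.
- rewrite /flat (lt_gtF x0) mulr0 subr0.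
  apply: (@near_eq_is_derive R R R (fun=> 0)).
  near=> y; rewrite ifF//; apply/negbTE; rewrite -leNgt; apply: ltW; near: y; exact: lt_nbhsl.
- apply: (@near_eq_is_derive R R R (fun y : R => y^-1 ^+ n * expR (- y^-1))).
    near=> y; rewrite /flat ifT//; near: y; exact: lt_nbhsr.
  have xn0 : x != 0 by rewrite gt_eqF.
  have dV : is_derive x 1 (fun y : R => y^-1) (- x ^- 2 * 1).
    have := @is_deriveV R id x 1 1 xn0 (is_derive_id _ _).
    by rewrite /GRing.scale.
  have dVn : is_derive x 1 (fun y : R => y^-1 ^+ n) (n%:R * x^-1 ^+ n.-1 * (- x ^- 2 * 1)).
    have := @is_deriveX R R (fun y : R => y^-1) n x 1 _ dV.
    rewrite (_ : _ ^+ n = (fun y : R => y^-1 ^+ n))//.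
    by elim: n => [|n IH]; apply/funext => z; rewrite ?expr0// exprS fctE IH exprS.
  have dE : is_derive x 1 (fun y : R => expR (- y^-1)) (expR (- x^-1) * - (- x ^- 2 * 1)).
    exact: (Dcomp (is_derive_expR _) (is_deriveN dV)).
  apply: (is_derive_eq (DM dVn dE)); rewrite /flat x0.
  case: n {dVn} => [|n]; rewrite /= -?exprVn !exprS; ring.
- rewrite /flat ltxx mulr0 subr0; apply/is_derive1P => e e0.
  pose C : R := n.+2`!%:R.
  have C0 : 0 < C by rewrite ltr0n fact_gt0.
  exists (e / C); first by rewrite divr_gt0.
  move=> y; rewrite !subr0 mul0r subr0 => yd; rewrite ltxx subr0.
  have [y0|y0] := leP y 0; first by rewrite normr0 mulr_ge0 // ltW.
  have := flat_le n y0; have := flat_ge0 n y; rewrite /flat y0 => h0 h1.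
  rewrite ger0_norm//; apply: (le_trans h1).
  rewrite gtr0_norm// ltr_pdivlMr// in yd; rewrite gtr0_norm//.
  by rewrite -/C; nra.
Unshelve. all: by end_near. Qed.

Lemma flat_cont n : continuous (flat n).
Proof. by move=> x; exact: is_derive1_cont (flat_derive n x). Qed.

Definition bump (x : R) : R := flat 0 x * flat 0 (1 - x).

Lemma bump_cont : continuous bump.
Proof.
move=> x; apply: continuousM; first exact: flat_cont.
apply: (@continuous_comp R R R (fun x => 1 - x) (flat 0)); last exact: flat_cont.
by apply: continuousB; [exact: cst_continuous|].
Qed.

Lemma bump_ge0 x : 0 <= bump x.
Proof. by rewrite mulr_ge0 ?flat_ge0. Qed.

Lemma bump_gt0 x : 0 < x < 1 -> 0 < bump x.
Proof.
move=> /andP[x0 x1]; rewrite /bump /flat x0 subr_gt0 x1 !expr0 !mul1r.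
by rewrite mulr_gt0 ?expR_gt0.
Qed.

Lemma bump_le0 x : x <= 0 -> bump x = 0.
Proof. by move=> x0; rewrite /bump /flat ltNge x0 mul0r. Qed.

Lemma bump_ge1 x : 1 <= x -> bump x = 0.
Proof. by move=> x0; rewrite /bump {2}/flat subr_gt0 ltNge x0 mulr0. Qed.

Lemma step_exists : exists2 th : R -> R, exists2 c : R, 0 < c & forall x : R, is_derive x 1 th (c * bump x) &
  (forall x, x <= 0 -> th x = 0) /\ (forall x, 1 <= x -> th x = 1).
Proof.
have [G dG G0] := antiderivative bump_cont bump_le0.
have cG : continuous G by move=> x; exact: is_derive1_cont (dG x).
have G1 : 0 < G 1.
  have [c] := @MVT R G bump 0 1 ltr01 (fun x _ => dG x) (cont_within cG).
  by rewrite in_itv /= (G0 0)// !subr0 mulr1 => c01 ->; exact: bump_gt0.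
exists (fun x => (G 1)^-1 * G x).
  by exists (G 1)^-1; [rewrite invr_gt0|move=> x; exact: DZ].
split=> x x0; first by rewrite (G0 x x0) mulr0.
have -> : G x = G 1; last by rewrite mulVf ?gt_eqF.
apply: derive0_cst => //; last exact: cont_within.
by move=> y /andP[y1 _]; apply: (is_derive_eq (dG y)); rewrite bump_ge1// ltW.
Qed.

End flat_function.

(** * A smooth B-spline and its moment identities *)

Section spline.
Context {R : realType}.

(* [th] is a smooth step, [Th] its antiderivative *)
Definition th : R -> R := sval (cid2 (@step_exists R)).

Lemma th_derive : exists2 c : R, 0 < c & forall x : R, is_derive x 1 th (c * bump x).
Proof. by rewrite /th; case: (cid2 _). Qed.

Definition th_c : R := sval (cid2 th_derive).

Lemma th_cgt0 : 0 < th_c.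
Proof. by rewrite /th_c; case: (cid2 _). Qed.

Lemma dth (x : R) : is_derive x 1 th (th_c * bump x).
Proof. by rewrite /th_c; case: (cid2 _). Qed.

Lemma th_le0 x : x <= 0 -> th x = 0.
Proof. by rewrite /th; case: (cid2 _) => f _ [h _] /=; exact: h. Qed.

Lemma th_ge1 x : 1 <= x -> th x = 1.
Proof. by rewrite /th; case: (cid2 _) => f _ [_ h] /=; exact: h. Qed.

Lemma th_cont : continuous th.
Proof. by move=> x; exact: is_derive1_cont (dth x). Qed.

Lemma th_nd x y : x <= y -> th x <= th y.
Proof.
move=> xy; apply: (@derive_ge0_nd R th (fun x => th_c * bump x)) => //.
- by move=> z _; exact: dth.
- by move=> z _; apply: mulr_ge0; [exact: ltW th_cgt0|exact: bump_ge0].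
- exact: cont_within th_cont.
Qed.

Lemma th_ge0 x : 0 <= th x.
Proof.
have [x0|x0] := leP x 0; first by rewrite th_le0.
by rewrite -(@th_le0 0)// th_nd// ltW.
Qed.

Lemma th_le1 x : th x <= 1.
Proof.
have [x0|x0] := leP 1 x; first by rewrite th_ge1.
by rewrite -(@th_ge1 1)// th_nd// ltW.
Qed.

Definition Th : R -> R := sval (cid2 (antiderivative th_cont th_le0)).

Lemma dTh (x : R) : is_derive x 1 Th (th x).
Proof. by rewrite /Th; case: (cid2 _). Qed.

Lemma Th_le0 x : x <= 0 -> Th x = 0.
Proof. by rewrite /Th; case: (cid2 _) => f _ h /=; exact: h. Qed.

Lemma Th_cont : continuous Th.
Proof. by move=> x; exact: is_derive1_cont (dTh x). Qed.

Lemma daff (f : R -> R) (b a c x : R) : is_derive (a * x + c) 1 f b ->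
  is_derive x 1 (fun y => f (a * y + c)) (a * b).
Proof.
move=> fb; rewrite mulrC; apply: Dcomp => //.
have h := @DD R R _ _ x 1 _ _ (@DZ R R a id x 1 1 (is_derive_id x 1)) (@Dcst R R c x 1).
by apply: (is_derive_eq h); rewrite addr0 mulr1.
Qed.

Lemma dshift (f : R -> R) (b c x : R) : is_derive (x - c) 1 f b ->
  is_derive x 1 (fun y => f (y - c)) b.
Proof.
move=> fb; have := @daff f b 1 (- c) x; rewrite !mul1r => /(_ fb).
by under eq_fun do rewrite mul1r.
Qed.

Lemma Th_ge1 x : 1 <= x -> Th x - Th 1 = x - 1.
Proof.
move=> x1; have := @derive0_cst R (fun y => Th y - y) 1 x x1 _ _.
have cc : {within `[1, x], continuous (fun y => Th y - y)}.
  by apply: cont_within => y; apply: continuousB; [exact: Th_cont|].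
have dd y : 1 < y < x -> is_derive (y : R) 1 (fun y => Th y - y) 0.
  move=> /andP[y1 _]; apply: (is_derive_eq (DB (dTh y) (is_derive_id y 1))).
  by rewrite th_ge1 ?subrr// ltW.
by move=> /(_ dd cc); lra.
Qed.

(** [bs] is the second difference of [Th], that is the hat function mollified by the normalized
    bump: a smooth B-spline supported in [0, 3]. [b0] and [bs'] are the derivatives of [B1] and
    [bs]. Second differences, rather than first ones, are taken so that the translates reproduce the
    slope of affine functions as well as constants. *)
Definition B1 (y : R) := Th y - Th (y - 1).
Definition b0 (y : R) := th y - th (y - 1).
Definition bs (y : R) := B1 y - B1 (y - 1).
Definition bs' (y : R) := b0 y - b0 (y - 1).

Lemma dbs (y : R) : is_derive y 1 bs (bs' y).
Proof.
apply: DB; first by apply: DB; [exact: dTh|apply: dshift; exact: dTh].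
by apply: dshift; apply: DB; [exact: dTh|apply: dshift; exact: dTh].
Qed.

Lemma B1_le0 y : y <= 0 -> B1 y = 0.
Proof. by move=> y0; rewrite /B1 !Th_le0 ?subrr//; lra. Qed.

Lemma B1_ge2 y : 2 <= y -> B1 y = 1.
Proof. by move=> y0; have := @Th_ge1 y; have := @Th_ge1 (y - 1); rewrite /B1; lra. Qed.

Lemma b0_le0 y : y <= 0 -> b0 y = 0.
Proof. by move=> y0; rewrite /b0 !th_le0 ?subrr//; lra. Qed.

Lemma b0_ge2 y : 2 <= y -> b0 y = 0.
Proof. by move=> y0; rewrite /b0 !th_ge1 ?subrr//; lra. Qed.

Lemma b0_ge0 y : 0 <= b0 y.
Proof. by rewrite subr_ge0 th_nd// gerBl. Qed.

Lemma B1_nd x y : x <= y -> B1 x <= B1 y.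
Proof.
have dB1 (z : R) : is_derive z 1 B1 (b0 z) by apply: DB; [exact: dTh|apply: dshift; exact: dTh].
move=> xy; apply: (@derive_ge0_nd R B1 b0) => //.
- by move=> z _; exact: b0_ge0.
- by apply: cont_within => z; exact: is_derive1_cont (dB1 z).
Qed.

Lemma bs_ge0 y : 0 <= bs y.
Proof. by rewrite subr_ge0 B1_nd// gerBl. Qed.

Lemma bs_out y : y <= 0 \/ 3 <= y -> bs y = 0.
Proof.
rewrite /bs => -[y0|y0]; first by rewrite !B1_le0 ?subrr//; lra.
by rewrite !B1_ge2 ?subrr//; lra.
Qed.

Lemma bs'_out y : y <= 0 \/ 3 <= y -> bs' y = 0.
Proof.
rewrite /bs' => -[y0|y0]; first by rewrite !b0_le0 ?subrr//; lra.
by rewrite !b0_ge2 ?subrr//; lra.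
Qed.

Lemma tele (f : R -> R) y m :
  \sum_(i < m) (f (y - i%:R) - f (y - i%:R - 1)) = f y - f (y - m%:R).
Proof.
elim: m => [|m IH]; first by rewrite big_ord0 subr0 subrr.
rewrite big_ord_recr /= IH; have -> : y - m.+1%:R = y - m%:R - 1 by rewrite -natr1; ring.
ring.
Qed.

Lemma sum_bs m y : 2 <= y <= m%:R -> \sum_(i < m) bs (y - i%:R) = 1.
Proof.
move=> /andP[y2 ym]; rewrite tele B1_ge2// B1_le0 ?subr0//; lra.
Qed.

Lemma sum_bs' m y : 2 <= y <= m%:R -> \sum_(i < m) bs' (y - i%:R) = 0.
Proof.
move=> /andP[y2 ym]; rewrite tele b0_ge2// b0_le0 ?subr0//; lra.
Qed.

Lemma sum_ibs' m y : 2 <= y <= m%:R -> \sum_(i < m) i%:R * bs' (y - i%:R) = 1.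
Proof.
move=> /andP[y2 ym].
(* Summation by parts puts the partial sums in closed form; for k = m all terms but [th (y - 1)],
   which is 1, vanish. *)
have E k : \sum_(i < k) i%:R * bs' (y - i%:R) =
    th (y - 1) - th (y - k%:R) - (k%:R - 1) * b0 (y - k%:R).
  elim: k => [|k IH]; first by rewrite big_ord0 /b0 !subr0; ring.
  rewrite big_ord_recr /= IH /bs' /b0 -(natr1 k).
  have -> : y - (k%:R + 1) = y - k%:R - 1 by ring.
  by ring.
rewrite E (@b0_le0 (y - m%:R)) ?(@th_le0 (y - m%:R)) ?(@th_ge1 (y - 1)); lra.
Qed.

(** [bs'] is a difference of two nonnegative translates of [b0], and each family of translates sums
    to at most 1 by telescoping. *)
Lemma sum_abs_bs' m y : 2 <= y <= m%:R -> \sum_(i < m) `|bs' (y - i%:R)| <= 2.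
Proof.
move=> /andP[y2 ym].
have h0 x k : \sum_(i < k) b0 (x - i%:R) <= 1.
  by rewrite tele; have := th_le1 x; have := th_ge0 (x - k%:R); lra.
apply: (@le_trans _ _ (\sum_(i < m) (b0 (y - i%:R) + b0 (y - 1 - i%:R)))).
  apply: ler_sum => i _; rewrite /bs'.
  have -> : y - i%:R - 1 = y - 1 - i%:R by ring.
  have := b0_ge0 (y - i%:R); have := b0_ge0 (y - 1 - i%:R).
  by move=> h1 h2; rewrite ler_norml; apply/andP; split; lra.
by rewrite big_split /=; have := h0 y m; have := h0 (y - 1) m; lra.
Qed.

End spline.

(** * Functions vanishing on the boundary as limits of test functions *)

Section smooth_class.
Context {R : realType}.

(** A syntactic class closed under differentiation: smoothness follows from membership, without
    computing higher derivatives. It contains every [flat n] because the derivative of [th] is a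
    product of such functions. *)
Inductive sm1 : (R -> R) -> Prop :=
| sm1_cst c : sm1 (fun=> c)
| sm1_flat n : sm1 (flat n)
| sm1_th : sm1 th
| sm1_Th : sm1 Th
| sm1_add f g : sm1 f -> sm1 g -> sm1 (fun x => f x + g x)
| sm1_mul f g : sm1 f -> sm1 g -> sm1 (fun x => f x * g x)
| sm1_aff f a c : sm1 f -> sm1 (fun x => f (a * x + c)).

Lemma sm1_derive f : sm1 f ->
  exists2 f', sm1 f' & forall x : R, is_derive x 1 f (f' x).
Proof.
elim=> [c|n|||{}f g sf [f' sf' df] sg [g' sg' dg]|{}f g sf [f' sf' df] sg [g' sg' dg]
       |{}f a c sf [f' sf' df]].
- by exists (fun=> 0); [exact: sm1_cst|move=> x; exact: Dcst].
- exists (fun x => flat n.+2 x + (- n%:R) * flat n.+1 x).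
    by apply: sm1_add; [exact: sm1_flat|apply: sm1_mul; [exact: sm1_cst|exact: sm1_flat]].
  by move=> x; apply: (is_derive_eq (flat_derive n x)); rewrite mulNr.
- exists (fun x => th_c * (flat 0 x * flat 0 (-1 * x + 1))).
    apply: sm1_mul; first exact: sm1_cst.
    by apply: sm1_mul; [exact: sm1_flat|apply: sm1_aff; exact: sm1_flat].
  by move=> x; apply: (is_derive_eq (dth x)); rewrite /bump mulN1r addrC.
- by exists th; [exact: sm1_th|move=> x; exact: dTh].
- by exists (fun x => f' x + g' x); [exact: sm1_add|move=> x; exact: DD].
- exists (fun x => f' x * g x + f x * g' x); last by move=> x; exact: DM.
  by apply: sm1_add; exact: sm1_mul.
- exists (fun x => a * f' (a * x + c)); last by move=> x; exact: daff.
  by apply: sm1_mul; [exact: sm1_cst|exact: sm1_aff].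
Qed.

Lemma sm1_cont f : sm1 f -> continuous f.
Proof. by move=> /sm1_derive[f' _ df] x; exact: is_derive1_cont (df x). Qed.

Context {N : nat}.
Local Notation space := 'rV[R]_N.

Inductive smN : (space -> R) -> Prop :=
| smN_cst c : smN (fun=> c)
| smN_coord f i : sm1 f -> smN (fun x => f (x ord0 i))
| smN_add f g : smN f -> smN g -> smN (fun x => f x + g x)
| smN_mul f g : smN f -> smN g -> smN (fun x => f x * g x).

Lemma dcoord (x : space) (i j : 'I_N) :
  is_derive x (e_ i) (fun y : space => y ord0 j) ((j == i)%:R : R).
Proof.
rewrite -[x]addr0 -(scale0r (e_ i)); apply/is_derive_line.
under eq_fun do rewrite !mxE eqxx /=.
have h := @DD R R _ _ 0 1 _ _ (@Dcst R R^o (x ord0 j) 0 1)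
  (@DM R R _ _ 0 1 _ _ (@is_derive_id R R 0 1) (@Dcst R R^o (j == i)%:R 0 1)).
by apply: (is_derive_eq h); rewrite mulr0 addr0 add0r mul1r.
Qed.

Lemma smN_derive f : smN f -> forall i,
  exists2 f', smN f' & forall x, is_derive x (e_ i) f (f' x).
Proof.
elim=> [c|{}f j /sm1_derive[f' sf' df]|{}f g sf IHf sg IHg|{}f g sf IHf sg IHg] i.
- by exists (fun=> 0); [exact: smN_cst|move=> x; exact: Dcst].
- exists (fun x => f' (x ord0 j) * (j == i)%:R).
    by apply: smN_mul; [exact: smN_coord|exact: smN_cst].
  by move=> x; apply: Dcomp => //; exact: dcoord.
- have [f' sf' df] := IHf i; have [g' sg' dg] := IHg i.
  by exists (fun x => f' x + g' x); [exact: smN_add|move=> x; exact: DD].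
- have [f' sf' df] := IHf i; have [g' sg' dg] := IHg i.
  exists (fun x => f' x * g x + f x * g' x); last by move=> x; exact: DM.
  by apply: smN_add; exact: smN_mul.
Qed.

Lemma smN_cont f : smN f -> continuous f.
Proof.
elim=> [c|{}f j /sm1_cont cf|{}f g sf IHf sg IHg|{}f g sf IHf sg IHg] x.
- exact: cst_continuous.
- by apply: (@continuous_comp _ _ _ (fun x : space => x ord0 j) f); [exact: coord_continuous|exact: cf].
- by apply: continuousD; [exact: IHf|exact: IHg].
- by apply: continuousM; [exact: IHf|exact: IHg].
Qed.

Lemma smN_smooth f : smN f -> smooth f.
Proof.
move=> sf k; elim: k f sf => [|k IH] f sf; first exact: smN_cont.
split; first exact: smN_cont.
move=> i; have [f' sf' df] := smN_derive sf i; split; first by move=> x; case: (df x).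
rewrite (_ : 'D_(e_ i) f = f'); first exact: IH.
by apply/funext => x; case: (df x).
Qed.

Lemma smN_sum (I : Type) (s : seq I) (F : I -> space -> R) :
  (forall i, smN (F i)) -> smN (fun x => \sum_(i <- s) F i x).
Proof.
move=> h; elim: s => [|i s IH].
  by under eq_fun do rewrite big_nil; exact: smN_cst.
by under eq_fun do rewrite big_cons; exact: smN_add.
Qed.

Lemma smN_prod (I : Type) (s : seq I) (F : I -> space -> R) :
  (forall i, smN (F i)) -> smN (fun x => \prod_(i <- s) F i x).
Proof.
move=> h; elim: s => [|i s IH].
  by under eq_fun do rewrite big_nil; exact: smN_cst.
by under eq_fun do rewrite big_cons; exact: smN_mul.
Qed.

(** In a tensor product only the factor of index [j] varies along the j-th axis, so the Leibniz rule
    leaves a single product. *)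
Lemma Dprod (x v : space) (I : eqType) (s : seq I) (F : I -> space -> R) (a : I -> R) (j : I) :
  uniq s -> (forall i, is_derive x v (F i) (if i == j then a i else 0)) ->
  is_derive x v (fun y => \prod_(i <- s) F i y)
    (if j \in s then \prod_(i <- s) (if i == j then a i else F i x) else 0).
Proof.
move=> + h; elim: s => [_|i s IH /= /andP[si us]].
  by rewrite in_nil; under eq_fun do rewrite big_nil; exact: Dcst.
under eq_fun do rewrite big_cons.
apply: (is_derive_eq (DM (h i) (IH us))); rewrite big_cons in_cons eq_sym.
have [ij|ij] := eqVneq i j; rewrite /=.
  subst i; rewrite (negbTE si) mulr0 addr0; congr (_ * _).
  rewrite !big_seq; apply: eq_bigr => l ls; rewrite ifF//.
  by apply: contraNF si => /eqP <-.
by rewrite mul0r add0r; case: ifP => // _; rewrite mulr0.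
Qed.

End smooth_class.

(** * Increments along axis-parallel paths *)

Section axis_path.
Context {R : realType} {N : nat}.
Local Notation space := 'rV[R]_N.

Definition pth (x y : space) (i : nat) : space :=
  \row_l (if (l < i)%N then y ord0 l else x ord0 l).

Lemma pth0 x y : pth x y 0 = x.
Proof. by apply/rowP => l; rewrite mxE. Qed.

Lemma pthN x y : pth x y N = y.
Proof. by apply/rowP => l; rewrite mxE ltn_ord. Qed.

Lemma pthS x y (i : 'I_N) : pth x y i.+1 = pth x y i + (y ord0 i - x ord0 i) *: e_ i.
Proof.
apply/rowP => l; rewrite !mxE eqxx /= ltnS leq_eqVlt.
have [->|li] := eqVneq l i; first by rewrite eqxx ltnn /= mulr1 addrC subrK.
by rewrite -[l == i :> nat]/(l == i) (negbTE li) /= mulr0 addr0.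
Qed.

Lemma pth_dist x y i : `|pth x y i - x| <= `|y - x|.
Proof.
apply: norm_le_coord => // l; rewrite !mxE; case: ifP => _; last by rewrite subrr normr0.
by have := coord_le_norm (y - x) l; rewrite !mxE.
Qed.

(** Only partial derivatives are at hand, so [x] is joined to [y] by changing one coordinate at a
    time and the increments telescope. In the sup norm this path stays within distance |y - x| of
    [x]. *)
Lemma axis_estimate (F : space -> R) (x y : space) (c : 'I_N -> R) (e : R) : 0 <= e ->
  (forall i p s, `|p - x| <= `|y - x| -> `|p + s *: e_ i - x| <= `|y - x| ->
    `|F (p + s *: e_ i) - F p - c i * s| <= e * `|s|) ->
  `|F y - F x - \sum_i c i * (y ord0 i - x ord0 i)| <= N%:R * e * `|y - x|.
Proof.
move=> e0 h.
have -> : F y - F x = \sum_(i < N) (F (pth x y i.+1) - F (pth x y i)).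
  rewrite -(big_mkord xpredT (fun i => F (pth x y i.+1) - F (pth x y i))).
  by rewrite telescope_sumr// pth0 pthN.
rewrite -sumrB; apply: (le_trans (ler_norm_sum _ _ _)).
rewrite -mulrA -[N in N%:R]card_ord mulr_natl -sumr_const.
apply: ler_sum => i _; rewrite pthS.
apply: (le_trans (h i _ _ _ _)); first exact: pth_dist.
- by rewrite -pthS; exact: pth_dist.
- by rewrite ler_wpM2l//; have := coord_le_norm (y - x) i; rewrite !mxE.
Qed.

End axis_path.

(** * Lipschitz bounds across the zero set of a function *)

Section lipschitz.
Context {R : realType}.

(** Smooth soft thresholding: it vanishes on [-1, 1], has slope between 0 and 1, and stays within 2
    of the identity. *)
Definition soft (s : R) := Th (s - 1) - Th (- s - 1).

Lemma dsoft (s : R) : is_derive s 1 soft (th (s - 1) + th (- s - 1)).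
Proof.
rewrite -[X in _ + X]opprK; apply: DB; first by apply: dshift; exact: dTh.
have := @daff R Th (th (- s - 1)) (-1) (-1) s; rewrite mulN1r => /(_ (dTh _)).
by rewrite mulN1r; under eq_fun do rewrite mulN1r.
Qed.

Lemma dsoft_bound (s : R) : `|th (s - 1) + th (- s - 1)| <= 1.
Proof.
rewrite ger0_norm ?addr_ge0 ?th_ge0//.
have := th_le1 (s - 1); have := th_le1 (- s - 1).
have [s0|s0] := leP s 0; first by rewrite (@th_le0 _ (s - 1)); lra.
by rewrite (@th_le0 _ (- s - 1)); lra.
Qed.

Lemma soft_small (s : R) : `|s| <= 1 -> soft s = 0.
Proof. by rewrite ler_norml => /andP[s1 s2]; rewrite /soft !Th_le0 ?subrr//; lra. Qed.

Lemma soft_dist (s : R) : `|soft s - s| <= 2.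
Proof.
have Th_bound (y : R) : `|Th y| <= Num.max y 0 /\ y - 1 <= Th y.
  have nd (a b : R) : a <= b -> Th a <= Th b.
    move=> ab; apply: (@derive_ge0_nd R Th th) => //; first by move=> z _; exact: dTh.
      by move=> z _; exact: th_ge0.
    exact: cont_within Th_cont.
  have T0 : Th (0 : R) = 0 by rewrite Th_le0.
  have [y0|y0] := leP y 0.
    by rewrite Th_le0// normr0; split => //; lra.
  have p0 : 0 <= Th y by rewrite -T0 nd// ltW.
  split.
    have := @MVT_le R Th th 0 y 1 (ltW y0); rewrite T0 !subr0 mul1r; apply.
    - by move=> z _; exact: dTh.
    - by move=> z _; rewrite ger0_norm ?th_ge0 ?th_le1.
    - exact: cont_within Th_cont.
  have [y1|y1] := leP 1 y; last lra.
  by have := Th_ge1 y1; have := nd 0 1 ler01; rewrite T0; lra.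
have H : forall s : R, 0 <= s -> `|soft s - s| <= 2.
  move=> {}s s0; rewrite /soft (@Th_le0 _ (- s - 1)); last lra.
  have [+ h2] := Th_bound (s - 1); rewrite ler_norml /Num.max; case: ifP => h3 /andP[h4 h5];
    rewrite ler_norml; apply/andP; split; lra.
have [s0|s0] := leP 0 s; first exact: H.
have := H (- s); rewrite oppr_ge0 => /(_ (ltW s0)).
rewrite /soft opprK => h; rewrite -normrN.
by rewrite (_ : - (_ - _ - s) = Th (- s - 1) - Th (s - 1) + s) //; ring.
Qed.

(** [g] need not be differentiable at the boundary of [O]. Its thresholding [S] at the scale [d] is
    differentiable everywhere: by the chain rule on [O], and because it vanishes near every point
    outside [O], where |g| < d by continuity. The mean value bound for [S] passes to [g] with an
    error of 2d at each end. *)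
Lemma lip_zero_ext (O : set R) (g g' : R -> R) (L a b : R) : a <= b -> 0 <= L -> continuous g ->
  (forall t, ~ O t -> g t = 0) ->
  (forall t, O t -> is_derive t 1 g (g' t)) -> (forall t, O t -> `|g' t| <= L) ->
  `|g b - g a| <= L * (b - a).
Proof.
move=> ab L0 cg g0 dg gL; apply/ler_addgt0Pr => e e0.
pose d := e / 4; have d0 : 0 < d by rewrite divr_gt0.
pose S t := d * soft (d^-1 * g t).
pose S' t := if pselect (O t) then (th (d^-1 * g t - 1) + th (- (d^-1 * g t) - 1)) * g' t else 0.
have dS (t : R) : is_derive t 1 S (S' t).
  rewrite /S'; case: pselect => Ot.
    have h := DZ d (@Dcomp R R soft (fun t => d^-1 * g t) t 1 _ _ (dsoft (d^-1 * g t)) (DZ d^-1 (dg t Ot))).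
    by apply: (is_derive_eq h); field; rewrite gt_eqF.
  apply: (@near_eq_is_derive R R R (fun=> 0)).
  have := cg t; move=> /cvgrPdist_lt /(_ d d0).
  apply: filterS => y; rewrite g0// sub0r normrN => yd.
  rewrite /S soft_small ?mulr0// normrM gtr0_norm ?invr_gt0// mulrC ler_pdivrMr// mul1r.
  exact: ltW.
have SL t : `|S' t| <= L.
  rewrite /S'; case: pselect => Ot; last by rewrite normr0.
  rewrite normrM -[leRHS]mul1r; apply: ler_pM => //; [exact: dsoft_bound|exact: gL].
have hS : `|S b - S a| <= L * (b - a).
  apply: (@MVT_le R S S') => //; apply: cont_within => t; exact: is_derive1_cont (dS t).
have hd t : `|S t - g t| <= e / 2.
  have := soft_dist (d^-1 * g t).
  have -> : S t - g t = d * (soft (d^-1 * g t) - d^-1 * g t) by rewrite /S; field; rewrite gt_eqF.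
  rewrite normrM gtr0_norm// => h; apply: (le_trans (ler_wpM2l (ltW d0) h)); rewrite /d; lra.
have := hd a; have := hd b; move: hS; rewrite !ler_norml.
by move=> /andP[? ?] /andP[? ?] /andP[? ?]; apply/andP; split; lra.
Qed.

End lipschitz.

(** * Weights of a grid of mesh 1/n in one variable *)

Section weights.
Context {R : realType}.
Variables (A n : nat).

(** The offset n A + 2 and the count 2 n A + 2 send |x| <= A into the interval [2, nodes], on which
    the spline identities hold without boundary corrections. *)
Definition nodes : nat := 2 * n * A + 2.
Definition offset : R := n%:R * A%:R + 2.
Definition node (i : nat) : R := (i%:R - offset) / n%:R.
Definition wt (i : nat) (x : R) : R := bs (n%:R * x + offset - i%:R).
Definition wt' (i : nat) (x : R) : R := bs' (n%:R * x + offset - i%:R).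

Hypothesis n0 : (0 < n)%N.
Let n0R : (0 : R) < n%:R. Proof. by rewrite ltr0n. Qed.

Lemma dwt i (x : R) : is_derive x 1 (wt i) (n%:R * wt' i x).
Proof.
have := @daff R bs (wt' i x) n%:R (offset - i%:R) x; rewrite addrA => /(_ (dbs _)).
by under eq_fun do rewrite addrA.
Qed.

Lemma wt_range (x : R) : `|x| <= A%:R -> 2 <= n%:R * x + offset <= nodes%:R.
Proof.
rewrite ler_norml => /andP[x1 x2]; rewrite /offset /nodes natrD !natrM.
have h1 : n%:R * x <= n%:R * A%:R by rewrite ler_wpM2l// ltW.
have h2 : n%:R * - A%:R <= n%:R * x by rewrite ler_wpM2l// ltW.
by apply/andP; split; lra.
Qed.

Lemma wt_ge0 i x : 0 <= wt i x.
Proof. exact: bs_ge0. Qed.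

Lemma sum_wt (x : R) : `|x| <= A%:R -> \sum_(i < nodes) wt i x = 1.
Proof. by move=> xA; exact: sum_bs (wt_range xA). Qed.

Lemma sum_wt' (x : R) : `|x| <= A%:R -> \sum_(i < nodes) wt' i x = 0.
Proof. by move=> xA; exact: sum_bs' (wt_range xA). Qed.

Lemma sum_node_wt' (x : R) : `|x| <= A%:R ->
  \sum_(i < nodes) n%:R * (node i - x) * wt' i x = 1.
Proof.
move=> xA; have h := sum_ibs' (wt_range xA); have h0 := sum_bs' (wt_range xA).
transitivity (\sum_(i < nodes) (i%:R * bs' (n%:R * x + offset - i%:R) -
    (n%:R * x + offset) * bs' (n%:R * x + offset - i%:R))).
  by apply: eq_bigr => i _; rewrite /node /wt'; field; rewrite gt_eqF.
by rewrite sumrB -mulr_sumr h h0 mulr0 subr0.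
Qed.

Lemma sum_abs_wt' (x : R) : `|x| <= A%:R -> \sum_(i < nodes) `|wt' i x| <= 2.
Proof. by move=> xA; exact: sum_abs_bs' (wt_range xA). Qed.

Lemma near_node i (x : R) : wt i x != 0 \/ wt' i x != 0 -> `|node i - x| <= 3 / n%:R.
Proof.
move=> h; have : 0 < n%:R * x + offset - i%:R < 3.
  rewrite !ltNge -negb_or; apply/negP => /orP h'.
  have h2 : n%:R * x + offset - i%:R <= 0 \/ 3 <= n%:R * x + offset - i%:R by case: h'; auto.
  by case: h => /eqP; apply; [exact: bs_out|exact: bs'_out].
move=> /andP[h1 h2].
have -> : node i - x = - (n%:R * x + offset - i%:R) / n%:R.
  by rewrite /node; field; rewrite gt_eqF.
rewrite normrM normrN (gtr0_norm h1) [`|_^-1|]gtr0_norm ?invr_gt0//.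
by rewrite ler_pM2r ?invr_gt0// ltW.
Qed.

Lemma sm1_wt i : sm1 (wt i).
Proof.
have s0 c : sm1 (fun y : R => Th (n%:R * y + c)) by apply: sm1_aff; exact: sm1_Th.
have sB f g : sm1 f -> sm1 g -> sm1 (fun y : R => f y - g y).
  move=> sf sg; rewrite (_ : (fun y => _) = (fun y => f y + (-1) * g y)).
    by apply: sm1_add => //; apply: sm1_mul => //; exact: sm1_cst.
  by apply/funext => y; rewrite mulN1r.
rewrite (_ : wt i = fun y => Th (n%:R * y + (offset - i%:R)) - Th (n%:R * y + (offset - i%:R - 1))
   - (Th (n%:R * y + (offset - i%:R - 1)) - Th (n%:R * y + (offset - i%:R - 1 - 1)))).
  by apply: (sB); apply: (sB).
by apply/funext => y; rewrite /wt /bs /B1 !addrA.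
Qed.

End weights.

(** * Tensor product weights *)

Section tensor_weights.
Context {R : realType} {N : nat}.
Local Notation space := 'rV[R]_N.
Variables (A n : nat).
Hypothesis n0 : (0 < n)%N.
Let n0R : (0 : R) < n%:R. Proof. by rewrite ltr0n. Qed.
Local Notation idx := {ffun 'I_N -> 'I_(nodes A n)}.

Definition Xn (k : idx) : space := \row_l node A n (k l).
Definition W (k : idx) (x : space) : R := \prod_(l < N) wt A n (k l) (x ord0 l).
Definition DW (j : 'I_N) (k : idx) (x : space) : R :=
  \prod_(l < N) (if l == j then wt' A n (k l) (x ord0 l) else wt A n (k l) (x ord0 l)).

Lemma dW j k (x : space) : is_derive x (e_ j) (W k) (n%:R * DW j k x).
Proof.
have h := @Dprod R N x (e_ j) _ (index_enum 'I_N)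
  (fun l (x : space) => wt A n (k l) (x ord0 l))
  (fun l => n%:R * wt' A n (k l) (x ord0 l)) j (index_enum_uniq _).
apply: (is_derive_eq (h _)) => [l|].
  have h1 := @Dcomp R space (wt A n (k l)) (fun x : space => x ord0 l) x (e_ j) _ _
    (@dwt R A n (k l) _) (dcoord x j l).
  apply: (is_derive_eq h1).
  by case: ifP => _; rewrite ?mulr1 ?mulr0.
rewrite mem_index_enum /DW (bigD1 j)//= eqxx [in RHS](bigD1 j)//= eqxx mulrA.
by congr (_ * _); apply: eq_bigr => l /negbTE ->.
Qed.

Variable x : space.
Hypothesis xA : forall l, `|x ord0 l| <= A%:R.

Lemma sum_W : \sum_k W k x = 1.
Proof.
rewrite /W -(bigA_distr_bigA (fun l (i : 'I_(nodes A n)) => wt A n i (x ord0 l))).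
by apply: big1 => l _; exact: sum_wt.
Qed.

Lemma sum_DW j : \sum_k DW j k x = 0.
Proof.
rewrite /DW -(bigA_distr_bigA (fun l (i : 'I_(nodes A n)) =>
  if l == j then wt' A n i (x ord0 l) else wt A n i (x ord0 l))).
by rewrite (bigD1 j)//= eqxx sum_wt'// mul0r.
Qed.

Lemma sum_Xn_DW i j : \sum_k n%:R * (Xn k ord0 i - x ord0 i) * DW j k x = (i == j)%:R.
Proof.
pose F l (m : 'I_(nodes A n)) : R :=
  (if l == i then n%:R * (node A n m - x ord0 l) else 1) *
  (if l == j then wt' A n m (x ord0 l) else wt A n m (x ord0 l)).
transitivity (\sum_(k : idx) \prod_(l < N) F l (k l)).
  apply: eq_bigr => k _; rewrite /F big_split /=; congr (_ * _).
  rewrite (bigD1 i)//= eqxx big1 ?mulr1 ?mxE//.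
  by move=> l /negbTE ->.
rewrite -(bigA_distr_bigA F) (bigD1 j)//=.
have [ij|ij] := eqVneq i j.
  rewrite /F ij eqxx sum_node_wt'// mul1r; apply: big1 => l /negbTE lj.
  by under eq_bigr do rewrite lj mul1r; exact: sum_wt.
rewrite /F eq_sym (negbTE ij) eqxx.
by under eq_bigr do rewrite mul1r; rewrite sum_wt'// mul0r.
Qed.

Lemma sum_abs_DW j : \sum_k `|DW j k x| <= 2.
Proof.
pose F l (m : 'I_(nodes A n)) : R :=
  `|if l == j then wt' A n m (x ord0 l) else wt A n m (x ord0 l)|.
have -> : \sum_k `|DW j k x| = \sum_(k : idx) \prod_(l < N) F l (k l).
  by apply: eq_bigr => k _; rewrite normr_prod.
rewrite -(bigA_distr_bigA F) (bigD1 j)//= [X in _ * X]big1 ?mulr1.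
  by rewrite /F eqxx; exact: sum_abs_wt'.
move=> l /negbTE lj; rewrite /F lj -[RHS](sum_wt n (xA l)).
by apply: eq_bigr => i _; rewrite ger0_norm// wt_ge0.
Qed.

Lemma near_Xn k : (W k x != 0 \/ exists j, DW j k x != 0) -> `|Xn k - x| <= 3 / n%:R.
Proof.
move=> h; apply: norm_le_coord => [|l]; first by rewrite divr_ge0.
rewrite !mxE; apply: near_node => //; case: h => [|[j]].
  by move/prodf_neq0 => /(_ l isT); left.
by move/prodf_neq0 => /(_ l isT); case: ifP => _; [right|left].
Qed.

Lemma W_ge0 k : 0 <= W k x.
Proof. by apply: prodr_ge0 => l _; exact: wt_ge0. Qed.

Lemma interp_err (a : idx -> R) (c e : R) :
  (forall k, `|Xn k - x| <= 3 / n%:R -> `|a k - c| <= e) ->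
  `|\sum_k a k * W k x - c| <= e.
Proof.
move=> h; rewrite -[c in X in `|X|]mulr1 -sum_W mulr_sumr -sumrB.
apply: (le_trans (ler_norm_sum _ _ _)); rewrite -[leRHS]mulr1 -sum_W mulr_sumr.
apply: ler_sum => k _; rewrite -mulrBl normrM [`|W k x|]ger0_norm ?W_ge0//.
have [->|w0] := eqVneq (W k x) 0; first by rewrite !mulr0.
by rewrite ler_wpM2r ?W_ge0// h// near_Xn//; left.
Qed.

(** The differentiated weights annihilate constants and reproduce slopes, so the affine part c +
    g.(X - x) of the coefficients yields exactly g_j. What remains is at most e times n times the
    absolute sum of the weights, which is at most 2. *)
Lemma interp_derr j (a : idx -> R) (c : R) (g : 'I_N -> R) (e : R) : 0 <= e ->
  (forall k, `|Xn k - x| <= 3 / n%:R ->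
     `|a k - c - \sum_i g i * (Xn k ord0 i - x ord0 i)| <= e) ->
  `|n%:R * \sum_k a k * DW j k x - g j| <= 2 * n%:R * e.
Proof.
move=> e0 h.
have -> : n%:R * (\sum_k a k * DW j k x) - g j =
  n%:R * \sum_k (a k - c - \sum_i g i * (Xn k ord0 i - x ord0 i)) * DW j k x.
  have E1 : \sum_k c * DW j k x = 0 by rewrite -mulr_sumr sum_DW mulr0.
  have E2 : n%:R * \sum_(k : idx) (\sum_i g i * (Xn k ord0 i - x ord0 i)) * DW j k x = g j.
    rewrite mulr_sumr; under eq_bigr do rewrite mulr_suml mulr_sumr.
    rewrite exchange_big /= (bigD1 j)//= [X in _ + X]big1 ?addr0 => [|i ij].
      transitivity (g j * \sum_(k : idx) n%:R * (Xn k ord0 j - x ord0 j) * DW j k x).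
        by rewrite mulr_sumr; apply: eq_bigr => k _; ring.
      by rewrite sum_Xn_DW eqxx mulr1.
    transitivity (g i * \sum_(k : idx) n%:R * (Xn k ord0 i - x ord0 i) * DW j k x).
      by rewrite mulr_sumr; apply: eq_bigr => k _; ring.
    by rewrite sum_Xn_DW (negbTE ij) mulr0.
  under [in RHS]eq_bigr do rewrite !mulrBl.
  by rewrite !sumrB E1 subr0 mulrBr E2.
rewrite normrM gtr0_norm// -mulrA mulrCA ler_pM2l//.
apply: (le_trans (ler_norm_sum _ _ _)).
have h2 : forall k, `|(a k - c - \sum_i g i * (Xn k ord0 i - x ord0 i)) * DW j k x| <= e * `|DW j k x|.
  move=> k; rewrite normrM; have [->|w0] := eqVneq (DW j k x) 0; first by rewrite normr0 !mulr0.
  by rewrite ler_wpM2r// h// near_Xn//; right; exists j.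
apply: (@le_trans _ _ (\sum_k e * `|DW j k x|)); first exact: ler_sum.
by rewrite -mulr_sumr mulrC ler_wpM2r// sum_abs_DW.
Qed.

End tensor_weights.

(** * Approximation by compactly supported smooth functions *)

Section zero_trace_approximation.
Context {R : realType} {N : nat}.
Local Notation space := 'rV[R]_N.
Variables (Omega : set space) (A : nat) (F : space -> R) (g : 'I_N -> space -> R) (L : R).
Hypothesis oO : open Omega.
Hypothesis OA : forall x l, Omega x -> `|x ord0 l| <= A%:R.
Hypothesis L0 : 0 <= L.
Hypothesis cF : continuous F.
Hypothesis F0 : forall x, ~ Omega x -> F x = 0.
Hypothesis dF : forall x j, Omega x -> is_derive x (e_ j) F (g j x).
Hypothesis gL : forall x j, Omega x -> `|g j x| <= L.
Hypothesis cg : forall x j, Omega x -> {for x, continuous (g j)}.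

Lemma continuous_line (p v : space) : continuous (fun t : R => p + t *: v).
Proof.
move=> t; apply: (@cvgD _ space); first exact: cvg_cst.
exact: scalel_continuous.
Qed.

(** The segment may leave [Omega] and return. Restricted to a line, [F] vanishes off the set of
    parameters lying in [Omega], which is the situation of [lip_zero_ext]. *)
Lemma axis_lip p i (s : R) : `|F (p + s *: e_ i) - F p| <= L * `|s|.
Proof.
pose G (t : R) := F (p + t *: e_ i).
have cG : continuous G.
  by move=> t; apply: (@continuous_comp _ _ _ (fun t : R => p + t *: e_ i) F);
    [exact: continuous_line|exact: cF].
have H (a b : R) : a <= b -> `|G b - G a| <= L * (b - a).
  move=> ab; apply: (@lip_zero_ext R [set t | Omega (p + t *: e_ i)] G
    (fun t => g i (p + t *: e_ i))) => //.
  - by move=> t /= ?; exact: F0.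
  - by move=> t /= Ot; apply/is_derive_line; exact: dF.
  - by move=> t /= Ot; exact: gL.
have G0 : F p = G 0 by rewrite /G scale0r addr0.
have [s0|s0] := leP 0 s.
  by have := H 0 s s0; rewrite subr0 G0 (ger0_norm s0).
have := H s 0 (ltW s0); rewrite sub0r G0 (ltr0_norm s0) => h.
by rewrite distrC.
Qed.

Lemma glob_lip x y : `|F y - F x| <= N%:R * L * `|y - x|.
Proof.
have := @axis_estimate R N F x y (fun=> 0) L L0.
rewrite big1 ?subr0 => [|i _]; last by rewrite mul0r.
by apply => i p s _ _; rewrite mul0r subr0; exact: axis_lip.
Qed.

Lemma local_linear (x y : space) (e : R) : 0 <= e ->
  (forall z, `|z - x| <= `|y - x| -> Omega z /\ forall j, `|g j z - g j x| <= e) ->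
  `|F y - F x - \sum_i g i x * (y ord0 i - x ord0 i)| <= N%:R * e * `|y - x|.
Proof.
move=> e0 h; apply: axis_estimate => // i p s hp hps.
pose G (t : R) := F (p + t *: e_ i) - g i x * t.
have hz t : 0 <= t <= 1 -> `|p + (t * s) *: e_ i - x| <= `|y - x|.
  move=> /andP[t0 t1].
  have -> : p + (t * s) *: e_ i - x = (1 - t) *: (p - x) + t *: (p + s *: e_ i - x).
    by apply/rowP => l; rewrite !mxE; ring.
  apply: (le_trans (ler_normD _ _)); rewrite !normrZ !ger0_norm ?subr_ge0//.
  by move: hp hps; nra.
have dG t : 0 <= t <= 1 ->
    is_derive (t : R) 1 (fun t => G (t * s)) ((g i (p + (t * s) *: e_ i) - g i x) * s).
  move=> t01; have [Oz _] := h _ (hz _ t01).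
  have d1 : is_derive (t * s) 1 (fun t : R => F (p + t *: e_ i)) (g i (p + (t * s) *: e_ i)).
    by apply/is_derive_line; exact: dF.
  have ds : is_derive (t : R) 1 (fun t : R => t * s) s.
    have h1 := @DM R R _ _ t 1 _ _ (@is_derive_id R R t 1) (@Dcst R R^o s t 1).
    by apply: (is_derive_eq h1); rewrite mulr0 addr0 mul1r.
  have h1 := @DB R R _ _ t 1 _ _ (@Dcomp R R (fun t : R => F (p + t *: e_ i)) (fun t => t * s) t 1 _ _ d1 ds)
     (DZ (g i x) ds).
  by apply: (is_derive_eq h1); rewrite mulrBl.
have := @MVT_le R (fun t => G (t * s)) (fun t => (g i (p + (t * s) *: e_ i) - g i x) * s) 0 1 (e * `|s|) ler01.
rewrite subr0 mulr1 mul1r mul0r /G scale0r addr0 mulr0 subr0.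
rewrite addrAC; apply.
- by move=> t /andP[t0 t1]; apply: dG; rewrite !ltW.
- move=> t /andP[t0 t1]; rewrite normrM ler_wpM2r//.
  by have [|_] := h _ (hz t _) => //; rewrite !ltW.
- apply: derivable_within_continuous => t; rewrite in_itv /= => t01.
  by have [] := dG t t01.
Qed.

Section step.
Variable n : nat.
Hypothesis n0 : (0 < n)%N.
Let n0R : (0 : R) < n%:R. Proof. by rewrite ltr0n. Qed.
Let hn0 : (0 : R) < 3 / n%:R. Proof. by rewrite divr_gt0. Qed.
Local Notation idx := {ffun 'I_N -> 'I_(nodes A n)}.

(** The radius 3/n is the reach of a weight, so that the weights of good nodes have compact support
    in [Omega]. *)
Definition good (y : space) : Prop := forall z, `|z - y| <= 3 / n%:R -> Omega z.
Definition an (k : idx) : R := if pselect (good (Xn k)) then F (Xn k) else 0.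
Definition interp (x : space) : R := \sum_k an k * W k x.
Definition dinterp (j : 'I_N) (x : space) : R := n%:R * \sum_k an k * DW j k x.

Lemma interp_derive j (x : space) : is_derive x (e_ j) interp (dinterp j x).
Proof.
have h := @Dsum R space _ (index_enum idx) (fun k (x : space) => an k * W k x)
  (fun k => an k * (n%:R * DW j k x)) x (e_ j).
have h1 (k : idx) : is_derive x (e_ j) (fun x : space => an k * W k x) (an k * (n%:R * DW j k x)).
  by apply: DZ; exact: dW.
apply: (is_derive_eq (h h1)).
by rewrite /dinterp mulr_sumr; apply: eq_bigr => k _; ring.
Qed.

Lemma interp_test : test_function Omega interp.
Proof.
split.
  apply: smN_smooth; apply: smN_sum => k; apply: smN_mul; first exact: smN_cst.
  by apply: smN_prod => l; apply: smN_coord; exact: sm1_wt.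
pose B (k : idx) := [set x : space | `|x - Xn k| <= 3 / n%:R].
have BK k : compact (B k).
  apply: bounded_closed_compact.
    exists (`|Xn k| + 3 / n%:R); split; first exact: num_real.
    move=> M hM x /= Bx; apply: (le_trans _ (ltW hM)).
    by rewrite -[x](subrK (Xn k)) addrC (le_trans (ler_normD _ _))// lerD.
  rewrite (_ : B k = closed_ball_ Num.norm (Xn k) (3 / n%:R)).
    exact: closed_closed_ball_.
  by apply/seteqP; split => x; rewrite /B /closed_ball_ /= distrC.
exists (\big[setU/set0]_(k <- index_enum idx | `[< good (Xn k) >]) B k); split.
- exact: bigsetU_compact.
- rewrite -bigcup_seq_cond; apply: bigcup_sub => k /= /andP[_ /asboolP gk] x.
  exact: gk.
- move=> x nK; rewrite /interp big1// => k _; rewrite /an; case: pselect => gk; last by rewrite mul0r.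
  have [->|w0] := eqVneq (W k x) 0; first by rewrite mulr0.
  exfalso; apply: nK; rewrite -bigcup_seq_cond; exists k => /=.
    by rewrite mem_index_enum; apply/asboolP.
  by rewrite /B /= distrC near_Xn//; left.
Qed.

(** A discarded node is within 3/n of a point outside [Omega], where [F] vanishes; this point is
    within 6/n of [x]. Replacing the nodal value by 0 therefore costs the same order 1/n as the
    Lipschitz bound at a kept node. *)
Lemma near_values x : Omega x -> forall k : idx, `|Xn k - x| <= 3 / n%:R ->
  `|an k - F x| <= 6 * N%:R * L / n%:R.
Proof.
move=> Ox k kx; rewrite /an; case: pselect => gk.
  apply: (le_trans (glob_lip _ _)); apply: (@le_trans _ _ (N%:R * L * (3 / n%:R))).
    by rewrite ler_wpM2l// mulr_ge0.
  have : 0 <= N%:R * L / n%:R by rewrite divr_ge0// mulr_ge0.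
  by lra.
move/existsNP: (gk) => [z /not_implyP[zk Oz]].
rewrite /= distrC subr0 -[F x]subr0 -(F0 Oz); apply: (le_trans (glob_lip _ _)).
have : `|x - z| <= 6 / n%:R.
  rewrite -[x - z](subrKA (Xn k)); apply: (le_trans (ler_normD _ _)).
  by rewrite distrC [`|_ - z|]distrC; lra.
move=> h; apply: (@le_trans _ _ (N%:R * L * (6 / n%:R))); last by lra.
by rewrite ler_wpM2l// mulr_ge0.
Qed.

Lemma interp_conv x : Omega x -> `|interp x - F x| <= 6 * N%:R * L / n%:R.
Proof.
move=> Ox; apply: interp_err => //; first by move=> l; exact: OA.
by move=> k; exact: near_values.
Qed.

(** [interp_derr] with slope 0: coefficients within 6 N L / n of F(x) give a derivative of at most 2
    n times that, uniformly up to the boundary. *)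
Lemma dinterp_bound j x : Omega x -> `|dinterp j x| <= 12 * N%:R * L.
Proof.
move=> Ox; have := @interp_derr R N A n n0 x (fun l => OA l Ox) j an (F x) (fun=> 0)
  (6 * N%:R * L / n%:R).
rewrite subr0 => h; apply: (le_trans (h _ _)).
- by rewrite divr_ge0// mulr_ge0// mulr_ge0.
- by move=> k kx; rewrite big1 ?subr0 => [|i _]; [exact: near_values|rewrite mul0r].
- by rewrite [leLHS](_ : _ = 12 * N%:R * L)//; field; rewrite gt_eqF.
Qed.

(** 6/n < d makes every node that contributes at [x] good: such a node is within 3/n of [x], and its
    own neighbourhood of radius 3/n stays within distance d. The coefficients are then true values
    of [F], affine at [x] up to N e 3/n. *)
Lemma dinterp_conv j x (e d : R) : 0 <= e -> 6 / n%:R < d ->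
  (forall z, `|z - x| < d -> Omega z /\ forall j, `|g j z - g j x| <= e) ->
  `|dinterp j x - g j x| <= 6 * N%:R * e.
Proof.
move=> e0 nd h.
have d0 : 0 < d by apply: le_lt_trans nd; rewrite divr_ge0.
have Ox : Omega x by have [] := h x; rewrite ?subrr ?normr0.
have n6 : 6 / n%:R = 3 / n%:R + 3 / n%:R :> R by field; rewrite gt_eqF.
have := @interp_derr R N A n n0 x (fun l => OA l Ox) j an (F x) (fun i => g i x)
  (N%:R * e * (3 / n%:R)).
move=> H; apply: (le_trans (H _ _)).
- by rewrite mulr_ge0// ?mulr_ge0// ltW.
- move=> k kx; rewrite /an; case: pselect => gk.
    apply: (@le_trans _ _ (N%:R * e * `|Xn k - x|)); last by rewrite ler_wpM2l// mulr_ge0.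
    apply: local_linear => // z zx; apply: h; have := hn0; lra.
  exfalso; apply: gk => z zk; have [] // := h z.
  rewrite -[z - x](subrKA (Xn k)); apply: le_lt_trans (ler_normD _ _) _; lra.
- by rewrite [leLHS](_ : _ = 6 * N%:R * e)//; field; rewrite gt_eqF.
Qed.

End step.

(** The gradients converge only pointwise, under a uniform bound; close to the boundary the
    discarded nodes keep them away from the limit. This is sufficient for dominated convergence in
    L^2. *)
Theorem zero_trace_approx : exists phi_ : nat -> space -> R, exists C : R,
  [/\ forall n, test_function Omega (phi_ n),
      forall n x, Omega x -> `|phi_ n x - F x| <= C,
      forall n j x, Omega x -> `|'D_(e_ j) (phi_ n) x| <= C,
      forall x, Omega x -> phi_ ^~ x @ \oo --> F x &
      forall j x, Omega x -> (fun n => 'D_(e_ j) (phi_ n) x) @ \oo --> g j x].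
Proof.
exists (fun n => interp n.+1), (12 * N%:R * L).
have NL : 0 <= N%:R * L by rewrite mulr_ge0.
have DE n j x : 'D_(e_ j) (interp n.+1) x = dinterp n.+1 j x by case: (@interp_derive n.+1 j x).
split.
- by move=> n; exact: interp_test.
- move=> n x Ox; apply: (le_trans (interp_conv _ Ox)) => //.
  rewrite ler_pdivrMr ?ltr0n//; have : (1 : R) <= n.+1%:R by rewrite ler1n.
  by move=> ?; nra.
- by move=> n j x Ox; rewrite DE dinterp_bound.
- move=> x Ox; apply/cvgrPdist_le => e e0.
  have c0 : 0 < 6 * N%:R * L + 1 by lra.
  have [k hk] := invS_small (divr_gt0 e0 c0).
  exists k => // n /= kn; rewrite distrC; apply: (le_trans (interp_conv _ Ox)) => //.
  have h : n.+1%:R^-1 <= k.+1%:R^-1 :> R by rewrite lef_pV2 ?posrE ?ltr0n// ler_nat.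
  have := le_lt_trans h hk; rewrite ltr_pdivlMr//.
  have n1 : (0 : R) < n.+1%:R^-1 by rewrite invr_gt0.
  have H (v : R) : 0 < v -> v * (6 * N%:R * L + 1) < e -> 6 * N%:R * L * v <= e.
    by move=> v0 vh; rewrite mulrDr mulr1 in vh; rewrite mulrC; apply: ltW; apply: lt_trans vh; rewrite ltrDl.
  exact: H.
- move=> j x Ox; apply/cvgrPdist_le => e e0.
  have c0 : (0 : R) < 6 * N%:R + 1 by rewrite ltr_wpDl// mulr_ge0.
  pose e' := e / (6 * N%:R + 1); have e'0 : 0 < e' by rewrite divr_gt0.
  have [d d0 hd] : exists2 d, 0 < d & forall z, `|z - x| < d ->
      Omega z /\ forall j, `|g j z - g j x| <= e'.
    have H : \forall z \near x, Omega z /\ forall j, `|g j z - g j x| <= e'.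
      near=> z; split; first by near: z; exact: oO.
      near: z; apply: filter_forall => i.
      by have := @cg x i Ox; move/cvgrPdist_le => /(_ e' e'0); apply: filterS => z; rewrite distrC.
    move: H => /nbhs_ballP[d /= d0 hd]; exists d => // z zx; apply: hd.
    by rewrite -ball_normE /= distrC.
  have [k hk] := invS_small (divr_gt0 d0 (ltr0n R 6)).
  exists k => // n /= kn; rewrite DE distrC.
  apply: (@le_trans _ _ (6 * N%:R * e')).
    apply: (@dinterp_conv n.+1 isT j x e' d) => //; first exact: ltW.
    have h : n.+1%:R^-1 <= k.+1%:R^-1 :> R by rewrite lef_pV2 ?posrE ?ltr0n// ler_nat.
    have H (u : R) : u < d / 6 -> 6 * u < d by lra.
    exact: H (le_lt_trans h hk).
  by rewrite /e' mulrA ler_pdivrMr//; nra.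
Unshelve. all: by end_near. Qed.

End zero_trace_approximation.

(** * Sobolev functions, the Poincare and Korn inequalities *)

Section compactly_supported.
Context {R : realType} {N : nat}.
Local Notation space := 'rV[R]_N.
Local Notation lebN := (lebesgue_rV R N).

Lemma closed_cube (M : R) : closed (cube N M : set space).
Proof.
rewrite (_ : cube N M = \bigcap_(i : 'I_N) [set x : space | `|x ord0 i| <= M]).
  apply: closed_bigI => i _.
  apply: (@preimage_closed _ _ (fun x : space => `|x ord0 i|) [set x | x <= M]); last exact: closed_le.
  move=> x _; apply: (@continuous_comp _ _ _ (fun x : space => x ord0 i) (fun z : R => `|z|)).
    exact: coord_continuous.
  exact: norm_continuous.
by apply/seteqP; split => [x h i _|x h i]; exact: h.
Qed.

Lemma compact_cube (M : R) : compact (cube N M : set space).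
Proof.
apply: bounded_closed_compact; last exact: closed_cube.
exists `|M|; split; first exact: num_real.
move=> x Mx y hy; apply: norm_le_coord => [|i]; first exact: le_trans (ltW Mx).
exact: le_trans (hy i) (le_trans (ler_norm _) (ltW Mx)).
Qed.

Lemma continuous_bounded_on (K : set space) (f : space -> R) : compact K ->
  {within K, continuous f} -> exists2 C : R, 0 <= C & forall x, K x -> `|f x| <= C.
Proof.
move=> cK cf; have [[x Kx]|/nonemptyPn K0] := pselect (K !=set0); last first.
  by exists 0 => // x; rewrite K0.
have cn : {within K, continuous (fun x => `|f x|)}.
  move=> y; apply: (@continuous_comp (subspace K) R R f (fun z : R => `|z|)); first exact: cf.
  exact: norm_continuous.
have [c _ hc] := @compact_EVT_max _ R (fun x => `|f x|) K (ex_intro _ x Kx) cK cn.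
by exists `|f c| => // y Ky; apply: hc; rewrite inE.
Qed.

Lemma continuous_shift (a : space) : continuous (fun x : space => x + a).
Proof.
by move=> x; exact: (cvgD cvg_id (cvg_cst _)).
Qed.

Lemma continuous_translate (f : space -> R) (a : space) : continuous f ->
  continuous (fun x : space => f (x + a)).
Proof.
move=> cf x; apply: (@continuous_comp _ _ _ (fun x : space => x + a) f); last exact: cf.
exact: continuous_shift.
Qed.

Definition Cc (f : space -> R) (M : R) : Prop :=
  continuous f /\ forall x, ~ cube N M x -> f x = 0.

Lemma Cc_bounded f M : Cc f M -> exists2 C : R, 0 <= C & forall x, `|f x| <= C.
Proof.
move=> [cf f0]; have [C C0 hC] := continuous_bounded_on (@compact_cube M) (continuous_subspaceT cf).
exists C => // x; have [/hC//|/f0 ->] := pselect (cube N M x); by rewrite normr0.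
Qed.

Lemma continuous_measurable_rV (f : space -> R) : continuous f -> measurable_fun setT f.
Proof.
by move=> cf; apply: within_continuous_measurable_rV => //; exact: continuous_subspaceT.
Qed.

Lemma intg_cube (f : space -> R) (M C : R) : measurable_fun setT f ->
  (forall x, `|f x| <= C) -> (forall x, ~ cube N M x -> f x = 0) -> intg lebN setT f.
Proof.
move=> mf fC f0; have mc : measurable (cube N M : set space) by exact: measurable_cube.
have h : intg lebN (cube N M) f.
  apply: (@intg_bd _ _ _ lebN (cube N M) f C) => //; first exact: lebesgue_rV_cube.
  exact: measurable_funS mf.
have := intgT_restrict mc h; apply: eq_integrable => // x _.
rewrite patchE; case: (boolP (x \in cube N M)) => //= xc.
by rewrite f0//; move: xc; rewrite notin_setE.
Qed.

Lemma Cc_intg f M : Cc f M -> intg lebN setT f.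
Proof.
move=> fM; have [C C0 hC] := Cc_bounded fM; have [cf f0] := fM.
by apply: (@intg_cube f M C) => //; exact: continuous_measurable_rV.
Qed.

Lemma cubeS (M M' : R) : M <= M' -> cube N M `<=` cube N M'.
Proof. by move=> MM x h i; exact: le_trans (h i) MM. Qed.

Lemma CcM f g M : Cc f M -> continuous g -> Cc (fun x => f x * g x) M.
Proof.
move=> [cf f0] cg; split; first by move=> x; apply: continuousM; [exact: cf|exact: cg].
by move=> x /f0 ->; rewrite mul0r.
Qed.

Lemma Cc_translate f M (a : space) : Cc f M -> Cc (fun x => f (x + a)) (M + `|a|).
Proof.
move=> [cf f0]; split; first exact: continuous_translate.
move=> x h; apply: f0 => h1; apply: h => i.
have := h1 i; rewrite mxE => h2; rewrite -[x ord0 i](addrK (a ord0 i)).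
by apply: (le_trans (ler_normB _ _)); apply: lerD => //; exact: coord_le_norm.
Qed.

(** Expand both sides and translate the variable by a + b, b and a in the three mixed terms. It is
    the discrete form of two integrations by parts, and it involves no second derivative. *)
Lemma diff_exchange f g M (a b : space) : Cc f M -> Cc g M ->
  \int[lebN]_x ((f (x + a) - f x) * (g (x + b) - g x)) =
  \int[lebN]_x ((f (x - b) - f x) * (g (x - a) - g x)).
Proof.
move=> fM gM; have [cf _] := fM; have [cg _] := gM.
have ct := continuous_translate.
have I (c d : space) : intg lebN setT (fun x => f (x + c) * g (x + d)).
  by apply: (@Cc_intg _ (M + `|c|)); apply: CcM; [exact: Cc_translate|exact: ct].
have E (c d : space) : \int[lebN]_x ((f (x + c) - f x) * (g (x + d) - g x)) =
   \int[lebN]_x (f (x + c) * g (x + d)) - \int[lebN]_x (f (x + c) * g (x + 0))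
   - (\int[lebN]_x (f (x + 0) * g (x + d)) - \int[lebN]_x (f (x + 0) * g (x + 0))).
  rewrite -!RintB//; last 2 first.
  - exact: intgB.
  - exact: intgB.
  by apply: eq_Rintegral => x _; rewrite !addr0; ring.
rewrite E [RHS]E.
have T (c d u : space) : \int[lebN]_x (f (x + c) * g (x + d)) =
    \int[lebN]_x (f (x + (c + u)) * g (x + (d + u))).
  rewrite -[LHS](@Rint_rV_translation R N u (fun x => f (x + c) * g (x + d))).
    by apply: eq_Rintegral => x _; congr (f _ * g _); rewrite -addrA; congr (_ + _); rewrite addrC.
  by apply: continuous_measurable_rV => x; apply: continuousM; exact: ct.
rewrite (T (- b) (- a) (a + b)) (T (- b) 0 b) (T 0 (- a) a).
rewrite !addNr !add0r.
have -> : - b + (a + b) = a by rewrite addrC addrK.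
have -> : - a + (a + b) = b by rewrite addrA addNr add0r.
ring.
Qed.

Definition C1c (i : 'I_N) (f f' : space -> R) (M : R) : Prop :=
  [/\ Cc f M, continuous f' & forall x, is_derive x (e_ i) f (f' x)].

Lemma C1c_deriv i f f' M : C1c i f f' M -> Cc f' M.
Proof.
move=> [[cf f0] cf' df]; split => // x nx.
have h : is_derive x (e_ i) f 0.
  apply: (@near_eq_is_derive R space R (fun=> 0)).
  have : open (~` (cube N M : set space)) by apply: closed_openC; exact: closed_cube.
  by move=> /(_ x nx); apply: filterS => y /f0 ->.
by case: h => _ h0; case: (df x) => _ <-.
Qed.

Lemma C1c_lip i f f' M (C : R) : C1c i f f' M -> (forall x, `|f' x| <= C) ->
  forall x s, `|f (x + s *: e_ i) - f x| <= C * `|s|.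
Proof.
move=> [[cf f0] cf' df] fC x s.
have cG : continuous (fun t : R => f (x + t *: e_ i)).
  by move=> t; apply: (@continuous_comp _ _ _ (fun t : R => x + t *: e_ i) f);
    [exact: continuous_line|exact: cf].
have H (a b : R) : a <= b -> `|f (x + b *: e_ i) - f (x + a *: e_ i)| <= C * (b - a).
  move=> ab; apply: (@MVT_le R (fun t => f (x + t *: e_ i)) (fun t => f' (x + t *: e_ i))) => //.
  - by move=> t _; apply/is_derive_line; exact: df.
  - exact: cont_within.
have [s0|s0] := leP 0 s.
  by have := H 0 s s0; rewrite subr0 scale0r addr0 (ger0_norm s0).
by have := H s 0 (ltW s0); rewrite sub0r scale0r addr0 (ltr0_norm s0) distrC.
Qed.

(** The sign s = 1 or -1 is kept because [diff_exchange] turns forward quotients into backward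
    ones. *)
Definition quot (i : 'I_N) (s : R) (f : space -> R) (n : nat) (x : space) : R :=
  n.+1%:R * (f (x + (s / n.+1%:R) *: e_ i) - f x).

Lemma quot_cont i s f n : continuous f -> continuous (quot i s f n).
Proof.
move=> cf x; apply: (@continuousM _ _ (fun=> n.+1%:R) (fun x : space => f (x + (s / n.+1%:R) *: e_ i) - f x)).
  exact: cst_continuous.
by apply: (@continuousB _ _ _ (fun x : space => f (x + (s / n.+1%:R) *: e_ i)) f); [exact: continuous_translate|exact: cf].
Qed.

Lemma quot_bound i s f f' n M C : C1c i f f' M -> (forall x, `|f' x| <= C) -> `|s| = 1 ->
  forall x, `|quot i s f n x| <= C * \1_(cube N (M + 1)) x.
Proof.
move=> H hC s1 x; have L := C1c_lip H hC; have [[_ h0] _ _] := H.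
rewrite indicE; case: (boolP (x \in cube N (M + 1))) => xc.
  rewrite mulr1 /quot normrM ger0_norm//.
  apply: (le_trans (ler_wpM2l (ler0n _ _) (L x _))).
  rewrite normrM s1 mul1r [`|_^-1|]ger0_norm//.
  by rewrite mulrCA divff ?mulr1// pnatr_eq0.
rewrite /= mulr0; have nx : ~ cube N (M + 1) x by move: xc; rewrite notin_setE.
rewrite /quot h0 ?h0 ?subrr ?mulr0 ?normr0//.
  by move=> hx; apply: nx; apply: cubeS hx; rewrite lerDl.
move=> hx; apply: nx => l; have := hx l; rewrite mxE => hl.
rewrite -[x ord0 l](addrK (((s / n.+1%:R) *: e_ i : space) ord0 l)).
apply: (le_trans (ler_normB _ _)); apply: lerD => //.
apply: (le_trans (coord_le_norm _ _)); rewrite normrZ -[leRHS]mul1r ler_pM//.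
  by rewrite normrM s1 mul1r ger0_norm// invf_le1 ?ltr0n// ler1n.
apply: norm_le_coord => // m.
by rewrite mxE eqxx /=; case: eqP; rewrite ?normr1 ?normr0.
Qed.

Lemma intg_cube_indic (C M : R) : intg lebN setT (fun x : space => C * \1_(cube N M) x).
Proof.
have mc : measurable (cube N M : set space) by exact: measurable_cube.
apply: intgZ => //; apply: intgP; first exact: measurable_indic.
under eq_integral do rewrite ger0_norm//.
by rewrite integral_indic// setIT lebesgue_rV_cube.
Qed.

Lemma quotient_cvg i f f' M (s : R) : C1c i f f' M -> forall x,
  (quot i s f) ^~ x @ \oo --> s * f' x.
Proof.
move=> [_ _ df] x; apply/cvgrPdist_le => e e0.
have d0 : is_derive (0 : R) 1 (fun t : R => f (x + t *: e_ i)) (f' x).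
  by apply/is_derive_line; rewrite scale0r addr0; exact: df.
have s1 : 0 < `|s| + 1 by rewrite ltr_wpDl.
have [d dd hd] := (is_derive1P _ _ _).1 d0 (e / (`|s| + 1)) (divr_gt0 e0 s1).
have [k hk] := invS_small (divr_gt0 dd s1).
exists k => // n /= kn.
rewrite /quot; have nR : (0 : R) < n.+1%:R by rewrite ltr0n.
have h : n.+1%:R^-1 <= k.+1%:R^-1 :> R by rewrite lef_pV2 ?posrE ?ltr0n// ler_nat.
have sn : `|s / n.+1%:R - 0| = `|s| * n.+1%:R^-1.
  by rewrite subr0 normrM [`|_^-1|]gtr0_norm// invr_gt0.
have := hd (s / n.+1%:R); rewrite sn scale0r addr0 => H.
have lt : `|s| * n.+1%:R^-1 < d.
  apply: (@le_lt_trans _ _ (`|s| * (d / (`|s| + 1)))).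
    by rewrite ler_wpM2l// ltW// (le_lt_trans h hk).
  by rewrite mulrA ltr_pdivrMr//; nra.
have {}H := H lt; rewrite subr0 in H.
have -> : s * f' x - n.+1%:R * (f (x + (s / n.+1%:R) *: e_ i) - f x) =
   - n.+1%:R * (f (x + (s / n.+1%:R) *: e_ i) - f x - f' x * (s / n.+1%:R)).
  by field; rewrite gt_eqF.
rewrite normrM normrN (gtr0_norm nR); apply: (le_trans (ler_wpM2l (ltW nR) H)).
have F (v w a : R) : v != 0 -> w != 0 -> v * (e / w * (a / v)) = e * (a / w).
  by move=> v0 w0; field; rewrite v0 w0.
rewrite F ?gt_eqF//.
by rewrite -[leRHS]mulr1 ler_wpM2l ?(ltW e0)// ler_pdivrMr// mul1r lerDl.
Qed.

Lemma Rint_cvg (D : set space) (q : nat -> space -> R) (f g : space -> R) : measurable D ->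
  (forall n, measurable_fun D (q n)) -> measurable_fun D f ->
  intg lebN D g -> (forall n x, D x -> `|q n x| <= g x) ->
  (forall x, D x -> q ^~ x @ \oo --> f x) ->
  (fun n => \int[lebN]_(x in D) q n x) @ \oo --> \int[lebN]_(x in D) f x.
Proof.
move=> mD mq mf ig qg qf.
have Hc : {ae lebN, forall x, D x -> (fun n => (q n x)%:E) @ \oo --> (f x)%:E}.
  by apply: aeW => x Dx; apply: cvg_EFin; [exact: nearW|exact: qf].
have Hb : {ae lebN, forall x n, D x -> (`|(q n x)%:E| <= (EFin \o g) x)%E}.
  by apply: aeW => x n Dx /=; rewrite lee_fin; exact: qg.
have mq' n : measurable_fun D (fun x => (q n x)%:E) by apply/measurable_EFinP.
have mf' : measurable_fun D (fun x => (f x)%:E) by apply/measurable_EFinP.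
have [H1 _ H2] := dominated_convergence mD mq' mf' Hc ig Hb.
move: H2; rewrite /Rintegral => H2; apply: fine_cvg.
by rewrite fineK//; exact: (integrable_fin_num mD H1).
Qed.

Lemma int_deriv0 i f f' M : C1c i f f' M -> \int[lebN]_x f' x = 0.
Proof.
move=> H; have [fM cf' df] := H; have f'M := C1c_deriv H.
have [C C0 hC] := Cc_bounded f'M; have [cf f0] := fM.
have := @Rint_cvg setT (quot i 1 f) f' _ measurableT
  (fun n => continuous_measurable_rV (@quot_cont i 1 f n cf)) (continuous_measurable_rV cf')
  (intg_cube_indic C (M + 1)) (fun n x _ => quot_bound n H hC (normr1 R) x).
have qc x : setT x -> (quot i 1 f) ^~ x @ \oo --> f' x.
  by move=> _; rewrite -[f' x]mul1r; exact: quotient_cvg H x.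
move=> /(_ qc); have q0 n : \int[lebN]_x quot i 1 f n x = 0.
  have I1 : intg lebN setT f := Cc_intg fM.
  have I2 : intg lebN setT (fun x => f (x + (1 / n.+1%:R) *: e_ i)).
    exact: Cc_intg (Cc_translate _ fM).
  rewrite /quot RintZ//; last exact: intgB.
  by rewrite RintB// Rint_rV_translation ?subrr ?mulr0//; exact: continuous_measurable_rV.
under eq_fun do rewrite q0.
by move=> /cvg_lim h; rewrite -h//; apply: lim_cst.
Qed.

(** The limit of [diff_exchange] with steps along the i-th and j-th axes. The two signs of the
    backward quotients cancel in the product, and C^1 regularity is enough. *)
Lemma deriv_exchange i j f fi fj g gi gj M :
  C1c i f fi M -> C1c j f fj M -> C1c i g gi M -> C1c j g gj M ->
  \int[lebN]_x (fi x * gj x) = \int[lebN]_x (fj x * gi x).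
Proof.
move=> Hfi Hfj Hgi Hgj; have [fM _ _] := Hfi; have [gM _ _] := Hgi.
have [cf f0] := fM; have [cg g0] := gM.
have bnd k l s h h' r r' (C C' : R) n : `|s| = 1 -> C1c k h h' M -> C1c l r r' M ->
    (forall x, `|h' x| <= C) -> (forall x, `|r' x| <= C') ->
    forall x, `|quot k s h n x * quot l s r n x| <= (C * C') * \1_(cube N (M + 1)) x.
  move=> s1 Hh Hr hC rC x; rewrite normrM.
  have -> : C * C' * \1_(cube N (M + 1)) x = (C * \1_(cube N (M + 1)) x) * (C' * \1_(cube N (M + 1)) x).
    by rewrite mulrACA -expr2 indicE; case: (x \in _); rewrite ?expr1n ?expr0n.
  by apply: ler_pM => //; [exact: quot_bound Hh hC s1 x|exact: quot_bound Hr rC s1 x].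
have conv k l s h h' r r' : `|s| = 1 -> C1c k h h' M -> C1c l r r' M ->
    (fun n => \int[lebN]_x (quot k s h n x * quot l s r n x)) @ \oo --> \int[lebN]_x (h' x * r' x).
  move=> s1 Hh Hr; have [[ch _] ch' _] := Hh; have [[cr _] cr' _] := Hr.
  have [C _ hC] := Cc_bounded (C1c_deriv Hh); have [C' _ rC] := Cc_bounded (C1c_deriv Hr).
  apply: (@Rint_cvg setT _ _ (fun x => (C * C') * \1_(cube N (M + 1)) x)) => //.
  - move=> n; apply: continuous_measurable_rV => x.
    by apply: continuousM; exact: quot_cont.
  - by apply: continuous_measurable_rV => x; apply: continuousM; [exact: ch'|exact: cr'].
  - exact: intg_cube_indic.
  - by move=> n x _; exact: bnd Hh Hr hC rC x.
  - move=> x _.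
    have -> : h' x * r' x = (s * h' x) * (s * r' x).
      by rewrite mulrACA -expr2 -[s ^+ 2]real_normK ?num_real// s1 expr1n mul1r.
    apply: (@cvgM _ _ _ _ (quot k s h ^~ x) (quot l s r ^~ x) (s * h' x) (s * r' x)).
      exact: quotient_cvg Hh x.
    exact: quotient_cvg Hr x.
have qI k l s h h' r r' n : `|s| = 1 -> C1c k h h' M -> C1c l r r' M ->
    intg lebN setT (fun x => (h (x + (s / n.+1%:R) *: e_ k) - h x) * (r (x + (s / n.+1%:R) *: e_ l) - r x)).
  move=> s1 Hh Hr; have [[ch _] ch' _] := Hh; have [[cr _] cr' _] := Hr.
  have [C _ hC] := Cc_bounded (C1c_deriv Hh); have [C' _ rC] := Cc_bounded (C1c_deriv Hr).
  apply: (@eq_intg _ _ _ lebN setT (fun x => (n.+1%:R ^+ 2)^-1 * (quot k s h n x * quot l s r n x))) => //.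
    have F (v u w : R) : v != 0 -> (v ^+ 2)^-1 * ((v * u) * (v * w)) = u * w.
      by move=> v0; field.
    by move=> x _; rewrite /quot F// pnatr_eq0.
  apply: intgZ => //; apply: (@le_intg _ _ _ lebN setT _ (fun x => (C * C') * \1_(cube N (M + 1)) x)) => //.
  - by apply: continuous_measurable_rV => x; apply: continuousM; exact: quot_cont.
  - by move=> x _; apply: le_trans (ler_norm _); exact: bnd Hh Hr hC rC x.
  - exact: intg_cube_indic.
have qE k l s h h' r r' n : `|s| = 1 -> C1c k h h' M -> C1c l r r' M ->
    \int[lebN]_x (quot k s h n x * quot l s r n x) = n.+1%:R ^+ 2 *
    \int[lebN]_x ((h (x + (s / n.+1%:R) *: e_ k) - h x) * (r (x + (s / n.+1%:R) *: e_ l) - r x)).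
  move=> s1 Hh Hr; rewrite -RintZ//; last exact: qI Hh Hr.
  by apply: eq_Rintegral => x _; rewrite /quot; ring.
have c1 := conv i j 1 f fi g gj (normr1 R) Hfi Hgj.
have c2 := conv j i (-1) f fj g gi (normrN1 R) Hfj Hgi.
have E n : \int[lebN]_x (quot i 1 f n x * quot j 1 g n x) = \int[lebN]_x (quot j (-1) f n x * quot i (-1) g n x).
  rewrite (qE _ _ _ _ _ _ _ _ (normr1 R) Hfi Hgj) (qE _ _ _ _ _ _ _ _ (normrN1 R) Hfj Hgi).
  by rewrite (diff_exchange _ _ fM gM) !mulNr !scaleNr.
move: c1; under eq_fun do rewrite E.
move=> c1; exact: (cvg_unique _ c1 c2).
Qed.

End compactly_supported.

Section euclidean_norm.
Context {R : realType}.

Lemma inner_ge0 m n (A : 'M[R]_(m, n)) : 0 <= inner A A.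
Proof. by apply: sumr_ge0 => i _; apply: sumr_ge0 => j _; rewrite -expr2 sqr_ge0. Qed.

Lemma enorm_sq m n (A : 'M[R]_(m, n)) : enorm A ^+ 2 = \sum_i \sum_j A i j ^+ 2.
Proof.
by rewrite /enorm sqr_sqrtr ?inner_ge0//.
Qed.

Lemma enorm_ge0 m n (A : 'M[R]_(m, n)) : 0 <= enorm A.
Proof. exact: sqrtr_ge0. Qed.

Lemma enorm_sq_rV n (v : 'rV[R]_n) : enorm v ^+ 2 = \sum_j v ord0 j ^+ 2.
Proof. by rewrite enorm_sq big_ord1. Qed.

Lemma entry_le_enorm m n (A : 'M[R]_(m, n)) i j : `|A i j| <= enorm A.
Proof.
rewrite -(@ler_pXn2r _ 2%N)// ?nnegrE ?enorm_ge0// real_normK ?num_real// enorm_sq.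
rewrite (bigD1 i)//= (bigD1 j)//= -addrA lerDl addr_ge0//.
  by apply: sumr_ge0 => k _; exact: sqr_ge0.
by apply: sumr_ge0 => k _; apply: sumr_ge0 => l _; exact: sqr_ge0.
Qed.

End euclidean_norm.

(** * Square integrable functions *)

Section L2.
Context d (X : measurableType d) (R : realType) (mu : {measure set X -> \bar R}).
Variable D : set X.
Hypothesis mD : measurable D.
Implicit Types a b : X -> R.

Definition L2 a : Prop := measurable_fun D a /\ intg mu D (fun x => a x ^+ 2).

Lemma L2M a b : L2 a -> L2 b -> intg mu D (fun x => a x * b x).
Proof. by move=> [ma ia] [mb ib]; exact: intg_sq. Qed.

Lemma L2D a b : L2 a -> L2 b -> L2 (fun x => a x + b x).
Proof.
move=> La Lb; have [ma ia] := La; have [mb ib] := Lb; split; first exact: measurable_funD.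
apply: (@eq_intg _ _ _ mu D (fun x => (a x ^+ 2 + b x ^+ 2) + 2 * (a x * b x))) => //.
  by move=> x _; ring.
by apply: intgD => //; [exact: intgD|apply: intgZ => //; exact: L2M].
Qed.

Lemma L2Z c a : L2 a -> L2 (fun x => c * a x).
Proof.
move=> [ma ia]; split; first exact: measurable_funM.
apply: (@eq_intg _ _ _ mu D (fun x => c ^+ 2 * a x ^+ 2)) => //; last exact: intgZ.
by move=> x _; rewrite exprMn.
Qed.

Lemma L2B a b : L2 a -> L2 b -> L2 (fun x => a x - b x).
Proof.
move=> La Lb; have := L2D La (L2Z (-1) Lb).
by rewrite (_ : (fun x => _ + _) = (fun x => a x - b x))//; apply/funext => x; rewrite mulN1r.
Qed.

Lemma L2_bd (C : R) a : (mu D < +oo)%E -> measurable_fun D a ->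
  (forall x, D x -> `|a x| <= C) -> L2 a.
Proof.
move=> Doo ma aC; split => //; apply: (@intg_bd _ _ _ mu D _ (C ^+ 2)) => //.
  exact: measurable_funX.
by move=> x Dx; rewrite normrX lerXn2r ?nnegrE// ?aC// (le_trans _ (aC _ Dx)).
Qed.

Lemma prod_approx a b : L2 a -> L2 b -> forall e : R, 0 < e -> exists2 dl : R, 0 < dl &
  forall a' b', L2 a' -> L2 b' ->
    \int[mu]_(x in D) ((a' x - a x) ^+ 2) <= dl ->
    \int[mu]_(x in D) ((b' x - b x) ^+ 2) <= dl ->
    `|\int[mu]_(x in D) (a' x * b' x) - \int[mu]_(x in D) (a x * b x)| <= e.
Proof.
move=> La Lb e e0.
pose S := \int[mu]_(x in D) (a x ^+ 2) + \int[mu]_(x in D) (b x ^+ 2).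
have S0 : 0 <= S by apply: addr_ge0; apply: Rintegral_ge0 => x _; exact: sqr_ge0.
(* Weight of Young's inequality on the fixed functions: l S <= e/2. The next constant makes the
   terms with the approximation errors at most e/2 as well. *)
pose l := e / (2 * (S + 1)).
have l0 : 0 < l by rewrite divr_gt0// mulr_gt0// ltr_wpDl.
pose dl := e / (4 * (1 + l^-1)).
have li0 : 0 < l^-1 by rewrite invr_gt0.
have dl0 : 0 < dl by rewrite divr_gt0// mulr_gt0// addr_gt0.
exists dl => // a' b' La' Lb' Ha Hb.
have [_ ia] := La; have [_ ib] := Lb.
have [_ iA] := L2B La' La; have [_ iB] := L2B Lb' Lb.
have I1 := L2M La' Lb'; have I2 := L2M La Lb.
rewrite -RintB//.
pose G x := (1 + l^-1) * ((a' x - a x) ^+ 2 + (b' x - b x) ^+ 2) + l * (a x ^+ 2 + b x ^+ 2).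
have iG : intg mu D G.
  by apply: intgD => //; apply: intgZ => //; exact: intgD.
apply: (@le_trans _ _ (\int[mu]_(x in D) G x)).
  apply: Rint_bound => //; apply: aeW => x _.
  have -> : a' x * b' x - a x * b x =
    (a' x - a x) * (b' x - b x) + (a' x - a x) * b x + a x * (b' x - b x) by ring.
  have h (u v : R) : `|u * v| <= l^-1 * u ^+ 2 + l * v ^+ 2.
    rewrite normrM -(real_normK (num_real u)) -(real_normK (num_real v)).
    have u0 := normr_ge0 u; have v0 := normr_ge0 v.
    have := sqr_ge0 (`|u| - l * `|v|) => h.
    have : 0 <= l^-1 * (`|u| - l * `|v|) ^+ 2 by rewrite mulr_ge0// ltW.
    have -> : l^-1 * (`|u| - l * `|v|) ^+ 2 = l^-1 * `|u| ^+ 2 + l * `|v| ^+ 2 - 2 * (`|u| * `|v|).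
      by field; rewrite gt_eqF.
    by have := mulr_ge0 u0 v0; lra.
  have h1 : `|(a' x - a x) * (b' x - b x)| <= (a' x - a x) ^+ 2 + (b' x - b x) ^+ 2.
    rewrite normrM -(real_normK (num_real (a' x - a x))) -(real_normK (num_real (b' x - b x))).
    have hu := normr_ge0 (a' x - a x); have hv := normr_ge0 (b' x - b x).
    have := sqr_ge0 (`|a' x - a x| - `|b' x - b x|); have := mulr_ge0 hu hv; lra.
  have h2 := h (a' x - a x) (b x); have h3 := h (b' x - b x) (a x).
  rewrite [a x * _]mulrC.
  apply: (le_trans (ler_normD _ _)); apply: (le_trans (lerD (ler_normD _ _) (lexx _))).
  by rewrite /G; lra.
rewrite RintD//; last 2 first.
- by apply: intgZ => //; exact: intgD.
- by apply: intgZ => //; exact: intgD.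
rewrite !RintZ//; last 2 first.
- exact: intgD.
- exact: intgD.
rewrite !RintD// -/S.
have h1 : (1 + l^-1) * (\int[mu]_(x in D) ((a' x - a x) ^+ 2) + \int[mu]_(x in D) ((b' x - b x) ^+ 2)) <= e / 2.
  have -> : e / 2 = (1 + l^-1) * (dl + dl).
    by rewrite /dl; field; rewrite !gt_eqF// addr_gt0.
  by rewrite ler_wpM2l ?lerD// ltW// addr_gt0.
have h2 : l * S <= e / 2.
  rewrite /l mulrAC ler_pdivrMr ?mulr_gt0 ?ltr_wpDl//.
  by have := ltW e0; nra.
by rewrite [e]splitr; exact: lerD.
Qed.

End L2.

(** * The space W^{1,2}_0 through approximation by test functions *)

Section W12.
Context {R : realType} {N : nat}.
Local Notation space := 'rV[R]_N.
Local Notation lebN := (lebesgue_rV R N).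
Variables (Omega : set space) (A : nat).
Hypothesis oO : open Omega.
Hypothesis OA : forall x l, Omega x -> `|x ord0 l| <= A%:R.

Let mO : measurable Omega. Proof. exact: open_measurable_rV. Qed.

Lemma Omega_finite : (lebN Omega < +oo)%E.
Proof.
apply: le_lt_trans (lebesgue_rV_cube N A%:R).
by apply: le_measure; rewrite ?inE//; [exact: measurable_cube|move=> x Ox l; exact: OA].
Qed.

Lemma test_C1c (phi : space -> R) : test_function Omega phi ->
  forall i, C1c i phi ('D_(e_ i) phi) A%:R.
Proof.
move=> [sm [K [cK KO f0]]] i.
have [c1 h1] := sm 1%N; have [d1 c2] := h1 i; split => //.
- by split => // x nx; apply: f0 => Kx; apply: nx => l; apply: OA; exact: KO.
Qed.

Lemma test_deriv_out (phi : space -> R) i x : test_function Omega phi -> ~ Omega x ->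
  phi x = 0 /\ 'D_(e_ i) phi x = 0.
Proof.
move=> tp nx; have [sm [K [cK KO f0]]] := tp.
have nK : ~ K x by move=> /KO.
split; first exact: f0.
have h : is_derive x (e_ i) phi 0.
  apply: (@near_eq_is_derive R space R (fun=> 0)).
  have : open (~` K) by apply: closed_openC; apply: compact_closed => //; exact: norm_hausdorff.
  by move=> /(_ x nK); apply: filterS => y /f0 ->.
by case: h.
Qed.

Lemma Rint_Omega (f : space -> R) : (forall x, ~ Omega x -> f x = 0) ->
  \int[lebN]_(x in Omega) f x = \int[lebN]_x f x.
Proof.
move=> f0; rewrite Rintegral_mkcond; apply: eq_Rintegral => x _.
by rewrite patchE; case: (boolP (x \in Omega)) => // xO; rewrite f0//; move: xO; rewrite notin_setE.
Qed.

Lemma test_L2 (phi : space -> R) : test_function Omega phi ->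
  L2 lebN Omega phi /\ forall j, L2 lebN Omega ('D_(e_ j) phi).
Proof.
move=> tp; have hM := test_C1c tp; have [sm _] := tp.
have L (f : space -> R) M' : Cc f M' -> L2 lebN Omega f.
  move=> fM; have [C _ hC] := Cc_bounded fM; have [cf _] := fM.
  apply: (@L2_bd _ _ _ _ _ mO C); [exact: Omega_finite| |by move=> x _; exact: hC].
  exact: measurable_funS (continuous_measurable_rV cf).
split; last by move=> j; exact: L (C1c_deriv (hM j)).
have [cp _] := sm 1%N; have [_ [K [cK KO f0]]] := tp.
apply: (L _ A%:R); split => // x nx; apply: f0 => Kx; apply: nx => l; apply: OA; exact: KO.
Qed.

(** W^{1,2}_0 with gradient [g], component by component and in epsilon form. Bilinear identities and
    inequalities need to be proved for test functions only; both the weak velocity and the strong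
    one satisfy it. *)
Definition Wapp (f : space -> R) (g : 'I_N -> space -> R) : Prop :=
  [/\ L2 lebN Omega f, forall j, L2 lebN Omega (g j) &
    forall e : R, 0 < e -> exists2 phi, test_function Omega phi &
      \int[lebN]_(x in Omega) ((phi x - f x) ^+ 2) <= e /\
      forall j, \int[lebN]_(x in Omega) (('D_(e_ j) phi x - g j x) ^+ 2) <= e].

Lemma W_test f g (e : R) : Wapp f g -> 0 < e -> exists2 phi,
  [/\ test_function Omega phi, L2 lebN Omega phi & forall j, L2 lebN Omega ('D_(e_ j) phi)] &
      \int[lebN]_(x in Omega) ((phi x - f x) ^+ 2) <= e /\
      forall j, \int[lebN]_(x in Omega) (('D_(e_ j) phi x - g j x) ^+ 2) <= e.
Proof.
move=> [_ _ h] e0; have [phi tp hp] := h e e0; exists phi => //.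
by have [L1 L2'] := test_L2 tp.
Qed.

Lemma eq_of_small (x y : R) : (forall e, 0 < e -> `|x - y| <= e) -> x = y.
Proof.
move=> h; apply/eqP; rewrite -subr_eq0 -normr_le0; apply/ler_addgt0Pr => e e0.
by rewrite add0r h.
Qed.

Lemma dist_half (u v w e : R) : `|v - u| <= e / 2 -> `|v - w| <= e / 2 -> `|u - w| <= e.
Proof.
by rewrite !ler_norml => /andP[? ?] /andP[? ?]; apply/andP; split; lra.
Qed.

Lemma W_sym f g h k i j : Wapp f g -> Wapp h k ->
  \int[lebN]_(x in Omega) (g i x * k j x) = \int[lebN]_(x in Omega) (g j x * k i x).
Proof.
move=> Wf Wh; have [_ Lg _] := Wf; have [_ Lk _] := Wh.
apply: eq_of_small => e e0.
have e2 : 0 < e / 2 by rewrite divr_gt0.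
have [d1 d10 H1] := prod_approx mO (Lg i) (Lk j) e2.
have [d2 d20 H2] := prod_approx mO (Lg j) (Lk i) e2.
pose dl := Num.min d1 d2; have dl0 : 0 < dl by rewrite lt_min d10.
have [phi [tp Lp Lp'] [_ hp]] := W_test Wf dl0.
have [psi [ts Ls Ls'] [_ hs]] := W_test Wh dl0.
have dd1 : dl <= d1 by rewrite ge_min lexx.
have dd2 : dl <= d2 by rewrite ge_min lexx orbT.
have B1 := H1 _ _ (Lp' i) (Ls' j) (le_trans (hp i) dd1) (le_trans (hs j) dd1).
have B2 := H2 _ _ (Lp' j) (Ls' i) (le_trans (hp j) dd2) (le_trans (hs i) dd2).
have E : \int[lebN]_(x in Omega) ('D_(e_ i) phi x * 'D_(e_ j) psi x) =
   \int[lebN]_(x in Omega) ('D_(e_ j) phi x * 'D_(e_ i) psi x).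
  rewrite !Rint_Omega => [|x nx|x nx].
  - exact: deriv_exchange (test_C1c tp i) (test_C1c tp j) (test_C1c ts i) (test_C1c ts j).
  - by rewrite (test_deriv_out j tp nx).2 mul0r.
  - by rewrite (test_deriv_out i tp nx).2 mul0r.
by rewrite E in B1; exact: dist_half B1 B2.
Qed.

(** Both sides are continuous in (f, g) for the L^2 norms, so an identity tested with smooth
    functions extends to W^{1,2}_0. The error e is shared among the N components and the zero order
    term, whence the division by N + 1. *)
Lemma W_weakdiv f g (B : 'I_N -> space -> R) (a : space -> R) :
  (forall j, L2 lebN Omega (B j)) -> L2 lebN Omega a ->
  (forall phi, test_function Omega phi ->
     \sum_j \int[lebN]_(x in Omega) (B j x * 'D_(e_ j) phi x) = - \int[lebN]_(x in Omega) (a x * phi x)) ->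
  Wapp f g ->
  \sum_j \int[lebN]_(x in Omega) (B j x * g j x) = - \int[lebN]_(x in Omega) (a x * f x).
Proof.
move=> LB La H Wf; have [Lf Lg _] := Wf.
apply: eq_of_small => e e0; have e2 : 0 < e / N.+1%:R by rewrite divr_gt0.
have [d0 d00 H0] := prod_approx mO La Lf e2.
have [dl dl0 [dd0 Hj]] : exists2 dl : R, 0 < dl & dl <= d0 /\ forall j a' b', L2 lebN Omega a' -> L2 lebN Omega b' ->
    \int[lebN]_(x in Omega) ((a' x - B j x) ^+ 2) <= dl ->
    \int[lebN]_(x in Omega) ((b' x - g j x) ^+ 2) <= dl ->
    `|\int[lebN]_(x in Omega) (a' x * b' x) - \int[lebN]_(x in Omega) (B j x * g j x)| <= e / N.+1%:R.
  have hj j := prod_approx mO (LB j) (Lg j) e2.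
  pose dj j := sval (cid2 (hj j)).
  have dj0 j : 0 < dj j by rewrite /dj; case: (cid2 (hj j)).
  exists (\big[Num.min/d0]_j dj j).
    by apply: (big_ind (fun x : R => 0 < x)) => // x y x0 y0; rewrite lt_min x0.
  split; first by apply/bigmin_leP; left.
  move=> j a' b' La' Lb' ha hb.
  have le : \big[Num.min/d0]_j dj j <= dj j by apply/bigmin_leP; right; exists j.
  have := hj j; rewrite /dj in le; move: le; case: (cid2 (hj j)) => /= x x0 hx le _.
  by apply: hx => //; exact: le_trans le.
have [phi [tp Lp Lp'] [hp0 hp]] := W_test Wf dl0.
have self0 (u : space -> R) (c : R) : 0 < c -> \int[lebN]_(x in Omega) ((u x - u x) ^+ 2) <= c.
  move=> c0; rewrite (@eq_Rintegral _ _ _ lebN Omega (cst 0)) => [|x _].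
    by rewrite /Rintegral integral0/= ltW.
  by rewrite subrr expr0n.
have B0 := H0 _ _ La Lp (self0 _ _ d00) (le_trans hp0 dd0).
have Bj j := Hj j _ _ (LB j) (Lp' j) (self0 _ _ dl0) (hp j).
rewrite opprK.
have -> : \sum_j \int[lebN]_(x in Omega) (B j x * g j x) + \int[lebN]_(x in Omega) (a x * f x) =
  - (\sum_j (\int[lebN]_(x in Omega) (B j x * 'D_(e_ j) phi x) - \int[lebN]_(x in Omega) (B j x * g j x)))
  + - (\int[lebN]_(x in Omega) (a x * phi x) - \int[lebN]_(x in Omega) (a x * f x)).
  by rewrite sumrB (H _ tp); ring.
have S : `|\sum_j (\int[lebN]_(x in Omega) (B j x * 'D_(e_ j) phi x) - \int[lebN]_(x in Omega) (B j x * g j x))| <= N%:R * (e / N.+1%:R).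
  apply: (le_trans (ler_norm_sum _ _ _)); rewrite -[N in N%:R]card_ord mulr_natl -sumr_const.
  by apply: ler_sum => j _; exact: Bj.
apply: (le_trans (ler_normD _ _)); rewrite !normrN.
apply: (le_trans (lerD S B0)).
rewrite -[X in _ + X]mul1r -mulrDl natr1 mulrCA divff ?mulr1// pnatr_eq0//.
Qed.

Lemma W_int_grad f g i : Wapp f g -> \int[lebN]_(x in Omega) g i x = 0.
Proof.
move=> Wf.
have Lc (c : R) : L2 lebN Omega (fun=> c).
  apply: (@L2_bd _ _ _ _ _ mO `|c|) => //; exact: Omega_finite.
(* The constant field equal to the i-th basis vector has weak divergence 0. *)
have := @W_weakdiv f g (fun j x => (j == i)%:R) (fun=> 0) (fun j => Lc _) (Lc 0) _ Wf.
rewrite [in RHS](@eq_Rintegral _ _ _ lebN Omega (cst 0)) => [|x _]; last by rewrite mul0r.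
rewrite [in RHS]/Rintegral integral0 oppr0 (bigD1 i)//= [X in _ + X]big1 => [|j /negbTE ji].
  rewrite addr0 eqxx => h.
  rewrite -[RHS]h; last first.
    move=> phi tp; rewrite (@eq_Rintegral _ _ _ lebN Omega (cst 0) (fun x => 0 * phi x)) => [|x _]; last by rewrite mul0r.
    rewrite [in RHS]/Rintegral integral0 oppr0 (bigD1 i)//= [X in _ + X]big1 => [|j /negbTE ji].
      rewrite addr0 eqxx; under eq_Rintegral do rewrite mul1r.
      rewrite Rint_Omega; last by move=> x nx; exact: (test_deriv_out i tp nx).2.
      by have hM := test_C1c tp; exact: int_deriv0 (hM i).
    rewrite (@eq_Rintegral _ _ _ lebN Omega (cst 0)) => [|x _]; last by rewrite ji mul0r.
    by rewrite /Rintegral integral0.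
  by apply: eq_Rintegral => x _; rewrite mul1r.
rewrite (@eq_Rintegral _ _ _ lebN Omega (cst 0)) => [|x _]; last by rewrite ji mul0r.
by rewrite /Rintegral integral0.
Qed.

Lemma poincare_pt (p c D a : R) : c ^+ 2 <= a ->
  0 <= 2^-1 * p ^+ 2 + 2 * a * D ^+ 2 - - (2 * (c * p * D)).
Proof.
move=> h.
have h4 : c ^+ 2 * D ^+ 2 <= a * D ^+ 2 by rewrite ler_wpM2r// sqr_ge0.
have -> : 2^-1 * p ^+ 2 + 2 * a * D ^+ 2 - - (2 * (c * p * D)) =
  2^-1 * (p + 2 * c * D) ^+ 2 + 2 * (a * D ^+ 2 - c ^+ 2 * D ^+ 2) by field.
by rewrite addr_ge0// mulr_ge0 ?sqr_ge0// subr_ge0.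
Qed.

(* The integral of the i-th derivative of [x_i * phi ^ 2] vanishes. *)
Lemma test_poincare (phi : space -> R) i : test_function Omega phi ->
  \int[lebN]_(x in Omega) (phi x ^+ 2) <=
  4 * A%:R ^+ 2 * \int[lebN]_(x in Omega) ('D_(e_ i) phi x ^+ 2).
Proof.
move=> tp; have [Lp Lp'] := test_L2 tp; have hM := test_C1c tp.
have [[cf f0] cf' df] := hM i.
pose F' (x : space) := phi x ^+ 2 + 2 * (x ord0 i * phi x) * 'D_(e_ i) phi x.
have H : C1c i (fun x : space => x ord0 i * (phi x * phi x)) F' A%:R.
  have cc : continuous (fun x : space => x ord0 i) by exact: coord_continuous.
  have c2 : continuous (fun x : space => phi x * phi x).
    by move=> x; apply: continuousM; exact: cf.
  split.
  - split; first by move=> x; apply: (@continuousM _ _ (fun x : space => x ord0 i)); [exact: cc|exact: c2].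
    by move=> x /f0 ->; rewrite mul0r mulr0.
  - move=> x; rewrite /F'; apply: (@continuousD _ _ _ (fun x : space => phi x ^+ 2)).
      have -> : (fun x : space => phi x ^+ 2) = (fun x => phi x * phi x) by apply/funext => y; rewrite expr2.
      exact: c2.
    apply: (@continuousM _ _ (fun x : space => 2 * (x ord0 i * phi x))); last exact: cf'.
    apply: (@continuousM _ _ (fun=> 2)); first exact: cst_continuous.
    by apply: (@continuousM _ _ (fun x : space => x ord0 i)); [exact: cc|exact: cf].
  - move=> x; have h := DM (dcoord x i i) (DM (df x) (df x)).
    by apply: (is_derive_eq h); rewrite eqxx mul1r /F'; ring.
have I0 := int_deriv0 H.
rewrite -Rint_Omega in I0; last first.
  by move=> x nx; have [h1 h2] := test_deriv_out i tp nx; rewrite /F' h1 h2 expr0n !mulr0 addr0.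
have Lx : L2 lebN Omega (fun x => x ord0 i * phi x).
  have [C _ hC] := Cc_bounded (conj cf f0).
  apply: (@L2_bd _ _ _ _ _ mO (A%:R * C)); first exact: Omega_finite.
    apply: measurable_funS (@continuous_measurable_rV R N _ _) => //.
    by move=> x; apply: (@continuousM _ _ (fun x : space => x ord0 i)); [exact: coord_continuous|exact: cf].
  by move=> x Ox; rewrite normrM ler_pM//; exact: OA.
have [_ ip] := Lp; have [_ id] := Lp' i.
have e1 : \int[lebN]_(x in Omega) F' x = \int[lebN]_(x in Omega) (phi x ^+ 2) +
    2 * \int[lebN]_(x in Omega) ((x ord0 i * phi x) * 'D_(e_ i) phi x).
  rewrite -RintZ//; last exact: L2M.
  rewrite -RintD//; last by apply: intgZ => //; exact: L2M.
  by apply: eq_Rintegral => x _; rewrite /F' !mulrA.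
have Y2 : - (2 * \int[lebN]_(x in Omega) ((x ord0 i * phi x) * 'D_(e_ i) phi x)) <=
   2^-1 * \int[lebN]_(x in Omega) (phi x ^+ 2) + 2 * A%:R ^+ 2 * \int[lebN]_(x in Omega) ('D_(e_ i) phi x ^+ 2).
  rewrite -!RintZ//; last exact: L2M.
  rewrite -RintN//; last by apply: intgZ => //; exact: L2M.
  rewrite -RintD//; last 2 first.
  - exact: intgZ.
  - exact: intgZ.
  apply: ae_le_Rint => //.
  - by apply: intgN => //; apply: intgZ => //; exact: L2M.
  - by apply: intgD => //; exact: intgZ.
  - apply: aeW => x Ox; rewrite -subr_ge0.
    apply: (@poincare_pt (phi x) (x ord0 i)).
    by rewrite -(real_normK (num_real (x ord0 i))) lerXn2r ?nnegrE// OA.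
move: I0 Y2; rewrite e1.
move: (\int[lebN]_(x in Omega) _) (\int[lebN]_(x in Omega) _) (\int[lebN]_(x in Omega) _) => u v w.
by lra.
Qed.

Lemma poincare_arith (F G p q u v a e : R) : 0 <= a ->
  F <= 2 * u + 2 * p -> q <= 2 * v + 2 * G -> p <= 4 * a * q ->
  u <= e / (2 + 16 * a) -> v <= e / (2 + 16 * a) -> F <= 16 * a * G + e.
Proof.
move=> a0 s1 s2 P hu hv.
have c0 : 0 < 2 + 16 * a by lra.
have E : 2 * (e / (2 + 16 * a)) + 16 * a * (e / (2 + 16 * a)) = e by field; rewrite gt_eqF.
have t1 : 16 * a * v <= 16 * a * (e / (2 + 16 * a)) by rewrite ler_wpM2l//; lra.
have t2 : 8 * a * q <= 8 * a * (2 * v + 2 * G) by rewrite ler_wpM2l//; lra.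
lra.
Qed.

Lemma W_poincare f g i : Wapp f g ->
  \int[lebN]_(x in Omega) (f x ^+ 2) <= 16 * A%:R ^+ 2 * \int[lebN]_(x in Omega) (g i x ^+ 2).
Proof.
move=> Wf; have [Lf Lg _] := Wf; apply/ler_addgt0Pr => e e0.
have c0 : (0 : R) < 2 + 16 * A%:R ^+ 2 by rewrite ltr_wpDr// mulr_ge0// exprn_ge0.
(* Passing from [phi] to [f] costs twice the first error; passing back through the gradient costs 16
   A^2 times the second. The constant 4 A^2 for test functions is doubled twice on the way. *)
have e1 : 0 < e / (2 + 16 * A%:R ^+ 2) by rewrite divr_gt0.
have [phi [tp Lp Lp'] [h0 /(_ i) h1]] := W_test Wf e1.
have P := test_poincare i tp.
have sq (u v : space -> R) : L2 lebN Omega u -> L2 lebN Omega v ->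
    \int[lebN]_(x in Omega) (u x ^+ 2) <= 2 * \int[lebN]_(x in Omega) ((v x - u x) ^+ 2) + 2 * \int[lebN]_(x in Omega) (v x ^+ 2).
  move=> Lu Lv; have [_ iu] := Lu; have [_ iv] := Lv; have [_ iw] := L2B mO Lv Lu.
  rewrite -!RintZ// -RintD//; last 2 first.
  - exact: intgZ.
  - exact: intgZ.
  apply: ae_le_Rint => //; first by apply: intgD => //; exact: intgZ.
  apply: aeW => x _; rewrite -subr_ge0.
  have -> : 2 * (v x - u x) ^+ 2 + 2 * v x ^+ 2 - u x ^+ 2 = (u x - 2 * v x) ^+ 2 by ring.
  exact: sqr_ge0.
have s1 := sq _ _ Lf Lp.
have s2 := sq _ _ (Lp' i) (Lg i).
have s3 : \int[lebN]_(x in Omega) ((g i x - 'D_(e_ i) phi x) ^+ 2) = \int[lebN]_(x in Omega) (('D_(e_ i) phi x - g i x) ^+ 2).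
  by apply: eq_Rintegral => x _; rewrite -sqrrN opprB.
rewrite s3 in s2.
have u0 : 0 <= \int[lebN]_(x in Omega) ((phi x - f x) ^+ 2) by apply: Rintegral_ge0 => x _; exact: sqr_ge0.
have v0 : 0 <= \int[lebN]_(x in Omega) (('D_(e_ i) phi x - g i x) ^+ 2) by apply: Rintegral_ge0 => x _; exact: sqr_ge0.
have a0 : (0 : R) <= A%:R ^+ 2 by rewrite exprn_ge0.
exact: poincare_arith s1 s2 P h0 h1.
Qed.

End W12.

Section within_continuity.
Context {R : realType}.

Lemma within_near {V : topologicalType} (B : set V) (f : V -> R) (x : V) (e : R) :
  {within B, continuous f} -> B x -> 0 < e ->
  \forall y \near x, B y -> `|f x - f y| < e.
Proof.
move=> /subspace_continuousP cf Bx e0.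
by have /cvgrPdist_lt/(_ e e0) := cf x Bx; rewrite near_withinE.
Qed.

Lemma near_within {V : topologicalType} (B : set V) (f : V -> R) :
  (forall x e, B x -> 0 < e -> \forall y \near x, B y -> `|f x - f y| < e) ->
  {within B, continuous f}.
Proof.
move=> H; apply/subspace_continuousP => x Bx; apply/cvgrPdist_lt => e e0.
by rewrite near_withinE; exact: H.
Qed.

Lemma within_open_cont {V : topologicalType} (O B : set V) (f : V -> R) (x : V) :
  open O -> O `<=` B -> {within B, continuous f} -> O x -> {for x, continuous f}.
Proof.
move=> oO OB cf Ox; apply/cvgrPdist_lt => e e0.
have := within_near cf (OB _ Ox) e0; move: (open_nbhs_nbhs (conj oO Ox)).
by apply: filterS2 => y Oy; apply; exact: OB.
Qed.

Lemma zero_ext_continuous {V : topologicalType} (O : set V) (f : V -> R) : open O ->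
  {within closure O, continuous f} -> (forall x, (closure O `\` O) x -> f x = 0) ->
  continuous (fun x => if `[< O x >] then f x else 0).
Proof.
move=> oO cf f0 x; apply/cvgrPdist_lt => e e0.
have [cx|ncx] := pselect (closure O x); last first.
  have nOx : ~ O x by move=> /subset_closure.
  have oc : open (~` closure O) by apply: closed_openC; exact: closed_closure.
  apply: filterS (open_nbhs_nbhs (conj oc ncx)) => y ny.
  have nOy : ~ O y by move=> /subset_closure.
  by rewrite !asboolF// subrr normr0.
have := within_near cf cx e0; have [Ox|nOx] := pselect (O x).
  apply: filterS2 (open_nbhs_nbhs (conj oO Ox)) => y Oy.
  by rewrite !asboolT//; apply; exact: subset_closure.
apply: filterS => y hy; rewrite (asboolF nOx).
have fx : f x = 0 by exact: f0.
have [Oy|nOy] := pselect (O y); last by rewrite asboolF// subrr normr0.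
by rewrite asboolT// -fx; apply: hy; exact: subset_closure.
Qed.

End within_continuity.

(** * Membership in W^{1,2}_0 *)

Section W12_membership.
Context {R : realType} {N : nat}.
Local Notation space := 'rV[R]_N.
Local Notation lebN := (lebesgue_rV R N).
Variables (Omega : set space) (A : nat).
Hypothesis oO : open Omega.
Hypothesis OA : forall x l, Omega x -> `|x ord0 l| <= A%:R.
Local Notation Wapp := (Wapp Omega).

Let mO : measurable Omega. Proof. exact: open_measurable_rV. Qed.
Let Ofin : (lebN Omega < +oo)%E. Proof. exact: Omega_finite OA. Qed.

Lemma compact_closure_bounded : compact (closure Omega).
Proof.
apply: (subclosed_compact _ (@compact_cube R N A%:R)); first exact: closed_closure.
rewrite [X in _ `<=` X](closure_id _).1; last exact: closed_cube.
by apply: closureS => x Ox l; exact: OA.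
Qed.

Lemma Ck_sub k (f g : space -> R) : Ck k f -> Ck k g -> Ck k (fun x => f x - g x).
Proof.
elim: k f g => [|k IH] f g /=; first by move=> cf cg x; apply: continuousB; [exact: cf|exact: cg].
move=> [cf hf] [cg hg]; split; first by move=> x; apply: continuousB; [exact: cf|exact: cg].
move=> i; have [df df'] := hf i; have [dg dg'] := hg i.
have dd x : is_derive x (e_ i) (fun y => f y - g y) ('D_(e_ i) f x - 'D_(e_ i) g x).
  by apply: DB; exact: DeriveDef.
split; first by move=> x; case: (dd x).
have -> : 'D_(e_ i) (fun x => f x - g x) = (fun x => 'D_(e_ i) f x - 'D_(e_ i) g x).
  by apply/funext => x; case: (dd x).
exact: IH.
Qed.

Lemma test_sub (f g : space -> R) : test_function Omega f -> test_function Omega g ->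
  test_function Omega (fun x => f x - g x).
Proof.
move=> [sf [K [cK KO f0]]] [sg [K' [cK' KO' g0]]]; split.
  by move=> k; apply: Ck_sub; [exact: sf|exact: sg].
exists (K `|` K'); split; first exact: compactU.
  by move=> x [/KO|/KO'].
by move=> x /not_orP[nK nK']; rewrite f0// g0// subrr.
Qed.

Lemma test_deriv (f : space -> R) i x : test_function Omega f ->
  is_derive x (e_ i) f ('D_(e_ i) f x).
Proof. by move=> [sf _]; have [_ /(_ i)[df _]] := sf 1%N; exact: DeriveDef. Qed.

Lemma Wapp_sub f g h k : Wapp f g -> Wapp h k ->
  Wapp (fun x => f x - h x) (fun j x => g j x - k j x).
Proof.
move=> Wf Wh; have [Lf Lg _] := Wf; have [Lh Lk _] := Wh; split.
- exact: L2B.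
- by move=> j; exact: L2B.
move=> e e0; have e4 : 0 < e / 4 by rewrite divr_gt0.
have [phi [tp Lp Lp'] [hp hp']] := W_test oO OA Wf e4.
have [psi [ts Ls Ls'] [hs hs']] := W_test oO OA Wh e4.
exists (fun x => phi x - psi x); first exact: test_sub.
have key (a b c d : space -> R) : L2 lebN Omega a -> L2 lebN Omega b -> L2 lebN Omega c -> L2 lebN Omega d ->
    \int[lebN]_(x in Omega) ((a x - b x) ^+ 2) <= e / 4 ->
    \int[lebN]_(x in Omega) ((c x - d x) ^+ 2) <= e / 4 ->
    \int[lebN]_(x in Omega) ((a x - c x - (b x - d x)) ^+ 2) <= e.
  move=> La Lb Lc Ld h1 h2.
  have [_ i1] := L2B mO La Lb; have [_ i2] := L2B mO Lc Ld.
  have [_ i3] := L2B mO (L2B mO La Lc) (L2B mO Lb Ld).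
  have -> : e = 2 * (e / 4) + 2 * (e / 4) by field.
  apply: (le_trans _ (lerD (ler_wpM2l _ h1) (ler_wpM2l _ h2))) => //.
  rewrite -!RintZ// -RintD//; [|exact: intgZ|exact: intgZ].
  apply: ae_le_Rint => //; first by apply: intgD => //; exact: intgZ.
  apply: aeW => x _; rewrite -subr_ge0.
  have -> : 2 * (a x - b x) ^+ 2 + 2 * (c x - d x) ^+ 2 - (a x - c x - (b x - d x)) ^+ 2 =
    (a x - b x + (c x - d x)) ^+ 2 by ring.
  exact: sqr_ge0.
split; first exact: key.
move=> j; rewrite (@eq_Rintegral _ _ _ lebN Omega
  (fun x => ('D_(e_ j) phi x - 'D_(e_ j) psi x - (g j x - k j x)) ^+ 2)); first exact: key.
move=> x _; congr ((_ - _) ^+ 2).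
have d : is_derive x (e_ j) (fun x => phi x - psi x) ('D_(e_ j) phi x - 'D_(e_ j) psi x).
  by apply: DB; exact: test_deriv.
by case: d.
Qed.

Lemma enorm_sq_entry n (v : 'rV[R]_n) j : v ord0 j ^+ 2 <= enorm v ^+ 2.
Proof.
by rewrite enorm_sq_rV (bigD1 j)//= lerDl; apply: sumr_ge0 => l _; exact: sqr_ge0.
Qed.

Lemma W12_0_Wapp f g : W12_0 Omega f g -> Wapp f (fun j x => g x ord0 j).
Proof.
move=> [mf mg [phi [tp cv]]].
pose q k x := (phi k x - f x) ^+ 2 + enorm (grad (phi k) x - g x) ^+ 2.
have q0 k x : 0 <= q k x by rewrite addr_ge0 ?sqr_ge0.
have gE k x j : (grad (phi k) x - g x) ord0 j = 'D_(e_ j) (phi k) x - g x ord0 j by rewrite !mxE.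
have mp k := test_L2 oO OA (tp k).
have mq k : measurable_fun Omega (q k).
  have [[m1 _] m2] := mp k; rewrite /q.
  apply: measurable_funD; first by apply: measurable_funX; exact: measurable_funB.
  under eq_fun do rewrite enorm_sq_rV.
  apply: measurable_sum => j.
  under eq_fun do rewrite gE.
  by apply: measurable_funX; apply: measurable_funB => //; case: (m2 j).
have main (e : R) : 0 < e -> exists k, intg lebN Omega (q k) /\ \int[lebN]_(x in Omega) q k x <= e.
  move=> e0; have ee : [set y | (y < e%:E)%E] 0%E by rewrite /= lte_fin.
  have oe : open [set y | (y < e%:E)%E] by exact: open_ereal_lt_ereal.
  have [k _ /(_ k (leqnn k)) /= hk] := cv _ (open_nbhs_nbhs (conj oe ee)).
  have iq : intg lebN Omega (q k).
    apply: intgP => //; under eq_integral do rewrite ger0_norm//.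
    by apply: lt_trans hk _; exact: ltry.
  exists k; split => //; rewrite -lee_fin -Rint_fin//; exact: ltW.
have diffs k : intg lebN Omega (q k) ->
    L2 lebN Omega (fun x => phi k x - f x) /\ forall j, L2 lebN Omega (fun x => 'D_(e_ j) (phi k) x - g x ord0 j).
  move=> iq; have [[m1 _] m2] := mp k; split; [|move=> j; have [m3 _] := m2 j];
    (split; first exact: measurable_funB);
    apply: (@le_intg _ _ _ lebN Omega _ (q k)) => //.
  - by apply: measurable_funX; exact: measurable_funB.
  - by move=> x _; rewrite !ger0_norm ?sqr_ge0// /q lerDl sqr_ge0.
  - by apply: measurable_funX; exact: measurable_funB.
  - move=> x _; rewrite !ger0_norm ?sqr_ge0// /q -gE.
    by apply: (le_trans (enorm_sq_entry _ _)); rewrite lerDr sqr_ge0.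
(* One test function at finite distance already shows that [f] and [g] are square integrable: each
   is a test quantity minus an L^2 difference. *)
have [k1 [iq1 _]] := main 1 ltr01; have [D0 Dj] := diffs _ iq1.
split.
- have := L2B mO (mp k1).1 D0; rewrite (_ : (fun x => _) = f)//.
  by apply/funext => x; rewrite opprB addrC subrK.
- move=> j; have := L2B mO ((mp k1).2 j) (Dj j); rewrite (_ : (fun x => _) = (fun x => g x ord0 j))//.
  by apply/funext => x; rewrite opprB addrC subrK.
move=> e e0; have [k [iq le]] := main e e0; have [[_ E0] Ej] := diffs _ iq.
exists (phi k) => //; split; [|move=> j; have [_ Ejj] := Ej j];
  apply: (le_trans _ le); apply: ae_le_Rint => //; apply: aeW => x _; rewrite /q.
  by rewrite lerDl sqr_ge0.
by rewrite -gE; apply: (le_trans (enorm_sq_entry _ _)); rewrite lerDr sqr_ge0.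
Qed.

Lemma closure_L2 (f : space -> R) : {within closure Omega, continuous f} -> L2 lebN Omega f.
Proof.
move=> cf; have [C _ hC] := continuous_bounded_on compact_closure_bounded cf.
apply: (@L2_bd _ _ _ _ _ mO C) => //; last by move=> x /subset_closure /hC.
apply: (@measurable_funS _ _ _ _ (closure Omega)).
- by apply: closed_measurable_rV; exact: closed_closure.
- exact: subset_closure.
- by apply: within_continuous_measurable_rV => //; apply: closed_measurable_rV; exact: closed_closure.
Qed.

Lemma Rint_sq_cvg0 (q : nat -> space -> R) (f : space -> R) (C : R) : L2 lebN Omega f ->
  (forall n, L2 lebN Omega (q n)) -> (forall n x, Omega x -> `|q n x - f x| <= C) ->
  (forall x, Omega x -> q ^~ x @ \oo --> f x) ->
  forall e : R, 0 < e -> \forall n \near \oo, \int[lebN]_(x in Omega) ((q n x - f x) ^+ 2) <= e.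
Proof.
move=> [mf _] Lq hC cq e e0.
have : (fun n => \int[lebN]_(x in Omega) ((q n x - f x) ^+ 2)) @ \oo --> \int[lebN]_(x in Omega) (fun=> 0) x.
  apply: (@Rint_cvg R N Omega (fun n x => (q n x - f x) ^+ 2) (fun=> 0) (fun=> C ^+ 2)) => //.
  - by move=> n; apply: measurable_funX; apply: measurable_funB => //; case: (Lq n).
  - exact: (@intg_bd _ _ _ lebN Omega _ `|C ^+ 2|).
  - by move=> n x Ox; rewrite normrX lerXn2r ?nnegrE ?hC// (le_trans _ (hC n x Ox)).
  - move=> x Ox.
    have h : (fun n => q n x - f x) @ \oo --> (0 : R).
      by rewrite -(subrr (f x)); apply: cvgB; [exact: cq|exact: cvg_cst].
    by have h2 := cvgM h h; rewrite mulr0 in h2; exact: h2.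
rewrite [X in _ --> X]/Rintegral integral0 /= => /cvgrPdist_le/(_ e e0); apply: filterS => n.
by rewrite sub0r normrN ger0_norm//; apply: Rintegral_ge0 => x _; exact: sqr_ge0.
Qed.

(** The extension by zero is continuous, and the partial derivatives are bounded and continuous
    inside, as [zero_trace_approx] requires. Bounded pointwise convergence on a set of finite
    measure then gives convergence in L^2. *)
Lemma Wapp_C1 (F : space -> R) (g : 'I_N -> space -> R) :
  {within closure Omega, continuous F} ->
  (forall j, {within closure Omega, continuous (g j)}) ->
  (forall x, (closure Omega `\` Omega) x -> F x = 0) ->
  (forall x j, Omega x -> is_derive x (e_ j) F (g j x)) -> Wapp F g.
Proof.
move=> cF cg F0 dF.
have OcO : Omega `<=` closure Omega by exact: subset_closure.
have LF := closure_L2 cF; have Lg j := closure_L2 (cg j); split => //.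
have [L L0 hL] : exists2 L : R, 0 <= L & forall x j, Omega x -> `|g j x| <= L.
  have hj j := continuous_bounded_on compact_closure_bounded (cg j).
  pose Lj j := sval (cid2 (hj j)).
  have Lj0 j : 0 <= Lj j by rewrite /Lj; case: (cid2 (hj j)).
  exists (\sum_j Lj j); first exact: sumr_ge0.
  move=> x j Ox; rewrite (bigD1 j)//=.
  have : `|g j x| <= Lj j by rewrite /Lj; case: (cid2 (hj j)) => C /= _ h; apply: h; exact: OcO.
  by move=> /le_trans; apply; rewrite lerDl; exact: sumr_ge0.
pose Fz x := if `[< Omega x >] then F x else 0.
have FzE x : Omega x -> Fz x = F x by move=> Ox; rewrite /Fz asboolT.
have cFz : continuous Fz by exact: zero_ext_continuous.
have Fz0 x : ~ Omega x -> Fz x = 0 by move=> nx; rewrite /Fz asboolF.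
have dFz x j : Omega x -> is_derive x (e_ j) Fz (g j x).
  move=> Ox; apply: (near_eq_is_derive (f := F)); last exact: dF.
  by apply: filterS (open_nbhs_nbhs (conj oO Ox)) => y Oy; rewrite FzE.
have cgz x j : Omega x -> {for x, continuous (g j)}.
  by move=> Ox; exact: within_open_cont oO OcO (cg j) Ox.
have [phi [C [tp b0 b1 c0 c1]]] := zero_trace_approx oO OA L0 cFz Fz0 dFz hL cgz.
move=> e e0.
have N0 : \forall n \near \oo, \int[lebN]_(x in Omega) ((phi n x - F x) ^+ 2) <= e.
  apply: (@Rint_sq_cvg0 _ _ C) => //.
  - by move=> n; exact: (test_L2 oO OA (tp n)).1.
  - by move=> n x Ox; rewrite -FzE//; exact: b0.
  - by move=> x Ox; rewrite -FzE//; exact: c0.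
have N1 : \forall n \near \oo, forall j, \int[lebN]_(x in Omega) (('D_(e_ j) (phi n) x - g j x) ^+ 2) <= e.
  apply: filter_forall => j.
  apply: (@Rint_sq_cvg0 (fun n => 'D_(e_ j) (phi n)) _ (C + L)) => //.
  - by move=> n; exact: (test_L2 oO OA (tp n)).2.
  - by move=> n x Ox; apply: (le_trans (ler_normB _ _)); apply: lerD; [exact: b1|exact: hL].
  - by move=> x Ox; exact: c1.
have [n [h0 h1]] := filter_ex (filterI N0 N1).
by exists (phi n).
Qed.

End W12_membership.

(** * The viscous bilinear form and Korn's inequality *)

Section viscous.
Context {R : realType} {N : nat}.
Local Notation space := 'rV[R]_N.
Local Notation lebN := (lebesgue_rV R N).
Implicit Types (A B : 'M[R]_N).

Lemma innerDl m n (A B C : 'M[R]_(m, n)) : inner (A + B) C = inner A C + inner B C.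
Proof.
rewrite /inner -big_split; apply: eq_bigr => i _; rewrite -big_split.
by apply: eq_bigr => j _; rewrite mxE mulrDl.
Qed.

Lemma innerZl m n (c : R) (A C : 'M[R]_(m, n)) : inner (c *: A) C = c * inner A C.
Proof.
rewrite /inner mulr_sumr; apply: eq_bigr => i _; rewrite mulr_sumr.
by apply: eq_bigr => j _; rewrite mxE mulrA.
Qed.

Lemma innerC m n (A B : 'M[R]_(m, n)) : inner A B = inner B A.
Proof. by apply: eq_bigr => i _; apply: eq_bigr => j _; rewrite mulrC. Qed.

Lemma innerNl m n (A C : 'M[R]_(m, n)) : inner (- A) C = - inner A C.
Proof. by rewrite -scaleN1r innerZl mulN1r. Qed.

Lemma inner_scalar (c : R) B : inner c%:M B = c * \tr B.
Proof.
rewrite /inner /mxtrace mulr_sumr; apply: eq_bigr => i _.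
rewrite (bigD1 i)//= big1 => [|j /negbTE ji]; first by rewrite addr0 mxE eqxx.
by rewrite mxE eq_sym ji mulr0n mul0r.
Qed.

Lemma viscousE (mu eta : R) A B : inner (viscous_stress mu eta A) B =
  mu * (inner A B + inner A^T B) + (eta - 2 / 3 * mu) * (\tr A * \tr B).
Proof.
by rewrite /viscous_stress innerDl innerZl !innerDl innerNl !inner_scalar; ring.
Qed.

Lemma viscousB (mu eta : R) A B :
  viscous_stress mu eta (A - B) = viscous_stress mu eta A - viscous_stress mu eta B.
Proof.
apply/matrixP => i j; rewrite /viscous_stress !mxE raddfB /=.
by case: (i == j); rewrite ?mulr1n ?mulr0n; ring.
Qed.

Lemma enorm_inner m n (A : 'M[R]_(m, n)) : enorm A ^+ 2 = inner A A.
Proof. by rewrite /enorm sqr_sqrtr// inner_ge0. Qed.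

Variables (Omega : set space) (bd : nat).
Hypothesis oO : open Omega.
Hypothesis OA : forall x l, Omega x -> `|x ord0 l| <= bd%:R.

Let mO : measurable Omega. Proof. exact: open_measurable_rV. Qed.

Lemma intg_inner m n (G H : space -> 'M[R]_(m, n)) :
  (forall i j, L2 lebN Omega (fun x => G x i j)) -> (forall i j, L2 lebN Omega (fun x => H x i j)) ->
  intg lebN Omega (fun x => inner (G x) (H x)).
Proof.
by move=> LG LH; apply: intg_sum => // i _; apply: intg_sum => // j _; exact: L2M.
Qed.

Lemma trtrE (A B : 'M[R]_N) : \tr A * \tr B = \sum_i \sum_j A i i * B j j.
Proof. by rewrite /mxtrace mulr_suml; apply: eq_bigr => i _; rewrite mulr_sumr. Qed.

Lemma intg_trtr (G H : space -> 'M[R]_N) :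
  (forall i j, L2 lebN Omega (fun x => G x i j)) -> (forall i j, L2 lebN Omega (fun x => H x i j)) ->
  intg lebN Omega (fun x => \tr (G x) * \tr (H x)).
Proof.
move=> LG LH; apply: (@eq_intg _ _ _ lebN Omega (fun x => \sum_i \sum_j G x i i * H x j j)) => //.
  by move=> x _; rewrite trtrE.
by apply: intg_sum => // i _; apply: intg_sum => // j _; exact: L2M.
Qed.

Lemma L2_tr (G : space -> 'M[R]_N) i j : (forall i j, L2 lebN Omega (fun x => G x i j)) ->
  L2 lebN Omega (fun x => (G x)^T i j).
Proof.
by move=> LG; rewrite (_ : (fun x => _) = (fun x => G x j i))//; apply/funext => x; rewrite mxE.
Qed.

Lemma intg_viscous (mu eta : R) (G H : space -> 'M[R]_N) :
  (forall i j, L2 lebN Omega (fun x => G x i j)) -> (forall i j, L2 lebN Omega (fun x => H x i j)) ->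
  intg lebN Omega (fun x => inner (viscous_stress mu eta (G x)) (H x)).
Proof.
move=> LG LH.
apply: (@eq_intg _ _ _ lebN Omega (fun x => mu * (inner (G x) (H x) + inner (G x)^T (H x)) +
   (eta - 2 / 3 * mu) * (\tr (G x) * \tr (H x)))) => //; first by move=> x _; rewrite viscousE.
have LT i j := L2_tr i j LG.
apply: intgD => //; apply: intgZ => //; first by apply: intgD => //; exact: intg_inner.
exact: intg_trtr.
Qed.

(* After two integrations by parts [(div u) ^ 2] and [grad u : (grad u)^T] have the
   same integral, so that the stress controls the full gradient. *)
Lemma korn (mu eta : R) (f : 'I_N -> space -> R) (G : space -> 'M[R]_N) :
  0 < mu -> 0 <= eta -> (forall i, Wapp Omega (f i) (fun j x => G x i j)) ->
  mu * \int[lebN]_(x in Omega) (enorm (G x) ^+ 2) <=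
  \int[lebN]_(x in Omega) inner (viscous_stress mu eta (G x)) (G x).
Proof.
move=> mu0 eta0 W.
have LG i j : L2 lebN Omega (fun x => G x i j) by have [_ + _] := W i; exact.
have LT i j := L2_tr i j LG.
have i1 := intg_inner LG LG; have i2 := intg_inner LT LG; have i3 := intg_trtr LG LG.
rewrite [leRHS](@eq_Rintegral _ _ _ lebN Omega (fun x => mu * (inner (G x) (G x) + inner (G x)^T (G x)) +
   (eta - 2 / 3 * mu) * (\tr (G x) * \tr (G x)))); last by move=> x _; rewrite viscousE.
rewrite RintD//; [|by apply: intgZ => //; exact: intgD|exact: intgZ].
rewrite !RintZ//; last exact: intgD.
rewrite RintD//.
have E : \int[lebN]_(x in Omega) inner (G x)^T (G x) = \int[lebN]_(x in Omega) (\tr (G x) * \tr (G x)).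
  rewrite Rint_sum//; last by move=> i _; apply: intg_sum => // j _; exact: L2M.
  rewrite [RHS](@eq_Rintegral _ _ _ lebN Omega (fun x => \sum_i \sum_j G x i i * G x j j)); last first.
    by move=> x _; rewrite trtrE.
  rewrite Rint_sum//; last by move=> i _; apply: intg_sum => // j _; exact: L2M.
  apply: eq_bigr => i _; rewrite !Rint_sum//; last 2 first.
  - by move=> j _; exact: L2M.
  - by move=> j _; exact: L2M.
  apply: eq_bigr => j _.
  rewrite (@eq_Rintegral _ _ _ lebN Omega (fun x => G x i j * G x j i)); last first.
    by move=> x _; rewrite mxE mulrC.
  exact: (W_sym oO OA j i (W i) (W j)).
rewrite E [X in mu * X <= _](@eq_Rintegral _ _ _ lebN Omega (fun x => inner (G x) (G x))); last first.
  by move=> x _; rewrite enorm_inner.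
have t0 : 0 <= \int[lebN]_(x in Omega) (\tr (G x) * \tr (G x)).
  by apply: Rintegral_ge0 => x _; rewrite -expr2 sqr_ge0.
(* The squared divergence is left with the coefficient mu + eta - 2 mu / 3, which is nonnegative. *)
rewrite mulrDr -addrA lerDl -mulrDl mulr_ge0//.
by move: mu0 eta0; lra.
Qed.

End viscous.

(** * Convexity of the pressure potential *)

Section ftc.
Context {R : realType}.
Local Notation leb := (@lebesgue_measure R).
Implicit Types f F : R -> R.

Lemma FTC2 f F (a b : R) : a <= b -> {within `[a, b], continuous f} ->
  {within `[a, b], continuous F} -> (forall x, a < x < b -> is_derive x 1 F (f x)) ->
  \int[leb]_(x in `[a, b]) f x = F b - F a.
Proof.
rewrite le_eqVlt => /predU1P[-> _ _ _|ab cf cF dF].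
  by rewrite subrr set_itv1 Rintegral_set1.
have [c1 c2 c3] := (continuous_within_itvP F ab).1 cF.
rewrite /Rintegral (continuous_FTC2 ab cf (F := F))//.
- split => // x; rewrite in_itv /= => xab; by case: (dF x xab).
- by move=> x; rewrite in_itv /= => xab; rewrite derive1E; case: (dF x xab).
Qed.

Lemma within_cont_at f (B : set R) : (forall x, B x -> {for x, continuous f}) ->
  {within B, continuous f}.
Proof.
by move=> cf; apply: continuous_in_subspaceT => x; rewrite inE; exact: cf.
Qed.

(** Freezing [f] to the left of [a] and subtracting f(a) gives, after a shift, a continuous function
    that vanishes on the negative axis; the linear term f(a) x restores the constant. *)
Lemma antiderivative_right f (a : R) : (forall x, a <= x -> {for x, continuous f}) ->
  exists F, forall x, a < x -> is_derive x 1 F (f x).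
Proof.
move=> cf.
pose g x := f (Num.max a (x + a)) - f a.
have cg : continuous g.
  move=> x; apply: (@continuousB _ _ _ (fun x => f (Num.max a (x + a))) (fun=> f a)); last exact: cst_continuous.
  apply: (@continuous_comp _ _ _ (fun x => Num.max a (x + a)) f).
    apply: (@continuous_max _ _ (fun=> a) (fun x => x + a)); first exact: cst_continuous.
    exact: (cvgD cvg_id (cvg_cst _)).
  by apply: cf; rewrite le_max lexx.
have g0 x : x <= 0 -> g x = 0.
  by move=> x0; rewrite /g max_l ?subrr// gerDr.
have [G dG _] := antiderivative cg g0.
exists (fun x => G (x - a) + f a * x) => x ax.
have h : is_derive x 1 (fun y : R => G (y - a)) (g (x - a)) by exact: dshift.
have h2 : is_derive x 1 (fun y : R => f a * y) (f a * 1) by apply: DZ; exact: is_derive_id.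
apply: (is_derive_eq (DD h h2)).
by rewrite /g subrK max_r ?(ltW ax)// mulr1 subrK.
Qed.

Lemma bounded_segment f (a b : R) : a <= b -> (forall x, a <= x <= b -> {for x, continuous f}) ->
  exists2 C : R, 0 <= C & forall x, a <= x <= b -> `|f x| <= C.
Proof.
move=> ab cf.
have cn : {within `[a, b], continuous (fun x => `|f x|)}.
  apply: within_cont_at => x; rewrite /= in_itv /= => /cf h.
  by apply: (@continuous_comp _ _ _ f Num.norm) => //; exact: norm_continuous.
have [c _ hc] := EVT_max ab cn.
by exists (`|f c|) => // x xab; apply: hc; rewrite in_itv.
Qed.

Lemma positive_segment f (a b : R) : a <= b -> (forall x, a <= x <= b -> {for x, continuous f}) ->
  (forall x, a <= x <= b -> 0 < f x) ->
  exists2 c : R, 0 < c & forall x, a <= x <= b -> c <= f x.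
Proof.
move=> ab cf f0.
have cn : {within `[a, b], continuous f}.
  by apply: within_cont_at => x; rewrite /= in_itv /= => /cf.
have [c ci hc] := EVT_min ab cn; rewrite in_itv /= in ci.
by exists (f c); [exact: f0|move=> x xab; apply: hc; rewrite in_itv].
Qed.

Lemma convex_tangent f (f' : R -> R) (a b r s : R) :
  (forall x, a <= x <= b -> is_derive x 1 f (f' x)) ->
  (forall x y, a <= x -> x <= y -> y <= b -> f' x <= f' y) ->
  a <= r <= b -> a <= s <= b -> 0 <= f s - f r - f' r * (s - r).
Proof.
move=> df f'nd /andP[ar rb] /andP[as_ sb].
pose h x := f x - f' r * x.
have dh x : a <= x <= b -> is_derive x 1 h (f' x - f' r).
  move=> xab; have h2 : is_derive x 1 (fun y : R => f' r * y) (f' r * 1) by apply: DZ; exact: is_derive_id.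
  by have := DB (df x xab) h2; rewrite mulr1.
have ch x : a <= x <= b -> {for x, continuous h} by move=> /dh /is_derive1_cont.
have -> : f s - f r - f' r * (s - r) = h s - h r by rewrite /h; ring.
rewrite subr_ge0; have [rs|/ltW sr] := leP r s.
  apply: (@derive_ge0_nd _ h (fun x => f' x - f' r)) => //.
  - by move=> x /andP[rx xs]; apply: dh; rewrite (le_trans ar (ltW rx)) (le_trans (ltW xs) sb).
  - by move=> x /andP[rx xs]; rewrite subr_ge0 f'nd// ?(ltW rx)// (le_trans (ltW xs) sb).
  - apply: within_cont_at => x; rewrite /= in_itv /= => /andP[rx xs]; apply: ch.
    by rewrite (le_trans ar rx) (le_trans xs sb).
rewrite -[h r]opprK -[h s]opprK lerN2.
apply: (@derive_ge0_nd _ (fun x => - h x) (fun x => - (f' x - f' r)) s r sr) => //.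
- move=> x /andP[rx xs]; have := DZ (-1) (dh x _).
  rewrite (le_trans as_ (ltW rx)) (le_trans (ltW xs) rb) => /(_ isT).
  by rewrite mulN1r (_ : (fun y => _) = (fun y => - h y))//; apply/funext => y; rewrite mulN1r.
- by move=> x /andP[sx xr]; rewrite oppr_ge0 subr_le0 f'nd// ?(ltW xr)// (le_trans as_ (ltW sx)).
- apply: within_cont_at => x; rewrite /= in_itv /= => /andP[rx xs].
  apply: (@continuousN _ _ _ h); apply: ch.
  by rewrite (le_trans as_ rx) (le_trans xs rb).
Qed.

Lemma limf_einf_gt0 (f : R -> R) : (0 < limf_einf (fun x => (f x)%:E) (pinfty_nbhs R))%E ->
  exists2 c : R, 0 < c & exists M : R, forall x, M < x -> c <= f x.
Proof.
rewrite /limf_einf oppe_gt0 => /ereal_inf_lt[_ [V [M [_ MV]] <-] sV].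
set S := ereal_sup _ in sV.
have [c c0 cS] : exists2 c : R, 0 < c & (S <= (- c)%:E)%E.
  move: sV; case: S => [s| |]//; rewrite ?lte_fin => s0; last by exists 1; rewrite ?leNye.
  by exists (- s); rewrite ?opprK// oppr_gt0.
exists c => //; exists M => x Mx; rewrite -lerN2 -lee_fin; apply: le_trans cS.
by apply: ereal_sup_ubound; exists x; [exact: MV|].
Qed.

End ftc.

(** * Coercivity of the relative pressure potential *)

Section relative_pressure.
Context {R : realType}.
Variables p p' p'' P P1 : R -> R.
Hypothesis dp : forall x : R, 0 < x -> is_derive x 1 p (p' x).
Hypothesis dp' : forall x : R, 0 < x -> is_derive x 1 p' (p'' x).
Hypothesis p''_cont : forall x : R, 0 < x -> {for x, continuous p''}.
Hypothesis p'_gt0 : forall x : R, 0 < x -> 0 < p' x.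
Hypothesis p_le : forall x y : R, 0 <= x -> x <= y -> p x <= p y.
Hypothesis p_gt0 : forall x : R, 0 < x -> 0 < p x.
Hypothesis p_ge0 : forall x : R, 0 <= x -> 0 <= p x.
Hypothesis P_0 : P 0 = 0.
Hypothesis dP : forall x : R, 0 < x -> is_derive x 1 P (P1 x).
Hypothesis dP1 : forall x : R, 0 < x -> is_derive x 1 P1 (p' x / x).
Hypothesis P1_eq : forall r : R, 0 < r -> r * P1 r - P r = p r.
Hypothesis P_large : exists2 k : R, 0 < k & exists M, forall x : R, M < x -> k <= P x / p x.

Let p'_cont (x : R) : 0 < x -> {for x, continuous p'}.
Proof. by move=> x0; exact: is_derive1_cont (dp' x0). Qed.

Lemma P1_lt (x y : R) : 0 < x -> x < y -> P1 x < P1 y.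
Proof.
move=> x0 xy.
have c z : x <= z -> {for z, continuous P1}.
  by move=> xz; apply: is_derive1_cont; apply: dP1; exact: lt_le_trans xz.
have cp : {within `[x, y], continuous P1}.
  by apply: within_cont_at => z; rewrite /= in_itv /= => /andP[/c].
have d z : z \in `]x, y[ -> is_derive z 1 P1 (p' z / z).
  by rewrite in_itv /= => /andP[xz _]; apply: dP1; exact: lt_trans xz.
have [z zi E] := MVT xy d cp; rewrite -subr_gt0 E mulr_gt0 ?subr_gt0//.
rewrite in_itv /= in zi; case/andP: zi => xz _.
have z0 : 0 < z by exact: lt_trans xz.
by rewrite divr_gt0// p'_gt0.
Qed.

Lemma P1_le (x y : R) : 0 < x -> x <= y -> P1 x <= P1 y.
Proof.
by move=> x0; rewrite le_eqVlt => /predU1P[->//|xy]; apply: ltW; exact: P1_lt.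
Qed.

Definition Prel (s r : R) : R := P s - P1 r * (s - r) - P r.

Lemma PrelE (s r : R) : 0 < r -> Prel s r = P s - P1 r * s + p r.
Proof. by move=> r0; rewrite -(P1_eq r0) /Prel; ring. Qed.

(** In its first argument the function has derivative P'(s) - P'(r), which has the sign of s - r by
    convexity of P. *)
Lemma Prel_mono (r s s' : R) : 0 < r -> (0 < s <= s' /\ s' <= r) \/ (r <= s' <= s) ->
  Prel s' r <= Prel s r.
Proof.
move=> r0 H.
have tg x y : 0 < x -> 0 < y -> 0 <= P y - P x - P1 x * (y - x).
  move=> x0 y0; pose a := Num.min x y; pose b := Num.max x y.
  have a0 : 0 < a by rewrite lt_min x0.
  apply: (@convex_tangent _ P P1 a b).
  - by move=> z /andP[az _]; apply: dP; exact: lt_le_trans az.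
  - by move=> z w az zw _; apply: P1_le => //; exact: lt_le_trans az.
  - by rewrite ge_min lexx le_max lexx.
  - by rewrite ge_min lexx le_max lexx !orbT.
have [s0 s'0] : 0 < s /\ 0 < s'.
  case: H => [[/andP[s0 ss'] _]|/andP[rs' ss']]; first by split => //; exact: lt_le_trans ss'.
  by have s'0 := lt_le_trans r0 rs'; split => //; exact: lt_le_trans ss'.
rewrite -subr_ge0; have := tg s' s s'0 s0.
have -> : Prel s r - Prel s' r = (P s - P s' - P1 s' * (s - s')) + (P1 s' - P1 r) * (s - s').
  by rewrite /Prel; ring.
move=> h; rewrite addr_ge0//; case: H => [[/andP[_ ss'] s'r]|/andP[rs' ss']].
  by rewrite -mulrNN mulr_ge0// oppr_ge0 subr_le0// P1_le.
by rewrite mulr_ge0// subr_ge0// P1_le.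
Qed.

(** Near [r1, r2] the bounds on P'' = p'/s and p'' make both sides quadratic. Below r1/2
    monotonicity bounds the potential away from 0. Above 2 r2 convexity gives linear growth, and
    there p is controlled by P through the lower bound on P/p. The constants are uniform in [r]. *)
Lemma pressure_bounds_gen (r1 r2 : R) : 0 < r1 -> r1 <= r2 ->
  exists2 c : R, 0 < c & exists2 C : R, 0 < C & forall r, r1 <= r <= r2 -> forall s, 0 <= s ->
  [/\ r1 / 2 <= s <= 2 * r2 -> c * (s - r) ^+ 2 <= Prel s r,
      s < r1 / 2 -> c <= Prel s r,
      2 * r2 < s -> c * s <= Prel s r &
      `|p s - p' r * (s - r) - p r| <= C * Prel s r].
Proof.
move=> r10 r12.
have r20 : 0 < r2 by exact: lt_le_trans r12.
set a := r1 / 2; set b := 2 * r2.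
have a0 : 0 < a by rewrite divr_gt0.
have ar1 : a < r1 by rewrite /a; lra.
have r2b : r2 < b by rewrite /b; lra.
have ab : a <= b by apply: ltW; apply: lt_trans ar1 _; apply: le_lt_trans r2b.
have pos x : a <= x <= b -> 0 < x by move=> /andP[ax _]; exact: lt_le_trans ax.
have [c1 c10 hc1] : exists2 c : R, 0 < c & forall x, a <= x <= b -> c <= p' x / x.
  apply: (positive_segment ab) => x /pos x0.
    apply: (@continuousM _ _ p' (fun z : R => z^-1)); first exact: p'_cont.
    by apply: (@continuousV _ _ id); rewrite ?gt_eqF.
  by rewrite divr_gt0// p'_gt0.
have [c2 c20 hc2] : exists2 C : R, 0 <= C & forall x, a <= x <= b -> `|p'' x| <= C.
  by apply: (bounded_segment ab) => x /pos; exact: p''_cont.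
have [c3 c30 hc3] : exists2 C : R, 0 <= C & forall x, a <= x <= b -> `|p' x| <= C.
  by apply: (bounded_segment ab) => x /pos; exact: p'_cont.
have [c4 c40 hc4] : exists2 C : R, 0 <= C & forall x, a <= x <= b -> `|P1 x| <= C.
  by apply: (bounded_segment ab) => x /pos x0; apply: is_derive1_cont; exact: dP1.
have [k k0 [S0 hS0]] := P_large.
(* Taylor's inequality in convex form; it is applied to P - c0 x^2 and to c2 x^2 - p and c2 x^2 + p,
   whose second derivatives are nonnegative. *)
have quad (f f' f'' : R -> R) (r s : R) : (forall x, a <= x <= b -> is_derive x 1 f (f' x)) ->
    (forall x, a <= x <= b -> is_derive x 1 f' (f'' x)) -> (forall x, a <= x <= b -> 0 <= f'' x) ->
    a <= r <= b -> a <= s <= b -> 0 <= f s - f r - f' r * (s - r).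
  move=> df df' f0 rab sab; apply: (convex_tangent df _ rab sab) => x y ax xy yb.
  have ok z : x <= z <= y -> a <= z <= b by move=> /andP[xz zy]; rewrite (le_trans ax xz) (le_trans zy yb).
  apply: (@derive_ge0_nd _ f' f'' x y xy).
  - by move=> z /andP[/ltW xz /ltW zy]; apply: df'; apply: ok; rewrite xz.
  - by move=> z /andP[/ltW xz /ltW zy]; apply: f0; apply: ok; rewrite xz.
  - by apply: within_cont_at => z; rewrite /= in_itv /= => /ok /df' /is_derive1_cont.
have dsq (c x : R) : is_derive x 1 (fun y : R => c * (y * y)) (c * (2 * x)).
  have := DZ c (DM (is_derive_id x (1 : R)) (is_derive_id x (1 : R))) => /is_derive_eq; apply.
  by ring.
have dsq' (c x : R) : is_derive x 1 (fun y : R => c * (2 * y)) (c * 2).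
  have := DZ c (DZ 2 (is_derive_id x (1 : R))) => /is_derive_eq; apply.
  by ring.
pose c0 := c1 / 2.
have c00 : 0 < c0 by rewrite divr_gt0.
have inab r : r1 <= r <= r2 -> a <= r <= b.
  by move=> /andP[h1 h2]; rewrite (le_trans (ltW ar1) h1) (le_trans h2 (ltW r2b)).
have mid r s : r1 <= r <= r2 -> a <= s <= b -> c0 * (s - r) ^+ 2 <= Prel s r.
  move=> /inab rab sab; rewrite -subr_ge0.
  have := @quad (fun x => P x - c0 * (x * x)) (fun x => P1 x - c0 * (2 * x)) (fun x => p' x / x - c0 * 2) r s.
  have -> : P s - c0 * (s * s) - (P r - c0 * (r * r)) - (P1 r - c0 * (2 * r)) * (s - r) =
    Prel s r - c0 * (s - r) ^+ 2 by rewrite /Prel; ring.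
  apply => // x xab; have x0 := pos x xab.
  - by apply: DB => //; exact: dP.
  - by apply: DB => //; exact: dP1.
  - by rewrite subr_ge0 /c0 mulfVK ?pnatr_eq0//; exact: hc1.
have midp r s : r1 <= r <= r2 -> a <= s <= b -> `|p s - p' r * (s - r) - p r| <= c2 * (s - r) ^+ 2.
  move=> /inab rab sab.
  have h (e : R) : `|e| = 1 -> 0 <= c2 * (s - r) ^+ 2 - e * (p s - p' r * (s - r) - p r).
    move=> e1.
    have := @quad (fun x => c2 * (x * x) - e * p x) (fun x => c2 * (2 * x) - e * p' x)
       (fun x => c2 * 2 - e * p'' x) r s.
    have -> : c2 * (s * s) - e * p s - (c2 * (r * r) - e * p r) - (c2 * (2 * r) - e * p' r) * (s - r) =
      c2 * (s - r) ^+ 2 - e * (p s - p' r * (s - r) - p r) by ring.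
    apply; [| | |exact: rab|exact: sab] => x xab; have x0 := pos x xab.
    - exact: (DB (dsq c2 x) (DZ e (dp x0))).
    - exact: (DB (dsq' c2 x) (DZ e (dp' x0))).
    - rewrite subr_ge0; apply: (le_trans (ler_norm _)); rewrite normrM e1 mul1r.
      by apply: (le_trans (hc2 x xab)); rewrite ler_peMr// ler1n.
  have h1 := h 1 (normr1 R); have h2 := h (-1) (etrans (normrN 1) (normr1 R)).
  rewrite mul1r in h1; rewrite mulN1r opprK in h2.
  by rewrite ler_norml; apply/andP; split; move: h1 h2; rewrite ?subr_ge0 //; rewrite -lerBlDr sub0r lerNl.
(* At s = 0, where P is not differentiated, the relative potential equals p(r) >= p(r1). For 0 < s <
   a it exceeds its value at [a], which is at distance at least [a] from [r]. *)
pose cl := Num.min (p r1) (c0 * a ^+ 2).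
have cl0 : 0 < cl by rewrite lt_min p_gt0//= mulr_gt0// exprn_gt0.
have low r s : r1 <= r <= r2 -> 0 <= s -> s < a -> cl <= Prel s r.
  move=> rr; have /andP[h1 h2] := rr; have r0 : 0 < r by exact: lt_le_trans h1.
  rewrite le_eqVlt => /predU1P[<- _|s0 sa].
    by rewrite PrelE// P_0 mulr0 subr0 add0r ge_min p_le// ltW.
  apply: (@le_trans _ _ (Prel a r)); last first.
    apply: Prel_mono => //; left; rewrite s0 (ltW sa); split => //.
    exact: le_trans (ltW ar1) h1.
  apply: (@le_trans _ _ (c0 * (a - r) ^+ 2)); last by apply: mid => //; rewrite lexx.
  rewrite ge_min; apply/orP; right; rewrite ler_pM2l//.
  have ra : a <= r - a by rewrite /a; move: h1; rewrite /a; lra.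
  by rewrite -[(a - r) ^+ 2]sqrrN opprB lerXn2r ?nnegrE ?(ltW a0)// (le_trans (ltW a0) ra).
pose kp := P1 b - P1 r2.
have kp0 : 0 < kp by rewrite subr_gt0 P1_lt.
(* [kp] bounds the slope beyond [b] from below; the second entry gives ch b <= c0 r2^2, a lower
   bound of the value at b = 2 r2. *)
pose ch := Num.min kp (c0 * r2 / 2).
have ch0 : 0 < ch by rewrite lt_min kp0/= divr_gt0// mulr_gt0.
have high r s : r1 <= r <= r2 -> b < s -> ch * s <= Prel s r.
  move=> rr bs; have /andP[h1 h2] := rr; have r0 : 0 < r by exact: lt_le_trans h1.
  have b0 : 0 < b by exact: lt_trans r2b.
  have s0 : 0 < s by exact: lt_trans bs.
  have t := @convex_tangent _ P P1 b s b s.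
  have {}t : 0 <= P s - P b - P1 b * (s - b).
    apply: t; rewrite ?lexx ?(ltW bs)//.
    - by move=> z /andP[bz _]; apply: dP; exact: lt_le_trans bz.
    - by move=> z w bz zw _; apply: P1_le => //; exact: lt_le_trans bz.
  have B : c0 * (b - r) ^+ 2 <= Prel b r by apply: mid => //; rewrite ab lexx.
  have B2 : c0 * r2 ^+ 2 <= c0 * (b - r) ^+ 2.
    by rewrite ler_pM2l// lerXn2r ?nnegrE ?(ltW r20)// /b; move: h2 r20; lra.
  have E : Prel s r = Prel b r + (P s - P b - P1 b * (s - b)) + (P1 b - P1 r) * (s - b).
    by rewrite /Prel; ring.
  have K : kp * (s - b) <= (P1 b - P1 r) * (s - b).
    rewrite ler_wpM2r ?subr_ge0 ?(ltW bs)// /kp lerD2l lerN2.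
    exact: P1_le.
  have k1 : ch * (s - b) <= kp * (s - b).
    by rewrite ler_wpM2r ?subr_ge0 ?(ltW bs)// ge_min lexx.
  have k2 : ch * b <= c0 * r2 ^+ 2.
    apply: (@le_trans _ _ (c0 * r2 / 2 * b)).
      by rewrite ler_wpM2r ?(ltW b0)// ge_min lexx orbT.
    by rewrite /b le_eqVlt; apply/orP; left; apply/eqP; field.
  have E2 : ch * s = ch * (s - b) + ch * b by ring.
  have arith (v1 v2 v3 v4 v5 v6 v7 v8 : R) : 0 <= v1 -> v7 <= v2 -> v8 <= v7 -> v4 <= v3 ->
    v5 <= v4 -> v6 <= v8 -> v5 + v6 <= v2 + v1 + v3 by lra.
  by rewrite E E2; exact: arith t B B2 K k1 k2.
pose S1 := Num.max S0 b.
(* The last summand serves s <= S1 + 1, where p is bounded and the relative potential is at least ch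
   b. The first serves larger s, where p <= P/k and P exceeds the relative potential by at most c4
   s. *)
pose Cp := k^-1 * (1 + c4 / ch) + p (S1 + 1) / (ch * b).
have b0 : 0 < b by exact: lt_trans r2b.
have S1b : b <= S1 by rewrite le_max lexx orbT.
have pS : 0 < p (S1 + 1) by apply: p_gt0; rewrite addr_gt0// (lt_le_trans b0).
have Cp0 : 0 < Cp.
  by rewrite addr_gt0 ?divr_gt0 ?mulr_gt0 ?invr_gt0 ?ltr_wpDr// divr_ge0// ltW.
have phigh r s : r1 <= r <= r2 -> b < s -> p s <= Cp * Prel s r.
  move=> rr bs; have /andP[h1 h2] := rr; have r0 : 0 < r by exact: lt_le_trans h1.
  have s0 : 0 < s by exact: lt_trans bs.
  have H := high r s rr bs.
  have Pr0 : 0 < Prel s r by apply: lt_le_trans H; rewrite mulr_gt0.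
  have A1 : 0 <= k^-1 * (1 + c4 / ch) * Prel s r.
    by rewrite mulr_ge0 ?(ltW Pr0)// mulr_ge0 ?invr_ge0 ?(ltW k0)// addr_ge0// divr_ge0// ltW.
  have A2 : 0 <= p (S1 + 1) / (ch * b) * Prel s r.
    by rewrite mulr_ge0 ?(ltW Pr0)// divr_ge0 ?(ltW pS)// mulr_ge0 ?(ltW ch0) ?(ltW b0).
  rewrite /Cp mulrDl; have [sS|Ss] := leP s (S1 + 1).
    apply: (@le_trans _ _ (p (S1 + 1) / (ch * b) * Prel s r)); last by rewrite lerDr.
    apply: (le_trans (p_le (ltW s0) sS)); rewrite mulrAC ler_pdivlMr ?mulr_gt0//.
    rewrite ler_pM2l//; apply: le_trans H; rewrite ler_pM2l//; exact: ltW.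
  apply: (@le_trans _ _ (k^-1 * (1 + c4 / ch) * Prel s r)); last by rewrite lerDl.
  have Q : k <= P s / p s.
    apply: hS0; apply: le_lt_trans Ss; apply: (@le_trans _ _ S1); first by rewrite le_max lexx.
    by rewrite lerDl.
  rewrite ler_pdivlMr ?p_gt0// in Q.
  rewrite -mulrA ler_pdivlMl//; apply: (le_trans Q).
  have hP : P s <= Prel s r + c4 * s.
    have -> : P s = Prel s r + P1 r * s - p r by rewrite PrelE//; ring.
    have : P1 r * s <= c4 * s.
      by rewrite ler_wpM2r ?(ltW s0)//; apply: le_trans (hc4 r (inab r rr)); exact: ler_norm.
    have := p_gt0 r0; move: (P1 r * s) (c4 * s) (Prel s r) (p r) => *; lra.
  apply: (le_trans hP); rewrite mulrDl mul1r lerD2l mulrAC ler_pdivlMr//.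
  by rewrite -mulrA ler_wpM2l// mulrC.
clearbody cl ch c0 Cp.
pose c := Num.min c0 (Num.min cl ch).
have cc : 0 < c by rewrite !lt_min c00 cl0 ch0.
have [cc0 ccl cch] : [/\ c <= c0, c <= cl & c <= ch].
  by split; rewrite /c !ge_min ?lexx ?orbT.
pose Clow := (p r1 + c3 * r2 + p r2) / cl.
pose Chigh := Cp + (c3 + c3 * r2 / b + p r2 / b) / ch.
exists c => //; exists (c2 / c0 + Clow + Chigh).
  have t1 : 0 <= c2 / c0 by rewrite divr_ge0// ltW.
  have t2 : 0 <= Clow by rewrite divr_ge0 ?(ltW cl0)// !addr_ge0 ?mulr_ge0 ?(ltW (p_gt0 _)) ?(ltW r20).
  have t3 : 0 < Chigh.
    rewrite /Chigh ltr_wpDr// divr_ge0 ?(ltW ch0)// !addr_ge0// divr_ge0 ?(ltW b0)//.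
      by rewrite mulr_ge0// ltW.
    by rewrite ltW// p_gt0.
  by rewrite ltr_wpDl// addr_ge0.
move=> r rr s s0; have /andP[h1 h2] := rr; have r0 : 0 < r by exact: lt_le_trans h1.
have t1 : 0 <= c2 / c0 by rewrite divr_ge0// ltW.
have t2 : 0 <= Clow by rewrite divr_ge0 ?(ltW cl0)// !addr_ge0 ?mulr_ge0 ?(ltW (p_gt0 _)) ?(ltW r20).
have t4 : 0 <= (c3 + c3 * r2 / b + p r2 / b) / ch.
  rewrite divr_ge0 ?(ltW ch0)// !addr_ge0// divr_ge0 ?(ltW b0)//.
    by rewrite mulr_ge0// ltW.
  by rewrite ltW// p_gt0.
have t3 : 0 <= Chigh by rewrite addr_ge0// ltW.
have tot (x C : R) : 0 <= Prel s r -> 0 <= C -> C <= c2 / c0 + Clow + Chigh -> x <= C * Prel s r ->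
    x <= (c2 / c0 + Clow + Chigh) * Prel s r.
  by move=> P0 C0 CC /le_trans; apply; rewrite ler_wpM2r.
have p'r : `|p' r| <= c3 by exact/hc3/inab.
have prr2 : p r <= p r2 by rewrite p_le// ltW.
have pr0 := p_gt0 r0.
split.
- by move=> sab; apply: le_trans (mid _ _ rr sab); rewrite ler_wpM2r ?sqr_ge0.
- by move=> sa; exact: le_trans ccl (low _ _ rr s0 sa).
- by move=> bs; apply: le_trans (high _ _ rr bs); rewrite ler_wpM2r.
have tri (u v w : R) : `|u - v - w| <= `|u| + `|v| + `|w|.
  by apply: (le_trans (ler_normB _ _)); rewrite lerD2r; exact: ler_normB.
have [sa|as_] := ltP s a.
  have L := low _ _ rr s0 sa.
  apply: (@tot _ Clow) => //.
  - by apply: le_trans L; exact: ltW.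
  - by rewrite -addrA addrCA lerDl addr_ge0.
  apply: (@le_trans _ _ (p r1 + c3 * r2 + p r2)); last first.
    rewrite /Clow mulrAC ler_pdivlMr// ler_wpM2l//.
    by rewrite !addr_ge0 ?mulr_ge0 ?(ltW (p_gt0 _)) ?(ltW r20).
  apply: (le_trans (tri _ _ _)); apply: lerD; last by rewrite gtr0_norm.
  apply: lerD.
    by rewrite ger0_norm ?p_ge0// p_le// ltW//; exact: lt_trans ar1.
  rewrite normrM ler_pM//.
  have sr : s <= r by apply: ltW; apply: lt_le_trans sa _; exact: le_trans (ltW ar1) h1.
  by rewrite ler0_norm ?subr_le0// opprB; apply: le_trans h2; rewrite gerBl.
have [sb|bs] := leP s b.
  have sab : a <= s <= b by rewrite as_ sb.
  have M := mid _ _ rr sab; have Mp := midp _ _ rr sab.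
  have P0 : 0 <= Prel s r by apply: le_trans M; rewrite mulr_ge0 ?sqr_ge0// ltW.
  apply: (@tot _ (c2 / c0)) => //; first by rewrite -addrA lerDl addr_ge0.
  apply: (le_trans Mp); rewrite mulrAC ler_pdivlMr// -mulrA ler_wpM2l// mulrC.
  by [].
have H := high _ _ rr bs; have Hp' := phigh _ _ rr bs.
have s1 : 0 < s by exact: lt_trans bs.
have P0 : 0 <= Prel s r by apply: le_trans H; rewrite mulr_ge0// ltW.
apply: (@tot _ Chigh) => //; first by rewrite lerDr addr_ge0.
apply: (le_trans (tri _ _ _)).
rewrite /Chigh mulrDl -addrA; apply: lerD; first by rewrite ger0_norm// p_ge0.
apply: (@le_trans _ _ ((c3 + c3 * r2 / b + p r2 / b) * s)); last first.
  rewrite -[leRHS]mulrA ler_wpM2l//; last by rewrite ler_pdivlMl.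
  rewrite !addr_ge0// divr_ge0 ?(ltW b0)//.
    by rewrite mulr_ge0// ltW.
  by rewrite ltW// p_gt0.
have sb1 : 1 <= s / b by rewrite ler_pdivlMr// mul1r ltW.
have q1 : `|p' r * (s - r)| <= c3 * s.
  rewrite normrM ler_pM// ger0_norm ?subr_ge0; first by rewrite gerBl ltW.
  by apply: ltW; apply: le_lt_trans h2 _; exact: lt_trans bs.
have q2 : `|p r| <= p r2 / b * s.
  rewrite gtr0_norm//; apply: (le_trans prr2); rewrite mulrAC -mulrA ler_peMr//.
  by rewrite ltW// p_gt0.
have q3 : 0 <= c3 * r2 / b * s by rewrite !mulr_ge0 ?invr_ge0 ?(ltW r20) ?(ltW b0).
rewrite !mulrDl; move: q1 q2 q3.
by move: `|_ * _| `|p r| (c3 * s) (c3 * r2 / b * s) (p r2 / b * s) => *; lra.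
Qed.

(** With r1 = r2 = r, the two outer regimes are strictly positive and the middle one dominates a
    multiple of (s - r)^2. *)
Lemma Prel_ge0_gen (s r : R) : 0 <= s -> 0 < r -> 0 <= Prel s r /\ (Prel s r = 0 -> s = r).
Proof.
move=> s0 r0.
have [c c0 [C _ /(_ r)]] := pressure_bounds_gen r0 (lexx r).
rewrite lexx => /(_ isT s s0)[h1 h2 h3 _].
have [sa|as_] := ltP s (r / 2).
  have h := lt_le_trans c0 (h2 sa); split; first exact: ltW.
  by move=> E; rewrite E ltxx in h.
have [sb|bs] := leP s (2 * r).
  have := h1; rewrite as_ sb => /(_ isT) h; split; first by apply: le_trans h; rewrite mulr_ge0 ?sqr_ge0// ltW.
  move=> E; rewrite E pmulr_rle0// in h.
  by apply/eqP; rewrite -subr_eq0 -sqrf_eq0 eq_le h sqr_ge0.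
have h : 0 < Prel s r.
  apply: lt_le_trans (h3 bs); rewrite mulr_gt0//; apply: lt_trans bs.
  by rewrite mulr_gt0.
by split; [exact: ltW|move=> E; rewrite E ltxx in h].
Qed.

End relative_pressure.

(** * The potential of a pressure law *)

Section pressure.
Context {R : realType}.
Variable p : R -> R.
Hypothesis pl : pressure_law p.
Local Notation leb := (@lebesgue_measure R).
Local Notation P := (pressure_potential p).
Local Notation p' := (derive1 p).

Lemma dp (x : R) : 0 < x -> is_derive x 1 p (p' x).
Proof.
by move=> x0; have [h _] := pressure_derivable pl x0; split => //; rewrite derive1E.
Qed.

Lemma dp' (x : R) : 0 < x -> is_derive x 1 p' (derive1n 2 p x).
Proof.
move=> x0; have [_ h] := pressure_derivable pl x0.
by have := derivableP h; rewrite -derive1E.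
Qed.

Lemma p_cont (x : R) : 0 < x -> {for x, continuous p}.
Proof. by move=> /dp /is_derive1_cont. Qed.

Lemma p'_cont (x : R) : 0 < x -> {for x, continuous p'}.
Proof. by move=> /dp' /is_derive1_cont. Qed.

Lemma p''_cont (x : R) : 0 < x -> {for x, continuous (derive1n 2 p)}.
Proof.
move=> x0; apply: (@within_open_cont R R `]0, +oo[%classic `]0, +oo[%classic (derive1n 2 p)).
- exact: interval_open.
- by [].
- exact: pressure_C2 pl.
- by rewrite /= in_itv /= x0.
Qed.

Lemma p_cont0 (b : R) : {within `[0, b], continuous p}.
Proof.
apply: continuous_subspaceW (pressure_continuous pl) => x.
by rewrite /= !in_itv /= => /andP[-> _].
Qed.

Lemma p_lt (x y : R) : 0 <= x -> x < y -> p x < p y.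
Proof.
move=> x0 xy.
have cp : {within `[x, y], continuous p}.
  apply: continuous_subspaceW (p_cont0 (b := y)) => z.
  by rewrite /= !in_itv /= => /andP[/(le_trans x0) -> ->].
have d z : z \in `]x, y[ -> is_derive z 1 p (p' z).
  by rewrite in_itv /= => /andP[xz _]; apply: dp; exact: le_lt_trans xz.
have [c ci E] := MVT xy d cp; rewrite -subr_gt0 E mulr_gt0 ?subr_gt0//.
apply: (pressure_increasing pl); rewrite in_itv /= in ci.
by case/andP: ci => xc _; exact: le_lt_trans xc.
Qed.

Lemma p_le (x y : R) : 0 <= x -> x <= y -> p x <= p y.
Proof.
by move=> x0; rewrite le_eqVlt => /predU1P[->//|xy]; apply: ltW; exact: p_lt.
Qed.

Lemma p_gt0 (x : R) : 0 < x -> 0 < p x.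
Proof. by move=> x0; rewrite -(pressure0 pl) p_lt. Qed.

Lemma p_ge0 (x : R) : 0 <= x -> 0 <= p x.
Proof. by move=> x0; rewrite -(pressure0 pl) p_le. Qed.

Definition Hp (x : R) : R := if 1 <= x
  then \int[leb]_(z in `[1, x]) (p z / z ^+ 2) else - \int[leb]_(z in `[x, 1]) (p z / z ^+ 2).

Lemma dHp (x : R) : 0 < x -> is_derive x 1 Hp (p x / x ^+ 2).
Proof.
move=> x0; pose f (z : R) := p z / z ^+ 2.
pose a := Num.min x 1 / 2.
have m0 : 0 < Num.min x 1 by rewrite lt_min x0 ltr01.
have a0 : 0 < a by rewrite divr_gt0.
have am : a < Num.min x 1 by rewrite /a ltr_pdivrMr// ltr_pMr// ltr1n.
have ax : a < x by apply: lt_le_trans am _; rewrite ge_min lexx.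
have a1 : a < 1 by apply: lt_le_trans am _; rewrite ge_min lexx orbT.
have cf z : 0 < z -> {for z, continuous f}.
  move=> z0; apply: (@continuousM _ _ p (fun z : R => (z ^+ 2)^-1)); first exact: p_cont.
  apply: (@continuousV _ _ (fun z : R => z ^+ 2)); first by rewrite sqrf_eq0 gt_eqF.
  exact: exprn_continuous.
(* The point [a] lies below both [x] and 1, so one primitive covers both orientations of the
   integral. *)
have [F dF] : exists F, forall z, a < z -> is_derive z 1 F (f z).
  by apply: antiderivative_right => z az; apply: cf; exact: lt_le_trans az.
have I u v : a < u -> u <= v -> \int[leb]_(z in `[u, v]) f z = F v - F u.
  move=> au uv; apply: FTC2 => //.
  - apply: within_cont_at => z; rewrite /= in_itv /= => /andP[uz _].
    by apply: cf; apply: lt_le_trans uz; exact: lt_trans au.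
  - apply: within_cont_at => z; rewrite /= in_itv /= => /andP[uz _].
    by apply: is_derive1_cont; apply: dF; exact: lt_le_trans uz.
  - by move=> z /andP[uz _]; apply: dF; exact: lt_trans uz.
have E z : a < z -> Hp z = F z - F 1.
  move=> az; rewrite /Hp; case: (leP 1 z) => z1; first by rewrite I.
  by rewrite I// ?(ltW z1)// opprB.
apply: (@near_eq_is_derive R R R (fun z => F z - F 1)).
  near=> z; rewrite E//; near: z; exact: lt_nbhsr.
by have := DB (dF x ax) (Dcst (F 1) x 1); rewrite subr0.
Unshelve. all: by end_near. Qed.

Definition P1 (x : R) : R := Hp x + p x / x.

Lemma dP (x : R) : 0 < x -> is_derive x 1 P (P1 x).
Proof.
move=> x0; have := DM (is_derive_id x (1 : R)) (dHp x0).
move=> /is_derive_eq; apply; rewrite /P1 mul1r; congr (_ + _).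
by field; rewrite gt_eqF.
Qed.

Lemma derive1P (x : R) : 0 < x -> derive1 P x = P1 x.
Proof. by move=> x0; rewrite derive1E; case: (dP x0). Qed.

Lemma dP1 (x : R) : 0 < x -> is_derive x 1 P1 (p' x / x).
Proof.
move=> x0; have hv : is_derive x 1 (fun y : R => y^-1) (- x ^- 2 *: 1).
  by apply: (is_deriveV (f := id)); rewrite ?gt_eqF.
have := DD (dHp x0) (DM (dp x0) hv) => /is_derive_eq; apply.
by rewrite /GRing.scale /= mulr1; field; rewrite gt_eqF.
Qed.

Lemma P1_eq (r : R) : 0 < r -> r * P1 r - P r = p r.
Proof. by move=> r0; rewrite /P1 /pressure_potential -/(Hp r); field; rewrite gt_eqF. Qed.

Lemma P_0 : P 0 = 0.
Proof. by rewrite /pressure_potential mul0r. Qed.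

Theorem pressure_bounds (r1 r2 : R) : 0 < r1 -> r1 <= r2 ->
  exists2 c : R, 0 < c & exists2 C : R, 0 < C & forall r, r1 <= r <= r2 -> forall s, 0 <= s ->
  [/\ r1 / 2 <= s <= 2 * r2 -> c * (s - r) ^+ 2 <= Prel P P1 s r,
      s < r1 / 2 -> c <= Prel P P1 s r,
      2 * r2 < s -> c * s <= Prel P P1 s r &
      `|p s - p' r * (s - r) - p r| <= C * Prel P P1 s r].
Proof.
exact: (pressure_bounds_gen dp dp' p''_cont (pressure_increasing pl) p_le p_gt0 p_ge0 P_0 dP dP1
  P1_eq (limf_einf_gt0 (pressure_liminf_potential pl))).
Qed.

Lemma Prel_ge0 (s r : R) : 0 <= s -> 0 < r -> 0 <= Prel P P1 s r /\ (Prel P P1 s r = 0 -> s = r).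
Proof.
exact: (Prel_ge0_gen dp dp' p''_cont (pressure_increasing pl) p_le p_gt0 p_ge0 P_0 dP dP1
  P1_eq (limf_einf_gt0 (pressure_liminf_potential pl))).
Qed.

End pressure.

(** * Pratt's lemma and Gronwall's inequality *)

Section almost_everywhere.
Context d (X : measurableType d) (R : realType) (mu : {measure set X -> \bar R}).

Lemma ae_S (P Q : X -> Prop) : {ae mu, forall x, P x} -> (forall x, P x -> Q x) ->
  {ae mu, forall x, Q x}.
Proof. by move=> h PQ; apply: filterS h. Qed.

Lemma ae_S2 (P1 P2 Q : X -> Prop) : {ae mu, forall x, P1 x} -> {ae mu, forall x, P2 x} ->
  (forall x, P1 x -> P2 x -> Q x) -> {ae mu, forall x, Q x}.
Proof. by move=> h1 h2 PQ; apply: filterS2 h1 h2. Qed.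

Lemma ae_S3 (P1 P2 P3 Q : X -> Prop) : {ae mu, forall x, P1 x} -> {ae mu, forall x, P2 x} ->
  {ae mu, forall x, P3 x} -> (forall x, P1 x -> P2 x -> P3 x -> Q x) -> {ae mu, forall x, Q x}.
Proof. by move=> h1 h2 h3 PQ; apply: filterS3 h1 h2 h3. Qed.

End almost_everywhere.

Section convergence.
Context d (X : measurableType d) (R : realType) (mu : {measure set X -> \bar R}).
Variable D : set X.
Hypothesis mD : measurable D.

Lemma Rint_dct (q : nat -> X -> R) (f g : X -> R) :
  (forall n, measurable_fun D (q n)) -> measurable_fun D f -> intg mu D g ->
  (forall n, {ae mu, forall x, D x -> `|q n x| <= g x}) ->
  {ae mu, forall x, D x -> q ^~ x @ \oo --> f x} ->
  intg mu D f /\ (fun n => \int[mu]_(x in D) q n x) @ \oo --> \int[mu]_(x in D) f x.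
Proof.
move=> mq mf ig qg qf.
have Hc : {ae mu, forall x, D x -> (fun n => (q n x)%:E) @ \oo --> (f x)%:E}.
  by apply: filterS qf => x + Dx => /(_ Dx) h; apply: cvg_EFin; [exact: nearW|exact: h].
have Hb : {ae mu, forall x n, D x -> (`|(q n x)%:E| <= (EFin \o g) x)%E}.
  have := ae_foralln qg; apply: filterS => x h n Dx; exact: h.
have [I1 _ I3] := dominated_convergence mD (fun n => (measurable_EFinP _ _).2 (mq n))
  ((measurable_EFinP _ _).2 mf) Hc ig Hb.
have If : intg mu D f by exact: I1.
split => //.
have Iq n : intg mu D (q n).
  apply: (ae_le_intg mD (mq n) _ ig); apply: filterS (qg n) => x + Dx => /(_ Dx) h.
  by apply: (le_trans h); exact: ler_norm.
have I3' : (fun n => (\int[mu]_(x in D) q n x)%:E) @ \oo --> (\int[mu]_(x in D) f x)%:E.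
  by rewrite -Rint_fin//; under eq_fun do rewrite -Rint_fin//; exact: I3.
exact: fine_cvg I3'.
Qed.

(** Cutting M_n + q_n at its limit m + f gives functions dominated by m + f, whose integrals
    converge to that of m + f. Since these are below M_n + q_n and the integrals of M_n do not
    asymptotically exceed that of m, a lower bound for the integrals of q_n results. *)
Lemma pratt (q M : nat -> X -> R) (f m : X -> R) :
  (forall n, intg mu D (q n)) -> (forall n, intg mu D (M n)) ->
  measurable_fun D f -> intg mu D m ->
  (forall n, {ae mu, forall x, D x -> `|q n x| <= M n x}) ->
  {ae mu, forall x, D x -> q ^~ x @ \oo --> f x} ->
  {ae mu, forall x, D x -> M ^~ x @ \oo --> m x} ->
  (forall e : R, 0 < e -> \forall n \near \oo, \int[mu]_(x in D) M n x <= \int[mu]_(x in D) m x + e) ->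
  intg mu D f /\ forall e : R, 0 < e ->
    \forall n \near \oo, \int[mu]_(x in D) f x - e <= \int[mu]_(x in D) q n x.
Proof.
move=> Iq IM mf Im qM qf Mm limM.
have qM' := ae_foralln qM.
have fm : {ae mu, forall x, D x -> `|f x| <= m x}.
  apply: filterS3 qM' qf Mm => x h1 h2 h3 Dx.
  have c1 := h2 Dx; have c2 := h3 Dx.
  have c1' : (fun n => `|q n x|) @ \oo --> `|f x| by exact: cvg_norm c1.
  by apply: (ler_cvg_to c1' c2); apply: nearW => n; exact: h1.
have If : intg mu D f.
  apply: (ae_le_intg mD mf _ Im); apply: filterS fm => x + Dx => /(_ Dx) h.
  by apply: (le_trans h); exact: ler_norm.
split => // e e0.
pose h x := m x + f x; pose g n x := Num.min (M n x + q n x) (h x).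
have Ih : intg mu D h by exact: intgD.
have mg n : measurable_fun D (g n).
  apply: measurable_minr; first by apply: measurable_funD; [exact: intg_meas (IM n)|exact: intg_meas (Iq n)].
  exact: intg_meas Ih.
have gh n : {ae mu, forall x, D x -> `|g n x| <= h x}.
  apply: filterS2 (qM n) fm => x h1 h2 Dx; rewrite ger0_norm ?ge_min ?lexx ?orbT//.
  rewrite le_min -!lerBlDr !sub0r; have := h1 Dx; have := h2 Dx.
  by rewrite !ler_norml => /andP[h3 _] /andP[h4 _]; rewrite lerNl h4/= lerNl h3.
have gc : {ae mu, forall x, D x -> g ^~ x @ \oo --> h x}.
  apply: filterS2 qf Mm => x h1 h2 Dx.
  have : (fun n => M n x + q n x) @ \oo --> h x by apply: cvgD; [exact: h2|exact: h1].
  move=> /cvgrPdist_le c; apply/cvgrPdist_le => e' e'0; apply: filterS (c e' e'0) => n.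
  apply: le_trans; rewrite /g minElt; case: ifP => // _.
  by rewrite subrr normr0.
have [_ lim] := Rint_dct mg (intg_meas Ih) Ih gh gc.
have e2 : 0 < e / 2 by rewrite divr_gt0.
move/cvgrPdist_le : lim => /(_ _ e2); move: (limM _ e2); apply: filterS2 => n lM lg.
have Ig n' : intg mu D (g n').
  apply: (ae_le_intg mD (mg n') _ Ih); apply: filterS (gh n') => x + Dx => /(_ Dx) l.
  by apply: (le_trans l); exact: ler_norm.
have le1 : \int[mu]_(x in D) g n x <= \int[mu]_(x in D) M n x + \int[mu]_(x in D) q n x.
  rewrite -RintD//; apply: ae_le_Rint => //; first exact: intgD.
  by apply: aeW => x _; rewrite ge_min lexx.
rewrite RintD// in lg; move: lM lg le1; rewrite ler_norml => lM /andP[_ lg] le1.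
move: lM lg le1.
by move: (\int[mu]_(x in D) _) (\int[mu]_(x in D) _) (\int[mu]_(x in D) _) (\int[mu]_(x in D) _) (\int[mu]_(x in D) _) => *; lra.
Qed.

End convergence.

(** * Primitives of integrable functions of time *)

Section primitive.
Context {R : realType}.
Local Notation leb := (@lebesgue_measure R).

Lemma intg_cc (f : R -> R) (a b : R) : a < b -> intg leb `]a, b[ f -> intg leb `[a, b] f.
Proof.
move=> ab If; have mf := measurable_fun_itv_cc (intg_meas If).
apply: intgP => //.
rewrite -integral_itv_bndo_bndc; last first.
  have mf' : measurable_fun `[a, b[ f by exact: measurable_fun_itv_co (intg_meas If).
  by apply/measurable_EFinP; apply: measurableT_comp => //.
rewrite -integral_itv_obnd_cbnd; last first.
  by apply/measurable_EFinP; apply: measurableT_comp => //; exact: intg_meas If.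
exact: intg_lty If.
Qed.

Lemma intg_oo (f : R -> R) (a b : R) : intg leb `[a, b] f -> intg leb `]a, b[ f.
Proof.
by apply: intgS => // x /=; rewrite !in_itv /= => /andP[/ltW -> /ltW ->].
Qed.

Lemma Rint_cc (f : R -> R) (a b : R) : a < b -> intg leb `]a, b[ f ->
  \int[leb]_(x in `[a, b]) f x = \int[leb]_(x in `]a, b[) f x.
Proof.
move=> ab If.
rewrite -Rintegral_itv_bndo_bndc; last first.
  apply: (@intgS _ _ _ leb `[a, b]) (intg_cc ab If) => // x /=.
  by rewrite !in_itv /= => /andP[-> /ltW ->].
by rewrite -Rintegral_itv_obnd_cbnd.
Qed.

Lemma ae_neq (a : R) : {ae leb, forall t, t <> a}.
Proof.
by exists [set a]; split => //; [exact: lebesgue_measure_set1|move=> t /= /contrapT].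
Qed.

Variables (T : R) (f : R -> R).
Hypothesis T0 : 0 <= T.
Hypothesis If : intg leb `[0, T] f.

Definition prim (t : R) : R := \int[leb]_(s in `[0, t]) f s.

Lemma prim_intg a b : 0 <= a -> b <= T -> intg leb `[a, b] f.
Proof.
move=> a0 bT; apply: intgS If => // x /=; rewrite !in_itv /= => /andP[ax xb].
by rewrite (le_trans a0 ax) (le_trans xb bT).
Qed.

Lemma prim_diff s t : 0 <= s -> s <= t -> t <= T ->
  \int[leb]_(x in `[s, t]) f x = prim t - prim s.
Proof.
move=> s0 st tT; rewrite /prim (@Rintegral_itvB R f (BLeft 0) (BRight t) s).
- rewrite [RHS]Rintegral_itv_obnd_cbnd//.
  apply: (intgS _ _ _ (prim_intg s0 tT)) => // x /=; rewrite !in_itv /= => /andP[/ltW -> ->].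
  by [].
- exact: prim_intg.
- by rewrite bnd_simp.
- by rewrite bnd_simp.
Qed.

Lemma prim0 : prim 0 = 0.
Proof. by rewrite /prim set_itv1 Rintegral_set1. Qed.

Lemma prim_cont : {within `[0, T], continuous prim}.
Proof. exact: parameterized_integral_continuous. Qed.

Lemma prim_nd : (forall s, 0 <= s <= T -> 0 <= f s) ->
  forall s t, 0 <= s -> s <= t -> t <= T -> prim s <= prim t.
Proof.
move=> f0 s t s0 st tT; rewrite -subr_ge0 -prim_diff//.
apply: Rintegral_ge0 => x /=; rewrite in_itv /= => /andP[sx xt].
by apply: f0; rewrite (le_trans s0 sx) (le_trans xt tT).
Qed.

Lemma prim_derive : {ae leb, forall t, 0 < t < T -> is_derive t 1 prim (f t)}.
Proof.
pose g : R -> R := f \_ `[0, T].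
have mT : measurable (`[0, T]%classic : set R) by [].
have Ig : leb.-integrable setT (EFin \o g).
  have := If; rewrite /intg integrable_mkcond//; apply: eq_integrable => // x _ /=.
  by rewrite /g !patchE; case: ifP.
have Ig' y : leb.-integrable [set` Interval (BLeft 0) (BRight y)] (EFin \o g).
  by apply: integrableS Ig.
have lg : locally_integrable setT g by apply: integrable_locally_restrict.
apply: (ae_S (FTC1 Ig' lg)) => t h /andP[t0 tT].
have [|d1 d2] := h; first by rewrite lte_fin.
have E : \forall s \near t, \int[leb]_(x in `[0, s]) g x = prim s.
  near=> s; rewrite /prim; apply: eq_Rintegral => x; rewrite inE /= in_itv /= => /andP[x0 xs].
  rewrite /g patchE mem_set//= in_itv /= x0 (le_trans xs)//.
  by apply: ltW; near: s; exact: lt_nbhsl.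
apply: (@near_eq_is_derive R R R (fun s => \int[leb]_(x in `[0, s]) g x)).
  by apply: filterS E => s ->.
split => //; rewrite -derive1E d2 /g patchE mem_set//=.
by rewrite in_itv /= !ltW.
Unshelve. all: by end_near. Qed.

End primitive.

Section gronwall.
Context {R : realType}.
Local Notation leb := (@lebesgue_measure R).
Variables (T : R) (k F : R -> R) (E0 B : R).
Hypothesis T0 : 0 < T.
Hypothesis Ik : intg leb `]0, T[ k.
Hypothesis k0 : forall t, 0 <= k t.
Hypothesis mF : measurable_fun `]0, T[ F.
Hypothesis FB : {ae leb, forall t, 0 < t < T -> 0 <= F t <= B}.
Hypothesis E00 : 0 <= E0.
Hypothesis HF : {ae leb, forall t, 0 < t < T -> F t <= E0 + \int[leb]_(s in `[0, t]) (k s * F s)}.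

Let Ik' : intg leb `[0, T] k. Proof. exact: intg_cc. Qed.

Lemma gronwall_intg : intg leb `[0, T] (fun s => k s * F s).
Proof.
apply: intg_cc => //; apply: (@ae_le_intg _ _ _ leb _ _ (fun s => B * k s)) => //.
- by apply: measurable_funM => //; exact: intg_meas Ik.
- apply: (ae_S FB) => t h; rewrite /= in_itv /= => /h/andP[F0 FB'].
  rewrite normrM mulrC [`|B * k t|]normrM ler_wpM2r//.
  by rewrite ger0_norm// (le_trans FB')// ler_norm.
- exact: intgZ.
Qed.

Let K := prim k.
Let y := prim (fun s => k s * F s).

Let y_nd s t : 0 <= s -> s <= t -> t <= T -> y s <= y t.
Proof.
move=> s0 st tT; rewrite -subr_ge0 -(prim_diff gronwall_intg)//.
have -> : (0 : R) = \int[leb]_(x in `[s, t]) (fun=> 0) x by rewrite /Rintegral integral0.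
apply: ae_le_Rint => //; first exact: intg0.
  exact: (prim_intg gronwall_intg).
apply: (ae_S3 FB (ae_neq 0) (ae_neq T)) => x h x0 xT; rewrite /= in_itv /= => /andP[sx xt].
have xx : 0 < x < T.
  rewrite lt_neqAle (le_trans s0 sx) andbT lt_neqAle (le_trans xt tT) andbT.
  by apply/andP; split; [apply/eqP => e; exact: x0 (esym e)|apply/eqP].
by have /andP[F0 _] := h xx; rewrite mulr_ge0.
Qed.

(* On an interval where the integral of [k] is at most 1/2 the constant doubles. *)
Lemma gronwall_step s t : 0 <= s -> s <= t -> t <= T -> K t - K s <= 2^-1 ->
  E0 + y t <= 2 * (E0 + y s).
Proof.
move=> s0 st tT Kst; pose A := E0 + y s.
have A0 : 0 <= A by rewrite addr_ge0//; apply: le_trans (y_nd (lexx 0) s0 (le_trans st tT)); rewrite /y prim0.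
have [B' B'0 FB'] : exists2 B' : R, 0 <= B' & {ae leb, forall x, 0 < x < T -> F x <= B'}.
  exists `|B| => //; apply: (ae_S FB) => x h /h/andP[_ /le_trans]; apply; exact: ler_norm.
(* A bootstrap: F <= c on the interval gives y(x) - y(s) <= c/2, hence F <= A + c/2. The fixed point
   is 2 A, and the excess due to the a priori bound [B'] is halved at each pass. This needs F only
   almost everywhere. *)
have P j : {ae leb, forall x, s < x < t -> F x <= 2 * A + B' * 2^-1 ^+ j} /\
           y t - y s <= A + B' * 2^-1 ^+ j.
  have step (c : R) : 0 <= c -> {ae leb, forall x, s < x < t -> F x <= c} ->
      forall x, s <= x <= t -> y x - y s <= c / 2.
    move=> c0 Fc x /andP[sx xt]; rewrite -(prim_diff gronwall_intg) ?(le_trans xt)//.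
    have Ix : intg leb `[s, x] k by apply: (prim_intg Ik') => //; exact: le_trans tT.
    apply: (@le_trans _ _ (\int[leb]_(z in `[s, x]) (c * k z))).
      apply: ae_le_Rint => //.
      - by apply: (prim_intg gronwall_intg) => //; exact: le_trans tT.
      - exact: intgZ.
      apply: (ae_S3 Fc (ae_neq s) (ae_neq t)) => z h zs zt; rewrite /= in_itv /= => /andP[sz zx].
      rewrite mulrC ler_wpM2r// h// lt_neqAle sz andbT lt_neqAle (le_trans zx xt) andbT.
      by apply/andP; split; [apply/eqP => e; exact: zs (esym e)|apply/eqP].
    rewrite RintZ// ler_wpM2l// (prim_diff Ik') ?(le_trans xt)//.
    apply: le_trans Kst; rewrite lerD2r; apply: (prim_nd Ik') => //; exact: le_trans sx.
  have c0 i : 0 <= 2 * A + B' * 2^-1 ^+ i by rewrite addr_ge0 ?mulr_ge0// exprn_ge0.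
  suff [H1 H2] : {ae leb, forall x, s < x < t -> F x <= 2 * A + B' * 2^-1 ^+ j} /\
      forall x, s <= x <= t -> y x - y s <= (2 * A + B' * 2^-1 ^+ j) / 2.
    split => //; apply: le_trans (H2 t _) _; first by rewrite st lexx.
    rewrite mulrDl mulrAC divff ?mul1r ?pnatr_eq0// lerD2l ler_pdivrMr// ler_peMr ?ler1n//.
    by rewrite mulr_ge0// exprn_ge0.
  elim: j => [|j [_ IH]].
    have H : {ae leb, forall x, s < x < t -> F x <= 2 * A + B' * 2^-1 ^+ 0}.
      apply: (ae_S FB') => x h /andP[sx xt]; rewrite expr0 mulr1 -[leLHS]add0r lerD ?mulr_ge0//.
      by rewrite h// (le_lt_trans s0 sx) (lt_le_trans xt tT).
    by split => //; exact: step.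
  have H : {ae leb, forall x, s < x < t -> F x <= 2 * A + B' * 2^-1 ^+ j.+1}.
    apply: (ae_S HF) => x h /andP[sx xt].
    have xT : 0 < x < T by rewrite (le_lt_trans s0 sx) (lt_le_trans xt tT).
    apply: (le_trans (h xT)); rewrite -/(prim _ _) -/y.
    have := IH x; rewrite (ltW sx) (ltW xt) => /(_ isT).
    rewrite exprS /A; move: (2^-1 ^+ j) => v.
    by move: (y x) (y s) => u w; lra.
  by split => //; exact: step.
have {}P j : y t - y s <= A + B' * 2^-1 ^+ j by exact: (P j).2.
have : y t - y s <= A.
  apply/ler_addgt0Pr => e e0.
  have [j hj] : exists j : nat, B' * 2^-1 ^+ j <= e.
    have [j /ltW hj] : exists j : nat, 2^-1 ^+ j < e / (B' + 1).
      have e1 : 0 < e / (B' + 1) by rewrite divr_gt0// ltr_wpDl.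
      have [j hj] := invS_small e1; exists j; apply: le_lt_trans hj.
      rewrite exprVn lef_pV2 ?posrE ?exprn_gt0 ?ltr0n//.
      by rewrite -natrX ler_nat ltn_expl.
    exists j; rewrite ler_pdivlMr ?ltr_wpDl// in hj; apply: le_trans hj.
    by rewrite mulrC ler_wpM2l ?exprn_ge0// lerDl.
  by apply: (le_trans (P j)); rewrite lerD2l.
by rewrite /A; move: (y t) (y s) => u w; lra.
Qed.

Lemma gronwall (n : nat) : 2 * \int[leb]_(s in `[0, T]) k s <= n%:R ->
  {ae leb, forall t, 0 < t < T -> F t <= 2 ^+ n * E0 /\
    \int[leb]_(s in `[0, t]) (k s * F s) <= 2 ^+ n * E0}.
Proof.
move=> Kn.
have K0 t : 0 <= t <= T -> 0 <= K t.
  by move=> /andP[t0 tT]; have := prim_nd Ik' (fun s _ => k0 s) (lexx 0) t0 tT; rewrite prim0.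
have P (i : nat) t : 0 <= t <= T -> K t <= i%:R / 2 -> E0 + y t <= 2 ^+ i * E0.
  elim: i t => [|i IH] t /andP[t0 tT] Kt.
    have Kt0 : K t - K 0 <= 2^-1.
      by rewrite /K prim0 subr0; apply: le_trans Kt _; rewrite mul0r invr_ge0.
    rewrite mul0r in Kt; rewrite expr0 mul1r gerDl.
    rewrite /y /prim; apply: (@le_trans _ _ (\int[leb]_(z in `[0, t]) (`|B| * k z))).
      apply: ae_le_Rint => //.
      - exact: (prim_intg gronwall_intg).
      - by apply: intgZ => //; exact: (prim_intg Ik').
      apply: (ae_S3 FB (ae_neq 0) (ae_neq T)) => x h x0 xT; rewrite /= in_itv /= => /andP[sx xt].
      have xx : 0 < x < T.
        rewrite lt_neqAle sx andbT lt_neqAle (le_trans xt tT) andbT.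
        by apply/andP; split; [apply/eqP => e; exact: x0 (esym e)|apply/eqP].
      have /andP[F0 F1] := h xx; rewrite mulrC ler_wpM2r//.
      by apply: (le_trans F1); exact: ler_norm.
    rewrite RintZ//; last exact: (prim_intg Ik').
    have -> : \int[leb]_(x in `[0, t]) k x = 0.
      by apply/eqP; rewrite eq_le Kt/=; apply: K0; rewrite t0.
    by rewrite mulr0.
  have [Ki|Ki] := leP (K t) (i%:R / 2).
    apply: (le_trans (IH t _ Ki)); first by rewrite t0.
    by rewrite exprS -mulrA ler_peMl ?mulr_ge0 ?exprn_ge0// ler1n.
  (* The time at which the integral of the rate reaches i/2; from there to [t] it grows by at most
     1/2, so one more doubling is enough. *)
  have [s /[!in_itv]/= /andP[s0 st] Ks] : exists2 s, s \in `[0, t] & K s = i%:R / 2.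
    apply: IVT => //.
      apply: continuous_subspaceW (prim_cont (ltW T0) Ik') => x /=.
      by rewrite !in_itv /= => /andP[-> /le_trans]; exact.
    rewrite /K prim0 -/K; have i0 : 0 <= i%:R / 2 :> R by rewrite divr_ge0.
    by rewrite min_l ?max_r ?i0 ?(ltW Ki) ?K0 ?t0.
  apply: (@le_trans _ _ (2 * (E0 + y s))).
    apply: gronwall_step => //; rewrite Ks.
    by move: Kt; rewrite -natr1; lra.
  rewrite exprS -mulrA ler_wpM2l//; apply: IH; first by rewrite s0 (le_trans st).
  by rewrite Ks.
apply: (ae_S HF) => t h t0T; have /andP[t0 tT] := t0T.
have Kt : K t <= n%:R / 2.
  apply: (@le_trans _ _ (K T)); first exact: (prim_nd Ik' (fun s _ => k0 s) (ltW t0) (ltW tT) (lexx T)).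
  by rewrite ler_pdivlMr// mulrC.
have H : E0 + y t <= 2 ^+ n * E0 by apply: (P n t _ Kt); rewrite (ltW t0) (ltW tT).
split; first by apply: le_trans H; exact: h.
by apply: le_trans H; rewrite lerDr.
Qed.

End gronwall.

(** * Time derivative and time averages of the strong velocity *)

Section countable_sup.
Context {R : realType} {I : countType}.
Local Notation leb := (@lebesgue_measure R).

(** The index type is enumerated with the value 0 at codes of no index, which is why the competing
    bounds [C] are nonnegative. [fine] gives a real function; its value is meaningful where the
    family is bounded. *)
Lemma ae_sup (D : set R) (g : I -> R -> R) : measurable D ->
  (forall i, measurable_fun D (g i)) -> (forall i t, 0 <= g i t) ->
  exists S : R -> R, [/\ measurable_fun D S, forall t, 0 <= S t &
    forall t, (exists C, forall i, g i t <= C) ->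
      (forall i, g i t <= S t) /\ forall C, 0 <= C -> (forall i, g i t <= C) -> S t <= C].
Proof.
move=> mD mg g0.
pose h n t := if unpickle n is Some i then g i t else 0.
have mh n : measurable_fun D (EFin \o h n).
  by apply/measurable_EFinP; rewrite /h; case: (unpickle n) => [i|]; [exact: mg|exact: measurable_cst].
have hi i : h (pickle i) = g i by apply/funext => t; rewrite /h pickleK.
have hn0 n t : 0 <= h n t by rewrite /h; case: (unpickle n).
pose S t := fine (esups (fun n => (EFin \o h n) t) 0%N).
exists S.
have ub t n : ((h n t)%:E <= esups (fun n => (EFin \o h n) t) 0%N)%E.
  by apply: ereal_sup_ubound; exists n.
have e0 t : (0 <= esups (fun n => (EFin \o h n) t) 0%N)%E.
  by apply: le_trans (ub t 0%N); rewrite lee_fin.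
split.
- by apply: measurableT_comp => //; exact: measurable_fun_esups.
- by move=> t; exact: fine_ge0.
move=> t [C hC].
have bd C' : 0 <= C' -> (forall i, g i t <= C') -> (esups (fun n => (EFin \o h n) t) 0%N <= C'%:E)%E.
  move=> C'0 hC'; apply: ge_ereal_sup => _ [n _ <-] /=; rewrite lee_fin /h.
  by case: (unpickle n).
have fn : esups (fun n => (EFin \o h n) t) 0%N \is a fin_num.
  rewrite ge0_fin_numE//; apply: (@le_lt_trans _ _ `|C|%:E); last exact: ltry.
  by apply: bd => // i; apply: le_trans (hC i) _; exact: ler_norm.
split.
  by move=> i; rewrite -lee_fin /S fineK// -(hi i); exact: ub.
by move=> C' C'0 hC'; rewrite -lee_fin /S fineK//; exact: bd.
Qed.

End countable_sup.

(** * Differentiability in time at all points simultaneously *)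

Section time_derivative.
Context {R : realType} {N : nat}.
Local Notation space := 'rV[R]_N.
Local Notation leb := (@lebesgue_measure R).
Variables (T : R) (Omega : set space) (bd : nat).
Hypothesis T0 : 0 < T.
Hypothesis oO : open Omega.
Hypothesis OA : forall x l, Omega x -> `|x ord0 l| <= bd%:R.

Let Q (i : 'rV[rat]_N) : space := rat_rV i.

Lemma rat_dense x e : closure Omega x -> 0 < e -> exists i, Omega (Q i) /\ `|x - Q i| < e.
Proof.
move=> cx e0; have e2 : 0 < e / 2 by rewrite divr_gt0.
have [y [Oy xy]] := cx _ (nbhsx_ballx x (PosNum e2)%:num e2).
have /nbhs_ballP[d /= d0 hd] : nbhs y Omega by apply: open_nbhs_nbhs; split.
have m0 : 0 < Num.min d (e / 2) by rewrite lt_min d0.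
have [i] := rV_rat_dense y m0; rewrite -ball_normE /= => yi.
exists i; split.
  by apply: hd; rewrite -ball_normE /= distrC; apply: lt_le_trans yi _; rewrite ge_min lexx.
rewrite -ball_normE /= in xy.
rewrite (_ : x - Q i = (x - y) + (y - Q i)); last by rewrite addrA subrK.
apply: (le_lt_trans (ler_normD _ _)); rewrite [e]splitr ltrD// distrC.
by apply: lt_le_trans yi _; rewrite ge_min lexx orbT.
Qed.

Lemma closure_le (f g : space -> R) x (C : R) : closure Omega x ->
  {within closure Omega, continuous f} ->
  (exists2 e, 0 < e & forall i, Omega (Q i) -> `|x - Q i| < e -> `|f (Q i)| <= C) -> `|f x| <= C.
Proof.
move=> cx cf [e e0 hf]; apply/ler_addgt0Pr => d d0.
have /nbhs_ballP[r /= r0 hr] := within_near cf cx d0.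
have m0 : 0 < Num.min r e by rewrite lt_min r0.
have [i [Oi xi]] := rat_dense cx m0.
have h1 : `|f x - f (Q i)| < d.
  apply: hr; last exact: subset_closure.
  by rewrite -ball_normE /=; apply: lt_le_trans xi _; rewrite ge_min lexx.
have h2 : `|f (Q i)| <= C by apply: hf => //; apply: lt_le_trans xi _; rewrite ge_min lexx orbT.
rewrite -[f x](subrK (f (Q i))) addrC; apply: (le_trans (ler_normD _ _)).
by apply: lerD => //; exact: ltW.
Qed.

Variables (U Ut : R -> space -> R).
Hypothesis cU : forall t, 0 <= t <= T -> {within closure Omega, continuous (U t)}.
Hypothesis cUt : {ae leb, forall t, 0 < t < T -> {within closure Omega, continuous (Ut t)}}.
Hypothesis mUt : forall x, closure Omega x -> measurable_fun `[0, T] (fun t => Ut t x).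
Hypothesis UUt : forall t1 t2 x, 0 <= t1 -> t1 <= t2 -> t2 <= T -> closure Omega x ->
    U t2 x - U t1 x = \int[leb]_(t in `[t1, t2]) Ut t x.
Variable S : R -> R.
Hypothesis IS : intg leb `[0, T] S.
Hypothesis US : {ae leb, forall t, 0 < t < T -> forall x, closure Omega x -> `|Ut t x| <= S t}.

Lemma Ut_intg x : closure Omega x -> intg leb `[0, T] (fun t => Ut t x).
Proof.
move=> cx; apply: (@ae_le_intg _ _ _ leb _ _ S) => //; first exact: mUt.
apply: (ae_S3 US (ae_neq 0) (ae_neq T)) => t h t0 tT; rewrite /= in_itv /= => /andP[t1 t2].
apply: le_trans (ler_norm _); apply: h => //.
rewrite lt_neqAle t1 andbT lt_neqAle t2 andbT.
by apply/andP; split; [apply/eqP => e; exact: t0 (esym e)|apply/eqP].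
Qed.

Lemma U_increment x s t : closure Omega x -> 0 <= s -> s <= t -> t <= T ->
  `|U t x - U s x| <= prim S t - prim S s.
Proof.
move=> cx s0 st tT; rewrite UUt// -(prim_diff IS)//.
apply: Rint_bound => //; first exact: (prim_intg IS).
apply: (ae_S3 US (ae_neq 0) (ae_neq T)) => x' h t0 tT'; rewrite /= in_itv /= => /andP[t1 t2].
apply: h => //; rewrite lt_neqAle (le_trans s0 t1) andbT lt_neqAle (le_trans t2 tT) andbT.
by apply/andP; split; [apply/eqP => e; exact: t0 (esym e)|apply/eqP].
Qed.

(** Its supremum over [l] is the oscillation of Ut(t) around the rational point of index [k];
    rational points make the supremum countable, hence measurable in [t]. *)
Let osc_f (k : 'rV[rat]_N) (m : nat) (l : 'rV[rat]_N) (t : R) : R :=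
  if `[< [/\ Omega (Q k), Omega (Q l) & `|Q l - Q k| < m.+1%:R^-1] >]
  then `|Ut t (Q l) - Ut t (Q k)| else 0.

Let bdd t : (forall x, closure Omega x -> `|Ut t x| <= S t) ->
  forall k m l, osc_f k m l t <= 2 * `|S t|.
Proof.
move=> h k m l; rewrite /osc_f; case: asboolP => [[Ok Ol _]|_]; last by rewrite mulr_ge0.
apply: (le_trans (ler_normB _ _)); rewrite mulrDl !mul1r.
by apply: lerD; apply: le_trans (h _ (subset_closure _)) (ler_norm _).
Qed.

Lemma osc_exists k m : exists w : R -> R, [/\ intg leb `[0, T] w, forall t, 0 <= w t,
  {ae leb, forall t, 0 < t < T -> forall l, osc_f k m l t <= w t} &
  {ae leb, forall t, 0 < t < T -> forall C, 0 <= C -> (forall l, osc_f k m l t <= C) -> w t <= C}].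
Proof.
have mosc l : measurable_fun `[0, T] (osc_f k m l).
  rewrite /osc_f; case: asboolP => [[Ok Ol _]|_]; last exact: measurable_cst.
  apply: measurableT_comp => //.
  by apply: measurable_funB; apply: mUt; exact: subset_closure.
have osc0 l t : 0 <= osc_f k m l t by rewrite /osc_f; case: ifP.
have [w [mw w0 hw]] := @ae_sup R _ `[0, T]%classic (osc_f k m) (measurable_itv _) mosc osc0.
exists w; split.
- apply: (@ae_le_intg _ _ _ leb _ _ (fun t => 2 * S t)) => //; last exact: intgZ.
  apply: (ae_S3 US (ae_neq 0) (ae_neq T)) => t h t0 tT; rewrite /= in_itv /= => /andP[t1 t2].
  have tt : 0 < t < T.
    rewrite lt_neqAle t1 andbT lt_neqAle t2 andbT.
    by apply/andP; split; [apply/eqP => e; exact: t0 (esym e)|apply/eqP].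
  rewrite ger0_norm// normrM (ger0_norm (ler0n R 2)).
  have [_] := hw t (ex_intro _ _ (bdd (h tt) k m)); apply; first by rewrite mulr_ge0.
  exact: (bdd (h tt)).
- exact: w0.
- apply: (ae_S US) => t h tt; have [h1 _] := hw t (ex_intro _ _ (bdd (h tt) k m)).
  exact: h1.
- apply: (ae_S US) => t h tt C C0 hC; have [_ h2] := hw t (ex_intro _ _ (bdd (h tt) k m)).
  exact: h2.
Qed.

Let w k m := sval (cid (osc_exists k m)).

Let w_intg k m : intg leb `[0, T] (w k m).
Proof. by rewrite /w; case: cid => ? []. Qed.

Let w_ge0 k m t : 0 <= w k m t.
Proof. by rewrite /w; case: cid => ? []. Qed.

Let w_ub k m : {ae leb, forall t, 0 < t < T -> forall l, osc_f k m l t <= w k m t}.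
Proof. by rewrite /w; case: cid => ? []. Qed.

Let w_lub k m : {ae leb, forall t, 0 < t < T -> forall C, 0 <= C ->
  (forall l, osc_f k m l t <= C) -> w k m t <= C}.
Proof. by rewrite /w; case: cid => ? []. Qed.

(** For rational points this is the integral of the oscillation; the left-hand side is continuous in
    [x], so it extends to the closure by density. *)
Let increment2 k m x s t : closure Omega x -> Omega (Q k) -> `|x - Q k| < m.+1%:R^-1 ->
  0 <= s -> s <= t -> t <= T ->
  `|(U t x - U s x) - (U t (Q k) - U s (Q k))| <= prim (w k m) t - prim (w k m) s.
Proof.
move=> cx Ok xk s0 st tT.
have cQ l : Omega (Q l) -> closure Omega (Q l) by exact: subset_closure.
have s01 : 0 <= s <= T by rewrite s0 (le_trans st).
have t01 : 0 <= t <= T by rewrite tT (le_trans s0).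
pose f x := (U t x - U s x) - (U t (Q k) - U s (Q k)).
have cf : {within closure Omega, continuous f}.
  move=> y; apply: (@continuousB _ _ (subspace (closure Omega))); last exact: cst_continuous.
  by apply: (@continuousB _ _ (subspace (closure Omega))); [exact: (cU t01)|exact: (cU s01)].
apply: (@closure_le f f) => //; exists (m.+1%:R^-1 - `|x - Q k|); first by rewrite subr_gt0.
move=> l Ol xl.
have lk : `|Q l - Q k| < m.+1%:R^-1.
  rewrite (_ : Q l - Q k = (Q l - x) + (x - Q k)); last by rewrite addrA subrK.
  by apply: (le_lt_trans (ler_normD _ _)); rewrite distrC -ltrBrDr.
have It y : closure Omega y -> intg leb `[s, t] (fun z => Ut z y).
  by move=> cy; apply: (prim_intg (Ut_intg cy)).
have -> : f (Q l) = \int[leb]_(z in `[s, t]) (Ut z (Q l) - Ut z (Q k)).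
  by rewrite /f (UUt s0 st tT (cQ _ Ol)) (UUt s0 st tT (cQ _ Ok)) RintB//; exact/It/cQ.
rewrite -(prim_diff (w_intg k m))//.
apply: Rint_bound => //; first exact: (prim_intg (w_intg k m)).
apply: (ae_S3 (w_ub k m) (ae_neq 0) (ae_neq T)) => z h z0 zT; rewrite /= in_itv /= => /andP[z1 z2].
have zz : 0 < z < T.
  rewrite lt_neqAle (le_trans s0 z1) andbT lt_neqAle (le_trans z2 tT) andbT.
  by apply/andP; split; [apply/eqP => e; exact: z0 (esym e)|apply/eqP].
by have := h zz l; rewrite /osc_f asboolT.
Qed.

Lemma ae_allc {I : countType} (P : I -> R -> Prop) : (forall i, {ae leb, forall t, P i t}) ->
  {ae leb, forall t, forall i, P i t}.
Proof.
move=> h; have H n : {ae leb, forall t, if unpickle n is Some i then P i t else True}.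
  by case: (unpickle n) => [i|]; [exact: h|exact: aeW].
by apply: (ae_S (ae_foralln H)) => t Ht i; have := Ht (pickle i); rewrite pickleK.
Qed.

(** For one [x] this is Lebesgue differentiation, with a null set that depends on [x]. The null sets
    are united over rational points and over the primitives of their oscillations. At a remaining
    [t], the increment at [x] differs from that at a nearby rational point by the increment of such
    a primitive, whose derivative is small by continuity of Ut(t). *)
Theorem ae_time_derivative : {ae leb, forall t, 0 < t < T -> forall x, closure Omega x ->
  is_derive t 1 (fun s => U s x) (Ut t x)}.
Proof.
have D1 : {ae leb, forall t, forall k, 0 < t < T -> Omega (Q k) -> is_derive t 1 (fun s => U s (Q k)) (Ut t (Q k))}.
  apply: ae_allc => k; have [Ok|nOk] := pselect (Omega (Q k)); last exact: aeW.
  have ck : closure Omega (Q k) by exact: subset_closure.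
  apply: (ae_S (prim_derive (Ut_intg ck))) => t h tt _.
  apply: (@near_eq_is_derive R R R (fun s => U 0 (Q k) + prim (fun s => Ut s (Q k)) s)).
    have /andP[t0 tT] := tt; near=> s.
    have s0 : 0 < s by near: s; exact: lt_nbhsr.
    have sT : s < T by near: s; exact: lt_nbhsl.
    by have E := UUt (lexx 0) (ltW s0) (ltW sT) ck; rewrite /prim -E addrC subrK.
  by have := DD (Dcst (U 0 (Q k)) t 1) (h tt); rewrite add0r.
have D2 : {ae leb, forall t, forall km : 'rV[rat]_N * nat, 0 < t < T ->
    is_derive t 1 (prim (w km.1 km.2)) (w km.1 km.2 t) /\
    forall C, 0 <= C -> (forall l, osc_f km.1 km.2 l t <= C) -> w km.1 km.2 t <= C}.
  apply: ae_allc => -[k m] /=.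
  by apply: (ae_S2 (prim_derive (w_intg k m)) (w_lub k m)) => t h1 h2 tt; split; [exact: h1|exact: h2].
apply: (ae_S3 D1 D2 cUt) => t h1 h2 h3 tt x cx.
have /andP[t0 tT] := tt; have ct := h3 tt.
apply/is_derive1P => e e0.
have e4 : 0 < e / 4 by rewrite divr_gt0.
have e8 : 0 < e / 8 by rewrite divr_gt0.
have /nbhs_ballP[r /= r0 hr] := within_near ct cx e8.
have r2 : 0 < r / 2 by rewrite divr_gt0.
have [m hm] := invS_small r2.
have m0 : 0 < m.+1%:R^-1 :> R by rewrite invr_gt0.
have [k [Ok xk]] := rat_dense cx m0.
have close l : Omega (Q l) -> `|x - Q l| < r -> `|Ut t x - Ut t (Q l)| <= e / 8.
  by move=> Ol xl; apply/ltW/hr; [rewrite -ball_normE|exact: subset_closure].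
have xkr : `|x - Q k| < r by apply: lt_trans xk _; apply: lt_trans hm _; rewrite ltr_pdivrMr// ltr_pMr// ltr1n.
have [dw wle] := h2 (k, m) tt; rewrite /= in dw wle.
(* All rational points entering the oscillation are within r of [x], so their values of Ut(t) differ
   from that at [x] by at most e/8. *)
have wt4 : w k m t <= e / 4.
  apply: wle => [|l]; first exact: ltW.
  rewrite /osc_f; case: asboolP => [[_ Ol lk]|_]; last exact: ltW.
  have -> : Ut t (Q l) - Ut t (Q k) = (Ut t x - Ut t (Q k)) - (Ut t x - Ut t (Q l)) by ring.
  apply: (le_trans (ler_normB _ _)); have -> : e / 4 = e / 8 + e / 8 by field.
  apply: lerD; apply: close => //.
  rewrite (_ : x - Q l = (x - Q k) - (Q l - Q k)); last by rewrite opprB addrA subrK.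
  apply: (le_lt_trans (ler_normB _ _)); rewrite [r]splitr; apply: ltrD; exact: lt_trans hm.
have [d1 d10 hd1] := (is_derive1P _ _ _).1 (h1 k tt Ok) _ e4.
have [d2 d20 hd2] := (is_derive1P _ _ _).1 dw _ e4.
pose d := Num.min (Num.min d1 d2) (Num.min t (T - t)).
have d0 : 0 < d by rewrite !lt_min d10 d20 t0 subr_gt0.
exists d => // s; rewrite !lt_min => /andP[/andP[s1 s2] /andP[s3 s4]].
have {hd1 s1}A1 := hd1 s s1; have {hd2 s2}A2 := hd2 s s2.
have s0 : 0 <= s.
  by move: s3; rewrite ltr_norml => /andP[+ _]; rewrite ltrBrDr addNr => /ltW.
have sT : s <= T.
  by move: s4; rewrite ltr_norml => /andP[_]; rewrite ltrD2r => /ltW.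
have A3 : `|(U s x - U t x) - (U s (Q k) - U t (Q k))| <= `|prim (w k m) s - prim (w k m) t|.
  have [st|/ltW ts] := leP s t.
    rewrite [leRHS]distrC.
    rewrite (_ : U s x - U t x - (U s (Q k) - U t (Q k)) = - (U t x - U s x - (U t (Q k) - U s (Q k)))); last by ring.
    rewrite normrN; apply: (le_trans (increment2 cx Ok xk s0 st (ltW tT))); exact: ler_norm.
  apply: (le_trans (increment2 cx Ok xk (ltW t0) ts sT)); exact: ler_norm.
have A4 : `|Ut t x - Ut t (Q k)| <= e / 8 by exact: close.
have A5 : `|prim (w k m) s - prim (w k m) t| <= e / 2 * `|s - t|.
  rewrite -[X in `|X|](subrK (w k m t * (s - t))).
  apply: (le_trans (ler_normD _ _)); rewrite (_ : e / 2 = e / 4 + e / 4); last by field.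
  rewrite mulrDl; apply: lerD => //; rewrite normrM (ger0_norm (w_ge0 _ _ _)).
  by rewrite ler_wpM2r.
have -> : U s x - U t x - Ut t x * (s - t) = ((U s x - U t x) - (U s (Q k) - U t (Q k))) +
  ((U s (Q k) - U t (Q k) - Ut t (Q k) * (s - t)) - (Ut t x - Ut t (Q k)) * (s - t)) by ring.
apply: (le_trans (ler_normD _ _)).
apply: (@le_trans _ _ (e / 2 * `|s - t| + (e / 4 * `|s - t| + e / 8 * `|s - t|))).
  apply: lerD; first exact: le_trans A3 A5.
  apply: (le_trans (ler_normB _ _)); apply: lerD => //.
  by rewrite normrM ler_wpM2r.
have := mulr_ge0 (ltW e0) (normr_ge0 (s - t)).
by move: `|s - t| => v; lra.
Unshelve. all: by end_near. Qed.

End time_derivative.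

(** * Continuity on the closed space-time cylinder *)

Section cylinder.
Context {R : realType} {N : nat}.
Local Notation space := 'rV[R]_N.
Variables (T : R) (Omega : set space).
Implicit Types f g : R -> space -> R.

Lemma cylD f g : continuous_cylinder T Omega f -> continuous_cylinder T Omega g ->
  continuous_cylinder T Omega (fun t x => f t x + g t x).
Proof. by move=> cf cg z; apply: cvgD; [exact: cf|exact: cg]. Qed.

Lemma cylM f g : continuous_cylinder T Omega f -> continuous_cylinder T Omega g ->
  continuous_cylinder T Omega (fun t x => f t x * g t x).
Proof. by move=> cf cg z; apply: cvgM; [exact: cf|exact: cg]. Qed.

Lemma cyl_cst (c : R) : continuous_cylinder T Omega (fun _ _ => c).
Proof. by move=> z; exact: cvg_cst. Qed.

Lemma cylN f : continuous_cylinder T Omega f -> continuous_cylinder T Omega (fun t x => - f t x).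
Proof. by move=> cf z; apply: cvgN; exact: cf. Qed.

Lemma cyl_sum (I : Type) (s : seq I) (P : pred I) (F : I -> R -> space -> R) :
  (forall i, continuous_cylinder T Omega (F i)) ->
  continuous_cylinder T Omega (fun t x => \sum_(i <- s | P i) F i t x).
Proof.
move=> cF; elim: s => [|a s IH].
  by rewrite (_ : (fun t x => _) = fun _ _ => 0); [exact: cyl_cst|apply/funext => t; apply/funext => x; rewrite big_nil].
rewrite (_ : (fun t x => _) = (fun t x => (if P a then F a t x else 0) + \sum_(i <- s | P i) F i t x)).
  by apply: cylD => //; case: (P a); [exact: cF|exact: cyl_cst].
by apply/funext => t; apply/funext => x; rewrite big_cons; case: (P a); rewrite ?add0r.
Qed.

Lemma cyl_time (h : R -> R) : continuous h -> continuous_cylinder T Omega (fun t _ => h t).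
Proof.
move=> ch; apply: continuous_subspaceT => z.
by apply: (@continuous_comp _ _ _ fst h); [exact: cvg_fst|exact: ch].
Qed.

Lemma cyl_near f t x (e : R) : continuous_cylinder T Omega f -> 0 <= t <= T -> closure Omega x ->
  0 < e -> exists2 d : R, 0 < d & forall s y, 0 <= s <= T -> closure Omega y ->
    `|s - t| < d -> `|y - x| < d -> `|f s y - f t x| < e.
Proof.
move=> cf tT cx e0.
have tx : closed_cylinder T Omega (t, x) by split => //=; rewrite in_itv.
have /nbhs_ballP[d /= d0 hd] := within_near cf tx e0.
exists d => // s y sT cy st yx; rewrite distrC.
apply: (hd (s, y)); split => //=; rewrite -?ball_normE /= ?in_itv//.
  by rewrite distrC.
by rewrite distrC.
Qed.

Lemma cyl_section f s : continuous_cylinder T Omega f -> 0 <= s <= T ->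
  {within closure Omega, continuous (f s)}.
Proof.
move=> cf sT; apply: near_within => x e cx e0.
have [d d0 hd] := cyl_near cf sT cx e0.
apply/nbhs_ballP; exists d => // y; rewrite -ball_normE /= => xy cy.
by rewrite distrC hd// ?subrr ?normr0// distrC.
Qed.

Lemma cyl_space (h : space -> R) : {within closure Omega, continuous h} ->
  continuous_cylinder T Omega (fun _ => h).
Proof.
move=> ch; apply: near_within => -[t x] e [_ cx] e0 /=.
have /nbhs_ballP[d /= d0 hd] := within_near ch cx e0.
apply/nbhs_ballP; exists d => // -[s y] [_ /= xy] [_ cy].
exact: hd.
Qed.

Lemma cyl_comp f (h : R -> R) : continuous_cylinder T Omega f ->
  (forall t x, 0 <= t <= T -> closure Omega x -> {for f t x, continuous h}) ->
  continuous_cylinder T Omega (fun t x => h (f t x)).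
Proof.
move=> cf ch; apply: near_within => -[t x] e [/= tT cx] e0.
rewrite in_itv /= in tT.
have /cvgrPdist_lt/(_ e e0)/nbhs_ballP[d /= d0 hd] := ch t x tT cx.
have [d' d'0 hd'] := cyl_near cf tT cx d0.
apply/nbhs_ballP; exists d' => // -[s y] [/= ts xy] [/= sT cy].
rewrite in_itv /= in sT.
apply: hd; rewrite -ball_normE /= distrC; apply: hd' => //.
  by move: ts; rewrite -ball_normE /= distrC.
by move: xy; rewrite -ball_normE /= distrC.
Qed.

Lemma cyl_bounded f : compact (closure Omega) -> continuous_cylinder T Omega f ->
  exists2 C : R, 0 <= C & forall t x, 0 <= t <= T -> closure Omega x -> `|f t x| <= C.
Proof.
move=> cO cf.
have cK : compact (closed_cylinder T Omega) by apply: compact_setX => //; exact: segment_compact.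
have [[z Kz]|/nonemptyPn K0] := pselect (closed_cylinder T Omega !=set0); last first.
  exists 0 => // t x tT cx; have : closed_cylinder T Omega (t, x) by split => //=; rewrite in_itv.
  by rewrite K0.
have cn : {within closed_cylinder T Omega, continuous (fun z => `|f z.1 z.2|)}.
  by move=> y; apply: cvg_norm; exact: cf.
have := continuous_compact cn cK => /compact_bounded[M [_ hM]].
exists (`|M| + 1); first by rewrite addr_ge0.
move=> t x tT cx; have M1 : M < `|M| + 1 by apply: le_lt_trans (ler_norm M) _; rewrite ltrDl.
have := hM _ M1 `|f t x|; rewrite /= normr_id; apply.
by exists (t, x) => //; split => //=; rewrite in_itv.
Qed.

End cylinder.

(** * Spline averages in time *)

Section time_approximation.
Context {R : realType} {N : nat}.
Local Notation space := 'rV[R]_N.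
Variables (T : R) (A : nat) (Omega : set space).
Hypothesis T0 : 0 < T.
Hypothesis TA : T <= A%:R.

(** Nodes are moved into the open interval (0, T): the spatial derivatives of the strong solution
    are classical only there, and grid nodes may also lie outside [0, T]. The margin tends to 0 with
    n. *)
Definition inner_time (n : nat) (s : R) : R :=
  Num.max (T / n.+2%:R) (Num.min s (T - T / n.+2%:R)).

Let dn (n : nat) : 0 < T / n.+2%:R. Proof. by rewrite divr_gt0. Qed.

Let dn2 (n : nat) : T / n.+2%:R <= T - T / n.+2%:R.
Proof.
have : 2 * (T / n.+2%:R) <= T by rewrite mulrCA ger_pMr// ler_pdivrMr// mul1r ler_nat.
by move: (T / n.+2%:R) => d; lra.
Qed.

Lemma inner_time_in n s : 0 < inner_time n s < T.
Proof.
have TT : T - T / n.+2%:R < T by rewrite ltrBlDr ltrDl.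
rewrite /inner_time lt_max dn/= gt_max gt_min TT orbT andbT.
exact: le_lt_trans (dn2 n) TT.
Qed.

Lemma inner_time_out n s t : inner_time n s < inner_time n t -> s <= inner_time n s /\ inner_time n t <= t.
Proof.
have := dn2 n; rewrite /inner_time; move: (T / n.+2%:R) => d h.
rewrite !maxElt !minElt; case: ifP; case: ifP => //; case: ifP; case: ifP => // *; split; lra.
Qed.

Lemma inner_time_id n s : T / n.+2%:R <= s <= T - T / n.+2%:R -> inner_time n s = s.
Proof. by move=> /andP[h1 h2]; rewrite /inner_time min_l// max_r. Qed.

Lemma inner_time_dist n s t : `|inner_time n s - inner_time n t| <= `|s - t|.
Proof.
have key u v : inner_time n u < inner_time n v -> `|inner_time n u - inner_time n v| <= `|u - v|.
  move=> uv; have [h1 h2] := inner_time_out uv.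
  rewrite distrC [leRHS]distrC gtr0_norm ?subr_gt0//; apply: le_trans (ler_norm _).
  by rewrite lerD// lerN2.
have [st|ts|->] := ltgtP (inner_time n s) (inner_time n t); last by rewrite subrr normr0.
- exact: key.
- by rewrite distrC [leRHS]distrC key.
Qed.

Lemma inner_time_near n t : 0 <= t <= T -> `|inner_time n t - t| <= T / n.+2%:R.
Proof.
move=> /andP[t0 tT]; have := dn2 n; have := dn n; rewrite /inner_time; move: (T / n.+2%:R) => d d0 h.
by rewrite maxElt minElt ler_norml; case: ifP; case: ifP => *; apply/andP; split; lra.
Qed.

(** A finite combination of time slices with smooth coefficients. Its time derivative therefore has
    as much spatial regularity as the averaged function, and boundary values are inherited. *)
Definition tapp n (f : R -> space -> R) (t : R) (x : space) : R :=
  \sum_(i < nodes A n) f (inner_time n (node A n i)) x * wt A n i t.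

Definition tapp' n (f : R -> space -> R) (t : R) (x : space) : R :=
  \sum_(i < nodes A n) f (inner_time n (node A n i)) x * (n%:R * wt' A n i t).

Let tA (t : R) : 0 <= t <= T -> `|t| <= A%:R.
Proof. by move=> /andP[t0 tT]; rewrite ger0_norm// (le_trans tT). Qed.

Let in01 n s : 0 <= inner_time n s <= T.
Proof. by have /andP[/ltW -> /ltW ->] := inner_time_in n s. Qed.

Section fixed.
Variable n : nat.
Hypothesis n0 : (0 < n)%N.

Lemma tapp_cyl f : continuous_cylinder T Omega f -> continuous_cylinder T Omega (tapp n f).
Proof.
move=> cf; apply: cyl_sum => i; apply: cylM.
  by apply: cyl_space; exact: cyl_section.
by apply: cyl_time => t; apply: is_derive1_cont; exact: (@dwt R A n i t).
Qed.

Lemma bs'_cont : continuous (bs' : R -> R).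
Proof.
have c (a b : R) : continuous (fun y : R => th (y - a - b)).
  move=> y; apply: (@continuous_comp _ _ _ (fun y => y - a - b) th); last exact: th_cont.
  by apply: (@cvgD _ _ _ _ _ (fun y => y - a)); [exact: (cvgD cvg_id (cvg_cst _))|exact: cvg_cst].
have E : bs' = (fun y : R => th (y - 0 - 0) - th (y - 1 - 0) - (th (y - 1 - 0) - th (y - 1 - 1))).
  by apply/funext => y; rewrite /bs' /b0 !subr0.
rewrite E => y.
have c1 : continuous (fun y : R => th (y - 0 - 0) - th (y - 1 - 0)).
  by move=> z; exact: (continuousB (c 0 0 z) (c 1 0 z)).
have c2 : continuous (fun y : R => th (y - 1 - 0) - th (y - 1 - 1)).
  by move=> z; exact: (continuousB (c 1 0 z) (c 1 1 z)).
exact: continuousB (c1 y) (c2 y).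
Qed.

Lemma tapp'_cyl f : continuous_cylinder T Omega f -> continuous_cylinder T Omega (tapp' n f).
Proof.
move=> cf; apply: cyl_sum => i; apply: cylM.
  by apply: cyl_space; exact: cyl_section.
apply: cyl_time => t; apply: (@cvgM _ _ _ _ (fun=> n%:R)); first exact: cvg_cst.
apply: (@continuous_comp R R R (fun t => n%:R * t + offset A n - i%:R) bs'); last exact: bs'_cont.
apply: cvgB; last exact: cvg_cst.
apply: cvgD; last exact: cvg_cst.
by apply: cvgM; [exact: cvg_cst|exact: cvg_id].
Qed.

Lemma tapp_dt f (t : R) (x : space) : is_derive t 1 (fun s => tapp n f s x) (tapp' n f t x).
Proof. by apply: Dsum => i; apply: DZ; exact: (@dwt R A n i t). Qed.

Lemma tapp_dx (f g : R -> space -> R) t (x v : space) :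
  (forall s, 0 < s < T -> is_derive x v (f s) (g s x)) ->
  is_derive x v (tapp n f t) (tapp n g t x).
Proof.
move=> df; apply: Dsum => i.
have := DZ (wt A n i t) (df _ (inner_time_in n (node A n i))).
rewrite mulrC (_ : (fun y => _) = fun y => f (inner_time n (node A n i)) y * wt A n i t)//.
by apply/funext => y; rewrite mulrC.
Qed.

Lemma tapp_err f t x (c e : R) : 0 <= t <= T ->
  (forall s, 0 < s < T -> `|s - t| <= (3 + T) / n%:R -> `|f s x - c| <= e) ->
  `|tapp n f t x - c| <= e.
Proof.
move=> tT h; have S := @sum_wt R A n t (tA tT).
have n0R : (0 : R) < n%:R by rewrite ltr0n.
rewrite -[c in X in `|X|]mulr1 -S mulr_sumr -sumrB.
apply: (le_trans (ler_norm_sum _ _ _)); rewrite -[leRHS]mulr1 -S mulr_sumr.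
apply: ler_sum => k _; rewrite -mulrBl normrM [`|wt _ _ _ _|]ger0_norm ?wt_ge0//.
have [->|w0] := eqVneq (wt A n k t) 0; first by rewrite !mulr0.
rewrite ler_wpM2r ?wt_ge0// h ?inner_time_in//.
rewrite mulrDl (_ : inner_time n (node A n k) - t =
  (inner_time n (node A n k) - inner_time n t) + (inner_time n t - t)); last by rewrite addrA subrK.
apply: (le_trans (ler_normD _ _)); apply: lerD.
  by apply: (le_trans (inner_time_dist _ _ _)); apply: near_node => //; left.
apply: (le_trans (inner_time_near n tT)).
by rewrite ler_pM2l// lef_pV2 ?posrE ?ltr0n// ler_nat -addn2 leq_addr.
Qed.

Lemma tapp_bound f t x (C : R) : 0 <= t <= T -> (forall s, 0 <= s <= T -> `|f s x| <= C) ->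
  `|tapp n f t x| <= C.
Proof.
move=> tT h; rewrite -[tapp _ _ _ _]subr0; apply: tapp_err => // s /andP[s0 sT] _.
by rewrite subr0 h// !ltW.
Qed.

Lemma tapp'_sub f t x (c : R) : 0 <= t <= T ->
  tapp' n f t x = \sum_(i < nodes A n) n%:R * (f (inner_time n (node A n i)) x - c) * wt' A n i t.
Proof.
move=> tT; have S := @sum_wt' R A n t (tA tT).
have : \sum_(i < nodes A n) c * n%:R * wt' A n i t = 0 by rewrite -mulr_sumr S mulr0.
move=> E; rewrite -[LHS]subr0 -[X in _ - X = _]E /tapp' -sumrB; apply: eq_bigr => i _; ring.
Qed.

(** The differentiated weights sum to 0, so a constant may be subtracted from the nodal values;
    their absolute sum is at most 2. *)
Lemma tapp'_le f t x (c v : R) : 0 <= t <= T -> 0 <= v ->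
  (forall s, `|s - t| <= 3 / n%:R -> `|f (inner_time n s) x - c| <= v) ->
  `|tapp' n f t x| <= 2 * n%:R * v.
Proof.
move=> tT v0 h; rewrite (tapp'_sub _ _ c tT).
have n0R : (0 : R) < n%:R by rewrite ltr0n.
apply: (le_trans (ler_norm_sum _ _ _)).
apply: (@le_trans _ _ (\sum_(i < nodes A n) n%:R * v * `|wt' A n i t|)).
  apply: ler_sum => i _; rewrite normrM.
  have [->|w0] := eqVneq (wt' A n i t) 0; first by rewrite normr0 !mulr0.
  rewrite ler_wpM2r// normrM gtr0_norm// ler_pM2l// h// near_node//; by right.
rewrite -mulr_sumr mulrC mulrA ler_wpM2r// ler_wpM2r ?(ltW n0R)//.
exact: (@sum_abs_wt' R A n t (tA tT)).
Qed.

(** Reproduction of slopes turns differentiability at the single time [t] into convergence of the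
    averaged derivative there. The constant 6 is the sum 2 of the weights times the reach 3 of the
    nodes; away from the ends the nodes are not moved. *)
Lemma tapp'_err f t x (a e : R) : T / n.+2%:R + 3 / n%:R <= t <= T - (T / n.+2%:R + 3 / n%:R) -> 0 <= e ->
  (forall s, `|s - t| <= 3 / n%:R -> `|f s x - f t x - a * (s - t)| <= e * `|s - t|) ->
  `|tapp' n f t x - a| <= 6 * e.
Proof.
move=> /andP[t1 t2] e0 h.
have n0R : (0 : R) < n%:R by rewrite ltr0n.
have d3 : 0 < 3 / n%:R :> R by rewrite divr_gt0.
have tT : 0 <= t <= T.
  by have := dn n; move: t1 t2 d3; move: (T / n.+2%:R) (3 / n%:R) => u v *; apply/andP; split; lra.
have S := @sum_node_wt' R A n n0 t (tA tT).
have Ea : a = \sum_(i < nodes A n) a * (n%:R * (node A n i - t) * wt' A n i t).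
  by rewrite -mulr_sumr S mulr1.
rewrite (tapp'_sub _ _ (f t x) tT) [X in `|_ - X|]Ea -sumrB.
apply: (le_trans (ler_norm_sum _ _ _)).
apply: (@le_trans _ _ (\sum_(i < nodes A n) 3 * e * `|wt' A n i t|)).
  apply: ler_sum => i _.
  have [->|w0] := eqVneq (wt' A n i t) 0; first by rewrite !mulr0 subrr normr0 mulr0.
  have near : `|node A n i - t| <= 3 / n%:R by apply: near_node => //; right.
  have E : inner_time n (node A n i) = node A n i.
    apply: inner_time_id; move: near; rewrite ler_norml => /andP[].
    by move: t1 t2; move: (node A n i) (T / n.+2%:R) (3 / n%:R) => u v w *; apply/andP; split; lra.
  rewrite E (_ : _ - _ = n%:R * (f (node A n i) x - f t x - a * (node A n i - t)) * wt' A n i t); last by ring.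
  rewrite normrM ler_wpM2r// normrM gtr0_norm//.
  apply: (@le_trans _ _ (n%:R * (e * (3 / n%:R)))).
    rewrite ler_pM2l//; apply: (le_trans (h _ near)); exact: ler_wpM2l.
  by rewrite le_eqVlt; apply/orP; left; apply/eqP; field; rewrite gt_eqF.
rewrite -mulr_sumr mulrC (_ : 6 * e = 2 * (3 * e)); last by ring.
by rewrite ler_wpM2r ?mulr_ge0//; exact: (@sum_abs_wt' R A n t (tA tT)).
Qed.

End fixed.

Lemma nat_frac_cvg0 (c d : R) : 0 < d -> \forall n \near \oo, c / n.+1%:R < d.
Proof.
move=> d0.
have [k hk] : exists k : nat, `|c| / d < k.+1%:R.
  exists (Num.truncn (`|c| / d)); exact: truncnS_gt.
exists k => // n /= kn; rewrite ltr_pdivrMr//.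
apply: le_lt_trans (ler_norm c) _; rewrite mulrC -ltr_pdivrMr//.
by apply: lt_le_trans hk _; rewrite ler_nat ltnS.
Qed.

Lemma tapp_cvg f t x : continuous_cylinder T Omega f -> 0 <= t <= T -> closure Omega x ->
  (fun n => tapp n.+1 f t x) @ \oo --> f t x.
Proof.
move=> cf tT cx; apply/cvgrPdist_le => e e0.
have [d d0 hd] := cyl_near cf tT cx e0.
apply: filterS (nat_frac_cvg0 (3 + T) d0) => n hn; rewrite distrC.
apply: tapp_err => // s /andP[s0 sT] st; apply: ltW; apply: hd => //.
- by rewrite !ltW.
- exact: le_lt_trans hn.
- by rewrite subrr normr0.
Qed.

Lemma tapp'_cvg f t x (a : R) : 0 < t < T -> is_derive t 1 (fun s => f s x) a ->
  (fun n => tapp' n.+1 f t x) @ \oo --> a.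
Proof.
move=> /andP[t0 tT] /is_derive1P df; apply/cvgrPdist_le => e e0.
have e6 : 0 < e / 6 by rewrite divr_gt0.
have [d d0 hd] := df _ e6.
have Tt : 0 < T - t by rewrite subr_gt0.
have n3 := nat_frac_cvg0 3 d0.
have n1 := nat_frac_cvg0 (T + 3) t0.
have n2 := nat_frac_cvg0 (T + 3) Tt.
apply: filterS3 n1 n2 n3 => n h1 h2 h3; rewrite distrC.
have -> : e = 6 * (e / 6) by field.
have le : T / n.+3%:R + 3 / n.+1%:R <= (T + 3) / n.+1%:R.
  by rewrite [leRHS]mulrDl lerD2r ler_pM2l// lef_pV2 ?posrE ?ltr0n// ler_nat ltnW.
apply: tapp'_err => //.
- apply/andP; split; first exact: ltW (le_lt_trans le h1).
  by rewrite lerBrDr -lerBrDl; exact: ltW (le_lt_trans le h2).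
- exact: ltW.
- by move=> s st; apply: hd; exact: le_lt_trans h3.
Qed.

End time_approximation.

(** * The majorant of the averaged time derivative *)

Section majorant.
Context {R : realType}.
Local Notation leb := (@lebesgue_measure R).
Variables (T : R) (S : R -> R).
Hypothesis T0 : 0 < T.
Hypothesis IS : intg leb `[0, T] S.
Hypothesis S0 : forall t, 0 <= S t.

Let clampT (t : R) : R := Num.max 0 (Num.min t T).

Let clamp_in t : 0 <= clampT t <= T.
Proof. by rewrite /clampT le_max lexx/= ge_max (ltW T0) ge_min lexx orbT. Qed.

Let clamp_nd s t : s <= t -> clampT s <= clampT t.
Proof.
move=> st; rewrite /clampT !maxElt !minElt.
by case: ifP; case: ifP; case: ifP; case: ifP => *; lra.
Qed.

(** The primitive continued by constants, because the windows in [maj] extend outside [0, T]. *)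
Definition Sprim (t : R) : R := prim S (clampT t).

Lemma Sprim_id t : 0 <= t <= T -> Sprim t = prim S t.
Proof. by move=> /andP[t0 tT]; rewrite /Sprim /clampT min_l// max_r. Qed.

Lemma Sprim_le0 t : t <= 0 -> Sprim t = 0.
Proof. by move=> t0; rewrite /Sprim /clampT max_l ?prim0// ge_min t0. Qed.

Lemma Sprim_nd s t : s <= t -> Sprim s <= Sprim t.
Proof.
move=> st; have /andP[s1 _] := clamp_in s; have /andP[_ t1] := clamp_in t.
by apply: (prim_nd IS (fun x _ => S0 x)) => //; exact: clamp_nd.
Qed.

Lemma Sprim_ge0 t : 0 <= Sprim t.
Proof.
by rewrite -(Sprim_le0 (t := Num.min t 0)) ?ge_min ?lexx ?orbT//; apply: Sprim_nd; rewrite ge_min lexx.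
Qed.

Lemma Sprim_cont : continuous Sprim.
Proof.
have cc : continuous clampT.
  move=> t; apply/cvgrPdist_lt => e e0; apply/nbhs_ballP; exists e => // s.
  rewrite /ball_ /= => st; apply: le_lt_trans st; rewrite /clampT !maxElt !minElt.
  have := ler_norm (t - s); have := ler_norm (s - t); rewrite [`|s - t|]distrC.
  have := normr_ge0 (t - s); move: `|t - s| => v v0 h1 h2.
  by rewrite ler_norml; case: ifP; case: ifP; case: ifP; case: ifP => *; apply/andP; split; lra.
have cp := prim_cont (ltW T0) IS.
move=> t; apply/cvgrPdist_lt => e e0.
have Ct : `[0, T]%classic (clampT t) by rewrite /= in_itv /= clamp_in.
have /nbhs_ballP[d /= d0 hd] := within_near cp Ct e0.
have /cvgrPdist_lt/(_ d d0) := cc t; apply: filterS => s hs.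
by apply: hd => //=; rewrite in_itv /= clamp_in.
Qed.

(** A difference quotient over a window of length 6/n multiplied by 12, hence the limit 12 S
    wherever the primitive is differentiable. *)
Definition maj (n : nat) (t : R) : R := 2 * n%:R * (Sprim (t + 3 / n%:R) - Sprim (t - 3 / n%:R)).

Lemma maj_ge0 n t : 0 <= maj n t.
Proof.
rewrite mulr_ge0// subr_ge0 Sprim_nd// lerD2l.
have h : 0 <= 3 / n%:R :> R by rewrite divr_ge0.
by apply: le_trans h; rewrite oppr_le0.
Qed.

Lemma maj_cont n : continuous (maj n).
Proof.
have sh (c : R) : continuous (fun t : R => Sprim (t + c)).
  move=> t; apply: (@continuous_comp R R R (fun t => t + c) Sprim); last exact: Sprim_cont.
  exact: (cvgD cvg_id (cvg_cst _)).
have c1 : continuous (fun t : R => Sprim (t + 3 / n%:R) - Sprim (t - 3 / n%:R)).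
  by move=> t; exact: (continuousB (sh _ t) (sh _ t)).
by move=> t; apply: (continuousM (@cst_continuous _ _ _ t) (c1 t)).
Qed.

Lemma maj_intg n tau : intg leb `[0, tau] (maj n).
Proof.
apply: continuous_compact_integrable; first exact: segment_compact.
by apply: cont_within; exact: maj_cont.
Qed.

Lemma maj_cvg t : 0 < t < T -> is_derive t 1 (prim S) (S t) ->
  (fun n => maj n.+1 t) @ \oo --> 12 * S t.
Proof.
move=> /andP[t0 tT] /is_derive1P dS; apply/cvgrPdist_le => e e0.
have e12 : 0 < e / 12 by rewrite divr_gt0.
have [d d0 hd] := dS _ e12.
have Tt : 0 < T - t by rewrite subr_gt0.
apply: filterS3 (nat_frac_cvg0 3 t0) (nat_frac_cvg0 3 Tt) (nat_frac_cvg0 3 d0) => n h1 h2 h3.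
have n0 : (0 : R) < n.+1%:R by rewrite ltr0n.
have hh : 0 < 3 / n.+1%:R :> R by rewrite divr_gt0.
rewrite distrC /maj; set h := 3 / n.+1%:R in h1 h2 h3 hh *.
have nE : n.+1%:R = 3 / h :> R by rewrite /h invf_div mulrCA divff ?mulr1// pnatr_eq0.
rewrite !Sprim_id; last 2 first.
- by rewrite subr_ge0 (ltW h1)/=; move: tT hh; lra.
- by apply/andP; split; move: t0 hh h2; lra.
have A1 := hd (t + h); have A2 := hd (t - h).
rewrite (_ : t + h - t = h) in A1; last by ring.
rewrite (_ : t - h - t = - h) in A2; last by ring.
rewrite normrN gtr0_norm// in A2; rewrite gtr0_norm// in A1.
have {}A1 := A1 h3; have {}A2 := A2 h3.
rewrite nE (_ : 2 * (3 / h) * (prim S (t + h) - prim S (t - h)) - 12 * S t =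
  (6 / h) * ((prim S (t + h) - prim S t - S t * h) - (prim S (t - h) - prim S t - S t * - h))); last first.
  by field; rewrite gt_eqF.
rewrite normrM gtr0_norm; last by rewrite divr_gt0.
rewrite mulrAC ler_pdivrMr// mulrC.
apply: (@le_trans _ _ ((e / 12 * h + e / 12 * h) * 6)).
  by rewrite ler_wpM2r//; apply: (le_trans (ler_normB _ _)); exact: lerD.
by rewrite le_eqVlt; apply/orP; left; apply/eqP; field.
Qed.

(** The integral telescopes to 2 n times the difference of the integrals of [Sprim] over the windows
    at [tau] and at 0. The latter is nonnegative, and the former is at most the window length times
    the largest value of the nondecreasing [Sprim]. *)
Lemma maj_int_le n tau : 0 <= tau -> (0 < n)%N ->
  \int[leb]_(t in `[0, tau]) maj n t <= 12 * Sprim (tau + 3 / n%:R).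
Proof.
move=> tau0 n0; have n0R : (0 : R) < n%:R by rewrite ltr0n.
set h := 3 / n%:R; have h0 : 0 < h by rewrite divr_gt0.
have [G dG G0] := antiderivative Sprim_cont Sprim_le0.
have dsh (c t : R) : is_derive t 1 (fun s : R => G (s + c)) (Sprim (t + c)).
  by have := @dshift R G (Sprim (t + c)) (- c) t; rewrite opprK => /(_ (dG _)).
pose F (t : R) : R := 2 * n%:R * (G (t + h) - G (t - h)).
have dF (t : R) : is_derive t 1 F (maj n t) by exact: DZ (DB (dsh h t) (dsh (- h) t)).
rewrite (@FTC2 _ (maj n) F)//; last 2 first.
- by apply: cont_within; exact: maj_cont.
- by apply: cont_within => t; exact: is_derive1_cont (dF t).
have F0 : 0 <= F 0.
  rewrite /F !add0r (G0 (- h)) ?oppr_le0 ?(ltW h0)// subr0 mulr_ge0//.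
  rewrite -(G0 0 (lexx _)); apply: (@derive_ge0_nd _ G Sprim) => //; first exact: ltW.
    by move=> x _; exact: Sprim_ge0.
  by apply: cont_within => t; exact: is_derive1_cont (dG t).
have Fle : F tau <= 12 * Sprim (tau + h).
  have hh : tau - h <= tau + h by move: h0; lra.
  have := @MVT_le _ G Sprim (tau - h) (tau + h) (Sprim (tau + h)) hh (fun x _ => dG x) _ _.
  move=> M; rewrite /F; apply: (@le_trans _ _ (2 * n%:R * (Sprim (tau + h) * (tau + h - (tau - h))))).
    rewrite ler_wpM2l ?mulr_ge0//; apply: le_trans (ler_norm _) (M _ _).
      by move=> x /andP[_ xh]; rewrite ger0_norm ?Sprim_ge0// Sprim_nd// ltW.
    by apply: cont_within => t; exact: is_derive1_cont (dG t).
  by rewrite /h le_eqVlt; apply/orP; left; apply/eqP; field; rewrite gt_eqF.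
by apply: le_trans Fle; rewrite gerBl.
Qed.

Lemma maj_int_lim tau : 0 <= tau <= T -> forall e : R, 0 < e ->
  \forall n \near \oo, \int[leb]_(t in `[0, tau]) maj n.+1 t <= \int[leb]_(t in `[0, tau]) (12 * S t) + e.
Proof.
move=> /andP[t0 tT] e e0.
have e12 : 0 < e / 12 by rewrite divr_gt0.
have /cvgrPdist_le/(_ _ e12)/nbhs_ballP[d /= d0 hd] := @Sprim_cont tau.
apply: filterS (nat_frac_cvg0 3 d0) => n hn.
apply: (le_trans (maj_int_le t0 (ltn0Sn n))).
have n3 : 0 <= 3 / n.+1%:R :> R by rewrite divr_ge0.
have : `|Sprim tau - Sprim (tau + 3 / n.+1%:R)| <= e / 12.
  by apply: hd; rewrite -ball_normE /= opprD addrA subrr sub0r normrN ger0_norm.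
rewrite RintZ//; last exact: (prim_intg IS).
rewrite -/(prim S tau) -Sprim_id ?t0// ler_norml => /andP[+ _].
move: (Sprim tau) (Sprim _) => u v; lra.
Qed.

Variable A : nat.
Hypothesis TA : T <= A%:R.

Lemma tapp'_maj n N (f : R -> 'rV[R]_N -> R) t x : (0 < n)%N -> 0 <= t <= T ->
  (forall u v, 0 <= u -> u <= v -> v <= T -> `|f v x - f u x| <= prim S v - prim S u) ->
  `|tapp' T A n f t x| <= maj n t.
Proof.
move=> n0 tT h; rewrite /maj; apply: (tapp'_le TA n0 (c := f (inner_time T n t) x)) => //.
  by rewrite subr_ge0 Sprim_nd// lerD2l; apply: (@le_trans _ _ 0); rewrite ?oppr_le0 divr_ge0.
move=> s st.
have key u v : `|u - t| <= 3 / n%:R -> `|v - t| <= 3 / n%:R -> inner_time T n u < inner_time T n v ->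
    `|f (inner_time T n v) x - f (inner_time T n u) x| <= Sprim (t + 3 / n%:R) - Sprim (t - 3 / n%:R).
  move=> ut vt uv; have [h1 h2] := inner_time_out T0 uv.
  have /andP[u0 uT] := inner_time_in T0 n u; have /andP[v0 vT] := inner_time_in T0 n v.
  apply: (le_trans (h _ _ (ltW u0) (ltW uv) (ltW vT))).
  rewrite -!Sprim_id ?(ltW u0) ?(ltW uT) ?(ltW v0) ?(ltW vT)//.
  apply: lerB; apply: Sprim_nd.
    by apply: (le_trans h2); move: vt; rewrite ler_norml lerBlDl => /andP[_].
  by apply: le_trans h1; move: ut; rewrite ler_norml lerBrDr => /andP[+ _]; rewrite addrC.
have tt : `|t - t| <= 3 / n%:R by rewrite subrr normr0 divr_ge0.
have [E|E|->] := ltgtP (inner_time T n s) (inner_time T n t).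
- by rewrite distrC; exact: key.
- exact: key.
- by rewrite subrr normr0 subr_ge0 Sprim_nd// lerD2l; apply: (@le_trans _ _ 0); rewrite ?oppr_le0 divr_ge0.
Qed.

End majorant.

(** * The remainder at a fixed time *)

Section integrand.
Context {R : realType}.

Lemma young_wa (n : nat) (w a : 'rV[R]_n) (k th : R) : 0 < th ->
  k * (\sum_i w ord0 i * a ord0 i) <= th * enorm w ^+ 2 + k ^+ 2 / (4 * th) * enorm a ^+ 2.
Proof.
move=> th0; rewrite !enorm_sq_rV !mulr_sumr -big_split /=; apply: ler_sum => i _.
rewrite -subr_ge0.
have -> : th * w ord0 i ^+ 2 + k ^+ 2 / (4 * th) * a ord0 i ^+ 2 - k * (w ord0 i * a ord0 i) =
  th * (w ord0 i - k / (2 * th) * a ord0 i) ^+ 2 by field; rewrite gt_eqF.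
by rewrite mulr_ge0 ?sqr_ge0// ltW.
Qed.

Lemma quad_bound (n : nat) (w : 'rV[R]_n) (g : 'M[R]_n) (G : R) : (forall i j, `|g i j| <= G) ->
  `|\sum_i \sum_j w ord0 i * w ord0 j * g i j| <= n%:R * G * enorm w ^+ 2.
Proof.
move=> gG; apply: (le_trans (ler_norm_sum _ _ _)).
apply: (@le_trans _ _ (\sum_(i < n) \sum_(j < n) G / 2 * (w ord0 i ^+ 2 + w ord0 j ^+ 2))).
  apply: ler_sum => i _; apply: (le_trans (ler_norm_sum _ _ _)); apply: ler_sum => j _.
  have G0 : 0 <= G by apply: le_trans (gG i j).
  rewrite normrM mulrC (_ : G / 2 * _ = G * ((w ord0 i ^+ 2 + w ord0 j ^+ 2) / 2)); last by field.
  apply: ler_pM => //; rewrite normrM -(real_normK (num_real (w ord0 i))) -(real_normK (num_real (w ord0 j))).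
  have := sqr_ge0 (`|w ord0 i| - `|w ord0 j|).
  rewrite sqrrB; move: (`|w ord0 i|) (`|w ord0 j|) => u v.
  rewrite -mulr_natl; move: (u ^+ 2) (v ^+ 2) (u * v) => *; lra.
under eq_bigr do rewrite -mulr_sumr big_split /= sumr_const card_ord.
rewrite -mulr_sumr big_split /= sumr_const card_ord sumrMnl -!enorm_sq_rV.
rewrite -mulr_natl; move: (enorm w ^+ 2) => v.
by rewrite le_eqVlt; apply/orP; left; apply/eqP; field.
Qed.

Lemma tr_bound (n : nat) (g : 'M[R]_n) (G : R) : (forall i j, `|g i j| <= G) -> `|\tr g| <= n%:R * G.
Proof.
move=> gG; apply: (le_trans (ler_norm_sum _ _ _)).
rewrite mulr_natl -[n in leRHS]card_ord -sumr_const; exact: ler_sum.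
Qed.

(** The three summands come from densities near [r1, r2], below r1/2 and above 2 r2, in this
    order. *)
Definition absorb_const (r1 c d : R) : R :=
  (4 * d * c * r1 ^+ 2)^-1 + (4 * d * c)^-1 + (2 * r1 * c)^-1.

(** Only the term linear in v - U is delicate, as the relative energy gives no control of |v - U|^2
    where s is small. Young's inequality leaves [d * W] there, and the factor (s - r)^2/r^2 or 1
    that it produces is bounded by the relative pressure potential. *)
Lemma integrand_scalar (s r r1 r2 c C Pr W A2 quad trg pd wa B1 B2 d : R) :
  0 < r1 -> r1 <= r -> r <= r2 -> 0 <= s -> 0 <= W -> 0 <= A2 -> 0 < c -> 0 < C -> 0 < d ->
  0 <= B1 -> 0 <= B2 ->
  (r1 / 2 <= s <= 2 * r2 -> c * (s - r) ^+ 2 <= Pr) -> (s < r1 / 2 -> c <= Pr) ->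
  (2 * r2 < s -> c * s <= Pr) -> `|pd| <= C * Pr -> `|quad| <= B1 * W -> `|trg| <= B2 ->
  (forall k th, 0 < th -> k * wa <= th * W + k ^+ 2 / (4 * th) * A2) ->
  - (s * quad) - pd * trg + (r - s) / r * wa <=
    d * W + (2 * B1 + C * B2 + r1^-1 + A2 * absorb_const r1 c d) * (2^-1 * s * W + Pr).
Proof.
move=> r10 r1r rr2 s0 W0 A0 c0 C0 d0 B10 B20 hA hB hC hpd hq ht hy.
have r0 : 0 < r by exact: lt_le_trans r1r.
have r20 : 0 < r2 by exact: lt_le_trans rr2.
have P0 : 0 <= Pr by rewrite -(pmulr_rge0 _ C0); exact: le_trans hpd.
have E0 : 0 <= 2^-1 * s * W by rewrite !mulr_ge0.
have t1 : - (s * quad) <= 2 * B1 * (2^-1 * s * W).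
  apply: (le_trans (ler_norm _)); rewrite normrN normrM ger0_norm//.
  apply: (le_trans (ler_wpM2l s0 hq)).
  by rewrite le_eqVlt; apply/orP; left; apply/eqP; field.
have t2 : - (pd * trg) <= C * B2 * Pr.
  apply: (le_trans (ler_norm _)); rewrite normrN normrM mulrAC; exact: ler_pM.
have q1 : 0 <= (4 * d * c * r1 ^+ 2)^-1 by rewrite invr_ge0 ltW// !mulr_gt0// exprn_gt0.
have q2 : 0 <= (4 * d * c)^-1 by rewrite invr_ge0 ltW// !mulr_gt0.
have q3 : 0 <= (2 * r1 * c)^-1 by rewrite invr_ge0 ltW// !mulr_gt0.
have q4 : 0 <= r1^-1 by rewrite invr_ge0 ltW.
have t3 : (r - s) / r * wa <= d * W + r1^-1 * (2^-1 * s * W) + A2 * absorb_const r1 c d * Pr.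
  have E (x y z : R) : A2 * (x + y + z) * Pr = A2 * x * Pr + A2 * y * Pr + A2 * z * Pr by ring.
  rewrite /absorb_const E.
  have z1 : 0 <= A2 * (4 * d * c * r1 ^+ 2)^-1 * Pr by rewrite !mulr_ge0.
  have z2 : 0 <= A2 * (4 * d * c)^-1 * Pr by rewrite !mulr_ge0.
  have z3 : 0 <= A2 * (2 * r1 * c)^-1 * Pr by rewrite !mulr_ge0.
  have z4 : 0 <= r1^-1 * (2^-1 * s * W) by rewrite mulr_ge0.
  have [sl|sl] := ltP s (r1 / 2).
    have kk : ((r - s) / r) ^+ 2 <= 1.
      rewrite exprn_ile1//; first by rewrite divr_ge0 ?ltW// subr_gt0; move: sl r1r r10; lra.
      by rewrite ler_pdivrMr// mul1r gerBl.
    have := hy ((r - s) / r) d d0.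
    have : ((r - s) / r) ^+ 2 / (4 * d) * A2 <= A2 * (4 * d * c)^-1 * Pr.
      rewrite [leLHS]mulrC -[leRHS]mulrA ler_wpM2l//.
      apply: (@le_trans _ _ (4 * d)^-1); first by rewrite ler_piMl// invr_ge0 mulr_ge0// ltW.
      rewrite [in leRHS]invfM -mulrA ler_peMr//; first by rewrite invr_ge0 mulr_ge0// ltW.
      by rewrite ler_pdivlMl// mulr1; exact: hB.
    move: z1 z2 z3 z4.
    by move: (_ / _ * wa) (_ / _ * A2) (A2 * _ * Pr) (A2 * _ * Pr) (A2 * _ * Pr) (r1^-1 * _) (d * W) => *; lra.
  have [su|su] := leP s (2 * r2).
    have := hy ((r - s) / r) d d0.
    have : ((r - s) / r) ^+ 2 / (4 * d) * A2 <= A2 * (4 * d * c * r1 ^+ 2)^-1 * Pr.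
      rewrite [leLHS]mulrC -[leRHS]mulrA ler_wpM2l//.
      have h := hA; rewrite sl su in h; have {}h := h isT.
      have -> : (4 * d * c * r1 ^+ 2)^-1 * Pr = (Pr / c) / r1 ^+ 2 / (4 * d).
        by field; rewrite !gt_eqF// exprn_gt0.
      rewrite ler_pM2r ?invr_gt0 ?mulr_gt0// expr_div_n -sqrrN opprB.
      apply: ler_pM => //.
      - by rewrite sqr_ge0.
      - by rewrite invr_ge0 exprn_ge0// ltW.
      - by rewrite ler_pdivlMr// mulrC.
      - by rewrite lef_pV2 ?posrE ?exprn_gt0// lerXn2r ?nnegrE// ltW.
    move: z1 z2 z3 z4.
    by move: (_ / _ * wa) (_ / _ * A2) (A2 * _ * Pr) (A2 * _ * Pr) (A2 * _ * Pr) (r1^-1 * _) (d * W) => *; lra.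
  have rs : r < s by move: su rr2 r20; lra.
  (* With this weight both coefficients of Young's inequality equal [th], which is at most s/(2 r1):
     the first product goes into the kinetic energy, the second into the linear growth of the
     potential. *)
  pose th := (s - r) / r / 2.
  have th0 : 0 < th by rewrite !divr_gt0// subr_gt0.
  have := hy ((r - s) / r) th th0.
  have -> : ((r - s) / r) ^+ 2 / (4 * th) = th.
    by rewrite /th; field; rewrite (gt_eqF r0) subr_eq0 gt_eqF.
  have hth : th <= s / r1 / 2.
    rewrite /th ler_pM2r ?invr_gt0//; apply: ler_pM; rewrite ?invr_ge0 ?subr_ge0 ?(ltW rs) ?(ltW r0)//.
      by rewrite gerBl ltW.
    by rewrite lef_pV2.
  have h1 : th * W <= r1^-1 * (2^-1 * s * W).
    apply: (le_trans (ler_wpM2r W0 hth)); rewrite le_eqVlt; apply/orP; left; apply/eqP; field.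
    by rewrite gt_eqF.
  have h2 : th * A2 <= A2 * (2 * r1 * c)^-1 * Pr.
    rewrite [leLHS]mulrC -[leRHS]mulrA ler_wpM2l//; apply: (le_trans hth).
    have -> : (2 * r1 * c)^-1 * Pr = (Pr / c) / r1 / 2 by field; rewrite !gt_eqF.
    by rewrite ler_pM2r ?invr_gt0// ler_pM2r ?invr_gt0// ler_pdivlMr// mulrC; exact: hC.
  have dW : 0 <= d * W by rewrite mulr_ge0// ltW.
  move: z1 z2 z3 h1 h2 dW.
  by move: (_ / _ * wa) (th * W) (th * A2) (A2 * _ * Pr) (A2 * _ * Pr) (A2 * _ * Pr) (r1^-1 * _) (d * W) => *; lra.
have u1 : 0 <= 2 * B1 * Pr by rewrite !mulr_ge0.
have u2 : 0 <= C * B2 * (2^-1 * s * W) by rewrite !mulr_ge0// ltW.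
have u3 : 0 <= r1^-1 * Pr by rewrite mulr_ge0.
have u4 : 0 <= A2 * absorb_const r1 c d * (2^-1 * s * W).
  by rewrite !mulr_ge0// /absorb_const !addr_ge0.
have E2 (p1 p2 p3 p4 x y : R) : (p1 + p2 + p3 + p4) * (x + y) =
  p1 * x + p2 * x + p3 * x + p4 * x + (p1 * y + p2 * y + p3 * y + p4 * y) by ring.
rewrite E2; move: t1 t2 t3 u1 u2 u3 u4.
move: (A2 * absorb_const r1 c d) => Z.
move: (_ / _ * wa) (s * quad) (pd * trg) (d * W) (2^-1 * s * W) => e1 e2 e3 e4 e5.
by move: (2 * B1 * e5) (C * B2 * Pr) (r1^-1 * e5) (Z * Pr) (2 * B1 * Pr) (C * B2 * e5) (r1^-1 * Pr) (Z * e5) => *; lra.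
Qed.

End integrand.

(** * Moments of a single measure *)

Section bracket_calculus.
Context {R : realType} {N : nat}.
Local Notation state := (R * 'rV[R]_N)%type.
Variable k : {measure set state -> \bar R}.
Hypothesis k1 : k state_space = 1%E.

Lemma measurable_state_space : measurable (@state_space R N).
Proof.
have -> : @state_space R N = fst @^-1` `[0, +oo[%classic.
  by apply/seteqP; split => y /=; rewrite in_itv /= andbT.
by rewrite -[X in measurable X]setTI; exact: measurable_fst.
Qed.
Let mS := measurable_state_space.

(** Integrability and value are carried together, so that a linear expression in the moments is
    integrated by composing the rules below. *)
Definition br (f : state -> R) (c : R) : Prop := intg k state_space f /\ bracket k f = c.

Lemma brD f g c d : br f c -> br g d -> br (fun y => f y + g y) (c + d).
Proof. by move=> [If <-] [Ig <-]; split; [exact: intgD|exact: RintD]. Qed.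

Lemma brB f g c d : br f c -> br g d -> br (fun y => f y - g y) (c - d).
Proof. by move=> [If <-] [Ig <-]; split; [exact: intgB|exact: RintB]. Qed.

Lemma brZ f a c : br f c -> br (fun y => a * f y) (a * c).
Proof. by move=> [If <-]; split; [exact: intgZ|exact: RintZ]. Qed.

Lemma brN f c : br f c -> br (fun y => - f y) (- c).
Proof. by move=> [If <-]; split; [exact: intgN|exact: RintN]. Qed.

Lemma br_cst c : br (fun=> c) c.
Proof.
split; first by apply: (@intg_bd _ _ _ k _ _ `|c|) => //; rewrite k1 ltry.
by rewrite /bracket Rintegral_cst// k1 mulr1.
Qed.

Lemma br_sum (I : Type) (s : seq I) (F : I -> state -> R) (c : I -> R) :
  (forall i, br (F i) (c i)) -> br (fun y => \sum_(i <- s) F i y) (\sum_(i <- s) c i).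
Proof.
move=> h; split; first by apply: intg_sum => // i _; exact: (h i).1.
by rewrite /bracket Rint_sum// => [|i _]; [apply: eq_bigr => i _; exact: (h i).2|exact: (h i).1].
Qed.

Lemma br_eq f g c : (forall y, 0 <= y.1 -> f y = g y) -> br f c -> br g c.
Proof.
move=> fg [If <-]; split; first exact: eq_intg fg If.
by apply: eq_Rintegral => y; rewrite inE => y0; rewrite fg.
Qed.

Lemma br_intg f : intg k state_space f -> br f (bracket k f).
Proof. by []. Qed.

Lemma br_le f g c d : br f c -> br g d -> (forall y, 0 <= y.1 -> f y <= g y) -> c <= d.
Proof. by move=> [If <-] [Ig <-] fg; apply: ae_le_Rint => //; apply: aeW => y; exact: fg. Qed.

Variable p : R -> R.
Hypothesis pl : pressure_law p.
Local Notation P := (pressure_potential p).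
Local Notation ii i := (fun y : state => y.2 ord0 i).

Hypothesis i_s : intg k state_space fst.
Hypothesis i_v : forall i, intg k state_space (ii i).
Hypothesis i_m : forall i, intg k state_space (fun y => momentum y ord0 i).
Hypothesis i_c : forall i j, intg k state_space (fun y => convection y i j).
Hypothesis i_p : intg k state_space (fun y => p y.1).
Hypothesis i_e : intg k state_space (energy p).

Lemma momentumE (y : state) i : momentum y ord0 i = y.1 * y.2 ord0 i.
Proof. by rewrite mxE. Qed.

Lemma convectionE (y : state) i j : convection y i j = y.1 * (y.2 ord0 i * y.2 ord0 j).
Proof. by rewrite /convection !mxE big_ord1 mxE. Qed.

(** The relative energy expanded with r P'(r) - P(r) = p(r): a combination of exactly those moments
    that the definition of the solution makes integrable in space and time. *)
Definition rel_energy (r : R) (U : 'rV[R]_N) : R :=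
  bracket k (energy p) - \sum_i U ord0 i * bracket k (fun y => momentum y ord0 i) +
  2^-1 * enorm U ^+ 2 * bracket k fst - P1 p r * bracket k fst + p r.

Lemma enorm_sqB n (v U : 'rV[R]_n) : enorm (v - U) ^+ 2 =
  enorm v ^+ 2 - 2 * (\sum_i U ord0 i * v ord0 i) + enorm U ^+ 2.
Proof.
rewrite !enorm_sq_rV mulr_sumr -sumrB -big_split /=; apply: eq_bigr => i _.
by rewrite !mxE; ring.
Qed.

Lemma redE (r : R) (U : 'rV[R]_N) y : 0 < r ->
  relative_energy_density p r U y = 2^-1 * y.1 * enorm (y.2 - U) ^+ 2 + Prel P (P1 p) y.1 r.
Proof. by move=> r0; rewrite /relative_energy_density derive1P// /Prel !addrA. Qed.

Lemma br_rel_energy (r : R) (U : 'rV[R]_N) : 0 < r ->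
  br (relative_energy_density p r U) (rel_energy r U).
Proof.
move=> r0; have h := brD (brB (brD (brB (br_intg i_e)
  (br_sum (index_enum 'I_N) (fun i => brZ (U ord0 i) (br_intg (i_m i)))))
  (brZ (2^-1 * enorm U ^+ 2) (br_intg i_s))) (brZ (P1 p r) (br_intg i_s))) (br_cst (p r)).
apply: br_eq h => y _; rewrite redE// (PrelE (@P1_eq R p))//.
rewrite enorm_sqB /energy.
under eq_bigr do rewrite momentumE mulrCA.
rewrite -mulr_sumr; move: (\sum_i _) (enorm y.2 ^+ 2) (enorm U ^+ 2) (P1 p r) (P y.1) (p r) y.1 => *.
by field.
Qed.

(** The classical remainder of the relative energy inequality, where [g] stands for grad U and [a]
    for div S(grad U). [integrand_mean] is its mean, written through moments as the weak equations
    produce it. *)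
Definition integrand (r : R) (U : 'rV[R]_N) (g : 'M[R]_N) (a : 'rV[R]_N) (y : state) : R :=
  - (y.1 * \sum_i \sum_j (y.2 - U) ord0 i * (y.2 - U) ord0 j * g i j)
  - (p y.1 - derive1 p r * (y.1 - r) - p r) * \tr g
  + (r - y.1) / r * (\sum_i (y.2 - U) ord0 i * a ord0 i).

Definition integrand_mean (r : R) (U : 'rV[R]_N) (g : 'M[R]_N) (a : 'rV[R]_N) : R :=
  let rho := bracket k fst in let m i := bracket k (fun y => momentum y ord0 i) in
  - (\sum_i \sum_j (bracket k (fun y => convection y i j) - U ord0 j * m i - U ord0 i * m j
       + U ord0 i * U ord0 j * rho) * g i j)
  - (bracket k (fun y => p y.1) - derive1 p r * (rho - r) - p r) * \tr g
  + \sum_i ((bracket k (ii i) - U ord0 i) - r^-1 * (m i - U ord0 i * rho)) * a ord0 i.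

Lemma br_integrand (r : R) (U : 'rV[R]_N) (g : 'M[R]_N) (a : 'rV[R]_N) : 0 < r ->
  br (integrand r U g a) (integrand_mean r U g a).
Proof.
move=> r0; rewrite /integrand_mean.
apply: (br_eq (f := fun y => - (\sum_i \sum_j (convection y i j - U ord0 j * momentum y ord0 i
     - U ord0 i * momentum y ord0 j + U ord0 i * U ord0 j * y.1) * g i j)
  - (p y.1 - derive1 p r * (y.1 - r) - p r) * \tr g
  + \sum_i ((y.2 ord0 i - U ord0 i) - r^-1 * (momentum y ord0 i - U ord0 i * y.1)) * a ord0 i)).
  move=> y _; rewrite /integrand; congr (- _ - _ + _).
    rewrite mulr_sumr; apply: eq_bigr => i _; rewrite mulr_sumr; apply: eq_bigr => j _.
    by rewrite convectionE !momentumE !mxE; ring.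
  rewrite mulr_sumr; apply: eq_bigr => i _; rewrite momentumE !mxE.
  by field; rewrite gt_eqF.
have brM f c e : br f c -> br (fun y => f y * e) (c * e).
  by move=> h; rewrite mulrC; apply: br_eq (brZ e h) => y _; rewrite mulrC.
apply: brD; [apply: brB|].
- apply: brN; apply: br_sum => i; apply: br_sum => j; apply: brM; apply: brD; last exact/brZ.
  by apply: brB; [apply: brB; [exact: br_intg|exact/brZ]|exact/brZ].
- apply: brM; apply: brB; last exact: br_cst.
  apply: brB; first exact: br_intg.
  by apply: brZ; apply: brB; [exact: br_intg|exact: br_cst].
- apply: br_sum => i; apply: brM; apply: brB.
    by apply: brB; [exact: br_intg|exact: br_cst].
  by apply: brZ; apply: brB; [exact: br_intg|exact/brZ].
Qed.

Theorem integrand_mean_le (r r1 r2 c C d G A2 : R) (U : 'rV[R]_N) (g : 'M[R]_N) (a : 'rV[R]_N) (w : R) :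
  0 < r1 -> r1 <= r -> r <= r2 -> 0 < c -> 0 < C -> 0 < d ->
  (forall s, 0 <= s -> [/\ r1 / 2 <= s <= 2 * r2 -> c * (s - r) ^+ 2 <= Prel P (P1 p) s r,
      s < r1 / 2 -> c <= Prel P (P1 p) s r, 2 * r2 < s -> c * s <= Prel P (P1 p) s r &
      `|p s - derive1 p r * (s - r) - p r| <= C * Prel P (P1 p) s r]) ->
  (forall i j, `|g i j| <= G) -> 0 <= G -> enorm a ^+ 2 <= A2 ->
  br (fun y => enorm (y.2 - U) ^+ 2) w ->
  integrand_mean r U g a <= d * w +
    (2 * (N%:R * G) + C * (N%:R * G) + r1^-1 + A2 * absorb_const r1 c d) * rel_energy r U.
Proof.
move=> r10 r1r rr2 c0 C0 d0 hP gG G0 aA hw.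
have r0 : 0 < r by exact: lt_le_trans r1r.
have h := brD (brZ d hw) (brZ (2 * (N%:R * G) + C * (N%:R * G) + r1^-1 + A2 * absorb_const r1 c d)
   (br_rel_energy U r0)).
apply: (br_le (br_integrand U g a r0) h) => y y0.
rewrite redE// /integrand; have [h1 h2 h3 h4] := hP _ y0.
have H := @integrand_scalar R y.1 r r1 r2 c C (Prel P (P1 p) y.1 r) (enorm (y.2 - U) ^+ 2) A2
  (\sum_i \sum_j (y.2 - U) ord0 i * (y.2 - U) ord0 j * g i j) (\tr g)
  (p y.1 - derive1 p r * (y.1 - r) - p r) (\sum_i (y.2 - U) ord0 i * a ord0 i) (N%:R * G) (N%:R * G) d.
apply: H => //.
- exact: sqr_ge0.
- by apply: le_trans aA; exact: sqr_ge0.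
- by rewrite mulr_ge0.
- by rewrite mulr_ge0.
- exact: quad_bound.
- exact: tr_bound.
- move=> k' th th0; apply: (le_trans (young_wa _ _ _ th0)); rewrite lerD2l ler_wpM2l//.
  by rewrite divr_ge0 ?sqr_ge0// mulr_ge0// ltW.
Qed.

End bracket_calculus.

(** * The remainder and the dissipation at a fixed time *)

Section fixed_time.
Context {R : realType} {N : nat}.
Local Notation space := 'rV[R]_N.
Local Notation state := (R * 'rV[R]_N)%type.
Local Notation lebN := (lebesgue_rV R N).
Variables (Omega : set space) (bd : nat).
Hypothesis oO : open Omega.
Hypothesis OA : forall x l, Omega x -> `|x ord0 l| <= bd%:R.

Let mO : measurable Omega. Proof. exact: open_measurable_rV. Qed.
Let OcO : Omega `<=` closure Omega. Proof. exact: subset_closure. Qed.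

(** A record, so that the closure rules below act on an opaque predicate instead of the unfolded
    continuity statement. *)
Record clc (f : space -> R) : Prop := Clc { clcP : {within closure Omega, continuous f} }.

Lemma clc_L2 (g : space -> R) : clc g -> L2 lebN Omega g.
Proof. by case=> cg; exact: closure_L2 oO OA _ cg. Qed.

Lemma cl_meas (g : space -> R) : clc g -> measurable_fun Omega g.
Proof. by move=> cg; case: (clc_L2 cg). Qed.

Lemma cl_intgM (f g : space -> R) : intg lebN Omega f -> clc g ->
  intg lebN Omega (fun x => f x * g x).
Proof.
move=> If cg; have [C _ hC] := continuous_bounded_on (compact_closure_bounded OA) (clcP cg).
apply: (@intg_bdM _ _ _ lebN Omega f g C) => //; first exact: cl_meas.
by move=> x /OcO; exact: hC.
Qed.

Lemma cl_intg (g : space -> R) : clc g -> intg lebN Omega g.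
Proof.
move=> cg; have [C _ hC] := continuous_bounded_on (compact_closure_bounded OA) (clcP cg).
apply: (@intg_bd _ _ _ lebN Omega g C) => //; [exact: Omega_finite OA|exact: cl_meas|].
by move=> x /OcO; exact: hC.
Qed.

Lemma clD (f g : space -> R) : clc f ->
  clc g -> clc (fun x => f x + g x).
Proof. by move=> [cf] [cg]; split => z; apply: cvgD; [exact: cf|exact: cg]. Qed.

Lemma clM (f g : space -> R) : clc f ->
  clc g -> clc (fun x => f x * g x).
Proof. by move=> [cf] [cg]; split => z; apply: cvgM; [exact: cf|exact: cg]. Qed.

Lemma cl_cst (a : R) : clc (fun=> a).
Proof. by split => z; exact: cvg_cst. Qed.

Lemma cl_sum (I : Type) (s : seq I) (F : I -> space -> R) :
  (forall i, clc (F i)) ->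
  clc (fun x => \sum_(i <- s) F i x).
Proof.
move=> cF; elim: s => [|a s IH].
  by rewrite (_ : (fun x => _) = fun=> 0); [exact: cl_cst|apply/funext => x; rewrite big_nil].
rewrite (_ : (fun x => _) = (fun x => F a x + \sum_(i <- s) F i x)); first exact: clD.
by apply/funext => x; rewrite big_cons.
Qed.

Lemma cl_comp (f : space -> R) (h : R -> R) : clc f ->
  (forall x, closure Omega x -> {for f x, continuous h}) ->
  clc (fun x => h (f x)).
Proof.
move=> [cf] ch; split; apply: near_within => x e cx e0.
have /cvgrPdist_lt/(_ e e0)/nbhs_ballP[d /= d0 hd] := ch x cx.
by apply: filterS (within_near cf cx d0) => y hy cy; apply: hd; exact: hy.
Qed.

Variables (p : R -> R) (mu eta : R).
Hypothesis pl : pressure_law p.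
Hypothesis mu0 : 0 < mu.
Hypothesis eta0 : 0 <= eta.
Local Notation p' := (derive1 p).

Variables (k : space -> {measure set state -> \bar R}) (gu : space -> 'M[R]_N).
Let rho x := bracket (k x) fst.
Let m i x := bracket (k x) (fun y => momentum y ord0 i).
Let c i j x := bracket (k x) (fun y => convection y i j).
Let pi x := bracket (k x) (fun y => p y.1).
Let u i x := bracket (k x) (fun y => y.2 ord0 i).
Hypothesis I_rho : intg lebN Omega rho.
Hypothesis I_m : forall i, intg lebN Omega (m i).
Hypothesis I_c : forall i j, intg lebN Omega (c i j).
Hypothesis I_pi : intg lebN Omega pi.
Hypothesis Wu : forall i, Wapp Omega (u i) (fun j x => gu x i j).

Variables (r : space -> R) (U Ut gr : space -> space) (gU : space -> 'M[R]_N) (divS : space -> space).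
Hypothesis r0 : forall x, closure Omega x -> 0 < r x.
Hypothesis cr : clc r.
Hypothesis cgr : forall i, clc (fun x => gr x ord0 i).
Hypothesis cU : forall i, clc (fun x => U x ord0 i).
Hypothesis cgU : forall i j, clc (fun x => gU x i j).
Hypothesis cUt : forall i, clc (fun x => Ut x ord0 i).
Hypothesis dr : forall x j, Omega x -> is_derive x (e_ j) r (gr x ord0 j).
Hypothesis dU : forall x i j, Omega x -> is_derive x (e_ j) (fun x => U x ord0 i) (gU x i j).
Hypothesis U0 : forall x, (closure Omega `\` Omega) x -> U x = 0.

(** The left-hand side of the momentum equation after the continuity equation is used. It represents
    div S almost everywhere, and unlike div S it is continuous up to the boundary at almost every
    time. *)
Definition force (x : space) : space := \row_i (r x * Ut x ord0 i +
  r x * (\sum_j U x ord0 j * gU x i j) + p' (r x) * gr x ord0 i).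

Hypothesis wd : weak_divergence Omega (fun x => viscous_stress mu eta (gU x)) divS.
Hypothesis strong : {ae lebN, forall x, Omega x -> forall i, force x ord0 i = divS x ord0 i}.

Let cforce i : clc (fun x => force x ord0 i).
Proof.
rewrite (_ : (fun x => _) = (fun x => r x * Ut x ord0 i +
  r x * (\sum_j U x ord0 j * gU x i j) + p' (r x) * gr x ord0 i)); last first.
  by apply/funext => x; rewrite mxE.
apply: clD; last first.
  by apply: clM => //; apply: cl_comp => // x cx; apply: (p'_cont pl); exact: r0.
apply: clD; first exact: clM.
by apply: clM => //; apply: cl_sum => j; exact: clM.
Qed.

Let WU i : Wapp Omega (fun x => U x ord0 i) (fun j x => gU x i j).
Proof.
apply: (Wapp_C1 oO OA) => //.
- exact: clcP (cU i).
- by move=> j; exact: clcP (cgU i j).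
- by move=> x /U0 ->; rewrite mxE.
Qed.

Let Ww i : Wapp Omega (fun x => u i x - U x ord0 i) (fun j x => (gu x - gU x) i j).
Proof.
have := Wapp_sub oO OA (Wu i) (WU i); rewrite (_ : (fun j x => _) = (fun j x => (gu x - gU x) i j))//.
by apply/funext => j; apply/funext => x; rewrite !mxE.
Qed.

Let LgU i j : L2 lebN Omega (fun x => gU x i j).
Proof. exact: clc_L2 (cgU i j). Qed.

Let Lgu i j : L2 lebN Omega (fun x => gu x i j).
Proof. by have [_ + _] := Wu i; exact. Qed.

Let Lgw i j : L2 lebN Omega (fun x => (gu x - gU x) i j).
Proof. by have [_ + _] := Ww i; exact. Qed.

Let cS i j : clc (fun x => viscous_stress mu eta (gU x) i j).
Proof.
have ctr : clc (fun x => \tr (gU x)) by apply: cl_sum => l; exact: cgU.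
have cc := cl_cst.
rewrite (_ : (fun x => _) = (fun x => mu * (gU x i j + gU x j i + (- (2 / 3) * (i == j)%:R) * \tr (gU x))
   + (eta * (i == j)%:R) * \tr (gU x))); last first.
  apply/funext => x; rewrite !mxE; case: (i == j); rewrite ?mulr1n ?mulr0n; ring.
by repeat (first [apply: clD|apply: clM]).
Qed.

(* [div S] pairs with [u - U] although [grad u] is only a weak gradient. *)
Lemma force_pairing : \int[lebN]_(x in Omega) inner (viscous_stress mu eta (gU x)) (gu x - gU x) =
  - \int[lebN]_(x in Omega) \sum_i (u i x - U x ord0 i) * force x ord0 i.
Proof.
have Lf i : L2 lebN Omega (fun x => force x ord0 i) := clc_L2 (cforce i).
have LS i j : L2 lebN Omega (fun x => viscous_stress mu eta (gU x) i j) := clc_L2 (cS i j).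
have Lw i : L2 lebN Omega (fun x => u i x - U x ord0 i) by have [+ _ _] := Ww i; exact.
rewrite Rint_sum//; last by move=> i _; apply: intg_sum => // j _; exact: L2M.
rewrite Rint_sum//; last by move=> i _; exact: L2M.
rewrite -sumrN; apply: eq_bigr => i _; rewrite Rint_sum//; last by move=> j _; exact: L2M.
rewrite [X in - X](@eq_Rintegral _ _ _ lebN Omega (fun x => force x ord0 i * (u i x - U x ord0 i))); last first.
  by move=> x _; rewrite mulrC.
apply: (@W_weakdiv R N Omega bd oO OA _ _ (fun j x => viscous_stress mu eta (gU x) i j) _ (LS i) (Lf i) _ (Ww i)).
move=> phi tp; have [w1 w2] := wd.
have [Lp Lp'] := test_L2 oO OA tp.
transitivity (\int[lebN]_(x in Omega) inner (row i (viscous_stress mu eta (gU x))) (grad phi x)).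
  rewrite -Rint_sum//; last by move=> j _; exact: L2M.
  apply: eq_Rintegral => x _; rewrite /inner big_ord1; apply: eq_bigr => j _.
  by rewrite !mxE.
rewrite w2//; congr (- _).
have [sp [K [cK KO f0]]] := tp.
have mK : measurable K by apply: closed_measurable_rV; apply: compact_closed => //; exact: norm_hausdorff.
(* The distributional divergence is integrable only on compact subsets, so the integrals are cut
   down to the support of the test function before the two representatives are identified. *)
have toK (f : space -> R) : \int[lebN]_(x in Omega) (f x * phi x) = \int[lebN]_(x in K) (f x * phi x).
  rewrite Rintegral_mkcond [RHS]Rintegral_mkcond; apply: eq_Rintegral => x _; rewrite !patchE.
  have [/[dup]Kx /KO Ox|nKx] := pselect (K x).
    by rewrite !mem_set.
  by rewrite (memNset nKx); case: ifP => // _; rewrite f0// mulr0.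
rewrite !toK; apply: ae_eq_Rint => //.
- apply: measurable_funM; first exact: intg_meas (w1 _ i cK KO).
  by apply: (measurable_funS _ KO) => //; case: Lp.
- apply: (measurable_funS _ KO) => //; apply: measurable_funM; first by case: (Lf i).
  by case: Lp.
- by apply: (ae_S strong) => x h /KO Ox; rewrite h.
Qed.

(** The integrand is the divergence of p(r) U, which belongs to W^{1,2}_0, and gradients there have
    mean zero. *)
Lemma int_div_pressure : \int[lebN]_(x in Omega)
  (p' (r x) * (\sum_j U x ord0 j * gr x ord0 j) + p (r x) * \tr (gU x)) = 0.
Proof.
have cpr : clc (fun x => p (r x)).
  by apply: cl_comp => // x cx; apply: (p_cont pl); exact: r0.
have cp'r : clc (fun x => p' (r x)).
  by apply: cl_comp => // x cx; apply: (p'_cont pl); exact: r0.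
have cG j i : clc (fun x => p' (r x) * gr x ord0 i * U x ord0 j + p (r x) * gU x j i).
  by apply: clD; apply: clM => //; exact: clM.
have W j : Wapp Omega (fun x => p (r x) * U x ord0 j)
    (fun i x => p' (r x) * gr x ord0 i * U x ord0 j + p (r x) * gU x j i).
  apply: (Wapp_C1 oO OA).
  - exact: clcP (clM cpr (cU j)).
  - by move=> i; exact: clcP (cG j i).
  - by move=> x /U0 ->; rewrite mxE mulr0.
  move=> x i Ox; apply: DM; last exact: dU.
  by apply: Dcomp; [apply: (dp pl); apply: r0; exact: OcO|exact: dr].
rewrite (@eq_Rintegral _ _ _ lebN Omega (fun x => \sum_j (p' (r x) * gr x ord0 j * U x ord0 j + p (r x) * gU x j j))).
  rewrite Rint_sum//; last by move=> j _; exact: cl_intg.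
  by apply: big1 => j _; exact: (W_int_grad oO OA j (W j)).
move=> x _; rewrite /mxtrace !mulr_sumr -big_split /=; apply: eq_bigr => j _.
by congr (_ + _); ring.
Qed.

Let rt x := - (\sum_j U x ord0 j * gr x ord0 j + r x * \tr (gU x)).

Lemma fixed_time_poincare :
  [/\ intg lebN Omega (fun x => \sum_i (u i x - U x ord0 i) ^+ 2),
      intg lebN Omega (fun x => enorm (gu x - gU x) ^+ 2) &
  \int[lebN]_(x in Omega) (\sum_i (u i x - U x ord0 i) ^+ 2) <=
  16 * bd%:R ^+ 2 * \int[lebN]_(x in Omega) (enorm (gu x - gU x) ^+ 2)].
Proof.
have Iw i : intg lebN Omega (fun x => (u i x - U x ord0 i) ^+ 2) by have [[]] := Ww i.
have Ig i j : intg lebN Omega (fun x => (gu x - gU x) i j ^+ 2) by have [_ h _] := Ww i; have [_] := h j; exact.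
have EG : (fun x => enorm (gu x - gU x) ^+ 2) = (fun x => \sum_i \sum_j (gu x - gU x) i j ^+ 2).
  by apply/funext => x; rewrite enorm_sq.
have IG i : intg lebN Omega (fun x => \sum_j (gu x - gU x) i j ^+ 2) by exact: intg_sum.
split; [exact: intg_sum|by rewrite EG; exact: intg_sum|].
rewrite EG Rint_sum// Rint_sum// mulr_sumr; apply: ler_sum => i _.
apply: le_trans (W_poincare oO OA i (Ww i)) _; rewrite ler_wpM2l ?mulr_ge0 ?exprn_ge0//.
apply: ae_le_Rint => //; apply: aeW => x _; rewrite (bigD1 i)//= lerDl.
by apply: sumr_ge0 => j _; exact: sqr_ge0.
Qed.

(** The terms that remain from the weak equations become the quadratic remainder once the pairing of
    [force] with u - U is exchanged for the stress S(grad U). The three stress integrals then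
    combine into the viscous form of u - U, which Korn's inequality bounds from below by mu times
    the squared gradient. *)
Theorem fixed_time_estimate :
  intg lebN Omega (fun x => integrand_mean (k x) p (r x) (U x) (gU x) (force x)) /\
  - (\int[lebN]_(x in Omega) (\sum_i (m i x - rho x * U x ord0 i) * Ut x ord0 i)) +
  \int[lebN]_(x in Omega) (- (\sum_i \sum_j c i j x * gU x i j) - pi x * \tr (gU x) +
     (\sum_j m j x * \sum_i U x ord0 i * gU x i j)
     - p' (r x) / r x * (rho x * rt x + \sum_j m j x * gr x ord0 j) + p' (r x) * rt x) +
  \int[lebN]_(x in Omega) inner (viscous_stress mu eta (gu x)) (gU x)
  <= \int[lebN]_(x in Omega) integrand_mean (k x) p (r x) (U x) (gU x) (force x)
     + \int[lebN]_(x in Omega) inner (viscous_stress mu eta (gu x)) (gu x)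
     - mu * \int[lebN]_(x in Omega) (enorm (gu x - gU x) ^+ 2).
Proof.
have cpr : clc (fun x => p (r x)).
  by apply: cl_comp => // x cx; apply: (p_cont pl); exact: r0.
have cp'r : clc (fun x => p' (r x)).
  by apply: cl_comp => // x cx; apply: (p'_cont pl); exact: r0.
have cri : clc (fun x => (r x)^-1).
  by apply: cl_comp => // x cx; apply: (@continuousV _ _ id); rewrite ?gt_eqF ?r0.
have ctr : clc (fun x => \tr (gU x)) by apply: cl_sum => l; exact: cgU.
have cc := cl_cst.
have crt : clc rt.
  rewrite (_ : rt = (fun x => -1 * (\sum_j U x ord0 j * gr x ord0 j + r x * \tr (gU x)))); last first.
    by apply/funext => x; rewrite mulN1r.
  by apply: clM => //; apply: clD; [apply: cl_sum => j; exact: clM|exact: clM].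
have iA : intg lebN Omega (fun x => \sum_i (m i x - rho x * U x ord0 i) * Ut x ord0 i).
  by apply: intg_sum => // i _; apply: cl_intgM => //; apply: intgB => //; exact: cl_intgM.
have iB : intg lebN Omega (fun x => - (\sum_i \sum_j c i j x * gU x i j) - pi x * \tr (gU x) +
     (\sum_j m j x * \sum_i U x ord0 i * gU x i j)
     - p' (r x) / r x * (rho x * rt x + \sum_j m j x * gr x ord0 j) + p' (r x) * rt x).
  apply: intgD => //; last by apply: cl_intg; exact: clM.
  apply: intgB => //; last first.
    apply: (@eq_intg _ _ _ lebN Omega (fun x => (rho x * rt x + \sum_j m j x * gr x ord0 j) * (p' (r x) * (r x)^-1))) => //.
      by move=> x _; rewrite mulrC.
    apply: cl_intgM; last exact: clM.
    by apply: intgD => //; [exact: cl_intgM|apply: intg_sum => // j _; exact: cl_intgM].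
  apply: intgD => //; last first.
    by apply: intg_sum => // j _; apply: cl_intgM => //; apply: cl_sum => i; exact: clM.
  apply: intgB => //; last exact: cl_intgM.
  by apply: intgN => //; apply: intg_sum => // i _; apply: intg_sum => // j _; exact: cl_intgM.
have iC := cl_intg (clD (clM cp'r (@cl_sum _ (index_enum 'I_N) _ (fun j => clM (cU j) (cgr j)))) (clM cpr ctr)).
have Lf i : L2 lebN Omega (fun x => force x ord0 i) := clc_L2 (cforce i).
have Lw i : L2 lebN Omega (fun x => u i x - U x ord0 i) by have [+ _ _] := Ww i; exact.
have iD : intg lebN Omega (fun x => \sum_i (u i x - U x ord0 i) * force x ord0 i).
  by apply: intg_sum => // i _; exact: L2M.
(* The remainder regrouped: the terms of the weak equations, then div(p(r) U), which integrates to
   0, then (u - U) . [force], which [force_pairing] evaluates. *)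
pose F x := - (\sum_i (m i x - rho x * U x ord0 i) * Ut x ord0 i) +
  (- (\sum_i \sum_j c i j x * gU x i j) - pi x * \tr (gU x) +
     (\sum_j m j x * \sum_i U x ord0 i * gU x i j)
     - p' (r x) / r x * (rho x * rt x + \sum_j m j x * gr x ord0 j) + p' (r x) * rt x) +
  (p' (r x) * (\sum_j U x ord0 j * gr x ord0 j) + p (r x) * \tr (gU x)) +
  \sum_i (u i x - U x ord0 i) * force x ord0 i.
have E0 x : Omega x -> integrand_mean (k x) p (r x) (U x) (gU x) (force x) = F x.
  move=> Ox; have rx := r0 (OcO Ox).
  rewrite /integrand_mean -/(rho x) -/(pi x).
  have -> : \sum_i ((bracket (k x) (fun y => y.2 ord0 i) - U x ord0 i) -
       (r x)^-1 * (bracket (k x) (fun y => momentum y ord0 i) - U x ord0 i * rho x)) * force x ord0 i =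
     \sum_i (u i x - U x ord0 i) * force x ord0 i
     - (\sum_i (m i x - rho x * U x ord0 i) * Ut x ord0 i)
     - (\sum_i \sum_j (m i x - rho x * U x ord0 i) * (U x ord0 j * gU x i j))
     - p' (r x) / r x * (\sum_i (m i x * gr x ord0 i)) + p' (r x) / r x * rho x * (\sum_i U x ord0 i * gr x ord0 i).
    rewrite !mulr_sumr -!sumrB -big_split /=; apply: eq_bigr => i _.
    rewrite -mulr_sumr /u /m mxE; move: (\sum_j _) => s1.
    by move: (bracket _ _) (bracket _ _) => v1 v2; field; rewrite gt_eqF.
  have -> : \sum_i \sum_j (bracket (k x) (fun y => convection y i j) -
       U x ord0 j * bracket (k x) (fun y => momentum y ord0 i) - U x ord0 i * bracket (k x) (fun y => momentum y ord0 j)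
       + U x ord0 i * U x ord0 j * rho x) * gU x i j =
     (\sum_i \sum_j c i j x * gU x i j)
     - (\sum_i \sum_j (m i x - rho x * U x ord0 i) * (U x ord0 j * gU x i j))
     - (\sum_j m j x * \sum_i U x ord0 i * gU x i j).
    have -> : \sum_j m j x * (\sum_i U x ord0 i * gU x i j) = \sum_i \sum_j m j x * (U x ord0 i * gU x i j).
      by rewrite [RHS]exchange_big; apply: eq_bigr => j _; rewrite mulr_sumr.
    rewrite -!sumrB; apply: eq_bigr => i _; rewrite -!sumrB; apply: eq_bigr => j _.
    by rewrite /c /m; ring.
  rewrite /F /rt.
  move: (\sum_i \sum_j c i j x * gU x i j)
    (\sum_i \sum_j (m i x - rho x * U x ord0 i) * (U x ord0 j * gU x i j))
    (\sum_j m j x * \sum_i U x ord0 i * gU x i j) (\sum_i (u i x - U x ord0 i) * force x ord0 i)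
    (\sum_i (m i x - rho x * U x ord0 i) * Ut x ord0 i) (\sum_i m i x * gr x ord0 i)
    (\sum_i U x ord0 i * gr x ord0 i) (\tr (gU x)) (rho x) (pi x) (p' (r x)) (p (r x)) => *.
  move: rx; move: (r x) => q rx; by field; rewrite gt_eqF.
have E : \int[lebN]_(x in Omega) integrand_mean (k x) p (r x) (U x) (gU x) (force x) = \int[lebN]_(x in Omega) F x.
  by apply: eq_Rintegral => x; rewrite inE; exact: E0.
have [iV iVU] := (intg_viscous oO mu eta Lgu Lgu, intg_viscous oO mu eta Lgu LgU).
have iUw := intg_viscous oO mu eta LgU Lgw.
have iww := intg_viscous oO mu eta Lgw Lgw.
have EF : \int[lebN]_(x in Omega) F x =
  - (\int[lebN]_(x in Omega) \sum_i (m i x - rho x * U x ord0 i) * Ut x ord0 i) +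
  \int[lebN]_(x in Omega) (- (\sum_i \sum_j c i j x * gU x i j) - pi x * \tr (gU x) +
     (\sum_j m j x * \sum_i U x ord0 i * gU x i j)
     - p' (r x) / r x * (rho x * rt x + \sum_j m j x * gr x ord0 j) + p' (r x) * rt x) +
  \int[lebN]_(x in Omega) \sum_i (u i x - U x ord0 i) * force x ord0 i.
  have iNA := intgN mO iA; have i2 := intgD mO iNA iB.
  rewrite /F (RintD mO (intgD mO i2 iC) iD) (RintD mO i2 iC) int_div_pressure addr0.
  by rewrite (RintD mO iNA iB) RintN.
split.
  apply: (@eq_intg _ _ _ lebN Omega F) => //; first by move=> x Ox; rewrite E0.
  have iNA := intgN mO iA; have i2 := intgD mO iNA iB.
  exact: (intgD mO (intgD mO i2 iC) iD).
rewrite E EF.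
have FP := force_pairing.
have K := korn oO OA mu0 eta0 Ww.
have EW : \int[lebN]_(x in Omega) inner (viscous_stress mu eta (gu x - gU x)) (gu x - gU x) =
  \int[lebN]_(x in Omega) inner (viscous_stress mu eta (gu x)) (gu x) -
  \int[lebN]_(x in Omega) inner (viscous_stress mu eta (gu x)) (gU x) -
  \int[lebN]_(x in Omega) inner (viscous_stress mu eta (gU x)) (gu x - gU x).
  rewrite -!RintB//; last exact: intgB.
  apply: eq_Rintegral => x _; rewrite viscousB innerDl innerNl [in X in _ = X - _]innerC.
  congr (_ - _); rewrite innerC innerDl innerNl ![inner _ (viscous_stress mu eta (gu x))]innerC.
  by [].
rewrite EW FP in K; move: K.
move: (\int[lebN]_(x in Omega) _) (\int[lebN]_(x in Omega) _) (\int[lebN]_(x in Omega) _) (\int[lebN]_(x in Omega) _)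
  (\int[lebN]_(x in Omega) _) (\int[lebN]_(x in Omega) _) => *; lra.
Qed.

End fixed_time.

(** * A measurable bound for the time derivative of the velocity *)

Section time_majorant.
Context {R : realType} {N : nat}.
Local Notation space := 'rV[R]_N.
Local Notation leb := (@lebesgue_measure R).
Variables (T : R) (Omega : set space) (bd : nat) (Ut : R -> space -> space).
Hypothesis T0 : 0 < T.
Hypothesis oO : open Omega.
Hypothesis O0 : Omega !=set0.
Hypothesis OA : forall x l, Omega x -> `|x ord0 l| <= bd%:R.
Hypothesis cUt : {ae leb, forall t, 0 < t < T ->
    forall i, {within closure Omega, continuous (fun x => Ut t x ord0 i)}}.
Hypothesis mUt : forall x i, closure Omega x -> measurable_fun `[0, T] (fun t => Ut t x ord0 i).
Hypothesis L2Ut : (\int[leb]_(t in `[0%R, T])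
    (sup_on (closure Omega) (fun x => enorm (Ut t x)) ^+ 2)%:E < +oo)%E.

Lemma le_sup_on {X : Type} (K : set X) (g : X -> R) (x : X) (C : R) :
  (forall y, K y -> g y <= C) -> K x -> g x <= sup_on K g.
Proof.
move=> gC Kx; apply: ub_le_sup; last by exists x.
by exists C => _ [y Ky <-]; exact: gC.
Qed.

Lemma sup_on_le {X : Type} (K : set X) (g : X -> R) (C : R) : K !=set0 ->
  (forall y, K y -> g y <= C) -> sup_on K g <= C.
Proof.
move=> [x Kx] gC; apply: ge_sup; first by exists (g x); exists x.
by move=> _ [y Ky <-]; exact: gC.
Qed.

Lemma enorm_le m n (B : 'M[R]_(m, n)) (C : R) : 0 <= C -> (forall i j, `|B i j| <= C) ->
  enorm B <= m%:R * n%:R * C + C.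
Proof.
move=> C0 h; have mn0 : 0 <= m%:R * n%:R * C + C by rewrite addr_ge0// !mulr_ge0.
rewrite -(@ler_pXn2r _ 2%N)// ?nnegrE ?enorm_ge0// enorm_sq.
apply: (@le_trans _ _ (m%:R * n%:R * C ^+ 2)).
  apply: (@le_trans _ _ (\sum_(i < m) \sum_(j < n) C ^+ 2)).
    apply: ler_sum => i _; apply: ler_sum => j _.
    by rewrite -(real_normK (num_real (B i j))) lerXn2r ?nnegrE.
  by rewrite !sumr_const !card_ord -mulrnA -[leLHS]mulr_natl natrM [X in X * _]mulrC.
have h1 (x : R) : 0 <= x -> x * C ^+ 2 <= (x * C + C) ^+ 2.
  move=> x0; rewrite -subr_ge0.
  have -> : (x * C + C) ^+ 2 - x * C ^+ 2 = (x ^+ 2 + x + 1) * C ^+ 2 by ring.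
  by rewrite mulr_ge0 ?sqr_ge0// !addr_ge0// sqr_ge0.
by apply: h1; rewrite mulr_ge0.
Qed.

Let Q (i : 'rV[rat]_N) : space := rat_rV i.

(** The supremum of the component moduli is taken over rational points of [Omega], which makes it
    measurable in [t]. For almost every [t] continuity extends the bound to the closure, and the
    supremum stays below the sup norm that enters [L2C_norm]. *)
Lemma time_majorant : exists S : R -> R, [/\ intg leb `[0, T] S, forall t, 0 <= S t,
  intg leb `[0, T] (fun t => S t ^+ 2), \int[leb]_(t in `[0, T]) (S t ^+ 2) <= L2C_norm T Omega Ut ^+ 2 &
  {ae leb, forall t, 0 < t < T -> forall i x, closure Omega x -> `|Ut t x ord0 i| <= S t}].
Proof.
have OcO : Omega `<=` closure Omega by exact: subset_closure.
pose g (ik : 'I_N * 'rV[rat]_N) t := if `[< Omega (Q ik.2) >] then `|Ut t (Q ik.2) ord0 ik.1| else 0.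
have mg ik : measurable_fun `[0, T] (g ik).
  rewrite /g; case: asboolP => [Ok|_]; last exact: measurable_cst.
  by apply: measurableT_comp => //; apply: mUt; exact: OcO.
have g0 ik t : 0 <= g ik t by rewrite /g; case: ifP.
have [S [mS S0 hS]] := @ae_sup R _ `[0, T]%classic g (measurable_itv _) mg g0.
have key : {ae leb, forall t, 0 < t < T -> (forall i x, closure Omega x -> `|Ut t x ord0 i| <= S t) /\
    S t <= sup_on (closure Omega) (fun x => enorm (Ut t x))}.
  apply: (ae_S cUt) => t h tt.
  have cK := compact_closure_bounded OA.
  have hb i := continuous_bounded_on cK (h tt i).
  pose C i := sval (cid2 (hb i)).
  have C0 i : 0 <= C i by rewrite /C; case: (cid2 (hb i)).
  have hC i x : closure Omega x -> `|Ut t x ord0 i| <= \sum_j C j.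
    move=> cx; apply: (@le_trans _ _ (C i)); first by rewrite /C; case: (cid2 (hb i)) => c /= _; exact.
    by rewrite (bigD1 i)//= lerDl; exact: sumr_ge0.
  have CC0 : 0 <= \sum_j C j by exact: sumr_ge0.
  have [h1 h2] : (forall ik, g ik t <= S t) /\ forall C, 0 <= C -> (forall ik, g ik t <= C) -> S t <= C.
    apply: hS; exists (\sum_j C j) => -[i k]; rewrite /g /=; case: asboolP => [Ok|_] //.
    by apply: hC; exact: OcO.
  split.
    move=> i x cx; apply: (closure_le oO (fun=> 0) cx (h tt i)); exists 1 => // k Ok _.
    by have := h1 (i, k); rewrite /g /= asboolT.
  have ub x : closure Omega x -> enorm (Ut t x) <= 1%:R * N%:R * (\sum_j C j) + \sum_j C j.
    by move=> cx; apply: enorm_le => // i j; rewrite ord1; exact: hC.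
  apply: h2.
    have [x Ox] := O0; apply: le_trans (le_sup_on ub (OcO _ Ox)); exact: enorm_ge0.
  move=> [i k]; rewrite /g /=; case: asboolP => [Ok|_].
    by apply: le_trans (le_sup_on ub (OcO _ Ok)); exact: entry_le_enorm.
  have [x Ox] := O0; apply: le_trans (le_sup_on ub (OcO _ Ox)); exact: enorm_ge0.
have mS2 : measurable_fun `[0, T] (fun t => S t ^+ 2) by exact: measurable_funX.
have le2 : (\int[leb]_(t in `[0%R, T]) (S t ^+ 2)%:E <=
   \int[leb]_(t in `[0%R, T]) (sup_on (closure Omega) (fun x => enorm (Ut t x)) ^+ 2)%:E)%E.
  apply: ae_nnint_le => //.
  - by move=> t _; rewrite lee_fin sqr_ge0.
  - by move=> t _; rewrite lee_fin sqr_ge0.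
  apply: (ae_S3 key (ae_neq 0) (ae_neq T)) => t h t0 tT; rewrite /= in_itv /= => /andP[t1 t2].
  have tt : 0 < t < T.
    rewrite lt_neqAle t1 andbT lt_neqAle t2 andbT.
    by apply/andP; split; [apply/eqP => e; exact: t0 (esym e)|apply/eqP].
  have [_ h2] := h tt; rewrite lee_fin lerXn2r ?nnegrE//.
  exact: le_trans h2.
have IS2 : intg leb `[0, T] (fun t => S t ^+ 2).
  apply: intgP => //; under eq_integral do rewrite ger0_norm ?sqr_ge0//.
  exact: le_lt_trans le2 L2Ut.
have i1 : intg leb `[0, T] (fun=> 1).
  apply: continuous_compact_integrable; first exact: segment_compact.
  by apply: cont_within => t; exact: cst_continuous.
exists S; split => //.
- apply: (@le_intg _ _ _ leb _ S (fun t => 1 + S t ^+ 2)) => //.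
    move=> t _; rewrite ger0_norm// ger0_norm ?addr_ge0 ?sqr_ge0//.
    have := sqr_ge0 (S t - 1); have := S0 t; rewrite sqrrB mulr1 expr1n -mulr_natl.
    by move: (S t) (S t ^+ 2) => *; lra.
  exact: intgD.
- have I0 : 0 <= \int[leb]_(t in `[0, T]) (sup_on (closure Omega) (fun x => enorm (Ut t x)) ^+ 2).
    by apply: Rintegral_ge0 => t _; exact: sqr_ge0.
  rewrite /L2C_norm sqr_sqrtr// /Rintegral fine_le//.
  + by rewrite ge0_fin_numE ?(le_lt_trans le2)//; apply: integral_ge0 => t _; rewrite lee_fin sqr_ge0.
  + by rewrite ge0_fin_numE//; apply: integral_ge0 => t _; rewrite lee_fin sqr_ge0.
- by apply: (ae_S key) => t h tt; have [] := h tt.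
Qed.

End time_majorant.

Lemma pker_mass {R : realType} {N : nat} d (X : measurableType d) (k : R.-pker X ~> (R * 'rV[R]_N)%type) (z : X) :
  k z (~` state_space) = 0%E -> k z state_space = 1%E.
Proof.
move=> h; have : k z setT = 1%E by exact: prob_kernel.
rewrite -(setUv (@state_space R N)).
rewrite measureU//.
- by move=> E; rewrite -[RHS]E -[LHS]adde0; congr (_ + _)%E; exact/esym/h.
- exact: (@measurable_state_space R N).
- by apply: measurableC; apply: (@measurable_state_space R N).
- exact: setICr.
Qed.

(** * The relative energy inequality *)

Section dominated_limits.
Context d (X : measurableType d) (R : realType) (mu : {measure set X -> \bar R}).
Variable D : set X.
Hypothesis mD : measurable D.

(** The hypotheses of dominated convergence in a form stable under the operations below: bounded
    sequences may be multiplied together and by a fixed integrable function, dominated ones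
    added. *)
Definition bounded_limit (q : nat -> X -> R) (f : X -> R) : Prop :=
  [/\ forall n, measurable_fun D (q n), exists C : R, forall n x, D x -> `|q n x| <= C
    & forall x, D x -> q ^~ x @ \oo --> f x].

Definition dominated_limit (q : nat -> X -> R) (f : X -> R) : Prop :=
  [/\ forall n, measurable_fun D (q n),
    exists2 g, intg mu D g & forall n x, D x -> `|q n x| <= g x
    & forall x, D x -> q ^~ x @ \oo --> f x].

Lemma bl_cst (f : X -> R) (C : R) : measurable_fun D f -> (forall x, D x -> `|f x| <= C) ->
  bounded_limit (fun=> f) f.
Proof. by move=> mf fC; split => //; [exists C => _; exact: fC|move=> x _; exact: cvg_cst]. Qed.

Lemma blM q f q' f' : bounded_limit q f -> bounded_limit q' f' ->
  bounded_limit (fun n x => q n x * q' n x) (fun x => f x * f' x).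
Proof.
move=> [m1 [C1 b1] c1] [m2 [C2 b2] c2]; split.
- by move=> n; exact: measurable_funM.
- by exists (C1 * C2) => n x Dx; rewrite normrM ler_pM ?b1 ?b2.
- by move=> x Dx; apply: cvgM; [exact: c1|exact: c2].
Qed.

Lemma bl_sum (I : finType) (q : I -> nat -> X -> R) (f : I -> X -> R) :
  (forall i, bounded_limit (q i) (f i)) ->
  bounded_limit (fun n x => \sum_i q i n x) (fun x => \sum_i f i x).
Proof.
move=> h; split.
- by move=> n; apply: measurable_sum => i; case: (h i).
- have hC i : exists C : R, forall n x, D x -> `|q i n x| <= C by case: (h i).
  have [C HC] := choice hC.
  exists (\sum_i C i) => n x Dx; apply: le_trans (ler_norm_sum _ _ _) _.
  by apply: ler_sum => i _; exact: HC.
- move=> x Dx; elim: (index_enum I) => [|a s IH].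
    by under eq_fun do rewrite big_nil; rewrite big_nil; exact: cvg_cst.
  under eq_fun do rewrite big_cons; rewrite big_cons; apply: cvgD => //.
  by case: (h a) => _ _; exact.
Qed.

Lemma dlM g q f : intg mu D g -> bounded_limit q f ->
  dominated_limit (fun n x => g x * q n x) (fun x => g x * f x).
Proof.
move=> Ig [m1 [C b1] c1]; split.
- by move=> n; apply: measurable_funM => //; exact: intg_meas Ig.
- exists (fun x => C * `|g x|); first by apply: intgZ => //; exact: intg_norm.
  by move=> n x Dx; rewrite normrM mulrC ler_wpM2r// b1.
- by move=> x Dx; apply: cvgM; [exact: cvg_cst|exact: c1].
Qed.

Lemma dl_cst f : intg mu D f -> dominated_limit (fun=> f) f.
Proof.
move=> If; split; first by move=> n; exact: intg_meas If.
  by exists (fun x => `|f x|) => //; exact: intg_norm.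
by move=> x _; exact: cvg_cst.
Qed.

Lemma dlD q f q' f' : dominated_limit q f -> dominated_limit q' f' ->
  dominated_limit (fun n x => q n x + q' n x) (fun x => f x + f' x).
Proof.
move=> [m1 [g1 i1 b1] c1] [m2 [g2 i2 b2] c2]; split.
- by move=> n; exact: measurable_funD.
- exists (fun x => g1 x + g2 x); first exact: intgD.
  by move=> n x Dx; apply: le_trans (ler_normD _ _) _; rewrite lerD ?b1 ?b2.
- by move=> x Dx; apply: cvgD; [exact: c1|exact: c2].
Qed.

Lemma dlB q f q' f' : dominated_limit q f -> dominated_limit q' f' ->
  dominated_limit (fun n x => q n x - q' n x) (fun x => f x - f' x).
Proof.
move=> [m1 [g1 i1 b1] c1] [m2 [g2 i2 b2] c2]; split.
- by move=> n; exact: measurable_funB.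
- exists (fun x => g1 x + g2 x); first exact: intgD.
  by move=> n x Dx; apply: le_trans (ler_normB _ _) _; rewrite lerD ?b1 ?b2.
- by move=> x Dx; apply: cvgB; [exact: c1|exact: c2].
Qed.

Lemma dl_sum (I : Type) (s : seq I) (q : I -> nat -> X -> R) (f : I -> X -> R) :
  (forall i, dominated_limit (q i) (f i)) ->
  dominated_limit (fun n x => \sum_(i <- s) q i n x) (fun x => \sum_(i <- s) f i x).
Proof.
move=> h; elim: s => [|a s IH].
  rewrite (_ : (fun n x => _) = (fun _ _ => 0)); last by apply/funext => n; apply/funext => x; rewrite big_nil.
  rewrite (_ : (fun x => _) = (fun _ => 0)); last by apply/funext => x; rewrite big_nil.
  by apply: dl_cst; exact: intg0.
rewrite (_ : (fun n x => _) = (fun n x => q a n x + \sum_(i <- s) q i n x)); last first.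
  by apply/funext => n; apply/funext => x; rewrite big_cons.
rewrite (_ : (fun x => _) = (fun x => f a x + \sum_(i <- s) f i x)); last first.
  by apply/funext => x; rewrite big_cons.
exact: dlD.
Qed.

Lemma dl_lim q f : dominated_limit q f ->
  intg mu D f /\ (fun n => \int[mu]_(x in D) q n x) @ \oo --> \int[mu]_(x in D) f x.
Proof.
move=> [m1 [g ig b] c]; apply: (Rint_dct mD m1 _ ig).
- exact: measurable_fun_cvg m1 c.
- by move=> n; apply: aeW => x; exact: b.
- by apply: aeW => x; exact: c.
Qed.

End dominated_limits.

Section fubini_symmetric.
Context d1 d2 (T1 : measurableType d1) (T2 : measurableType d2) (R : realType).
Variables (m1 : {sigma_finite_measure set T1 -> \bar R}) (m2 : {sigma_finite_measure set T2 -> \bar R}).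

(** The order of integration opposite to [fub_Rint]. The sections are integrable for every [y],
    which continuity in time provides where the lemma is used. *)
Lemma fub_Rint_sym A B (f : T1 * T2 -> R) : measurable A -> measurable B ->
  intg (m1 \x m2)%E (A `*` B) f -> (forall y, B y -> intg m1 A (fun x => f (x, y))) ->
  \int[m2]_(y in B) \int[m1]_(x in A) f (x, y) = \int[(m1 \x m2)%E]_(z in A `*` B) f z.
Proof.
move=> mA mB If Iy.
have iR := intgT_restrict (measurableX mA mB) If.
rewrite [in RHS]/Rintegral [in RHS]integral_mkcond -(integral21_prod_meas1 iR).
rewrite /Rintegral; congr fine; rewrite [in LHS]integral_mkcond.
apply: eq_integral => y _; rewrite /fubini_G patchE; case: (boolP (y \in B)) => yB.
  have By : B y by rewrite inE in yB.
  have E : (\int[m1]_x0 ((EFin \o (fun x => f (x, y))) \_ A) x0 =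
      \int[m1]_x ((EFin \o f) \_ (A `*` B)) (x, y))%E.
    apply: eq_integral => x _; rewrite /patch.
    by congr (if _ then _ else _); apply/idP/idP; rewrite !inE => //= -[].
  by rewrite -E -integral_mkcond fineK//; exact: integrable_fin_num (Iy _ By).
apply/esym; apply: integral0_eq => x _; rewrite patchE.
by case: (boolP ((x, y) \in _)) => //; rewrite inE => -[/= _ By]; move: yB; rewrite notin_setE => /(_ By).
Qed.

End fubini_symmetric.

(** * Dirac measures on the state space *)

Section dirac.
Context {R : realType} {N : nat}.
Local Notation space := 'rV[R]_N.
Local Notation state := (R * 'rV[R]_N)%type.

Lemma measurable_point (y : state) : measurable [set y].
Proof.
pose f (z : state) : R := (z.1 - y.1) ^+ 2 + \sum_i (z.2 ord0 i - y.2 ord0 i) ^+ 2.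
have mf : measurable_fun [set: state] f.
  apply: measurable_funD; first by apply: measurable_funX; apply: measurable_funB.
  apply: measurable_sum => i; apply: measurable_funX; apply: measurable_funB => //.
  exact: (measurableT_comp (measurable_coord i) measurable_snd).
rewrite (_ : [set y] = f @^-1` [set 0]); last first.
  apply/seteqP; split => [z -> /=|z /= fz].
    by rewrite /f subrr expr0n add0r big1// => i _; rewrite subrr expr0n.
  have s0 : 0 <= \sum_i (z.2 ord0 i - y.2 ord0 i) ^+ 2 by apply: sumr_ge0 => i _; exact: sqr_ge0.
  move/eqP: fz; rewrite /f paddr_eq0 ?sqr_ge0// sqrf_eq0 subr_eq0 => /andP[/eqP e1].
  rewrite psumr_eq0 => [/allP h|i _]; last exact: sqr_ge0.
  rewrite [z]surjective_pairing [y]surjective_pairing e1; congr pair.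
  apply/rowP => i; have := h i (mem_index_enum _); rewrite sqrf_eq0 subr_eq0 => /eqP.
  by [].
by rewrite -[X in measurable X]setTI; apply: mf.
Qed.

Variable k : {measure set state -> \bar R}.

Lemma dirac_ae (y : state) : is_dirac k y -> {ae k, forall z, z = y}.
Proof.
move=> h; exists (~` [set y]); split.
- by apply: measurableC; exact: measurable_point.
- rewrite h; last by apply: measurableC; exact: measurable_point.
  by rewrite diracE memNset//; apply.
- by move=> z.
Qed.

Lemma ae_dirac (y : state) : k setT = 1%E -> {ae k, forall z, z = y} -> is_dirac k y.
Proof.
move=> k1 [Z [mZ Z0 hZ]] A mA; rewrite diracE.
have null C : measurable C -> ~ C y -> k C = 0%E.
  move=> mC nC; apply/eqP; rewrite eq_le measure_ge0 andbT -[X in (_ <= X)%E]Z0.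
  apply: le_measure; rewrite ?inE//; move=> z Cz; apply: hZ => /= zy; apply: nC; by rewrite -zy.
have [Ay|nAy] := pselect (A y); last by rewrite memNset// null.
rewrite mem_set//= -k1 -(setUv A) measureU//; last exact: setICr; last exact: measurableC.
rewrite [X in (_ + X)%E]null ?adde0//; first exact: measurableC.
Qed.

End dirac.

Lemma measurable_cylinder {R : realType} {N : nat} (a : R) (Omega : set 'rV[R]_N) :
  open Omega -> measurable (`]0, a[%classic `*` Omega).
Proof. by move=> oO; apply: measurableX => //; exact: open_measurable_rV. Qed.

(** * The strong solution and the test functions made from it *)

Section relative_energy_estimate.
Context {R : realType} {N : nat}.
Local Notation space := 'rV[R]_N.
Local Notation leb := (@lebesgue_measure R).
Variables (T : R) (A : nat) (Omega : set space) (bd : nat).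
Hypothesis T0 : 0 < T.
Hypothesis TA : T <= A%:R.
Hypothesis oO : open Omega.
Hypothesis OA : forall x l, Omega x -> `|x ord0 l| <= bd%:R.
Variables (p : R -> R) (mu eta : R).
Hypothesis pl : pressure_law p.
Variables (r : R -> space -> R) (U Ut gr : R -> space -> space) (gU : R -> space -> 'M[R]_N).
Hypothesis str : strong_solution T Omega mu eta p r U gr gU Ut.

Let OcO : Omega `<=` closure Omega. Proof. exact: subset_closure. Qed.
Local Notation cyl := (continuous_cylinder T Omega).

Lemma row_ent (i j : 'I_N) (B : 'M[R]_N) : row i B ord0 j = B i j.
Proof. by rewrite mxE. Qed.

Lemma str_cU i : cyl (fun t x => U t x ord0 i).
Proof. by have [h _ _] := strong_U str i. Qed.

Lemma str_cgU i j : cyl (fun t x => gU t x i j).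
Proof.
have [_ h _] := strong_U str i; have := h j.
by rewrite (_ : (fun t x => row i (gU t x) ord0 j) = (fun t x => gU t x i j))//;
  apply/funext => t; apply/funext => x; rewrite row_ent.
Qed.

Lemma str_dU t x i j : 0 < t < T -> Omega x -> is_derive x (e_ j) (fun x => U t x ord0 i) (gU t x i j).
Proof. by have [_ _ h] := strong_U str i; move=> tt Ox; have := h t x j tt Ox; rewrite row_ent. Qed.

Lemma str_cr : cyl r. Proof. by have [h _ _] := strong_r str. Qed.
Lemma str_cgr j : cyl (fun t x => gr t x ord0 j). Proof. by have [_ h _] := strong_r str; exact: h. Qed.

Lemma str_dr t x j : 0 < t < T -> Omega x -> is_derive x (e_ j) (r t) (gr t x ord0 j).
Proof. by have [_ _ h] := strong_r str; exact: h. Qed.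

Lemma cyl_tr : cyl (fun t x => \tr (gU t x)).
Proof. by apply: cyl_sum => i; exact: str_cgU. Qed.

(** The time derivative of r read off the continuity equation. It is continuous on the closed
    cylinder, although the class of r says nothing about its time regularity. *)
Definition rt (t : R) (x : space) : R :=
  - (\sum_j U t x ord0 j * gr t x ord0 j + r t x * \tr (gU t x)).

Lemma cyl_rt : cyl rt.
Proof.
apply: cylN; apply: cylD; last by apply: cylM; [exact: str_cr|exact: cyl_tr].
by apply: cyl_sum => j; apply: cylM; [exact: str_cU|exact: str_cgr].
Qed.

Lemma str_drt t x : 0 < t < T -> Omega x -> is_derive t 1 (fun s => r s x) (rt t x).
Proof.
move=> tt Ox; have [h1 h2] := strong_continuity str tt Ox; split => //.
apply/eqP; rewrite -subr_eq0 opprK -[X in _ == X]h2; apply/eqP; congr (_ + _).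
rewrite /divergence /mxtrace mulr_sumr -big_split /=; apply: eq_bigr => j _.
have -> : (fun y => (r t y *: U t y) ord0 j) = (fun y => r t y * U t y ord0 j).
  by apply/funext => y; rewrite mxE.
have d : is_derive x (e_ j) (fun y => r t y * U t y ord0 j)
    (gr t x ord0 j * U t x ord0 j + r t x * gU t x j j).
  by apply: DM; [exact: str_dr|exact: str_dU].
by case: d => _ ->; rewrite [U t x ord0 j * _]mulrC.
Qed.

Definition phi n t x : space := \row_i tapp T A n.+1 (fun s y => U s y ord0 i) t x.
Definition phit n t x : space := \row_i tapp' T A n.+1 (fun s y => U s y ord0 i) t x.
Definition gphi n t x : 'M[R]_N := \matrix_(i, j) tapp T A n.+1 (fun s y => gU s y i j) t x.

Lemma phiE n i : (fun t x => phi n t x ord0 i) = tapp T A n.+1 (fun s y => U s y ord0 i).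
Proof. by apply/funext => t; apply/funext => x; rewrite mxE. Qed.
Lemma phitE n i : (fun t x => phit n t x ord0 i) = tapp' T A n.+1 (fun s y => U s y ord0 i).
Proof. by apply/funext => t; apply/funext => x; rewrite mxE. Qed.
Lemma gphiE n i j : (fun t x => gphi n t x i j) = tapp T A n.+1 (fun s y => gU s y i j).
Proof. by apply/funext => t; apply/funext => x; rewrite mxE. Qed.

Lemma cyl_phi n i : cyl (fun t x => phi n t x ord0 i).
Proof. by rewrite phiE; apply: tapp_cyl => //; exact: str_cU. Qed.
Lemma cyl_phit n i : cyl (fun t x => phit n t x ord0 i).
Proof. by rewrite phitE; apply: tapp'_cyl => //; exact: str_cU. Qed.
Lemma cyl_gphi n i j : cyl (fun t x => gphi n t x i j).
Proof. by rewrite gphiE; apply: tapp_cyl => //; exact: str_cgU. Qed.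

Lemma phi_dx n t x i j : Omega x -> is_derive x (e_ j) (fun y => phi n t y ord0 i) (gphi n t x i j).
Proof.
move=> Ox; rewrite mxE (_ : (fun y => phi n t y ord0 i) = tapp T A n.+1 (fun s y => U s y ord0 i) t); last first.
  by apply/funext => y; rewrite mxE.
by apply: tapp_dx => // s st; exact: str_dU.
Qed.

Lemma phi_dt n (t : R) x i : is_derive t 1 (fun s => phi n s x ord0 i) (phit n t x ord0 i).
Proof.
rewrite mxE (_ : (fun s => phi n s x ord0 i) = (fun s => tapp T A n.+1 (fun s y => U s y ord0 i) s x)); last first.
  by apply/funext => y; rewrite mxE.
exact: tapp_dt.
Qed.

Lemma phi_admissible n : vC1_cylinder T Omega (phi n) (phit n) (gphi n).
Proof.
move=> i; split; last by move=> t x _ _; exact: phi_dt.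
  split; first exact: cyl_phi.
    move=> j; rewrite (_ : (fun t x => row i (gphi n t x) ord0 j) = (fun t x => gphi n t x i j)).
      exact: cyl_gphi.
    by apply/funext => t; apply/funext => x; rewrite row_ent.
  by move=> t x j _ Ox; rewrite row_ent; exact: phi_dx.
exact: cyl_phit.
Qed.

Lemma phi_zero n : zero_on_boundary T Omega (phi n).
Proof.
move=> t x tT bx; apply/rowP => i; rewrite !mxE /tapp big1// => k _.
have /andP[h1 h2] := inner_time_in T0 n.+1 (node A n.+1 k).
by rewrite (strong_boundary str _ bx) ?mxE ?mul0r// !ltW.
Qed.

(** Half the square of the averaged field, not the average of half the square: only then do the time
    derivatives combine with those of the momentum equation into (m - rho phi) . phi_t. *)
Definition psi n t x : R := 2^-1 * \sum_i phi n t x ord0 i * phi n t x ord0 i.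
Definition psit n t x : R := \sum_i phi n t x ord0 i * phit n t x ord0 i.
Definition gpsi n t x : space := \row_j \sum_i phi n t x ord0 i * gphi n t x i j.

Lemma psi_admissible n : C1_cylinder T Omega (psi n) (psit n) (gpsi n).
Proof.
have half (f : 'I_N -> R) (g : 'I_N -> R) : 2^-1 * \sum_i (f i * g i + g i * f i) = \sum_i g i * f i.
  rewrite big_split /= (eq_bigr (fun i => g i * f i)) => [|i _]; last exact: mulrC.
  by move: (\sum_i _) => u; field.
split.
- split.
  + apply: cylM; first exact: cyl_cst.
    by apply: cyl_sum => i; apply: cylM; exact: cyl_phi.
  + move=> j; rewrite (_ : (fun t x => _) = (fun t x => \sum_i phi n t x ord0 i * gphi n t x i j)).
      by apply: cyl_sum => i; apply: cylM; [exact: cyl_phi|exact: cyl_gphi].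
    by apply/funext => t; apply/funext => x; rewrite mxE.
  + move=> t x j tt Ox; rewrite mxE -(half (fun i => gphi n t x i j)).
    by apply: DZ; apply: Dsum => i; apply: DM; exact: phi_dx.
- by apply: cyl_sum => i; apply: cylM; [exact: cyl_phi|exact: cyl_phit].
- move=> t x tt Ox; rewrite /psit -(half (fun i => phit n t x ord0 i)).
  by apply: DZ; apply: Dsum => i; apply: DM; exact: phi_dt.
Qed.

Definition psir t x : R := P1 p (r t x).
Definition psirt t x : R := derive1 p (r t x) / r t x * rt t x.
Definition gpsir t x : space := (derive1 p (r t x) / r t x) *: gr t x.

Lemma cyl_p''r : cyl (fun t x => derive1 p (r t x) / r t x).
Proof.
apply: cylM; apply: cyl_comp; try exact: str_cr.
- by move=> t x tT cx; apply: (p'_cont pl); exact: strong_r_gt0 str _ _ tT cx.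
- move=> t x tT cx; apply: (@continuousV _ _ id) => //.
  by rewrite gt_eqF//; exact: strong_r_gt0 str _ _ tT cx.
Qed.

Lemma cyl_gpsir j : cyl (fun t x => gpsir t x ord0 j).
Proof.
rewrite (_ : (fun t x => _) = (fun t x => derive1 p (r t x) / r t x * gr t x ord0 j)).
  by apply: cylM; [exact: cyl_p''r|exact: str_cgr].
by apply/funext => t; apply/funext => x; rewrite mxE.
Qed.

Lemma cyl_psir : cyl psir.
Proof.
apply: cyl_comp; first exact: str_cr.
move=> t x tT cx; apply: is_derive1_cont; apply: (dP1 pl).
exact: strong_r_gt0 str _ _ tT cx.
Qed.

(** P'(r) is of class C^1 thanks to [rt] and P''(r) = p'(r)/r, so it is used without averaging. *)
Lemma psir_admissible : C1_cylinder T Omega psir psirt gpsir.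
Proof.
have rp t x : 0 < t < T -> Omega x -> 0 < r t x.
  by move=> /andP[t1 t2] /OcO cx; apply: (strong_r_gt0 str) => //; rewrite !ltW.
split.
- split; [exact: cyl_psir|exact: cyl_gpsir|].
  move=> t x j tt Ox; rewrite mxE; apply: Dcomp; last exact: str_dr.
  by apply: (dP1 pl); exact: rp.
- by apply: cylM; [exact: cyl_p''r|exact: cyl_rt].
- move=> t x tt Ox; apply: (@Dcomp R R (P1 p) (fun s => r s x)); last exact: str_drt.
  by apply: (dP1 pl); exact: rp.
Qed.

Lemma phi_cvg t x i : 0 <= t <= T -> closure Omega x -> (fun n => phi n t x ord0 i) @ \oo --> U t x ord0 i.
Proof.
move=> tT cx; rewrite (_ : (fun n => _) = (fun n => tapp T A n.+1 (fun s y => U s y ord0 i) t x)).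
  by apply: (tapp_cvg T0 TA _ tT cx); exact: str_cU.
by apply/funext => n; rewrite mxE.
Qed.

Lemma gphi_cvg t x i j : 0 <= t <= T -> closure Omega x -> (fun n => gphi n t x i j) @ \oo --> gU t x i j.
Proof.
move=> tT cx; rewrite (_ : (fun n => _) = (fun n => tapp T A n.+1 (fun s y => gU s y i j) t x)).
  by apply: (tapp_cvg T0 TA _ tT cx); exact: str_cgU.
by apply/funext => n; rewrite mxE.
Qed.

Lemma phit_cvg t x i (a : R) : 0 < t < T -> is_derive t 1 (fun s => U s x ord0 i) a ->
  (fun n => phit n t x ord0 i) @ \oo --> a.
Proof.
move=> tT d; rewrite (_ : (fun n => _) = (fun n => tapp' T A n.+1 (fun s y => U s y ord0 i) t x)).
  exact: (tapp'_cvg T0 TA tT d).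
by apply/funext => n; rewrite mxE.
Qed.

Variables (B : R).
Hypothesis UB : forall t x i, 0 <= t <= T -> closure Omega x -> `|U t x ord0 i| <= B.
Hypothesis gUB : forall t x i j, 0 <= t <= T -> closure Omega x -> `|gU t x i j| <= B.

Lemma phi_bound n t x i : 0 <= t <= T -> closure Omega x -> `|phi n t x ord0 i| <= B.
Proof.
by move=> tT cx; rewrite mxE; apply: (tapp_bound T0 TA) => // s sT; exact: UB.
Qed.

Lemma gphi_bound n t x i j : 0 <= t <= T -> closure Omega x -> `|gphi n t x i j| <= B.
Proof.
by move=> tT cx; rewrite mxE; apply: (tapp_bound T0 TA) => // s sT; exact: gUB.
Qed.

Local Notation state := (R * 'rV[R]_N)%type.
Local Notation lebN := (lebesgue_rV R N).
Local Notation lam := (@lebesgue_measure R \x lebesgue_rV R N)%E.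
Local Notation Q := (`]0, T[%classic `*` Omega).

Let mO : measurable Omega. Proof. exact: open_measurable_rV. Qed.

Let mQ := measurable_cylinder T oO.

Lemma measurable_closed_cylinder : measurable (closed_cylinder T Omega).
Proof. by apply: measurableX => //; apply: closed_measurable_rV; exact: closed_closure. Qed.

Lemma cylinder_sub : Q `<=` closed_cylinder T Omega.
Proof.
move=> [t x] [/= + Ox]; rewrite /closed_cylinder /= !in_itv /= => /andP[t0 tT]; split => /=.
  by rewrite !ltW.
exact: OcO.
Qed.

Lemma cyl_measurable (f : R -> space -> R) : continuous_cylinder T Omega f ->
  measurable_fun Q (fun z => f z.1 z.2).
Proof.
move=> cf; apply: (measurable_funS measurable_closed_cylinder cylinder_sub).
by apply: within_continuous_measurable_prod => //; exact: measurable_closed_cylinder.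
Qed.

Lemma cylinder_finite : (lam Q < +oo)%E.
Proof.
have L : (@lebesgue_measure R `]0%R, T[%classic < +oo)%E.
  by rewrite lebesgue_measure_itv /=; case: ifP => // _; rewrite -EFinB ltry.
rewrite product_measure1E// lte_mul_pinfty//; last exact: (Omega_finite oO OA).
by rewrite ge0_fin_numE//; exact: L.
Qed.

Lemma cyl_intgM (g : R * space -> R) (f : R -> space -> R) : intg lam Q g ->
  continuous_cylinder T Omega f -> intg lam Q (fun z => g z * f z.1 z.2).
Proof.
move=> Ig cf; have [C _ hC] := cyl_bounded (compact_closure_bounded OA) cf.
apply: (@intg_bdM _ _ _ lam Q g _ C) => //; first exact: cyl_measurable.
by move=> z /cylinder_sub[/= z1 z2]; apply: hC => //; move: z1; rewrite in_itv.
Qed.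

Lemma cyl_intg (f : R -> space -> R) : continuous_cylinder T Omega f ->
  intg lam Q (fun z => f z.1 z.2).
Proof.
move=> cf; have [C _ hC] := cyl_bounded (compact_closure_bounded OA) cf.
apply: (@intg_bd _ _ _ lam Q _ C) => //; [exact: cylinder_finite|exact: cyl_measurable|].
by move=> z /cylinder_sub[/= z1 z2]; apply: hC => //; move: z1; rewrite in_itv.
Qed.

Lemma cyl_L2 (f : R -> space -> R) : continuous_cylinder T Omega f ->
  L2 lam Q (fun z => f z.1 z.2).
Proof.
move=> cf; split; first exact: cyl_measurable.
rewrite (_ : (fun z => _) = (fun z => f z.1 z.2 * f z.1 z.2)); last by apply/funext => z; rewrite expr2.
by apply: cyl_intgM => //; exact: cyl_intg.
Qed.

Definition slice (g : R * space -> R) (t : R) : R := \int[lebN]_(x in Omega) g (t, x).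

Lemma slice_intg g : intg lam Q g -> intg leb `]0, T[ (slice g).
Proof. by move=> Ig; exact: (fub_intg _ mO Ig). Qed.

Lemma slice_intg_tau g tau : intg lam Q g -> 0 < tau -> tau <= T -> intg leb `]0, tau[ (slice g).
Proof.
move=> Ig t0 tT; apply: (intgS _ _ _ (slice_intg Ig)) => // x /=.
by rewrite !in_itv /= => /andP[-> /lt_le_trans]; exact.
Qed.

Lemma slice_intg_cc g tau : intg lam Q g -> 0 < tau -> tau <= T -> intg leb `[0, tau] (slice g).
Proof. by move=> Ig t0 tT; apply: intg_cc => //; exact: slice_intg_tau. Qed.

Lemma ae_slice g : intg lam Q g -> {ae leb, forall t, 0 < t < T -> intg lebN Omega (fun x => g (t, x))}.
Proof.
move=> Ig; apply: (ae_S (fub_ae _ mO Ig)) => // t h tt; exact: h.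
Qed.

Lemma slice_prod g tau : intg lam Q g -> 0 < tau -> tau <= T ->
  \int[leb]_(t in `[0, tau]) slice g t = \int[lam]_(z in `]0, tau[ `*` Omega) g z.
Proof.
move=> Ig t0 tT; rewrite Rint_cc//; last exact: slice_intg_tau.
apply: fub_Rint => //; apply: (intgS _ _ _ Ig) => //; first exact: measurableX.
by move=> [t x] [/= + Ox]; rewrite !in_itv /= => /andP[-> /lt_le_trans ht]; split => //=; exact: ht.
Qed.

(** * Moments of the measure-valued solution *)

Variables (cP : R).
Hypothesis mu0 : 0 < mu.
Hypothesis eta0 : 0 <= eta.
Variables (nu : R.-pker (R * 'rV[R]_N) ~> (R * 'rV[R]_N)%type) (nu0 : R.-pker 'rV[R]_N ~> (R * 'rV[R]_N)%type) (D : R -> R) (gu : R -> space -> 'M[R]_N) (rC : R -> 'I_1 -> 'I_N -> {charge set space -> \bar R}) (chi : R -> R) (rM : R -> 'I_N -> 'I_N -> {charge set space -> \bar R}) (xi : R -> R).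
Hypothesis dmv : dissipative_mv_solution T Omega mu eta p cP nu nu0 D gu rC chi rM xi.

Definition rho (z : R * space) : R := bracket (nu z) fst.
Definition mom i (z : R * space) : R := bracket (nu z) (fun y => momentum y ord0 i).
Definition cnv i j (z : R * space) : R := bracket (nu z) (fun y => convection y i j).
Definition prs (z : R * space) : R := bracket (nu z) (fun y => p y.1).
Definition ene (z : R * space) : R := bracket (nu z) (energy p).
Definition vel i (z : R * space) : R := bracket (nu z) (fun y => y.2 ord0 i).

Lemma I_rho : intg lam Q rho. Proof. by have [] := mv_density_int dmv. Qed.
Lemma I_mom i : intg lam Q (mom i). Proof. by have [] := mv_momentum_int dmv i. Qed.
Lemma I_cnv i j : intg lam Q (cnv i j). Proof. by have [] := mv_convection_int dmv i j. Qed.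
Lemma I_prs : intg lam Q prs. Proof. by have [] := mv_pressure_int dmv. Qed.
Lemma I_ene : intg lam Q ene. Proof. by have [] := mv_energy_int dmv. Qed.

Definition regular (k : {measure set state -> \bar R}) : Prop :=
  [/\ k state_space = 1%E, intg k state_space fst,
   (forall i, intg k state_space (fun y : state => y.2 ord0 i)) /\
   (forall i, intg k state_space (fun y : state => momentum y ord0 i)),
   (forall i j, intg k state_space (fun y : state => convection y i j)) &
   intg k state_space (fun y : state => p y.1) /\ intg k state_space (energy p)].

Lemma ae_forall_fin d (X : measurableType d) (m : {measure set X -> \bar R}) (I : finType)
    (P : I -> X -> Prop) : (forall i, {ae m, forall x, P i x}) -> {ae m, forall x i, P i x}.
Proof.
move=> h; have H n : {ae m, forall x, if unpickle n is Some i then P i x else True}.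
  by case: (unpickle n) => [i|]; [exact: h|exact: aeW].
by apply: (ae_S (ae_foralln H)) => t Ht i; have := Ht (pickle i); rewrite pickleK.
Qed.

Lemma ae_regular : {ae lam, forall z, Q z -> regular (nu z)}.
Proof.
have hi := ae_forall_fin (fun i => (mv_velocity_int dmv i).1).
have hm := ae_forall_fin (fun i => (mv_momentum_int dmv i).1).
have hc := ae_forall_fin (fun i => ae_forall_fin (fun j => (mv_convection_int dmv i j).1)).
have h3 := ae_S3 hi hm hc (fun z a b c => conj a (conj b c)).
have h4 := ae_S3 (mv_density_int dmv).1 (mv_pressure_int dmv).1 (mv_energy_int dmv).1 (fun z a b c => conj a (conj b c)).
apply: (ae_S3 h3 h4 (mv_carried dmv)) => z [a1 [a2 a3]] [b1 [b2 b3]] b4 Qz; split.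
- by apply: pker_mass; exact: b4.
- exact: b1.
- by split => i; [exact: a1|exact: a2].
- by move=> i j; exact: a3.
- by split; [exact: b2|exact: b3].
Qed.

(** P may be negative, but it lies above its tangent at 1. *)
Lemma P_lower (s : R) : 0 <= s ->
  - ((`|P1 p 1| + `|pressure_potential p 1|) * (1 + s)) <= pressure_potential p s.
Proof.
move=> s0; have [h _] := Prel_ge0 pl s0 ltr01; move: h; rewrite /Prel.
move: (P1 p 1) (pressure_potential p 1) (pressure_potential p s) => a b c h.
have ha := ler_norm a; have hb := ler_norm (- b); have hna := ler_norm (- a); rewrite normrN in hb; rewrite normrN in hna.
have h1 := mulr_ge0 (normr_ge0 b) s0.
have h2 : - (`|a| * s) <= a * s by rewrite -mulNr ler_wpM2r// lerNl.
rewrite (_ : (`|a| + `|b|) * (1 + s) = `|a| + `|b| + `|a| * s + `|b| * s); last by ring.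
move: h; rewrite mulrBr mulr1; move: ha hb hna h1 h2.
by move: (a * s) (`|a| * s) (`|b| * s) `|a| `|b| => q1 q2 q3 q4 q5 *; lra.
Qed.

Definition moment_const : R := `|P1 p 1| + `|pressure_potential p 1|.

(** s |v_i| <= s + s |v|^2 / 2 pointwise, and the kinetic part exceeds the energy by at most the
    linear lower bound of P. *)
Lemma regular_bounds k : regular k -> 0 <= bracket k fst /\ forall i,
  `|bracket k (fun y => momentum y ord0 i)| <=
  bracket k fst + bracket k (energy p) + moment_const * (1 + bracket k fst).
Proof.
move=> [k1 i1 [i2 i3] i4 [i5 i6]]; split; first by apply: Rintegral_ge0 => y.
move=> i; have b1 := br_intg i1; have b6 := br_intg i6; have b3 := br_intg (i3 i).
have key (e : R) : `|e| = 1 -> e * bracket k (fun y => momentum y ord0 i) <=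
    bracket k fst + bracket k (energy p) + moment_const * (1 + bracket k fst).
  move=> e1; apply: (br_le (brZ e b3) (brD (brD b1 b6) (brZ moment_const (brD (br_cst k1 1) b1)))).
  move=> y y0; have PL := P_lower y0; rewrite -/moment_const in PL.
  rewrite momentumE /energy.
  have h : e * (y.1 * y.2 ord0 i) <= y.1 + 2^-1 * y.1 * enorm y.2 ^+ 2.
    apply: (@le_trans _ _ (y.1 * `|y.2 ord0 i|)).
      by apply: (le_trans (ler_norm _)); rewrite !normrM e1 mul1r ger0_norm.
    rewrite [leRHS](_ : _ = y.1 * (1 + 2^-1 * enorm y.2 ^+ 2)); last by ring.
    rewrite ler_wpM2l//; apply: (@le_trans _ _ (1 + 2^-1 * (y.2 ord0 i) ^+ 2)).
      rewrite -(real_normK (num_real (y.2 ord0 i))); have := sqr_ge0 (`|y.2 ord0 i| - 1).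
      by rewrite sqrrB mulr1 expr1n -mulr_natl; move: `|_| (_ ^+ 2) => *; lra.
    by rewrite lerD2l ler_wpM2l//; exact: enorm_sq_entry.
  by move: h PL; move: (e * _) (_ * enorm y.2 ^+ 2) (moment_const * _) (pressure_potential p y.1) => *; lra.
rewrite ler_norml; apply/andP; split; last by rewrite -[X in X <= _]mul1r key ?normr1.
by rewrite lerNl -mulN1r key// normrN1.
Qed.

Lemma pairing0 (tau : R) : pairing Omega (rC tau) (fun=> 0) = 0.
Proof.
rewrite /pairing big1// => i _; rewrite big1// => j _; rewrite /charge_integral.
rewrite (@eq_Rintegral _ _ _ _ _ (cst 0)) => [|x _]; last by rewrite mxE.
rewrite [X in _ - X](@eq_Rintegral _ _ _ _ _ (cst 0)) => [|x _]; last by rewrite mxE.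
by rewrite /Rintegral !integral0 subr0.
Qed.

(** The test function 1 has zero gradient, so the defect measure drops out. *)
Lemma mass_conservation : {ae leb, forall tau, 0 < tau < T ->
  slice rho tau = \int[lebN]_(x in Omega) bracket (nu0 x) fst}.
Proof.
apply: (ae_S (mv_continuity dmv)) => tau h tt.
have adm : C1_cylinder T Omega (fun _ _ => 1) (fun _ _ => 0) (fun _ _ => 0).
  split; last by move=> t x _ _; exact: Dcst.
    split; first exact: cyl_cst.
      move=> j; rewrite (_ : (fun t x => _) = (fun _ _ => 0)); first exact: cyl_cst.
      by apply/funext => t; apply/funext => x; rewrite mxE.
    by move=> t x j _ _; rewrite mxE; exact: Dcst.
  exact: cyl_cst.
have [_ E] := h tt _ _ _ adm.
apply/eqP; rewrite -subr_eq0; apply/eqP; transitivity (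
  \int[lebN]_(x in Omega) (bracket (nu (tau, x)) fst * 1) - \int[lebN]_(x in Omega) (bracket (nu0 x) fst * 1)).
  by congr (_ - _); apply: eq_Rintegral => x _; rewrite mulr1.
rewrite E [X in X + _](_ : _ = 0); last first.
  rewrite (@eq_Rintegral _ _ _ leb _ (cst 0)) => [|t _]; first by rewrite /Rintegral integral0.
  rewrite (@eq_Rintegral _ _ _ lebN _ (cst 0)) => [|x _]; first by rewrite /Rintegral integral0.
  by rewrite mulr0 add0r /inner big1// => i _; rewrite big1// => j _; rewrite [in X in _ * X]mxE mulr0.
rewrite add0r (@eq_Rintegral _ _ _ leb _ (cst 0)) => [|t _]; last by rewrite pairing0.
by rewrite /Rintegral integral0.
Qed.

Lemma vel_L2 i : L2 lam Q (vel i) /\ forall j, L2 lam Q (fun z => gu z.1 z.2 i j).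
Proof.
have [m1 m2 _ fin] := mv_velocity dmv.
have m1' k : measurable_fun Q (vel k).
  have := m1 k; rewrite (_ : (fun z => velocity nu z.1 z.2 ord0 k) = vel k)//.
  by apply/funext => z; rewrite /velocity mxE; case: z.
pose h (z : R * space) := enorm (velocity nu z.1 z.2) ^+ 2 + enorm (gu z.1 z.2) ^+ 2.
have h0 z : 0 <= h z by rewrite addr_ge0 ?sqr_ge0.
have mh : measurable_fun Q h.
  apply: measurable_funD.
    rewrite (_ : (fun z => _) = (fun z => \sum_j velocity nu z.1 z.2 ord0 j ^+ 2)); last first.
      by apply/funext => z; rewrite enorm_sq_rV.
    by apply: measurable_sum => k; apply: measurable_funX; exact: m1.
  rewrite (_ : (fun z => _) = (fun z => \sum_i \sum_j gu z.1 z.2 i j ^+ 2)); last first.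
    by apply/funext => z; rewrite enorm_sq.
  by apply: measurable_sum => k; apply: measurable_sum => l; apply: measurable_funX; exact: m2.
have Ih : intg lam Q h.
  apply: intgP => //; under eq_integral do rewrite ger0_norm//.
  have [_ ->] := @tonelli _ _ _ _ _ leb lebN `]0, T[%classic Omega (EFin \o h) (measurable_itv _) mO
     ((measurable_EFinP _ _).2 mh) (fun z _ => h0 z).
  exact: fin.
have gi (f : R * space -> R) : measurable_fun Q f -> (forall z, Q z -> `|f z| <= `|h z|) -> intg lam Q f.
  by move=> mf fh; apply: (@le_intg _ _ _ lam Q f h).
split; [split; [exact: m1'|apply: gi]|move=> j; split; [exact: m2|apply: gi]].
- by apply: measurable_funX; exact: m1'.
- move=> z _; rewrite ger0_norm ?sqr_ge0// ger0_norm// /h.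
  have := enorm_sq_entry (velocity nu z.1 z.2) i.
  rewrite /velocity mxE -surjective_pairing -/(vel i z) => /le_trans; apply.
  by rewrite lerDl sqr_ge0.
- by apply: measurable_funX; exact: m2.
- move=> z _; rewrite ger0_norm ?sqr_ge0// ger0_norm// /h.
  apply: (@le_trans _ _ (enorm (gu z.1 z.2) ^+ 2)); last by rewrite lerDr sqr_ge0.
  by rewrite -(real_normK (num_real (gu z.1 z.2 i j))) lerXn2r ?nnegrE ?enorm_ge0//; exact: entry_le_enorm.
Qed.

Lemma visc_intg (G H : R -> space -> 'M[R]_N) :
  (forall i j, L2 lam Q (fun z => G z.1 z.2 i j)) -> (forall i j, L2 lam Q (fun z => H z.1 z.2 i j)) ->
  intg lam Q (fun z => inner (viscous_stress mu eta (G z.1 z.2)) (H z.1 z.2)).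
Proof.
move=> LG LH.
apply: (@eq_intg _ _ _ lam Q (fun z => mu * (\sum_i \sum_j G z.1 z.2 i j * H z.1 z.2 i j +
   \sum_i \sum_j G z.1 z.2 j i * H z.1 z.2 i j) +
   (eta - 2 / 3 * mu) * (\sum_i \sum_j G z.1 z.2 i i * H z.1 z.2 j j))) => //.
  move=> z _; rewrite viscousE trtrE; congr (mu * (_ + _) + _).
  by apply: eq_bigr => i _; apply: eq_bigr => j _; rewrite mxE.
apply: intgD => //; apply: intgZ => //; first apply: intgD => //;
  by apply: intg_sum => // i _; apply: intg_sum => // j _; exact: L2M.
Qed.

Lemma I_visc : intg lam Q (fun z => inner (viscous_stress mu eta (gu z.1 z.2)) (gu z.1 z.2)).
Proof. by apply: visc_intg => i j; have [_] := vel_L2 i; exact. Qed.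

Lemma ae_Wapp : {ae leb, forall t, 0 < t < T -> forall i,
  Wapp Omega (fun x => vel i (t, x)) (fun j x => gu t x i j)}.
Proof.
have [_ _ h _] := mv_velocity dmv.
apply: (ae_S h) => t ht tt i; have := W12_0_Wapp oO OA (ht tt i).
rewrite (_ : (fun x => velocity nu t x ord0 i) = (fun x => vel i (t, x))); last first.
  by apply/funext => x; rewrite mxE.
by rewrite (_ : (fun j x => row i (gu t x) ord0 j) = (fun j x => gu t x i j))//;
  apply/funext => j; apply/funext => x; rewrite mxE.
Qed.

Lemma visc_ge0 : {ae leb, forall t, 0 < t < T ->
  0 <= slice (fun z => inner (viscous_stress mu eta (gu z.1 z.2)) (gu z.1 z.2)) t}.
Proof.
apply: (ae_S ae_Wapp) => t h tt.
apply: le_trans (korn oO OA mu0 eta0 (h tt)).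
by rewrite mulr_ge0 ?(ltW mu0)//; apply: Rintegral_ge0 => x _; exact: sqr_ge0.
Qed.

Lemma energy_bound : {ae leb, forall tau, 0 < tau < T ->
  slice ene tau + D tau <= \int[lebN]_(x in Omega) bracket (nu0 x) (energy p)}.
Proof.
apply: (ae_S (mv_energy dmv)) => tau h tt; apply: le_trans (h tt).
rewrite lerD2r lerDl; have /andP[t0 tT] := tt.
have E0 : \int[leb]_(t in `[0, tau]) (fun=> 0 : R) t = 0 by rewrite /Rintegral integral0.
rewrite -[leLHS]E0.
apply: ae_le_Rint => //; first exact: intg0.
  exact: (slice_intg_cc I_visc t0 (ltW tT)).
apply: (ae_S2 visc_ge0 (ae_neq 0)) => t ht tn0; rewrite /= in_itv /= => /andP[t1 t2].
apply: ht; rewrite lt_neqAle t1 andbT (le_lt_trans t2 tT) andbT.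
by apply/eqP => e; exact: tn0 (esym e).
Qed.

(** The space integral of [regular_bounds], with the mass conserved and the energy bounded by its
    initial value. *)
Lemma mom_bound : exists2 C : R, 0 <= C & {ae leb, forall t, 0 < t < T ->
  0 <= slice rho t <= C /\ forall i, \int[lebN]_(x in Omega) `|mom i (t, x)| <= C}.
Proof.
pose rr := \int[lebN]_(x in Omega) bracket (nu0 x) fst.
pose e0 := \int[lebN]_(x in Omega) bracket (nu0 x) (energy p).
have [c1 [c10 i1]] : exists c : R, 0 <= c /\ intg lebN Omega (fun=> 1 : R) /\ \int[lebN]_(x in Omega) (1 : R) = c.
  exists (\int[lebN]_(x in Omega) (1 : R)); split; first by apply: Rintegral_ge0.
  split => //; apply: (@intg_bd _ _ _ lebN Omega _ 1) => //; first exact: (Omega_finite oO OA).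
  by move=> x _; rewrite normr1.
have mc0 : 0 <= moment_const by rewrite addr_ge0.
exists (`|rr| + (`|rr| + `|e0| + moment_const * (c1 + `|rr|))).
  by rewrite !addr_ge0// mulr_ge0// addr_ge0.
have ireg : {ae leb, forall t, {ae lebN, forall x, Q (t, x) -> regular (nu (t, x))}}.
  by apply: (@ae_prodP _ _ _ _ _ leb lebN (fun t x => Q (t, x) -> regular (nu (t, x))));
    apply: (ae_S ae_regular) => -[t x].
have islices := ae_S3 (ae_slice I_rho) (ae_slice I_ene) (ae_forall_fin (fun i => ae_slice (I_mom i)))
  (fun t a b c => conj a (conj b c)).
have ig := ae_S2 ireg (defect_ge0 dmv) (fun t a b => conj a b).
have ib := ae_S2 mass_conservation energy_bound (fun t a b => conj a b).
apply: (ae_S3 islices ig ib) => t [a1 [a2 a3]] [b1 b2] [d1 d2] tt.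
have {}a1 := a1 tt; have {}a2 := a2 tt; have {}d1 := d1 tt; have {}d2 := d2 tt; have {}b2 := b2 tt.
have QO x : Omega x -> Q (t, x) by split => //=; rewrite in_itv.
have rho0 : 0 <= slice rho t.
  have E0 : \int[lebN]_(x in Omega) (fun=> 0 : R) x = 0 by rewrite /Rintegral integral0.
  rewrite -[leLHS]E0.
  apply: ae_le_Rint => //; first exact: intg0.
  by apply: (ae_S b1) => x hx Ox; have [] := regular_bounds (hx (QO _ Ox)).
have sr : slice rho t <= `|rr| by rewrite d1; exact: ler_norm.
have se : slice ene t <= `|e0| by apply: le_trans (ler_norm _); apply: le_trans d2; rewrite lerDl.
split.
  rewrite rho0/=; apply: (le_trans sr); rewrite lerDl !addr_ge0// mulr_ge0// addr_ge0//.
move=> i; have a3i := a3 i tt; have [io1 eo1] := i1.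
apply: (@le_trans _ _ (\int[lebN]_(x in Omega) (rho (t, x) + ene (t, x) + moment_const * (1 + rho (t, x))))).
  apply: ae_le_Rint => //.
  - exact: intg_norm.
  - by apply: intgD; [|exact: intgD|apply: intgZ => //; exact: intgD].
  - by apply: (ae_S b1) => x hx Ox; have [_] := regular_bounds (hx (QO _ Ox)); exact.
rewrite RintD//; [|exact: intgD|by apply: intgZ => //; exact: intgD].
rewrite RintD// RintZ//; last exact: intgD.
rewrite RintD// eo1 -/(slice rho t) -/(slice ene t).
have h : moment_const * (c1 + slice rho t) <= moment_const * (c1 + `|rr|) by rewrite ler_wpM2l// lerD2l.
apply: (@le_trans _ _ (`|rr| + `|e0| + moment_const * (c1 + `|rr|))); last by rewrite lerDr.
by apply: lerD => //; exact: lerD.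
Qed.

Hypothesis O0 : Omega !=set0.
Local Notation Qt tau := (`]0, tau[%classic `*` Omega).

Let cO0 : closure Omega !=set0. Proof. by have [x Ox] := O0; exists x; exact: OcO. Qed.

Lemma sup_on_ge0 {Y : Type} (K : set Y) (g : Y -> R) : (forall x, 0 <= g x) -> 0 <= sup_on K g.
Proof.
move=> g0; rewrite /sup_on; have [h|/sup_out -> //] := pselect (has_sup (g @` K)).
have [[z [x Kx xz]] ub] := h; apply: le_trans (g0 x) _.
by apply: ub_le_sup => //; exists x.
Qed.

Definition defect_rate (t : R) : R := (`|chi t| + `|xi t|) * D t.

Lemma I_defect_rate : intg leb `]0, T[ defect_rate.
Proof.
have [M HM] := defect_bounded dmv.
have Ic : intg leb `]0, T[ (fun t => `|chi t| + `|xi t|).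
  by apply: intgD => //; apply: intg_norm; [exact: mv_chi dmv|exact: mv_xi dmv].
apply: (@ae_le_intg _ _ _ leb _ _ (fun t => M * (`|chi t| + `|xi t|))) => //.
- by apply: measurable_funM; [exact: intg_meas Ic|exact: defect_measurable dmv].
- apply: (ae_S2 HM (defect_ge0 dmv)) => t h1 h2; rewrite /= in_itv /= => tt.
  rewrite !normrM mulrC ler_wpM2r// ger0_norm ?h2//; apply: le_trans (h1 tt) _; exact: ler_norm.
- exact: intgZ.
Qed.

Lemma I_defect_rate_cc tau : 0 < tau -> tau <= T -> intg leb `[0, tau] defect_rate.
Proof.
move=> t0 tT; apply: intg_cc => //; apply: (intgS _ _ _ I_defect_rate) => // x /=.
by rewrite !in_itv /= => /andP[-> /lt_le_trans]; exact.
Qed.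

Let error_bound (q s : R -> R) (c : R -> R) K tau : 0 < tau < T ->
  (forall t, c t <= `|chi t| + `|xi t|) -> (forall t, 0 <= s t) -> 0 <= K ->
  (forall t, 0 <= t <= T -> s t <= K) ->
  {ae leb, forall t, 0 < t < T -> `|q t| <= c t * D t * s t} ->
  `|\int[leb]_(t in `[0, tau]) q t| <= K * \int[leb]_(t in `[0, tau]) defect_rate t.
Proof.
move=> /andP[t0 tT] hc s0 K0 sK hq; have Ir := I_defect_rate_cc t0 (ltW tT).
rewrite -RintZ//; apply: Rint_bound => //; first exact: intgZ.
apply: (ae_S3 hq (ae_neq 0) (defect_ge0 dmv)) => t h tn0 hD; rewrite /= in_itv /= => /andP[t1 t2].
have tt : 0 < t < T.
  by rewrite lt_neqAle t1 andbT (le_lt_trans t2 tT) andbT; apply/eqP => e; exact: tn0 (esym e).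
apply: le_trans (h tt) _; have {}hD := hD tt.
have st : s t <= K by case/andP: tt => a b; rewrite sK// !ltW.
apply: (@le_trans _ _ (defect_rate t * s t)).
  by rewrite ler_wpM2r// ler_wpM2r.
by rewrite mulrC ler_wpM2r// mulr_ge0// addr_ge0.
Qed.

(** * The balance laws with the defect measures estimated *)

Definition Iq (tau : R) (g : R * space -> R) : R := \int[lam]_(z in Qt tau) g z.

Lemma mass_equation : {ae leb, forall tau, 0 < tau < T ->
  forall psi psit gpsi K, C1_cylinder T Omega psi psit gpsi -> 0 <= K ->
  (forall t, 0 <= t <= T -> sup_on (closure Omega) (fun x => `|psi t x|) +
       sup_on (closure Omega) (fun x => enorm (gpsi t x)) <= K) ->
  `|\int[lebN]_(x in Omega) (rho (tau, x) * psi tau x) -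
    \int[lebN]_(x in Omega) (bracket (nu0 x) fst * psi 0 x) -
    Iq tau (fun z => rho z * psit z.1 z.2 + \sum_j mom j z * gpsi z.1 z.2 ord0 j)|
  <= K * \int[leb]_(t in `[0, tau]) defect_rate t}.
Proof.
apply: (ae_S (mv_continuity dmv)) => tau h tt psi psit gpsi K adm K0 hK.
have /andP[t0 tT] := tt; have [_ E] := h tt _ _ _ adm.
have [[_ cg _] cpt _] := adm.
have Ig : intg lam Q (fun z => rho z * psit z.1 z.2 + \sum_j mom j z * gpsi z.1 z.2 ord0 j).
  apply: intgD; first exact: measurable_cylinder.
    exact: (cyl_intgM I_rho cpt).
  apply: intg_sum => [|j _]; first exact: measurable_cylinder.
  exact: (cyl_intgM (I_mom j) (cg j)).
rewrite /rho E /Iq -(slice_prod Ig t0 (ltW tT)) addrAC.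
rewrite [X in X - _ + _](_ : _ = \int[leb]_(t in `[0, tau])
   slice (fun z => rho z * psit z.1 z.2 + \sum_j mom j z * gpsi z.1 z.2 ord0 j) t); last first.
  apply: eq_Rintegral => t _; apply: eq_Rintegral => x _; congr (_ + _).
  by rewrite /inner big_ord1; apply: eq_bigr => j _; rewrite mxE.
rewrite subrr add0r; apply: (@error_bound _ (fun t => sup_on (closure Omega) (fun x => `|psi t x|) +
       sup_on (closure Omega) (fun x => enorm (gpsi t x))) chi) => //.
- by move=> t; apply: (le_trans (ler_norm _)); rewrite lerDl.
- by move=> t; rewrite addr_ge0// sup_on_ge0// => x; exact: enorm_ge0.
- by apply: (ae_S (mv_continuity dmv)) => t ht tt'; have [] := ht tt' _ _ _ adm.
Qed.

Lemma momentum_equation : {ae leb, forall tau, 0 < tau < T ->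
  forall phi phit gphi K, vC1_cylinder T Omega phi phit gphi -> zero_on_boundary T Omega phi -> 0 <= K ->
  (forall t, 0 <= t <= T -> sup_on (closure Omega) (fun x => enorm (phi t x)) +
       sup_on (closure Omega) (fun x => enorm (gphi t x)) <= K) ->
  `|\int[lebN]_(x in Omega) (\sum_i mom i (tau, x) * phi tau x ord0 i) -
    \int[lebN]_(x in Omega) (\sum_i bracket (nu0 x) (fun y => momentum y ord0 i) * phi 0 x ord0 i) -
    (Iq tau (fun z => \sum_i mom i z * phit z.1 z.2 ord0 i +
        \sum_i \sum_j cnv i j z * gphi z.1 z.2 i j + prs z * \tr (gphi z.1 z.2)) -
     Iq tau (fun z => inner (viscous_stress mu eta (gu z.1 z.2)) (gphi z.1 z.2)))|
  <= K * \int[leb]_(t in `[0, tau]) defect_rate t}.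
Proof.
apply: (ae_S (mv_momentum dmv)) => tau h tt phi phit gphi K adm z0 K0 hK.
have /andP[t0 tT] := tt; have [_ E] := h tt _ _ _ adm z0.
have cgphi i j : continuous_cylinder T Omega (fun t x => gphi t x i j).
  have [[_ cg _] _ _] := adm i; have := cg j.
  by rewrite (_ : (fun t x => row i (gphi t x) ord0 j) = (fun t x => gphi t x i j))//;
    apply/funext => t; apply/funext => x; rewrite mxE.
have cphit i : continuous_cylinder T Omega (fun t x => phit t x ord0 i) by have [_ + _] := adm i; exact.
have Ig : intg lam Q (fun z => \sum_i mom i z * phit z.1 z.2 ord0 i +
        \sum_i \sum_j cnv i j z * gphi z.1 z.2 i j + prs z * \tr (gphi z.1 z.2)).
  apply: intgD => //; first apply: intgD => //.
  - by apply: intg_sum => // i _; exact: (cyl_intgM (I_mom i) (cphit i)).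
  - by apply: intg_sum => // i _; apply: intg_sum => // j _; exact: (cyl_intgM (I_cnv i j) (cgphi i j)).
  - have ctr : continuous_cylinder T Omega (fun t x => \tr (gphi t x)) by apply: cyl_sum => i; exact: cgphi.
    exact: (cyl_intgM I_prs ctr).
have IV : intg lam Q (fun z => inner (viscous_stress mu eta (gu z.1 z.2)) (gphi z.1 z.2)).
  by apply: visc_intg => i j; [have [_] := vel_L2 i; exact|exact: (cyl_L2 (cgphi i j))].
rewrite /Iq -(slice_prod Ig t0 (ltW tT)) -(slice_prod IV t0 (ltW tT)).
rewrite [X in `|X - _ - _|](_ : _ = \int[lebN]_(x in Omega) inner (bracket_mx (nu (tau, x)) momentum) (phi tau x)); last first.
  by apply: eq_Rintegral => x _; rewrite /inner big_ord1; apply: eq_bigr => j _; rewrite mxE.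
rewrite [X in `|_ - X - _|](_ : _ = \int[lebN]_(x in Omega) inner (bracket_mx (nu0 x) momentum) (phi 0 x)); last first.
  by apply: eq_Rintegral => x _; rewrite /inner big_ord1; apply: eq_bigr => j _; rewrite mxE.
rewrite E [X in X - _ + _ - _](_ : _ = \int[leb]_(t in `[0, tau])
   slice (fun z => \sum_i mom i z * phit z.1 z.2 ord0 i +
        \sum_i \sum_j cnv i j z * gphi z.1 z.2 i j + prs z * \tr (gphi z.1 z.2)) t); last first.
  apply: eq_Rintegral => t _; apply: eq_Rintegral => x _; congr (_ + _ + _).
    by rewrite /inner big_ord1; apply: eq_bigr => j _; rewrite mxE.
  by rewrite /inner; apply: eq_bigr => i _; apply: eq_bigr => j _; rewrite mxE.
rewrite addrAC subrr add0r; apply: (@error_bound _ (fun t => sup_on (closure Omega) (fun x => enorm (phi t x)) +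
       sup_on (closure Omega) (fun x => enorm (gphi t x))) xi) => //.
- by move=> t; apply: (le_trans (ler_norm _)); rewrite lerDr.
- by move=> t; rewrite addr_ge0// sup_on_ge0// => x; exact: enorm_ge0.
- by apply: (ae_S (mv_momentum dmv)) => t ht tt'; have [] := ht tt' _ _ _ adm z0.
Qed.

Local Notation II tau := (Iq tau).

Variables (Br : R).
Hypothesis B0 : 0 <= B.
Hypothesis Br0 : 0 <= Br.
Hypothesis rBr : forall t x, 0 <= t <= T -> closure Omega x -> `|psir t x| <= Br.
Hypothesis grBr : forall t x j, 0 <= t <= T -> closure Omega x -> `|gpsir t x ord0 j| <= Br.

(** The part evaluated at a fixed time when the four balances are added; for v = U it is the
    relative energy. *)
Definition boundary_density (e : R) (m : 'I_N -> R) (rh : R) (v : space) (a : R) : R :=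
  e - \sum_i m i * v ord0 i + rh * (2^-1 * \sum_i v ord0 i * v ord0 i) - rh * P1 p a + p a.

(** The only term containing the time derivative of the averaged field. It is separated because its
    limit needs Pratt's lemma, whereas all coefficients in [q2] are uniformly bounded. *)
Definition q1 n (z : R * space) : R :=
  \sum_i (mom i z - rho z * phi n z.1 z.2 ord0 i) * phit n z.1 z.2 ord0 i.

Definition q2gen (G : 'M[R]_N) (w : space) (z : R * space) : R :=
  \sum_j mom j z * w ord0 j - \sum_i \sum_j cnv i j z * G i j - prs z * \tr G
  - rho z * psirt z.1 z.2 - \sum_j mom j z * gpsir z.1 z.2 ord0 j
  + derive1 p (r z.1 z.2) * rt z.1 z.2 + inner (viscous_stress mu eta (gu z.1 z.2)) G.

Definition q2 n (z : R * space) : R := q2gen (gphi n z.1 z.2) (gpsi n z.1 z.2) z.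

Definition q2lim (z : R * space) : R :=
  q2gen (gU z.1 z.2) (\row_j \sum_i U z.1 z.2 ord0 i * gU z.1 z.2 i j) z.

Definition viscous_rate (z : R * space) : R := inner (viscous_stress mu eta (gu z.1 z.2)) (gu z.1 z.2).

(** The C^1 norms in space of the three test functions phi, |phi|^2/2 and P'(r), uniformly in time
    and in n. *)
Definition defect_const : R :=
  (N%:R * B + B + (N%:R * N%:R * B + B)) +
  (2^-1 * (N%:R * (B * B)) + (N%:R * (N%:R * (B * B)) + N%:R * (B * B))) + (Br + (N%:R * Br + Br)).

Lemma norm_sum_le n (f : 'I_n -> R) (C : R) : (forall i, `|f i| <= C) -> `|\sum_i f i| <= n%:R * C.
Proof.
move=> h; apply: (le_trans (ler_norm_sum _ _ _)).
by rewrite mulr_natl -[n in leRHS]card_ord -sumr_const; apply: ler_sum => i _.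
Qed.

Lemma enorm_row_le (v : space) (C : R) : 0 <= C -> (forall i, `|v ord0 i| <= C) -> enorm v <= N%:R * C + C.
Proof.
move=> C0 h; have := @enorm_le R 1 N v C C0; rewrite mul1r; apply.
by move=> i j; rewrite ord1; exact: h.
Qed.

Lemma gpsi_bound n t x j : 0 <= t <= T -> closure Omega x -> `|gpsi n t x ord0 j| <= N%:R * (B * B).
Proof.
move=> tT cx; rewrite mxE; apply: norm_sum_le => i; rewrite normrM.
by apply: ler_pM => //; [exact: phi_bound|exact: gphi_bound].
Qed.

Lemma sup_phi n t : 0 <= t <= T -> sup_on (closure Omega) (fun x => enorm (phi n t x)) +
  sup_on (closure Omega) (fun x => enorm (gphi n t x)) <= N%:R * B + B + (N%:R * N%:R * B + B).
Proof.
move=> tT; apply: lerD; apply: sup_on_le => // x cx.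
  by apply: enorm_row_le => // i; exact: phi_bound.
by apply: enorm_le => // i j; exact: gphi_bound.
Qed.

Lemma sup_psi n t : 0 <= t <= T -> sup_on (closure Omega) (fun x => `|psi n t x|) +
  sup_on (closure Omega) (fun x => enorm (gpsi n t x)) <=
  2^-1 * (N%:R * (B * B)) + (N%:R * (N%:R * (B * B)) + N%:R * (B * B)).
Proof.
move=> tT; apply: lerD; apply: sup_on_le => // x cx.
  rewrite normrM ger0_norm// ler_wpM2l//; apply: norm_sum_le => i; rewrite normrM.
  by apply: ler_pM => //; exact: phi_bound.
by apply: enorm_row_le => [|i]; [rewrite !mulr_ge0|exact: gpsi_bound].
Qed.

Lemma sup_psir t : 0 <= t <= T -> sup_on (closure Omega) (fun x => `|psir t x|) +
  sup_on (closure Omega) (fun x => enorm (gpsir t x)) <= Br + (N%:R * Br + Br).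
Proof.
move=> tT; apply: lerD; apply: sup_on_le => // x cx; first exact: rBr.
by apply: enorm_row_le => // i; exact: grBr.
Qed.

Lemma clc_cyl (f : R -> space -> R) t : cyl f -> 0 <= t <= T -> clc Omega (f t).
Proof. by move=> cf tT; split; exact: (cyl_section cf tT). Qed.

Lemma cyl_pr : cyl (fun t x => p (r t x)).
Proof.
apply: cyl_comp; first exact: str_cr.
by move=> t x tT cx; apply: (p_cont pl); exact: strong_r_gt0 str _ _ tT cx.
Qed.

Lemma cyl_p'rt : cyl (fun t x => derive1 p (r t x) * rt t x).
Proof.
apply: cylM; last exact: cyl_rt.
apply: cyl_comp; first exact: str_cr.
by move=> t x tT cx; apply: (p'_cont pl); exact: strong_r_gt0 str _ _ tT cx.
Qed.

Lemma cyl_psirt : cyl psirt.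
Proof. by apply: cylM; [exact: cyl_p''r|exact: cyl_rt]. Qed.

Lemma cyl_gpsi n j : cyl (fun t x => gpsi n t x ord0 j).
Proof.
rewrite (_ : (fun t x => _) = (fun t x => \sum_i phi n t x ord0 i * gphi n t x i j)).
  by apply: cyl_sum => i; apply: cylM; [exact: cyl_phi|exact: cyl_gphi].
by apply/funext => t; apply/funext => x; rewrite mxE.
Qed.

(** Supplies the summand p(r) of the relative energy, which no equation of the measure-valued
    solution contains. *)
Lemma pressure_increment tau : 0 < tau < T ->
  \int[lebN]_(x in Omega) p (r tau x) - \int[lebN]_(x in Omega) p (r 0 x) =
  II tau (fun z => derive1 p (r z.1 z.2) * rt z.1 z.2).
Proof.
move=> /andP[t0 tT]; have cl t : 0 <= t <= T -> clc Omega (fun x => p (r t x)) by exact: clc_cyl cyl_pr.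
have tt : 0 <= tau <= T by rewrite !ltW.
have t00 : 0 <= (0 : R) <= T by rewrite lexx ltW.
rewrite -RintB//; [|exact: (cl_intg oO OA (cl _ tt))|exact: (cl_intg oO OA (cl _ t00))].
have IQ : intg lam Q (fun z => derive1 p (r z.1 z.2) * rt z.1 z.2) := cyl_intg (@cyl_p'rt).
have IQt : intg lam (Qt tau) (fun z => derive1 p (r z.1 z.2) * rt z.1 z.2).
  apply: (intgS _ _ _ IQ); [exact: measurable_cylinder|exact: measurable_cylinder|].
  by move=> [t x] [/= + Ox]; rewrite !in_itv /= => /andP[-> /lt_trans h]; split => //=; exact: h.
have sub x : Omega x -> forall f, cyl f -> {within `[0, tau], continuous (fun t => f t x)}.
  move=> Ox f cf; apply: near_within => t e; rewrite /= in_itv /= => /andP[s0 st] e0.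
  have sT : 0 <= t <= T by rewrite s0 (le_trans st (ltW tT)).
  have [d d0 hd] := cyl_near cf sT (OcO Ox) e0.
  apply/nbhs_ballP; exists d => // s; rewrite /ball /= => ts; rewrite /= in_itv /= => /andP[u0 ut].
  by rewrite distrC hd ?u0 ?(le_trans ut (ltW tT)) ?subrr ?normr0//; [exact: OcO|rewrite distrC].
have cont x : Omega x -> {within `[0, tau], continuous (fun t => derive1 p (r t x) * rt t x)}.
  by move=> Ox; apply: (sub x Ox (fun t x => derive1 p (r t x) * rt t x)); exact: cyl_p'rt.
rewrite /Iq -fub_Rint_sym//; last first.
  move=> x Ox; apply: intg_oo; apply: continuous_compact_integrable; first exact: segment_compact.
  exact: cont.
apply: eq_Rintegral => x; rewrite inE => Ox /=; rewrite -Rint_cc//; last first.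
  apply: intg_oo; apply: continuous_compact_integrable; first exact: segment_compact.
  exact: cont.
apply/esym; apply: (@FTC2 R _ (fun t => p (r t x)) 0 tau (ltW t0) (cont x Ox)).
  by apply: (sub x Ox (fun t x => p (r t x))); exact: cyl_pr.
move=> t /andP[s0 st]; have tt' : 0 < t < T by rewrite s0 (lt_trans st).
apply: (@Dcomp R R p (fun s => r s x)); last exact: str_drt.
apply: (dp pl); apply: (strong_r_gt0 str); last exact: OcO.
by case/andP: tt' => *; rewrite !ltW.
Qed.

Lemma boundary_split (e rh : space -> R) (m : 'I_N -> space -> R) n t : 0 <= t <= T ->
  intg lebN Omega e -> (forall i, intg lebN Omega (m i)) -> intg lebN Omega rh ->
  \int[lebN]_(x in Omega) boundary_density (e x) (m^~ x) (rh x) (phi n t x) (r t x) =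
  \int[lebN]_(x in Omega) e x - \int[lebN]_(x in Omega) (\sum_i m i x * phi n t x ord0 i)
  + \int[lebN]_(x in Omega) (rh x * psi n t x) - \int[lebN]_(x in Omega) (rh x * psir t x)
  + \int[lebN]_(x in Omega) p (r t x).
Proof.
move=> tT Ie Im Ir.
have cp i : cyl (fun t x => phi n t x ord0 i) by exact: cyl_phi.
have c1 i : clc Omega (fun x => phi n t x ord0 i) := clc_cyl (cp i) tT.
have c2 : clc Omega (psi n t).
  by apply: clM; [exact: cl_cst|apply: cl_sum => i; exact: clM].
have c3 : clc Omega (psir t) := @clc_cyl psir t cyl_psir tT.
have c4 : clc Omega (fun x => p (r t x)) := @clc_cyl _ t (@cyl_pr) tT.
have i1 : intg lebN Omega (fun x => \sum_i m i x * phi n t x ord0 i).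
  by apply: intg_sum => // i _; exact: (cl_intgM oO OA).
have i2 : intg lebN Omega (fun x => rh x * psi n t x) by exact: (cl_intgM oO OA).
have i3 : intg lebN Omega (fun x => rh x * psir t x) by exact: (cl_intgM oO OA).
have i4 : intg lebN Omega (fun x => p (r t x)) by exact: (cl_intg oO OA).
have i5 : intg lebN Omega (fun x => e x - \sum_i m i x * phi n t x ord0 i) by exact: intgB.
have i6 : intg lebN Omega (fun x => e x - \sum_i m i x * phi n t x ord0 i + rh x * psi n t x) by exact: intgD.
have i7 : intg lebN Omega (fun x => e x - \sum_i m i x * phi n t x ord0 i + rh x * psi n t x - rh x * psir t x) by exact: intgB.
by rewrite (RintD mO i7 i4) (RintB mO i6 i3) (RintD mO i5 i2) (RintB mO Ie i1).
Qed.

Lemma intg_Qt tau g : 0 < tau < T -> intg lam Q g -> intg lam (Qt tau) g.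
Proof.
move=> /andP[_ tT]; apply: intgS; [exact: measurable_cylinder|exact: measurable_cylinder|].
by move=> [t x] [/= + Ox]; rewrite !in_itv /= => /andP[-> /lt_trans h]; split => //=; exact: h.
Qed.

Lemma I_q1 n : intg lam Q (q1 n).
Proof.
apply: intg_sum => // i _.
have cp : cyl (fun t x => phi n t x ord0 i) by exact: cyl_phi.
have cpt : cyl (fun t x => phit n t x ord0 i) by exact: cyl_phit.
apply: (@eq_intg _ _ _ lam Q (fun z => mom i z * phit n z.1 z.2 ord0 i -
  rho z * (phi n z.1 z.2 ord0 i * phit n z.1 z.2 ord0 i))) => // [z _|]; first by ring.
apply: intgB => //.
  exact: (cyl_intgM (I_mom i) cpt).
exact: (cyl_intgM I_rho (cylM cp cpt)).
Qed.

(** The energy inequality, minus the momentum balance for phi, plus the mass balance for |phi|^2/2,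
    minus the mass balance for P'(r), plus the increment of p(r). Each use of a balance costs a C^1
    norm times the integrated defect rate. *)
Lemma approximate_inequality : {ae leb, forall tau, 0 < tau < T -> forall n,
  \int[lebN]_(x in Omega) boundary_density (ene (tau, x)) (fun i => mom i (tau, x)) (rho (tau, x))
      (phi n tau x) (r tau x)
  + \int[leb]_(t in `[0, tau]) slice viscous_rate t + D tau <=
  \int[lebN]_(x in Omega) boundary_density (bracket (nu0 x) (energy p))
      (fun i => bracket (nu0 x) (fun y => momentum y ord0 i)) (bracket (nu0 x) fst) (phi n 0 x) (r 0 x)
  - II tau (q1 n) + II tau (q2 n) + defect_const * \int[leb]_(t in `[0, tau]) defect_rate t}.
Proof.
have Hs := ae_S3 (ae_slice I_rho) (ae_slice I_ene) (ae_forall_fin (fun i => ae_slice (I_mom i)))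
  (fun t a b c => conj a (conj b c)).
have He := ae_S3 mass_equation momentum_equation (mv_energy dmv)
  (fun t a b c => conj a (conj b c)).
apply: (ae_S2 Hs He) => tau [s1 [s2 s3]] [h1 [h2 h3]] tt n.
have {}s1 := s1 tt; have {}s2 := s2 tt; have {}h1 := h1 tt; have {}h2 := h2 tt; have {}h3 := h3 tt.
have tT : 0 <= tau <= T by case/andP: tt => a b; rewrite !ltW.
have tT0 : 0 <= (0 : R) <= T by rewrite lexx ltW.
rewrite (boundary_split n tT s2 (fun i => s3 i tt) s1).
rewrite (boundary_split n tT0 (mv_energy_int0 dmv).2 (fun i => (mv_momentum_int0 dmv i).2) (mv_density_int0 dmv).2).
have C0 : 0 <= N%:R * (B * B) :> R by rewrite !mulr_ge0.
have K1 : 0 <= 2^-1 * (N%:R * (B * B)) + (N%:R * (N%:R * (B * B)) + N%:R * (B * B)) :> R.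
  by rewrite !addr_ge0// mulr_ge0.
have K2 : 0 <= Br + (N%:R * Br + Br) by rewrite !addr_ge0// mulr_ge0.
have K3 : 0 <= N%:R * B + B + (N%:R * N%:R * B + B) by rewrite !addr_ge0// !mulr_ge0.
have e1 := h1 _ _ _ _ (psi_admissible n) K1 (@sup_psi n).
have e2 := h1 _ _ _ _ psir_admissible K2 sup_psir.
have e3 := h2 _ _ _ _ (phi_admissible n) (phi_zero n) K3 (@sup_phi n).
have e4 := pressure_increment tt.
pose g1 z := \sum_i mom i z * phit n z.1 z.2 ord0 i + \sum_i \sum_j cnv i j z * gphi n z.1 z.2 i j +
  prs z * \tr (gphi n z.1 z.2).
pose g2 z := inner (viscous_stress mu eta (gu z.1 z.2)) (gphi n z.1 z.2).
pose g3 z := rho z * psit n z.1 z.2 + \sum_j mom j z * gpsi n z.1 z.2 ord0 j.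
pose g4 z := rho z * psirt z.1 z.2 + \sum_j mom j z * gpsir z.1 z.2 ord0 j.
pose g5 z := derive1 p (r z.1 z.2) * rt z.1 z.2.
have cpt i : cyl (fun t x => phit n t x ord0 i) by exact: cyl_phit.
have cgp i j : cyl (fun t x => gphi n t x i j) by exact: cyl_gphi.
have ctr : cyl (fun t x => \tr (gphi n t x)) by apply: cyl_sum => i; exact: cgp.
have cgr j : cyl (fun t x => gpsir t x ord0 j) by exact: cyl_gpsir.
have [_ cpsit _] := psi_admissible n.
have cM g f : intg lam Q g -> cyl f -> intg lam Q (fun z => g z * f z.1 z.2) := @cyl_intgM g f.
have j1 : intg lam Q g1.
  apply: intgD => //; first apply: intgD => //.
  - by apply: intg_sum => // i _; exact: (cM _ _ (I_mom i) (cpt i)).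
  - by apply: intg_sum => // i _; apply: intg_sum => // j _; exact: (cM _ _ (I_cnv i j) (cgp i j)).
  - exact: (cM _ _ I_prs ctr).
have j2 : intg lam Q g2.
  apply: visc_intg => i j; last exact: (cyl_L2 (cgp i j)).
  by have [_] := vel_L2 i; exact.
have j3 : intg lam Q g3.
  apply: intgD => //; first exact: (cM _ _ I_rho cpsit).
  by apply: intg_sum => // j _; exact: (cM _ _ (I_mom j) (@cyl_gpsi n j)).
have j4 : intg lam Q g4.
  apply: intgD => //; first exact: (cM _ _ I_rho (@cyl_psirt)).
  by apply: intg_sum => // j _; exact: (cM _ _ (I_mom j) (cgr j)).
have j5 : intg lam Q g5 := cyl_intg (@cyl_p'rt).
have jq := @I_q1 n.
(* The terms with phi_t in [g1] and [g3] add up to minus [q1], so adding [q1] leaves an expression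
   free of time derivatives of phi. *)
have qE z : q2 n z = q1 n z + (g2 z - g1 z + g3 z - g4 z + g5 z).
  have -> : q1 n z = \sum_i mom i z * phit n z.1 z.2 ord0 i - rho z * psit n z.1 z.2.
    rewrite /q1 mulr_sumr -sumrB; apply: eq_bigr => i _; ring.
  rewrite /q2 /q2gen /g1 /g2 /g3 /g4 /g5.
  move: (\sum_i mom i z * phit n z.1 z.2 ord0 i) (rho z * psit n z.1 z.2) (inner _ _) (\sum_i \sum_j _)
    (prs z * _) (\sum_j mom j z * gpsi n z.1 z.2 ord0 j) (\sum_j mom j z * gpsir z.1 z.2 ord0 j)
    (rho z * _) (derive1 p _ * _) => a1 a2 a3 a4 a5 a6 a7 a8 a9; ring.
have i21 : intg lam Q (fun z => g2 z - g1 z) by exact: intgB.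
have i213 : intg lam Q (fun z => g2 z - g1 z + g3 z) by exact: intgD.
have i2134 : intg lam Q (fun z => g2 z - g1 z + g3 z - g4 z) by exact: intgB.
have i5 : intg lam Q (fun z => g2 z - g1 z + g3 z - g4 z + g5 z) by exact: intgD.
have ID f g : intg lam Q f -> intg lam Q g -> II tau (fun z => f z + g z) = II tau f + II tau g.
  by move=> If Ig; apply: RintD; [exact: measurable_cylinder|exact: intg_Qt|exact: intg_Qt].
have IB f g : intg lam Q f -> intg lam Q g -> II tau (fun z => f z - g z) = II tau f - II tau g.
  by move=> If Ig; apply: RintB; [exact: measurable_cylinder|exact: intg_Qt|exact: intg_Qt].
have E : II tau (q2 n) = II tau (q1 n) + (II tau g2 - II tau g1 + II tau g3 - II tau g4 + II tau g5).
  have -> : II tau (q2 n) = II tau (fun z => q1 n z + (g2 z - g1 z + g3 z - g4 z + g5 z)).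
    by apply: eq_Rintegral => z _; exact: qE.
  by rewrite (ID _ _ jq i5) (ID _ _ i2134 j5) (IB _ _ i213 j4) (ID _ _ i21 j3) (IB _ _ j2 j1).
move: e1 e2 e3 e4 h3; rewrite E /defect_const -/g1 -/g2 -/g3 -/g4 -/g5 !ler_norml => /andP[_ e1] /andP[e2 _] /andP[e3 _] e4 h3.
have h3' : \int[lebN]_(x in Omega) ene (tau, x) + \int[leb]_(t in `[0, tau]) slice viscous_rate t + D tau <=
  \int[lebN]_(x in Omega) bracket (nu0 x) (energy p) := h3.
move: e1 e2 e3 e4 h3'; clear.
move: (\int[leb]_(t in `[0, tau]) defect_rate t) => K.
move: (II tau g1) (II tau g2) (II tau g3) (II tau g4) (II tau g5) (II tau (q1 n)) => a1 a2 a3 a4 a5 a6.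
move: (D tau) (\int[leb]_(t in `[0, tau]) _) => a7 a8.
move: (\int[lebN]_(x in Omega) ene (tau, x)) (\int[lebN]_(x in Omega) (bracket (nu0 x) (energy p))) => b1 b2.
move: (\int[lebN]_(x in Omega) p (r tau x)) (\int[lebN]_(x in Omega) p (r 0 x)) => b3 b4.
move: (\int[lebN]_(x in Omega) (rho (tau, x) * psi n tau x)) (\int[lebN]_(x in Omega) (rho (tau, x) * psir tau x)) => b5 b6.
move: (\int[lebN]_(x in Omega) (bracket (nu0 x) fst * psi n 0 x)) (\int[lebN]_(x in Omega) (bracket (nu0 x) fst * psir 0 x)) => b7 b8.
move: (\int[lebN]_(x in Omega) (\sum_i mom i (tau, x) * _)) (\int[lebN]_(x in Omega) (\sum_i bracket (nu0 x) _ * _)) => b9 b10.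
rewrite !mulrDl; move: (_ * K) (_ * K) (_ * K) (_ * K) (_ * K) (_ * K) (_ * K).
by move: (Br * K) => *; lra.
Qed.

Lemma bl_cyl (f : nat -> R -> space -> R) (F : R -> space -> R) (C tau : R) : 0 < tau < T ->
  (forall n, cyl (f n)) -> (forall n t x, 0 <= t <= T -> closure Omega x -> `|f n t x| <= C) ->
  (forall t x, 0 <= t <= T -> closure Omega x -> (fun n => f n t x) @ \oo --> F t x) ->
  bounded_limit (Qt tau) (fun n z => f n z.1 z.2) (fun z => F z.1 z.2).
Proof.
move=> /andP[_ tT] cf fC fF.
have H z : Qt tau z -> 0 <= z.1 <= T /\ closure Omega z.2.
  move=> [/= + Oz]; rewrite in_itv /= => /andP[a b].
  by split; [rewrite !ltW// (lt_trans b)|exact: OcO].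
split.
- move=> n; apply: (measurable_funS mQ _ (cyl_measurable (cf n))).
  by move=> [t x] [/= + Ox]; rewrite !in_itv /= => /andP[-> /lt_trans h]; split => //=; exact: h.
- by exists C => n z /H[h1 h2]; exact: fC.
- by move=> z /H[h1 h2]; exact: fF.
Qed.

Lemma bl_section (f : nat -> R -> space -> R) (F : R -> space -> R) (C t : R) : 0 <= t <= T ->
  (forall n, cyl (f n)) -> (forall n t x, 0 <= t <= T -> closure Omega x -> `|f n t x| <= C) ->
  (forall t x, 0 <= t <= T -> closure Omega x -> (fun n => f n t x) @ \oo --> F t x) ->
  bounded_limit Omega (fun n => f n t) (F t).
Proof.
move=> tT cf fC fF; split.
- by move=> n; apply: (cl_meas oO OA); exact: clc_cyl (cf n) tT.
- by exists C => n x /OcO; exact: fC.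
- by move=> x /OcO; exact: fF.
Qed.

Lemma bl_cylc (f : R -> space -> R) tau : 0 < tau < T -> cyl f ->
  bounded_limit (Qt tau) (fun _ z => f z.1 z.2) (fun z => f z.1 z.2).
Proof.
move=> tt cf; have [C _ hC] := cyl_bounded (compact_closure_bounded OA) cf.
apply: (@bl_cyl (fun=> f) f C tau tt) => [n|n t x|t x _ _]; [exact: cf|exact: hC|exact: cvg_cst].
Qed.

Lemma bl_sectionc (f : R -> space -> R) t : 0 <= t <= T -> cyl f ->
  bounded_limit Omega (fun _ => f t) (f t).
Proof.
move=> tt cf; have [C _ hC] := cyl_bounded (compact_closure_bounded OA) cf.
apply: (@bl_section (fun=> f) f C t tt) => [n|n s x|s x _ _]; [exact: cf|exact: hC|exact: cvg_cst].
Qed.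

Lemma bl_phi tau i : 0 < tau < T ->
  bounded_limit (Qt tau) (fun n z => phi n z.1 z.2 ord0 i) (fun z => U z.1 z.2 ord0 i).
Proof.
move=> tt; apply: (@bl_cyl (fun n t x => phi n t x ord0 i) (fun t x => U t x ord0 i) B) => //.
- by move=> n; exact: cyl_phi.
- by move=> n t x; exact: phi_bound.
- by move=> t x h1 h2; exact: phi_cvg.
Qed.

Lemma bl_gphi tau i j : 0 < tau < T ->
  bounded_limit (Qt tau) (fun n z => gphi n z.1 z.2 i j) (fun z => gU z.1 z.2 i j).
Proof.
move=> tt; apply: (@bl_cyl (fun n t x => gphi n t x i j) (fun t x => gU t x i j) B) => //.
- by move=> n; exact: cyl_gphi.
- by move=> n t x; exact: gphi_bound.
- by move=> t x h1 h2; exact: gphi_cvg.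
Qed.

Lemma bl_gpsi tau j : 0 < tau < T -> bounded_limit (Qt tau) (fun n z => gpsi n z.1 z.2 ord0 j)
  (fun z => (\row_j \sum_i U z.1 z.2 ord0 i * gU z.1 z.2 i j) ord0 j).
Proof.
move=> tt; have := @bl_sum _ _ R (Qt tau) _ _ _ (fun i => blM (@bl_phi tau i tt) (@bl_gphi tau i j tt)).
rewrite (_ : (fun n z => \sum_i _) = (fun n z => gpsi n z.1 z.2 ord0 j)); last first.
  by apply/funext => n; apply/funext => z; rewrite mxE.
rewrite (_ : (fun z => \sum_i _) = (fun z => (\row_j \sum_i U z.1 z.2 ord0 i * gU z.1 z.2 i j) ord0 j))//.
by apply/funext => z; rewrite mxE.
Qed.

Lemma bl_phi_section t i : 0 <= t <= T ->
  bounded_limit Omega (fun n x => phi n t x ord0 i) (fun x => U t x ord0 i).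
Proof.
move=> tt; apply: (@bl_section (fun n t x => phi n t x ord0 i) (fun t x => U t x ord0 i) B) => //.
- by move=> n; exact: cyl_phi.
- by move=> n s x; exact: phi_bound.
- by move=> s x h1 h2; exact: phi_cvg.
Qed.

Lemma boundary_limit (e rh : space -> R) (m : 'I_N -> space -> R) t : 0 <= t <= T ->
  intg lebN Omega e -> (forall i, intg lebN Omega (m i)) -> intg lebN Omega rh ->
  intg lebN Omega (fun x => boundary_density (e x) (m^~ x) (rh x) (U t x) (r t x)) /\
  (fun n => \int[lebN]_(x in Omega) boundary_density (e x) (m^~ x) (rh x) (phi n t x) (r t x)) @ \oo -->
  \int[lebN]_(x in Omega) boundary_density (e x) (m^~ x) (rh x) (U t x) (r t x).
Proof.
move=> tT Ie Im Ir; apply: (dl_lim mO); apply: (dlD mO); first apply: (dlB mO); first apply: (dlD mO); first apply: (dlB mO).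
- exact: dl_cst.
- by apply: (dl_sum mO) => i; apply: (dlM mO (Im i)); exact: bl_phi_section.
- apply: (dlM mO Ir); apply: blM; last by apply: bl_sum => i; apply: blM; exact: bl_phi_section.
  by apply: (@bl_cst _ _ _ _ (fun=> 2^-1) 2^-1) => // x _; rewrite ger0_norm.
- by apply: (dlM mO Ir); apply: (@bl_sectionc psir) => //; exact: cyl_psir.
- have cp : cyl (fun t x => p (r t x)) by exact: cyl_pr.
  by apply: dl_cst; exact: (cl_intg oO OA (clc_cyl cp tT)).
Qed.

Lemma I_viscous_entry i j : intg lam Q (fun z => viscous_stress mu eta (gu z.1 z.2) i j).
Proof.
apply: (@eq_intg _ _ _ lam Q (fun z => inner (viscous_stress mu eta (gu z.1 z.2)) (delta_mx i j))) => //.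
  move=> z _; rewrite /inner (bigD1 i)//= [X in _ + X]big1 ?addr0 => [|k ki]; last first.
    by rewrite big1// => l _; rewrite [delta_mx _ _ _ _]mxE (negbTE ki) mulr0.
  rewrite (bigD1 j)//= [X in _ + X]big1 ?addr0 => [|k ki]; first by rewrite [delta_mx _ _ _ _]mxE !eqxx mulr1.
  by rewrite [delta_mx _ _ _ _]mxE (negbTE ki) andbF mulr0.
apply: (@visc_intg gu (fun _ _ => delta_mx i j)) => k l.
  by have [_] := vel_L2 k; exact.
by apply: (cyl_L2 (f := fun _ _ => delta_mx i j k l)); exact: cyl_cst.
Qed.

Lemma q2_limit tau : 0 < tau < T -> intg lam (Qt tau) q2lim /\ (fun n => II tau (q2 n)) @ \oo --> II tau q2lim.
Proof.
move=> tt; have mQt := measurable_cylinder tau oO; have W := intg_Qt tt.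
have cp''r : cyl psirt by exact: cyl_psirt.
have cgr j : cyl (fun t x => gpsir t x ord0 j) by exact: cyl_gpsir.
apply: (@dl_lim _ _ _ lam (Qt tau) mQt q2 q2lim); rewrite /q2 /q2lim /q2gen /inner.
have HD := @dlD _ _ _ lam (Qt tau) mQt; have HB := @dlB _ _ _ lam (Qt tau) mQt.
have HM := @dlM _ _ _ lam (Qt tau) mQt; have HC := @dl_cst _ _ _ lam (Qt tau).
have H_sum := @dl_sum _ _ _ lam (Qt tau) mQt.
apply: (HD); first apply: (HD); first apply: (HB); first apply: (HB);
  first apply: (HB); first apply: (HB).
- apply: (H_sum) => j; apply: (HM); [exact: (W _ (I_mom j))|exact: bl_gpsi].
- apply: (H_sum) => i; apply: (H_sum) => j; apply: (HM); [exact: (W _ (I_cnv i j))|exact: bl_gphi].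
- apply: (HM); [exact: (W _ I_prs)|apply: bl_sum => i; exact: bl_gphi].
- by apply: (HM); [exact: (W _ I_rho)|exact: (@bl_cylc psirt)].
- apply: (H_sum) => j; apply: (HM); first exact: (W _ (I_mom j)).
  by apply: (@bl_cylc (fun t x => gpsir t x ord0 j)).
- by apply: HC; apply: W; apply: (cyl_intg (f := fun t x => derive1 p (r t x) * rt t x)); exact: cyl_p'rt.
- apply: (H_sum) => i; apply: (H_sum) => j; apply: (HM); [exact: (W _ (I_viscous_entry i j))|exact: bl_gphi].
Qed.

(** * Removal of the time averaging *)

Variables (S : R -> R).
Hypothesis IS : intg leb `[0, T] S.
Hypothesis S0 : forall t, 0 <= S t.
Hypothesis US : {ae leb, forall t, 0 < t < T -> forall i x, closure Omega x -> `|Ut t x ord0 i| <= S t}.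

Let USi i : {ae leb, forall t, 0 < t < T -> forall x, closure Omega x -> `|Ut t x ord0 i| <= S t}.
Proof. by apply: (ae_S US) => t h tt x; exact: h. Qed.

Lemma phit_maj n t x i : 0 <= t <= T -> closure Omega x -> `|phit n t x ord0 i| <= maj T S n.+1 t.
Proof.
move=> tT cx; rewrite mxE; apply: (tapp'_maj T0 IS S0 TA) => // u v u0 uv vT.
by apply: (U_increment (U := fun t x => U t x ord0 i) _ IS (USi i)) => // t1 t2 y a b c cy; exact: (strong_Ut str).
Qed.

Lemma strong_time_derivative : {ae leb, forall t, forall i : 'I_N, 0 < t < T -> forall x, closure Omega x ->
    is_derive t 1 (fun s => U s x ord0 i) (Ut t x ord0 i)}.
Proof.
apply: ae_forall_fin => i; apply: (ae_time_derivative oO (U := fun t x => U t x ord0 i) _ _ _ _ IS (USi i)).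
- have cU : cyl (fun t x => U t x ord0 i) by exact: str_cU.
  by move=> t tT; exact: (cyl_section cU tT).
- by apply: (ae_S (strong_Ut_continuous str)) => t h tt; exact: h.
- by move=> x cx; exact: (strong_Ut_measurable str).
- by move=> t1 t2 x a b c cx; exact: (strong_Ut str).
Qed.

(* The slices converge at almost every t; the limsup is used because it is measurable in t. *)
Definition time_rate (t : R) : R := fine (limn_esup (fun n => (slice (q1 n) t)%:E)).

Lemma time_rate_cvg : {ae leb, forall t, 0 < t < T ->
  time_rate t = \int[lebN]_(x in Omega) (\sum_i (mom i (t, x) - rho (t, x) * U t x ord0 i) * Ut t x ord0 i) /\
  (fun n => slice (q1 n) t) @ \oo --> time_rate t}.
Proof.
have Hs := ae_S2 (ae_slice I_rho) (ae_forall_fin (fun i => ae_slice (I_mom i))) (fun t a b => conj a b).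
have Hd := strong_time_derivative.
apply: (ae_S3 Hs Hd (prim_derive IS)) => t [s1 s2] hd hS tt.
have {}s1 := s1 tt; have {}hS := hS tt.
have tT : 0 <= t <= T by case/andP: tt => a b; rewrite !ltW.
have L : (fun n => slice (q1 n) t) @ \oo -->
    \int[lebN]_(x in Omega) (\sum_i (mom i (t, x) - rho (t, x) * U t x ord0 i) * Ut t x ord0 i).
  have cM := maj_cvg tt hS.
  have [C HC] : exists C : R, forall n, maj T S n.+1 t <= C.
    have /cvg_has_ub[C HC] : cvgn (fun n => maj T S n.+1 t) by apply/cvg_ex; eexists; exact: cM.
    by exists C => n; apply: (le_trans (ler_norm _)); apply: HC; exists n.
  have bt i : bounded_limit Omega (fun n x => phit n t x ord0 i) (fun x => Ut t x ord0 i).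
    split.
    - move=> n; have cp : cyl (fun t x => phit n t x ord0 i) by exact: cyl_phit.
      exact: (cl_meas oO OA (clc_cyl cp tT)).
    - by exists C => n x /OcO cx; apply: le_trans (HC n); exact: phit_maj.
    - by move=> x /OcO cx; apply: (phit_cvg tt); exact: hd.
  apply: (proj2 (dl_lim mO (f := fun x => \sum_i (mom i (t, x) - rho (t, x) * U t x ord0 i) * Ut t x ord0 i)
     (q := fun n x => q1 n (t, x)) _)).
  apply: (dl_sum mO) => i.
  have H := dlB mO (dlM mO (s2 i tt) (bt i)) (dlM mO s1 (blM (bl_phi_section i tT) (bt i))).
  rewrite (_ : (fun n x => _) = (fun n x => mom i (t, x) * phit n t x ord0 i - rho (t, x) * (phi n t x ord0 i * phit n t x ord0 i))); last first.
    by apply/funext => n; apply/funext => x /=; ring.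
  by rewrite (_ : (fun x => _ * Ut t x ord0 i) = (fun x => mom i (t, x) * Ut t x ord0 i - rho (t, x) * (U t x ord0 i * Ut t x ord0 i)))//;
    apply/funext => x; ring.
suff E : time_rate t = \int[lebN]_(x in Omega) (\sum_i (mom i (t, x) - rho (t, x) * U t x ord0 i) * Ut t x ord0 i).
  by rewrite E.
have L' : (fun n => (slice (q1 n) t)%:E) @ \oo -->
    (\int[lebN]_(x in Omega) (\sum_i (mom i (t, x) - rho (t, x) * U t x ord0 i) * Ut t x ord0 i))%:E.
  by apply: cvg_EFin; [exact: nearW|exact: L].
rewrite /time_rate is_cvg_limn_esupE; last by apply/cvg_ex; eexists; exact: L'.
by rewrite (cvg_lim _ L').
Qed.

(** [maj] bounds phi_t uniformly in space, so it can be taken out of the space integral; the moments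
    left there are bounded uniformly in time. *)
Lemma q1_majorant : exists2 C : R, 0 < C & forall n,
  {ae leb, forall t, 0 < t < T -> `|slice (q1 n) t| <= C * maj T S n.+1 t}.
Proof.
have [C C0 HC] := mom_bound.
exists (N%:R * (C + B * C) + 1); first by rewrite ltr_wpDl// mulr_ge0// addr_ge0// mulr_ge0.
move=> n; have ireg : {ae leb, forall t, {ae lebN, forall x, Q (t, x) -> regular (nu (t, x))}}.
  by apply: (@ae_prodP _ _ _ _ _ leb lebN (fun t x => Q (t, x) -> regular (nu (t, x))));
    apply: (ae_S ae_regular) => -[t x].
have Hs := ae_S2 (ae_slice I_rho) (ae_forall_fin (fun i => ae_slice (I_mom i))) (fun t a b => conj a b).
apply: (ae_S3 HC ireg Hs) => t hC hr [s1 s2] tt.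
have [/andP[_ h1] h2] := hC tt; have {}s1 := s1 tt.
have tT : 0 <= t <= T by case/andP: tt => a b; rewrite !ltW.
have M0 : 0 <= maj T S n.+1 t by exact: (maj_ge0 T0 IS S0).
have Ib : intg lebN Omega (fun x => \sum_(i < N) (`|mom i (t, x)| + B * rho (t, x))).
  by apply: intg_sum => // i _; apply: intgD => //; [apply: intg_norm; exact: s2|exact: intgZ].
apply: (@le_trans _ _ (\int[lebN]_(x in Omega) (maj T S n.+1 t * \sum_(i < N) (`|mom i (t, x)| + B * rho (t, x))))).
  apply: Rint_bound => //; first exact: intgZ.
  apply: (ae_S hr) => x hx Ox; have Qx : Q (t, x) by split => //=; rewrite in_itv.
  have [rho0 _] := regular_bounds (hx Qx).
  apply: (le_trans (ler_norm_sum _ _ _)); rewrite mulr_sumr; apply: ler_sum => i _ /=.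
  rewrite normrM mulrC; apply: ler_pM => //; first exact: phit_maj tT (OcO Ox).
  apply: (le_trans (ler_normB _ _)); rewrite lerD2l normrM mulrC (ger0_norm rho0).
  by apply: ler_wpM2r => //; exact: phi_bound tT (OcO Ox).
rewrite RintZ// mulrC ler_wpM2r// Rint_sum//; last first.
  by move=> i _; apply: intgD => //; [apply: intg_norm; exact: s2|exact: intgZ].
apply: (@le_trans _ _ (N%:R * (C + B * C))); last by rewrite lerDl.
rewrite mulr_natl -[N in leRHS]card_ord -sumr_const; apply: ler_sum => i _.
rewrite RintD//; [|apply: intg_norm; exact: s2|exact: intgZ].
by rewrite RintZ// lerD// ler_wpM2l.
Qed.

(** Pratt's lemma is applied in time to the space integrals. The term carries a minus sign in the
    inequality, so a lower bound for the approximations is the right direction. *)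
Lemma time_rate_limit tau : 0 < tau < T -> intg leb `[0, tau] time_rate /\ forall e : R, 0 < e ->
  \forall n \near \oo, \int[leb]_(t in `[0, tau]) time_rate t - e <= II tau (q1 n).
Proof.
move=> /andP[t0 tT]; have [C C0 HC] := q1_majorant.
have inn (t : R) : t <> 0 -> 0 <= t <= tau -> 0 < t < T.
  move=> tn /andP[a b]; rewrite lt_neqAle a andbT (le_lt_trans b tT) andbT.
  by apply/eqP => e; exact: tn (esym e).
have Iq1 n : intg leb `[0, tau] (slice (q1 n)).
  by apply: (slice_intg_cc _ t0 (ltW tT)); exact: I_q1.
have ISt : intg leb `[0, tau] S by apply: (prim_intg IS) => //; exact: ltW.
have mI : measurable (`[0, tau]%classic : set R) by [].
have IM n : intg leb `[0, tau] (fun t => C * maj T S n.+1 t) by apply: intgZ => //; apply: maj_intg.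
have Im : intg leb `[0, tau] (fun t => C * (12 * S t)) by apply: intgZ => //; exact: intgZ.
have mr : measurable_fun `[0, tau] time_rate.
  apply: (measurableT_comp (fine_measurable _)) => //.
  by apply: measurable_fun_limn_esup => n; apply/measurable_EFinP; exact: intg_meas (Iq1 n).
have [] := @pratt _ _ _ leb `[0, tau]%classic mI (fun n => slice (q1 n)) (fun n t => C * maj T S n.+1 t)
  time_rate (fun t => C * (12 * S t)) Iq1 IM mr Im.
- move=> n; apply: (ae_S2 (HC n) (ae_neq 0)) => t h tn; rewrite /= in_itv /= => tt.
  exact/h/inn.
- apply: (ae_S2 time_rate_cvg (ae_neq 0)) => t h tn; rewrite /= in_itv /= => tt.
  by have [_] := h (inn _ tn tt).
- apply: (ae_S2 (prim_derive IS) (ae_neq 0)) => t h tn; rewrite /= in_itv /= => tt.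
  apply: cvgM; first exact: cvg_cst.
  exact: (maj_cvg (inn _ tn tt) (h (inn _ tn tt))).
- move=> e e0; have eC : 0 < e / C by rewrite divr_gt0.
  have t0T : 0 <= tau <= T by rewrite !ltW.
  have := maj_int_lim T0 IS S0 t0T eC; apply: filterS => n h.
  have i12 : intg leb `[0, tau] (fun t => 12 * S t) by exact: intgZ.
  have -> : \int[leb]_(t in `[0, tau]) (C * maj T S n.+1 t) = C * \int[leb]_(t in `[0, tau]) maj T S n.+1 t.
    by apply: RintZ => //; apply: maj_intg.
  have -> : \int[leb]_(t in `[0, tau]) (C * (12 * S t)) = C * \int[leb]_(t in `[0, tau]) (12 * S t).
    exact: RintZ.
  rewrite -[e in leRHS](mulfVK (lt0r_neq0 C0)) [e / C * C]mulrC -mulrDr; apply: ler_wpM2l => //; exact: ltW.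
- move=> Hi Hl; split => // e e0; apply: filterS (Hl e e0) => n.
  by rewrite (slice_prod (I_q1 n) t0 (ltW tT)).
Qed.

Theorem limit_inequality : {ae leb, forall tau, 0 < tau < T ->
  \int[lebN]_(x in Omega) boundary_density (ene (tau, x)) (fun i => mom i (tau, x)) (rho (tau, x))
      (U tau x) (r tau x)
  + \int[leb]_(t in `[0, tau]) slice viscous_rate t + D tau <=
  \int[lebN]_(x in Omega) boundary_density (bracket (nu0 x) (energy p))
      (fun i => bracket (nu0 x) (fun y => momentum y ord0 i)) (bracket (nu0 x) fst) (U 0 x) (r 0 x)
  - \int[leb]_(t in `[0, tau]) time_rate t + II tau q2lim
  + defect_const * \int[leb]_(t in `[0, tau]) defect_rate t}.
Proof.
have Ha := approximate_inequality.
have Hs := ae_S3 (ae_slice I_rho) (ae_slice I_ene) (ae_forall_fin (fun i => ae_slice (I_mom i)))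
  (fun t a b c => conj a (conj b c)).
apply: (ae_S2 Ha Hs) => tau h [s1 [s2 s3]] tt; have {}h := h tt.
have tT : 0 <= tau <= T by case/andP: tt => a b; rewrite !ltW.
have tT0 : 0 <= (0 : R) <= T by rewrite lexx ltW.
have [_ c1] := boundary_limit tT (s2 tt) (fun i => s3 i tt) (s1 tt).
have [_ c2] := boundary_limit tT0 (mv_energy_int0 dmv).2 (fun i => (mv_momentum_int0 dmv i).2) (mv_density_int0 dmv).2.
have [_ c3] := q2_limit tt; have [_ c4] := time_rate_limit tt.
apply/ler_addgt0Pr => e e0; have e4 : 0 < e / 4 by rewrite divr_gt0.
have /cvgrPdist_le/(_ _ e4) d1 := c1; have /cvgrPdist_le/(_ _ e4) d2 := c2.
have /cvgrPdist_le/(_ _ e4) d3 := c3; have d4 := c4 _ e4.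
have [n [f1 [f2 [f3 f4]]]] := filter_ex (filterI d1 (filterI d2 (filterI d3 d4))).
have g := h n; move: f1 f2 f3 f4 g; rewrite !ler_norml => /andP[f1 f1'] /andP[f2 f2'] /andP[f3 f3'] f4 g.
move: f1 f1' f2 f2' f3 f3' f4 g.
move: (II tau (q1 n)) (II tau (q2 n)) (II tau q2lim) (\int[leb]_(t in `[0, tau]) time_rate t) => a1 a2 a3 a4.
move: (\int[lebN]_(x in Omega) _) (\int[lebN]_(x in Omega) _) => b1 b2.
move: (\int[lebN]_(x in Omega) _) (\int[lebN]_(x in Omega) _) => b3 b4.
move: (\int[leb]_(t in `[0, tau]) slice _ t) (defect_const * _) (D tau) => k1 k2 k3 *; lra.
Qed.

(** * The strong equations and the remainder at almost every time *)

Definition sforce t x : space := force p (r t) (U t) (Ut t) (gr t) (gU t) x.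

(** The product rule is applied to the conservative form; the terms with the time derivative of r
    and with div U cancel by the continuity equation. Differentiability of U in time at every x, for
    almost every t, makes the product rule valid. *)
Lemma strong_force : {ae leb, forall t, 0 < t < T -> exists divS : space -> space,
  weak_divergence Omega (fun x => viscous_stress mu eta (gU t x)) divS /\
  {ae lebN, forall x, Omega x -> forall i, sforce t x ord0 i = divS x ord0 i}}.
Proof.
have [dS [H1 H2]] := strong_momentum str.
have H3 : {ae leb, forall t, {ae lebN, forall x, Q (t, x) ->
    'D_1 (fun s => r s x *: U s x) t + divergence_mx (fun y => r t y *: tensor (U t y) (U t y)) x +
      grad (fun y => p (r t y)) x = dS t x}}.
  apply: (@ae_prodP _ _ _ _ _ leb lebN (fun t x => Q (t, x) ->
    'D_1 (fun s => r s x *: U s x) t + divergence_mx (fun y => r t y *: tensor (U t y) (U t y)) x +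
      grad (fun y => p (r t y)) x = dS t x)).
  by apply: (ae_S H2) => -[t x].
have Hd := strong_time_derivative.
apply: (ae_S3 H1 H3 Hd) => t h1 h3 hd tt; exists (dS t); split; first exact: h1.
apply: (ae_S h3) => x hx Ox i; have Qx : Q (t, x) by split => //=; rewrite in_itv.
rewrite -(hx Qx) !mxE.
have dr := str_drt tt Ox; have dU j := hd j tt x (OcO Ox).
have rx : 0 < r t x by apply: (strong_r_gt0 str _ (OcO Ox)); case/andP: tt => a b; rewrite !ltW.
have dm j : is_derive t 1 (fun s => r s x * U s x ord0 j) (rt t x * U t x ord0 j + r t x * Ut t x ord0 j).
  exact: (@DM R R (fun s => r s x) (fun s => U s x ord0 j)).
have -> : 'D_1 (fun s => r s x *: U s x) t ord0 i = rt t x * U t x ord0 i + r t x * Ut t x ord0 i.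
  have E k j : (fun s => (r s x *: U s x) k j) = (fun s => r s x * U s x ord0 j).
    by apply/funext => s; rewrite mxE ord1.
  rewrite derive_mx; last by apply/derivable_mxP => k j; rewrite E; case: (dm j).
  by rewrite mxE E; case: (dm i).
have -> : divergence (fun y => row i (r t y *: tensor (U t y) (U t y))) x =
    \sum_j (gr t x ord0 j * (U t x ord0 i * U t x ord0 j) +
      r t x * (gU t x i j * U t x ord0 j + U t x ord0 i * gU t x j j)).
  apply: eq_bigr => j _.
  have -> : (fun y => row i (r t y *: tensor (U t y) (U t y)) ord0 j) = (fun y => r t y * (U t y ord0 i * U t y ord0 j)).
    by apply/funext => y; rewrite !mxE big_ord1 !mxE.
  have d : is_derive x (e_ j) (fun y => r t y * (U t y ord0 i * U t y ord0 j))
    (gr t x ord0 j * (U t x ord0 i * U t x ord0 j) + r t x * (gU t x i j * U t x ord0 j + U t x ord0 i * gU t x j j)).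
    by apply: DM; [exact: str_dr|apply: DM; exact: str_dU].
  by case: d.
have -> : 'D_(e_ i) (fun y => p (r t y)) x = derive1 p (r t x) * gr t x ord0 i.
  have d : is_derive x (e_ i) (fun y => p (r t y)) (derive1 p (r t x) * gr t x ord0 i).
    by apply: Dcomp; [exact: (dp pl)|exact: str_dr].
  by case: d.
have -> : rt t x = - (\sum_j U t x ord0 j * gr t x ord0 j + r t x * \tr (gU t x)) by [].
have -> : \sum_j (gr t x ord0 j * (U t x ord0 i * U t x ord0 j) +
      r t x * (gU t x i j * U t x ord0 j + U t x ord0 i * gU t x j j)) =
    U t x ord0 i * (\sum_j U t x ord0 j * gr t x ord0 j) + r t x * (\sum_j U t x ord0 j * gU t x i j) +
    r t x * U t x ord0 i * \tr (gU t x).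
  rewrite /mxtrace !mulr_sumr -!big_split /=; apply: eq_bigr => j _; ring.
by move: (\sum_j _) (\sum_j _) (\tr _) => a b e; ring.
Qed.

Lemma I_q2lim : intg lam Q q2lim.
Proof.
have cgr j : cyl (fun t x => gpsir t x ord0 j) by exact: cyl_gpsir.
have cpt : cyl psirt by exact: cyl_psirt.
have cgp i j : cyl (fun t x => gU t x i j) by exact: str_cgU.
have ctr : cyl (fun t x => \tr (gU t x)) by exact: cyl_tr.
have cw j : cyl (fun t x => (\row_j \sum_i U t x ord0 i * gU t x i j) ord0 j).
  rewrite (_ : (fun t x => _) = (fun t x => \sum_i U t x ord0 i * gU t x i j)).
    by apply: cyl_sum => i; apply: cylM; [exact: str_cU|exact: str_cgU].
  by apply/funext => t; apply/funext => x; rewrite mxE.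
have c5 : cyl (fun t x => derive1 p (r t x) * rt t x) by exact: cyl_p'rt.
have cM g f : intg lam Q g -> cyl f -> intg lam Q (fun z => g z * f z.1 z.2) := @cyl_intgM g f.
apply: intgD => //; last first.
  apply: visc_intg => i j; last exact: (cyl_L2 (cgp i j)).
  by have [_] := vel_L2 i; exact.
apply: intgD => //; last exact: (cyl_intg c5).
apply: intgB => //; last by apply: intg_sum => // j _; exact: (cM _ _ (I_mom j) (cgr j)).
apply: intgB => //; last exact: (cM _ _ I_rho cpt).
apply: intgB => //; last exact: (cM _ _ I_prs ctr).
apply: intgB => //; first by apply: intg_sum => // j _; exact: (cM _ _ (I_mom j) (cw j)).
by apply: intg_sum => // i _; apply: intg_sum => // j _; exact: (cM _ _ (I_cnv i j) (cgp i j)).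
Qed.

Definition gap (z : R * space) : R := enorm (gu z.1 z.2 - gU z.1 z.2) ^+ 2.

Definition mean_int (t : R) : R :=
  \int[lebN]_(x in Omega) integrand_mean (nu (t, x)) p (r t x) (U t x) (gU t x) (sforce t x).

Lemma fixed_time : {ae leb, forall t, 0 < t < T ->
  [/\ intg lebN Omega (fun x => integrand_mean (nu (t, x)) p (r t x) (U t x) (gU t x) (sforce t x)),
    - time_rate t + slice q2lim t <= mean_int t + slice viscous_rate t - mu * slice gap t,
    intg lebN Omega (fun x => \sum_i (vel i (t, x) - U t x ord0 i) ^+ 2) &
    \int[lebN]_(x in Omega) (\sum_i (vel i (t, x) - U t x ord0 i) ^+ 2) <=
      16 * bd%:R ^+ 2 * slice gap t]}.
Proof.
have IV : intg lam Q (fun z => inner (viscous_stress mu eta (gu z.1 z.2)) (gU z.1 z.2)).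
  apply: visc_intg => i j; last by apply: (cyl_L2 (f := fun t x => gU t x i j)); exact: str_cgU.
  by have [_] := vel_L2 i; exact.
have hs1 := ae_S3 (ae_slice I_rho) (ae_slice I_prs) (ae_forall_fin (fun i => ae_slice (I_mom i)))
  (fun t a b c => conj a (conj b c)).
have hs2 := ae_forall_fin (fun i => ae_forall_fin (fun j => ae_slice (I_cnv i j))).
have hs3 := ae_S2 (ae_slice IV) (ae_slice I_q2lim) (fun t a b => conj a b).
have hs := ae_S3 hs1 hs2 hs3 (fun t a b c => conj a (conj b c)).
have ht := ae_S3 time_rate_cvg (strong_Ut_continuous str) ae_Wapp
  (fun t a b c => conj a (conj b c)).
apply: (ae_S3 hs ht strong_force) => t [[s1 [s2 s3]] [s4 [s5 s6]]] [h1 [h2 h3]] h4 tt.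
have [dS [wd sf]] := h4 tt; have [E1 _] := h1 tt.
have tT : 0 <= t <= T by case/andP: tt => a b; rewrite !ltW.
have r0 x : closure Omega x -> 0 < r t x by move=> cx; exact: (strong_r_gt0 str).
have cl (f : R -> space -> R) : cyl f -> clc Omega (f t) by move=> cf; exact: (clc_cyl cf tT).
have cr : clc Omega (r t) by apply: cl; exact: str_cr.
have cgr i : clc Omega (fun x => gr t x ord0 i) by apply: (cl (fun t x => gr t x ord0 i)); exact: str_cgr.
have cU i : clc Omega (fun x => U t x ord0 i) by apply: (cl (fun t x => U t x ord0 i)); exact: str_cU.
have cgU i j : clc Omega (fun x => gU t x i j) by apply: (cl (fun t x => gU t x i j)); exact: str_cgU.
have cUt i : clc Omega (fun x => Ut t x ord0 i) by split; exact: h2.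
have dr x j : Omega x -> is_derive x (e_ j) (r t) (gr t x ord0 j) by move=> Ox; exact: str_dr.
have dU x i j : Omega x -> is_derive x (e_ j) (fun x => U t x ord0 i) (gU t x i j) by move=> Ox; exact: str_dU.
have U0 x : (closure Omega `\` Omega) x -> U t x = 0 by move=> bx; exact: (strong_boundary str).
have W i : Wapp Omega (fun x => bracket (nu (t, x)) (fun y => y.2 ord0 i)) (fun j x => gu t x i j) by exact: h3.
have [J1 J2] := fixed_time_estimate oO OA pl mu0 eta0 (s1 tt) (fun i => s3 i tt) (fun i j => s4 i j tt) (s2 tt) W
  r0 cr cgr cU cgU cUt dr dU U0 wd sf.
have [K1 K2 K3] := fixed_time_poincare oO OA W cU cgU dU U0.
split => //; apply: le_trans J2; rewrite E1 -addrA lerD2l.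
pose q x := - (\sum_i \sum_j cnv i j (t, x) * gU t x i j) - prs (t, x) * \tr (gU t x) +
     (\sum_j mom j (t, x) * \sum_i U t x ord0 i * gU t x i j)
     - derive1 p (r t x) / r t x * (rho (t, x) * rt t x + \sum_j mom j (t, x) * gr t x ord0 j)
     + derive1 p (r t x) * rt t x.
pose v x := inner (viscous_stress mu eta (gu t x)) (gU t x).
have qE x : q2lim (t, x) = q x + v x.
  rewrite /q2lim /q2gen /q /v /=.
  have -> : \sum_j mom j (t, x) * (\row_j0 \sum_i U t x ord0 i * gU t x i j0) ord0 j =
      \sum_j mom j (t, x) * \sum_i U t x ord0 i * gU t x i j by apply: eq_bigr => j _; rewrite mxE.
  have -> : \sum_j mom j (t, x) * gpsir t x ord0 j = derive1 p (r t x) / r t x * \sum_j mom j (t, x) * gr t x ord0 j.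
    by rewrite mulr_sumr; apply: eq_bigr => j _; rewrite mxE; ring.
  have -> : psirt t x = derive1 p (r t x) / r t x * rt t x by [].
  move: (rho (t, x)) (rt t x) (prs (t, x) * _) (derive1 p (r t x)) (r t x) (\sum_i \sum_j _) (inner _ _)
    (\sum_j mom j (t, x) * gr _ _ _ _) (\sum_j mom j (t, x) * _) => *; ring.
have iq : intg lebN Omega q.
  apply: (@eq_intg _ _ _ lebN Omega (fun x => q2lim (t, x) - v x)) => //; first by move=> x _; rewrite qE addrK.
  by apply: intgB; [exact: mO|exact: (s6 tt)|exact: (s5 tt)].
rewrite -(RintD mO iq (s5 tt)) /slice.
by under eq_Rintegral do rewrite qE.
Qed.

Definition relative_energy_at (z : R * space) : R := rel_energy (nu z) p (r z.1 z.2) (U z.1 z.2).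

Lemma rel_energyE (k : {measure set state -> \bar R}) (a : R) (V : space) : rel_energy k p a V =
  boundary_density (bracket k (energy p)) (fun i => bracket k (fun y => momentum y ord0 i)) (bracket k fst) V a.
Proof.
rewrite /rel_energy /boundary_density enorm_sq_rV.
have -> : \sum_i V ord0 i ^+ 2 = \sum_i V ord0 i * V ord0 i by apply: eq_bigr => i _; rewrite expr2.
have -> : \sum_i V ord0 i * bracket k (fun y => momentum y ord0 i) = \sum_i bracket k (fun y => momentum y ord0 i) * V ord0 i.
  by apply: eq_bigr => i _; rewrite mulrC.
by move: (\sum_i _) (\sum_i _) => b e; ring.
Qed.

Lemma I_rel : intg lam Q relative_energy_at.
Proof.
have cM g f : intg lam Q g -> cyl f -> intg lam Q (fun z => g z * f z.1 z.2) := @cyl_intgM g f.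
have cU i : cyl (fun t x => U t x ord0 i) by exact: str_cU.
have c1 : cyl (fun t x => 2^-1 * \sum_i U t x ord0 i * U t x ord0 i).
  by apply: cylM; [exact: cyl_cst|apply: cyl_sum => i; exact: cylM].
have c2 : cyl psir by exact: cyl_psir.
have c3 : cyl (fun t x => p (r t x)) by exact: cyl_pr.
apply: (@eq_intg _ _ _ lam Q (fun z => boundary_density (ene z) (fun i => mom i z) (rho z) (U z.1 z.2) (r z.1 z.2))) => //.
  by move=> z _; rewrite /relative_energy_at rel_energyE.
apply: intgD => //; last exact: (cyl_intg c3).
apply: intgB => //; last exact: (cM _ _ I_rho c2).
apply: intgD => //; last exact: (cM _ _ I_rho c1).
apply: intgB => //; first exact: I_ene.
by apply: intg_sum => // i _; exact: (cM _ _ (I_mom i) (cU i)).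
Qed.

Lemma regular_rel (k : {measure set state -> \bar R}) (a : R) (V : space) : regular k -> 0 < a ->
  br k (relative_energy_density p a V) (rel_energy k p a V).
Proof. by move=> [k1 i1 [i2 i3] i4 [i5 i6]] a0; exact: br_rel_energy. Qed.

Lemma density_ge0 (a : R) (V : space) (y : state) : 0 < a -> 0 <= y.1 -> 0 <= relative_energy_density p a V y.
Proof.
move=> a0 y0; rewrite redE// addr_ge0//; first by rewrite mulr_ge0 ?sqr_ge0// mulr_ge0.
by have [] := Prel_ge0 pl y0 a0.
Qed.

Lemma br_density_ge0 (k : {measure set state -> \bar R}) (a : R) (V : space) e :
  br k (relative_energy_density p a V) e -> 0 < a -> 0 <= e.
Proof. by move=> [_ <-] a0; apply: Rintegral_ge0 => y y0; exact: density_ge0. Qed.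

Lemma rel_ge0 (k : {measure set state -> \bar R}) (a : R) (V : space) : regular k -> 0 < a ->
  0 <= rel_energy k p a V.
Proof. by move=> kr a0; exact: br_density_ge0 (regular_rel V kr a0) a0. Qed.

Lemma I_gap : intg lam Q gap.
Proof.
have cg i j : cyl (fun t x => gU t x i j) by exact: str_cgU.
apply: (@eq_intg _ _ _ lam Q (fun z => \sum_i \sum_j (gu z.1 z.2 i j - gU z.1 z.2 i j) ^+ 2)) => //.
  by move=> z _; rewrite /gap enorm_sq; apply: eq_bigr => i _; apply: eq_bigr => j _; rewrite !mxE.
apply: intg_sum => // i _; apply: intg_sum => // j _.
have [_ h] := vel_L2 i; have H : L2 lam Q (fun z => gu z.1 z.2 i j - gU z.1 z.2 i j).
  by apply: L2B => //; exact: (cyl_L2 (cg i j)).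
by case: H.
Qed.

(** * Absorption of the terms linear in the velocity difference *)

Variables (r1 r2 c C Bf d k0 k1 : R).
Hypothesis r10 : 0 < r1.
Hypothesis rr1 : forall t x, 0 <= t <= T -> closure Omega x -> r1 <= r t x.
Hypothesis rr2 : forall t x, 0 <= t <= T -> closure Omega x -> r t x <= r2.
Hypothesis c0 : 0 < c.
Hypothesis C0 : 0 < C.
Hypothesis cC : forall a, r1 <= a <= r2 -> forall s, 0 <= s ->
  [/\ r1 / 2 <= s <= 2 * r2 -> c * (s - a) ^+ 2 <= Prel (pressure_potential p) (P1 p) s a,
      s < r1 / 2 -> c <= Prel (pressure_potential p) (P1 p) s a,
      2 * r2 < s -> c * s <= Prel (pressure_potential p) (P1 p) s a &
      `|p s - derive1 p a * (s - a) - p a| <= C * Prel (pressure_potential p) (P1 p) s a].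
Hypothesis Bf0 : 0 <= Bf.
Hypothesis fB : forall t x i, 0 <= t <= T -> closure Omega x -> `|derive1 p (r t x) * gr t x ord0 i| <= Bf.
Hypothesis d0 : 0 < d.
Hypothesis d1 : 32 * d * bd%:R ^+ 2 <= mu / 2.

Definition force_bound (t : R) : R := N%:R * (r2 * S t + (r2 * (N%:R * (B * B)) + Bf)) + (r2 * S t + (r2 * (N%:R * (B * B)) + Bf)).

Hypothesis kle : forall t, 2 * (N%:R * B) + C * (N%:R * B) + r1^-1 + force_bound t ^+ 2 * absorb_const r1 c d <= k0 + k1 * S t ^+ 2.

Let r20 : 0 <= r2.
Proof.
have [x cx] := cO0; have h : 0 <= (0:R) <= T by rewrite lexx ltW.
exact: (ltW (lt_le_trans r10 (le_trans (rr1 h cx) (rr2 h cx)))).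
Qed.

Lemma force_le t x : 0 <= t <= T -> closure Omega x -> (forall i, `|Ut t x ord0 i| <= S t) ->
  enorm (sforce t x) ^+ 2 <= force_bound t ^+ 2.
Proof.
move=> tT cx h; have q0 : 0 <= r2 * S t + (r2 * (N%:R * (B * B)) + Bf).
  by rewrite addr_ge0 ?mulr_ge0// addr_ge0// !mulr_ge0.
apply: lerXn2r; rewrite ?nnegrE ?enorm_ge0//; first by rewrite /force_bound addr_ge0// mulr_ge0.
apply: enorm_row_le => // i; rewrite mxE -addrA; apply: (le_trans (ler_normD _ _)).
have ra : `|r t x| <= r2 by rewrite ger0_norm ?rr2// (le_trans (ltW r10) (rr1 tT cx)).
apply: lerD; first by rewrite normrM ler_pM.
apply: (le_trans (ler_normD _ _)); apply: lerD; last exact: fB.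
rewrite normrM ler_pM//; apply: norm_sum_le => j; rewrite normrM.
by apply: ler_pM => //; [exact: UB|exact: gUB].
Qed.

(** What remains of the right-hand side after the relative energy and the dissipation are used, with
    half of the gradient term kept for the final estimate. *)
Definition excess (t : R) : R := - time_rate t + slice q2lim t - slice viscous_rate t
  - (k0 + k1 * S t ^+ 2) * slice relative_energy_at t + mu / 2 * slice gap t.

(* The right-hand side is an integral of an arbitrary nonnegative function, so that no
   measurability in (t, x) of the variance of the parameterized measure is needed. *)
Lemma excess_le : {ae leb, forall t, 0 < t < T -> (((2 * d)^-1 * Num.max 0 (excess t))%:E <=
  \int[lebN]_(x in Omega) \int[nu (t, x)]_(y in state_space) (enorm (y.2 - velocity nu t x) ^+ 2)%:E)%E}.
Proof.
have ireg : {ae leb, forall t, {ae lebN, forall x, Q (t, x) -> regular (nu (t, x))}}.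
  by apply: (@ae_prodP _ _ _ _ _ leb lebN (fun t x => Q (t, x) -> regular (nu (t, x))));
    apply: (ae_S ae_regular) => -[t x].
have hs := ae_S2 (ae_slice I_rel) US (fun t a b => conj a b).
apply: (ae_S3 hs fixed_time ireg) => t [s1 us] h2 h3 tt.
have {}s1 := s1 tt; have {}us := us tt; have [J1 J2 J3 J4] := h2 tt.
have tT : 0 <= t <= T by case/andP: tt => a b; rewrite !ltW.
pose K := k0 + k1 * S t ^+ 2.
(* Subtracting 2 d |u - U|^2 leaves at most 2 d times the variance. The integral of the subtracted
   term is paid by Poincare's inequality, 2 d 16 bd^2 being at most mu/2. *)
pose Y x := integrand_mean (nu (t, x)) p (r t x) (U t x) (gU t x) (sforce t x) - K * relative_energy_at (t, x)
  - 2 * d * \sum_i (vel i (t, x) - U t x ord0 i) ^+ 2.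
have IK : intg lebN Omega (fun x => K * relative_energy_at (t, x)) by exact: intgZ.
have Iw : intg lebN Omega (fun x => 2 * d * \sum_i (vel i (t, x) - U t x ord0 i) ^+ 2) by exact: intgZ.
have Ib : intg lebN Omega (fun x => integrand_mean (nu (t, x)) p (r t x) (U t x) (gU t x) (sforce t x) - K * relative_energy_at (t, x)).
  exact: intgB.
have IY : intg lebN Omega Y by exact: intgB.
have IM : intg lebN Omega (fun x => Num.max 0 (Y x)).
  apply: (le_intg mO _ _ IY); first by apply: measurable_maxr => //; exact: intg_meas IY.
  move=> x _; rewrite maxElt; by case: ifP => // _; rewrite normr0.
have EY : excess t <= \int[lebN]_(x in Omega) Y x.
  rewrite /Y (RintB mO Ib Iw) (RintB mO J1 IK) (RintZ _ mO s1) (RintZ _ mO J3).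
  have gp : 0 <= slice gap t by apply: Rintegral_ge0 => x _; exact: sqr_ge0.
  have h := ler_wpM2l (ltW (mulr_gt0 (ltr0Sn R 1) d0)) J4.
  have h' := ler_wpM2r gp d1.
  rewrite /excess -/K -/(slice relative_energy_at t) -/(mean_int t).
  have e1 : 2 * d * (16 * bd%:R ^+ 2 * slice gap t) = 32 * d * bd%:R ^+ 2 * slice gap t by ring.
  have e2 : mu * slice gap t = mu / 2 * slice gap t + mu / 2 * slice gap t by field.
  rewrite e1 in h; rewrite e2 in J2; move: h h' J2; rewrite -/(slice relative_energy_at t).
  move: (K * slice relative_energy_at t) (mu / 2 * slice gap t) (32 * d * bd%:R ^+ 2 * slice gap t) => a1 a2 a3.
  move: (2 * d * _) (mean_int t) (slice q2lim t) (slice viscous_rate t) (time_rate t) => *; lra.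
have dp0 : 0 < (2 * d)^-1 by rewrite invr_gt0 mulr_gt0.
apply: (@le_trans _ _ (((2 * d)^-1 * \int[lebN]_(x in Omega) Num.max 0 (Y x))%:E)).
  rewrite lee_fin; apply: ler_wpM2l; first exact: ltW.
  rewrite ge_max; apply/andP; split.
    by apply: Rintegral_ge0 => x _; rewrite le_max lexx.
  apply: (le_trans EY); apply: ae_le_Rint => //; apply: aeW => x _; by rewrite le_max lexx orbT.
rewrite -RintZ// -Rint_fin//; last exact: intgZ.
apply: ae_nnint_le => //.
- by move=> x _; rewrite lee_fin mulr_ge0 ?(ltW dp0)// le_max lexx.
- by move=> x _; apply: integral_ge0 => y _; rewrite lee_fin sqr_ge0.
apply: (ae_S h3) => x hx Ox; have kr : regular (nu (t, x)) by apply: hx; split => //=; rewrite in_itv.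
set W := (\int[_]_(y in _) _)%E.
have W0 : (0 <= W)%E by apply: integral_ge0 => y _; rewrite lee_fin sqr_ge0.
(* An infinite variance makes the bound trivial; a finite one makes the second moment about U
   integrable. *)
have [Woo|Woo] := ltP W +oo%E; last by apply: le_trans Woo; rewrite leey.
have rx : 0 < r t x by exact: lt_le_trans r10 (rr1 tT (OcO Ox)).
have [n1 i1 [i2 i3] i4 [i5 i6]] := kr.
have mS := @measurable_state_space R N.
have mE (V : space) : measurable_fun state_space (fun y : state => enorm (y.2 - V) ^+ 2).
  rewrite (_ : (fun y => _) = (fun y : state => \sum_i (y.2 ord0 i - V ord0 i) ^+ 2)); last first.
    by apply/funext => y; rewrite enorm_sq_rV; apply: eq_bigr => i _; rewrite !mxE.
  by apply: measurable_sum => i; apply: measurable_funX; apply: measurable_funB => //; exact: intg_meas (i2 i).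
set u := velocity nu t x in W W0 Woo *.
have Iu : intg (nu (t, x)) state_space (fun y => enorm (y.2 - u) ^+ 2).
  apply: intgP; first exact: mE.
  by under eq_integral do rewrite ger0_norm ?sqr_ge0//; exact: Woo.
have WE : W = (bracket (nu (t, x)) (fun y => enorm (y.2 - u) ^+ 2))%:E by rewrite /W Rint_fin.
have bu := br_intg Iu.
have split2 (V : space) (y : state) : enorm (y.2 - V) ^+ 2 <= 2 * enorm (y.2 - u) ^+ 2 + 2 * enorm (u - V) ^+ 2.
  rewrite !enorm_sq_rV !mulr_sumr -big_split /=; apply: ler_sum => i _; rewrite !mxE.
  move: (y.2 ord0 i) (bracket _ _) (V ord0 i) => a b e; have := sqr_ge0 (a - 2 * b + e); nra.
have b2 := brD (brZ 2 bu) (br_cst n1 (2 * enorm (u - U t x) ^+ 2)).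
have IU : intg (nu (t, x)) state_space (fun y => enorm (y.2 - U t x) ^+ 2).
  apply: (le_intg mS (mE _) _ b2.1) => y _; rewrite !ger0_norm ?sqr_ge0//.
  by rewrite addr_ge0// mulr_ge0// sqr_ge0.
have bU := br_intg IU.
have wle := br_le bU b2 (fun y _ => split2 _ y).
have ra : r1 <= r t x <= r2 by rewrite rr1 ?rr2//; exact: OcO.
have /andP[ra1 ra2] := ra.
have IL := integrand_mean_le n1 pl i1 i2 i3 i4 i5 i6 r10 ra1 ra2 c0 C0 d0 (cC ra)
  (fun i j => gUB i j tT (OcO Ox)) B0 (force_le tT (OcO Ox) (fun i => us i x (OcO Ox))) bU.
have eu : enorm (u - U t x) ^+ 2 = \sum_i (vel i (t, x) - U t x ord0 i) ^+ 2.
  by rewrite enorm_sq_rV; apply: eq_bigr => i _; rewrite !mxE.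
have r0' := rel_ge0 (U t x) kr rx.
have kK := ler_wpM2r r0' (kle t).
rewrite WE lee_fin ler_pdivrMl ?mulr_gt0// ge_max; apply/andP; split.
  by rewrite !mulr_ge0 ?(ltW d0)//; apply: Rintegral_ge0 => y _; exact: sqr_ge0.
have hd := ler_wpM2l (ltW d0) wle.
have h := le_trans IL (lerD hd kK).
rewrite /Y -eu /relative_energy_at /= -/K; move: h; rewrite -/K.
move: (integrand_mean _ _ _ _ _ _) (rel_energy _ _ _ _) (bracket _ _) (enorm _ ^+ 2) => a1 a2 a3 a4 h.
by rewrite !lerBlDr; apply: (le_trans h); rewrite le_eqVlt; apply/orP; left; apply/eqP; ring.
Qed.

Section relative_energy_integral.

Lemma density_eq0 (a : R) (V : space) (y : state) : 0 < a -> 0 <= y.1 ->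
  relative_energy_density p a V y = 0 -> y = (a, V).
Proof.
move=> a0 y0; rewrite redE// => /eqP; have [h1 h2] := Prel_ge0 pl y0 a0.
have h3 : 0 <= 2^-1 * y.1 * enorm (y.2 - V) ^+ 2 by rewrite mulr_ge0 ?sqr_ge0// mulr_ge0.
rewrite paddr_eq0// => /andP[/eqP e1 /eqP /h2 e2].
rewrite [LHS]surjective_pairing e2; congr pair; apply/eqP; rewrite -subr_eq0; apply/eqP/rowP => i.
move/eqP: e1; rewrite e2 mulf_eq0 mulf_eq0 invr_eq0 pnatr_eq0/= (gt_eqF a0)/= enorm_sq_rV.
rewrite psumr_eq0 => [/allP h|j _]; last exact: sqr_ge0.
by have := h i (mem_index_enum _); rewrite sqrf_eq0 [RHS]mxE => /eqP.
Qed.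

Variables (k : space -> {measure set state -> \bar R}) (a : space -> R) (V : space -> space).
Hypothesis a0 : forall x, Omega x -> 0 < a x.

Let dge x y : Omega x -> state_space y -> 0 <= relative_energy_density p (a x) (V x) y.
Proof. by move=> Ox y0; apply: density_ge0 => //; exact: a0. Qed.

(** The inner extended integral is identified only almost everywhere, so equality is obtained from
    two inequalities between integrals of nonnegative functions. *)
Lemma relative_energyE : {ae lebN, forall x, Omega x ->
    br (k x) (relative_energy_density p (a x) (V x)) (rel_energy (k x) p (a x) (V x))} ->
  intg lebN Omega (fun x => rel_energy (k x) p (a x) (V x)) ->
  relative_energy p Omega k a V = (\int[lebN]_(x in Omega) rel_energy (k x) p (a x) (V x))%:E.
Proof.
move=> hb Ir; set e := fun x => rel_energy (k x) p (a x) (V x).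
have e0 : {ae lebN, forall x, Omega x -> 0 <= e x}.
  by apply: (ae_S hb) => x h Ox; exact: (br_density_ge0 (h Ox) (a0 Ox)).
have Ia : intg lebN Omega (fun x => `|e x|) by exact: intg_norm.
have -> : \int[lebN]_(x in Omega) e x = \int[lebN]_(x in Omega) `|e x|.
  by apply: ae_eq_Rint => //; [exact: intg_meas Ir|exact: intg_meas Ia|apply: (ae_S e0) => x h Ox; rewrite ger0_norm ?h].
rewrite -Rint_fin//.
have f0 x : Omega x -> (0 <= \int[k x]_(y in state_space) (relative_energy_density p (a x) (V x) y)%:E)%E.
  by move=> Ox; apply: integral_ge0 => y y0; rewrite lee_fin; exact: dge.
have fe : {ae lebN, forall x, Omega x ->
    (\int[k x]_(y in state_space) (relative_energy_density p (a x) (V x) y)%:E = (`|e x|)%:E)%E}.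
  apply: (ae_S2 hb e0) => x h1 h2 Ox; have [i1 e1] := h1 Ox.
  by rewrite ger0_norm ?h2// /e -e1 Rint_fin//; exact: measurable_state_space.
apply/eqP; rewrite eq_le; apply/andP; split; apply: ae_nnint_le => //.
- by apply: (ae_S fe) => x h Ox; rewrite h.
- by apply: (ae_S fe) => x h Ox; rewrite h.
Qed.

Lemma relative_energy_dirac : {ae lebN, forall x, Omega x -> is_dirac (k x) (a x, V x)} ->
  relative_energy p Omega k a V = 0%E.
Proof.
move=> hd; apply/eqP; rewrite eq_le; apply/andP; split; last first.
  apply: integral_ge0 => x Ox; apply: integral_ge0 => y y0; rewrite lee_fin; exact: dge.
have z : (\int[lebN]_(x in Omega) 0 = 0 :> \bar R)%E by rewrite integral0.
rewrite -[leRHS]z; apply: ae_nnint_le => //.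
  by move=> x Ox; apply: integral_ge0 => y y0; rewrite lee_fin; exact: dge.
apply: (ae_S hd) => x h Ox.
have z' : (\int[k x]_(y in state_space) 0 = 0 :> \bar R)%E by rewrite integral0.
rewrite -[leRHS]z'; apply: ae_nnint_le => //.
  by move=> y y0; rewrite lee_fin; exact: dge.
apply: (ae_S (dirac_ae (h Ox))) => y -> _; rewrite lee_fin redE ?a0// /= subrr.
have -> : enorm (0 : space) = 0 by rewrite /enorm /inner big1 ?sqrtr0// => i _; rewrite big1// => j _; rewrite mxE mulr0.
by rewrite expr0n /= mulr0 add0r /Prel (subrr (a x)) mulr0 subr0 subrr.
Qed.

Lemma rel_energy_eq0_dirac x : Omega x -> k x setT = 1%E -> k x (~` state_space) = 0%E ->
  br (k x) (relative_energy_density p (a x) (V x)) 0 -> is_dirac (k x) (a x, V x).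
Proof.
move=> Ox km kc [i1 e1]; apply: ae_dirac => //.
have mS := @measurable_state_space R N.
have hc : {ae k x, forall y, state_space y}.
  by exists (~` state_space); split => //; exact: measurableC.
have h0 : {ae k x, forall y, state_space y -> 0 <= relative_energy_density p (a x) (V x) y}.
  by apply: aeW => y y0; exact: dge.
have h := ge0_Rint_eq0 mS i1 h0 (_ : _ <= 0).
apply: (ae_S2 (h _) hc) => [|y e y0]; first by rewrite -/(bracket _ _) e1.
exact: density_eq0 (a0 Ox) y0 (e y0).
Qed.

End relative_energy_integral.

(** * The integral inequality and its consequences *)

Hypothesis d2 : 2 * d * cP <= 2^-1.
Hypothesis k00 : 0 <= k0.
Hypothesis k10 : 0 <= k1.
Hypothesis IS2 : intg leb `[0, T] (fun t => S t ^+ 2).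

Local Notation energy_gap := (slice relative_energy_at).
Local Notation Kd := defect_const.

Definition initial_energy : R := \int[lebN]_(x in Omega) rel_energy (nu0 x) p (r 0 x) (U 0 x).

Let inn tau (t : R) : tau < T -> t <> 0 -> 0 <= t <= tau -> 0 < t < T.
Proof.
move=> tT tn /andP[a b]; rewrite lt_neqAle a andbT (le_lt_trans b tT) andbT.
by apply/eqP => e; exact: tn (esym e).
Qed.

Let ireg : {ae leb, forall t, {ae lebN, forall x, Q (t, x) -> regular (nu (t, x))}}.
Proof.
by apply: (@ae_prodP _ _ _ _ _ leb lebN (fun t x => Q (t, x) -> regular (nu (t, x))));
  apply: (ae_S ae_regular) => -[t x].
Qed.

Let rpos t x : 0 <= t <= T -> closure Omega x -> 0 < r t x.
Proof. by move=> tT cx; exact: lt_le_trans r10 (rr1 tT cx). Qed.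

(** Gronwall's argument starts from a bounded function; this bound does not enter the final
    constant. *)
Lemma slice_rel_bounded : exists M : R, {ae leb, forall t, 0 < t < T -> 0 <= energy_gap t <= M}.
Proof.
have [M M0 HM] := mom_bound.
have cpr : cyl (fun t x => p (r t x)) by exact: cyl_pr.
have [Mp Mp0 hMp] := cyl_bounded (compact_closure_bounded OA) cpr.
pose e0 := \int[lebN]_(x in Omega) bracket (nu0 x) (energy p).
have ip : intg lebN Omega (fun=> Mp) by apply: (cl_intg oO OA); exact: cl_cst.
pose a := 2^-1 * (N%:R * (B * B)) + Br.
have a0 : 0 <= a by rewrite addr_ge0// !mulr_ge0.
exists (e0 + B * (\sum_(i < N) M) + a * M + \int[lebN]_(x in Omega) Mp).
have hs := ae_S3 (ae_slice I_rho) (ae_slice I_ene) (ae_forall_fin (fun i => ae_slice (I_mom i)))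
  (fun t a b c => conj a (conj b c)).
have hb := ae_S3 HM energy_bound (defect_ge0 dmv) (fun t a b c => conj a (conj b c)).
have hr := ae_S2 (ae_slice I_rel) ireg (fun t a b => conj a b).
apply: (ae_S3 hs hb hr) => t [s1 [s2 s3]] [b1 [b2 b3]] [ir rg] tt.
have {}s1 := s1 tt; have {}s2 := s2 tt; have {}ir := ir tt.
have [/andP[_ b4] b5] := b1 tt; have {}b2 := b2 tt; have {}b3 := b3 tt.
have tT : 0 <= t <= T by case/andP: tt => x y; rewrite !ltW.
have E00 : \int[lebN]_(x in Omega) (fun=> 0 : R) x = 0 by rewrite /Rintegral integral0.
have QO x : Omega x -> Q (t, x) by move=> Ox; split => //=; rewrite in_itv.
apply/andP; split.
  rewrite -[leLHS]E00; apply: ae_le_Rint => //; first exact: intg0.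
  by apply: (ae_S rg) => x hx Ox; apply: rel_ge0; [exact/hx/QO|exact: rpos tT (OcO Ox)].
have im : intg lebN Omega (fun x => \sum_i `|mom i (t, x)|).
  by apply: intg_sum => // i _; apply: intg_norm; exact: s3.
have imB : intg lebN Omega (fun x => B * \sum_i `|mom i (t, x)|) by exact: intgZ.
have irh : intg lebN Omega (fun x => a * rho (t, x)) by exact: intgZ.
have i1 : intg lebN Omega (fun x => ene (t, x) + B * \sum_i `|mom i (t, x)|) by exact: intgD.
have i2 : intg lebN Omega (fun x => ene (t, x) + B * (\sum_i `|mom i (t, x)|) + a * rho (t, x)) by exact: intgD.
apply: (@le_trans _ _ (\int[lebN]_(x in Omega) (ene (t, x) + B * (\sum_i `|mom i (t, x)|) + a * rho (t, x) + Mp))).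
  apply: ae_le_Rint => //; first exact: intgD.
  apply: (ae_S rg) => x hx Ox; have cx := OcO Ox.
  have [rho0 _] := regular_bounds (hx (QO _ Ox)).
  rewrite /relative_energy_at rel_energyE /boundary_density.
  have h1 : - (\sum_i mom i (t, x) * U t x ord0 i) <= B * \sum_i `|mom i (t, x)|.
    apply: le_trans (ler_norm _) _; rewrite normrN mulr_sumr; apply: (le_trans (ler_norm_sum _ _ _)).
    by apply: ler_sum => i _; rewrite normrM mulrC ler_wpM2r//; exact: UB.
  have h2 : 2^-1 * (\sum_i U t x ord0 i * U t x ord0 i) <= 2^-1 * (N%:R * (B * B)).
    rewrite ler_wpM2l//; apply: le_trans (ler_norm _) _; apply: norm_sum_le => i.
    by rewrite normrM ler_pM//; exact: UB.
  have h3 : - P1 p (r t x) <= Br by apply: le_trans (ler_norm _) _; rewrite normrN; exact: rBr.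
  have h4 : p (r t x) <= Mp by apply: le_trans (ler_norm _) _; exact: hMp.
  have h5 := ler_wpM2l rho0 h2; have h6 := ler_wpM2l rho0 h3.
  move: h1 h4 h5 h6; rewrite /a -/(rho (t, x)) -/(ene (t, x)) /=.
  rewrite [_ * rho (t, x)]mulrDl ![_ * rho (t, x)]mulrC mulrN.
  move: (- (\sum_i mom i (t, x) * _)) (B * _) (rho (t, x) * _) (rho (t, x) * _) (rho (t, x) * _) (rho (t, x) * _) (ene (t, x)) => *; lra.
rewrite (RintD mO i2 ip) (RintD mO i1 irh) (RintD mO s2 imB) (RintZ _ mO im) (RintZ _ mO s1).
rewrite lerD2r; apply: lerD; last by rewrite ler_wpM2l.
apply: lerD; first by apply: le_trans b2; rewrite lerDl.
rewrite ler_wpM2l// Rint_sum//; last by move=> i _; apply: intg_norm; exact: s3.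
by apply: ler_sum => i _; exact: b5.
Qed.

Local Notation k := (fun t => k0 + k1 * S t ^+ 2).

Let Irel := I_rel.
Let Ik : intg leb `[0, T] k.
Proof.
apply: intgD => //; last exact: intgZ.
by apply: continuous_compact_integrable; [exact: segment_compact|apply: cont_within => x; exact: cvg_cst].
Qed.

Lemma I_kE : intg leb `]0, T[ (fun t => k t * energy_gap t).
Proof.
have [M HM] := slice_rel_bounded.
have mE := intg_meas (slice_intg Irel).
have Iko := intg_oo Ik.
apply: (@ae_le_intg _ _ _ leb _ _ (fun t => M * k t)) => //.
- by apply: measurable_funM => //; exact: intg_meas Iko.
- apply: (ae_S HM) => t h; rewrite /= in_itv /= => tt; have /andP[h1 h2] := h tt.
  have K0 : 0 <= k t by rewrite addr_ge0// mulr_ge0// sqr_ge0.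
  by rewrite !normrM mulrC ler_wpM2r// ger0_norm// (le_trans h2)// ler_norm.
- exact: intgZ.
Qed.

Lemma integral_inequality : {ae leb, forall tau, 0 < tau < T ->
  energy_gap tau + mu / 2 * \int[leb]_(t in `[0, tau]) slice gap t + 2^-1 * D tau <=
  initial_energy + \int[leb]_(t in `[0, tau]) (k t * energy_gap t) + Kd * \int[leb]_(t in `[0, tau]) defect_rate t}.
Proof.
have hl := limit_inequality.
apply: (ae_S3 hl (mv_poincare dmv) (defect_ge0 dmv)) => tau h1 h2 h3 tt.
have {}h1 := h1 tt; have {}h2 := h2 tt; have {}h3 := h3 tt; have /andP[t0 tT] := tt.
have mI : measurable (`[0, tau]%classic : set R) by [].
have iF : intg leb `[0, tau] time_rate.
  by have [] := time_rate_limit tt.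
have Jq := I_q2lim.
have iq := slice_intg_cc Jq t0 (ltW tT).
have iV := slice_intg_cc I_visc t0 (ltW tT).
have iG := slice_intg_cc I_gap t0 (ltW tT).
have iK : intg leb `[0, tau] (fun t => k t * energy_gap t).
  apply: intg_cc => //; apply: (intgS _ _ _ I_kE) => // t /=; rewrite !in_itv /=.
  by move=> /andP[-> /lt_trans]; exact.
have iG2 : intg leb `[0, tau] (fun t => mu / 2 * slice gap t) by exact: intgZ.
have iN : intg leb `[0, tau] (fun t => - time_rate t) by exact: intgN.
have i1 : intg leb `[0, tau] (fun t => - time_rate t + slice q2lim t) by exact: intgD.
have i2 : intg leb `[0, tau] (fun t => - time_rate t + slice q2lim t - slice viscous_rate t) by exact: intgB.
have i3 : intg leb `[0, tau] (fun t => - time_rate t + slice q2lim t - slice viscous_rate t - k t * energy_gap t).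
  exact: intgB.
have iX : intg leb `[0, tau] excess by exact: intgD.
have LD f g : intg leb `[0, tau] f -> intg leb `[0, tau] g -> \int[leb]_(t in `[0, tau]) (f t + g t) =
    \int[leb]_(t in `[0, tau]) f t + \int[leb]_(t in `[0, tau]) g t by move=> If Ig; exact: RintD.
have LB f g : intg leb `[0, tau] f -> intg leb `[0, tau] g -> \int[leb]_(t in `[0, tau]) (f t - g t) =
    \int[leb]_(t in `[0, tau]) f t - \int[leb]_(t in `[0, tau]) g t by move=> If Ig; exact: RintB.
have LN f : intg leb `[0, tau] f -> \int[leb]_(t in `[0, tau]) (- f t) = - \int[leb]_(t in `[0, tau]) f t.
  by move=> If; exact: RintN.
have LZ a f : intg leb `[0, tau] f -> \int[leb]_(t in `[0, tau]) (a * f t) = a * \int[leb]_(t in `[0, tau]) f t.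
  by move=> If; exact: RintZ.
have EX : \int[leb]_(t in `[0, tau]) excess t = - (\int[leb]_(t in `[0, tau]) time_rate t) +
    \int[leb]_(t in `[0, tau]) slice q2lim t - \int[leb]_(t in `[0, tau]) slice viscous_rate t -
    \int[leb]_(t in `[0, tau]) (k t * energy_gap t) + mu / 2 * \int[leb]_(t in `[0, tau]) slice gap t.
  rewrite /excess (LD _ _ i3 iG2) (LB _ _ i2 iK) (LB _ _ i1 iV) (LD _ _ iN iq) (LN _ iF).
  by rewrite (LZ _ _ iG).
have iM : intg leb `[0, tau] (fun t => Num.max 0 (excess t)).
  apply: (@le_intg _ _ _ leb `[0, tau]%classic _ excess) => //; first by apply: measurable_maxr => //; exact: intg_meas iX.
  by move=> x _; rewrite maxElt; case: ifP => // _; rewrite normr0.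
have dp0 : 0 < (2 * d)^-1 by rewrite invr_gt0 mulr_gt0.
have hM : (2 * d)^-1 * \int[leb]_(t in `[0, tau]) Num.max 0 (excess t) <= cP * D tau.
  rewrite -lee_fin -(LZ _ _ iM) -Rint_fin//; last exact: intgZ.
  apply: le_trans h2; apply: ae_nnint_le.
  - by move=> t _; rewrite lee_fin mulr_ge0 ?(ltW dp0)// le_max lexx.
  - move=> t _; apply: integral_ge0 => x _; apply: integral_ge0 => y _; by rewrite lee_fin sqr_ge0.
  - apply: (ae_S2 excess_le (ae_neq 0)).
    by move=> t h tn; rewrite /= in_itv /= => /(inn tT tn); exact: h.
(* The Poincare-type inequality bounds the integrated excess by 2 d cP D, that is by half of the
   defect on the left-hand side. *)
have hX : \int[leb]_(t in `[0, tau]) excess t <= 2^-1 * D tau.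
  apply: (@le_trans _ _ (\int[leb]_(t in `[0, tau]) Num.max 0 (excess t))).
    by apply: ae_le_Rint => //; apply: aeW => t _; rewrite le_max lexx orbT.
  move: hM; rewrite ler_pdivrMl ?mulr_gt0// => hM; apply: (le_trans hM).
  by rewrite mulrA ler_wpM2r.
have EE : energy_gap tau = \int[lebN]_(x in Omega) boundary_density (ene (tau, x)) (fun i => mom i (tau, x)) (rho (tau, x)) (U tau x) (r tau x).
  by apply: eq_Rintegral => x _; rewrite /relative_energy_at rel_energyE.
have EE0 : initial_energy = \int[lebN]_(x in Omega) boundary_density (bracket (nu0 x) (energy p))
      (fun i => bracket (nu0 x) (fun y => momentum y ord0 i)) (bracket (nu0 x) fst) (U 0 x) (r 0 x).
  by apply: eq_Rintegral => x _; rewrite rel_energyE.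
have Eq : II tau q2lim = \int[leb]_(t in `[0, tau]) slice q2lim t.
  exact: (esym (slice_prod Jq t0 (ltW tT))).
move: h1; rewrite -EE -EE0 Eq; move: hX; rewrite EX.
move: (energy_gap tau) initial_energy (D tau) (Kd * \int[leb]_(t in `[0, tau]) defect_rate t) (mu / 2 * \int[leb]_(t in `[0, tau]) slice gap t) => a1 a2 a3 a4 a5.
move: (\int[leb]_(t in `[0, tau]) _) (\int[leb]_(t in `[0, tau]) _) (\int[leb]_(t in `[0, tau]) _) (\int[leb]_(t in `[0, tau]) _) => *; lra.
Qed.

Lemma br_initial : {ae lebN, forall x, Omega x ->
  br (nu0 x) (relative_energy_density p (r 0 x) (U 0 x)) (rel_energy (nu0 x) p (r 0 x) (U 0 x))}.
Proof.
have h1 := ae_S3 (mv_carried0 dmv) (mv_density_int0 dmv).1 (mv_energy_int0 dmv).1 (fun t a b c => conj a (conj b c)).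
apply: (ae_S2 h1 (ae_forall_fin (fun i => (mv_momentum_int0 dmv i).1))) => x [a1 [a2 a3]] a4 Ox.
apply: (br_rel_energy _ pl) => //.
- by apply: pker_mass; exact: a1.
- exact: a2.
- by move=> i; exact: a4.
- exact: a3.
- by apply: rpos; [rewrite lexx ltW|exact: OcO].
Qed.

Lemma I_initial : intg lebN Omega (fun x => rel_energy (nu0 x) p (r 0 x) (U 0 x)).
Proof.
have tT0 : 0 <= (0 : R) <= T by rewrite lexx ltW.
have [h _] := boundary_limit tT0 (mv_energy_int0 dmv).2
  (fun i => (mv_momentum_int0 dmv i).2) (mv_density_int0 dmv).2.
by apply: (@eq_intg _ _ _ lebN Omega _ _ mO _ h) => x _; rewrite rel_energyE.
Qed.

Lemma initial_energy_ge0 : 0 <= initial_energy.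
Proof.
have h : \int[lebN]_(x in Omega) (fun=> 0 : R) x = 0 by rewrite /Rintegral integral0.
rewrite -[leLHS]h; apply: ae_le_Rint => //; [exact: intg0|exact: I_initial|].
apply: (ae_S br_initial) => x hx Ox; apply: (br_density_ge0 (hx Ox)).
by apply: rpos; [rewrite lexx ltW|exact: OcO].
Qed.

(** The factor 2 compensates for the half of D contained in the quantity to which Gronwall's
    inequality is applied. *)
Definition growth_rate (t : R) : R := k t + 2 * Kd * (`|chi t| + `|xi t|).

Let Kd0 : 0 <= Kd.
Proof. by rewrite /defect_const !addr_ge0// ?mulr_ge0// ?addr_ge0// ?mulr_ge0. Qed.

Theorem relative_energy_bound (n : nat) : 2 * \int[leb]_(t in `[0, T]) growth_rate t <= n%:R ->
  {ae leb, forall tau, 0 < tau < T -> [/\ 0 <= energy_gap tau, 0 <= D tau &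
    energy_gap tau + \int[leb]_(t in `[0, tau]) slice gap t + D tau <= (3 + 2 / mu) * (1 + 2 ^+ n) * initial_energy]}.
Proof.
move=> hn.
have [M HM] := slice_rel_bounded.
have [MD HMD] := defect_bounded dmv.
have IC : intg leb `]0, T[ (fun t => `|chi t| + `|xi t|).
  by apply: intgD => //; apply: intg_norm; [exact: mv_chi dmv|exact: mv_xi dmv].
have Iko := intg_oo Ik.
have Ig : intg leb `]0, T[ growth_rate by apply: intgD => //; exact: intgZ.
have g0 t : 0 <= growth_rate t.
  by rewrite addr_ge0// ?mulr_ge0// addr_ge0// mulr_ge0// sqr_ge0.
pose F t := energy_gap t + 2^-1 * D t.
have mF : measurable_fun `]0, T[ F.
  apply: measurable_funD; first exact: intg_meas (slice_intg Irel).
  by apply: measurable_funM => //; exact: defect_measurable dmv.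
have FB : {ae leb, forall t, 0 < t < T -> 0 <= F t <= M + 2^-1 * MD}.
  apply: (ae_S3 HM HMD (defect_ge0 dmv)) => t a1 a2 a3 tt; have /andP[b1 b2] := a1 tt.
  have b3 := a2 tt; have b4 := a3 tt.
  by rewrite addr_ge0 ?mulr_ge0//= lerD// ler_wpM2l.
have IgF := gronwall_intg T0 Ig mF FB.
have IgFt tau : 0 < tau < T -> intg leb `[0, tau] (fun t => growth_rate t * F t).
  move=> /andP[_ tT]; apply: (intgS _ _ _ IgF) => // t /=; rewrite !in_itv /= => /andP[-> /le_trans]; apply.
  exact: ltW.
have pw tau : 0 < tau < T -> \int[leb]_(t in `[0, tau]) (k t * energy_gap t) + Kd * \int[leb]_(t in `[0, tau]) defect_rate t <=
    \int[leb]_(t in `[0, tau]) (growth_rate t * F t).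
  move=> tt; have /andP[t0 tT] := tt.
  have mI : measurable (`[0, tau]%classic : set R) by [].
  have iK : intg leb `[0, tau] (fun t => k t * energy_gap t).
    apply: intg_cc => //; apply: (intgS _ _ _ I_kE) => // t /=; rewrite !in_itv /=.
    by move=> /andP[-> /lt_trans]; exact.
  have iD := I_defect_rate_cc t0 (ltW tT).
  have iKD : intg leb `[0, tau] (fun t => Kd * defect_rate t) by exact: intgZ.
  have LZ : \int[leb]_(t in `[0, tau]) (Kd * defect_rate t) = Kd * \int[leb]_(t in `[0, tau]) defect_rate t.
    exact: RintZ.
  have LD : \int[leb]_(t in `[0, tau]) (k t * energy_gap t + Kd * defect_rate t) =
    \int[leb]_(t in `[0, tau]) (k t * energy_gap t) + \int[leb]_(t in `[0, tau]) (Kd * defect_rate t) by exact: RintD.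
  rewrite -LZ -LD; apply: ae_le_Rint => //; [exact: intgD|exact: IgFt|].
  apply: (ae_S3 HM (ae_neq 0) (defect_ge0 dmv)) => t a1 tn a3; rewrite /= in_itv /= => /(inn tT tn) tt'.
  have /andP[b1 _] := a1 tt'; have b4 := a3 tt'.
  rewrite /growth_rate /F /defect_rate.
  have K0 : 0 <= k t by rewrite addr_ge0// mulr_ge0// sqr_ge0.
  have L0 : 0 <= Kd * (`|chi t| + `|xi t|) by rewrite mulr_ge0// addr_ge0.
  have h1 := mulr_ge0 K0 b4; have h2 := mulr_ge0 L0 b1.
  rewrite -subr_ge0 (_ : _ - _ = 2^-1 * (k t * D t) + 2 * (Kd * (`|chi t| + `|xi t|) * energy_gap t)).
    by rewrite addr_ge0// mulr_ge0.
  by move: (k0 + k1 * S t ^+ 2) (`|chi t| + `|xi t|) Kd (energy_gap t) (D t) => *; field.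
have HF : {ae leb, forall t, 0 < t < T -> F t <= initial_energy + \int[leb]_(s in `[0, t]) (growth_rate s * F s)}.
  apply: (ae_S integral_inequality) => tau h tt; have {}h := h tt; have p1 := pw _ tt.
  have G0 : 0 <= mu / 2 * \int[leb]_(t in `[0, tau]) slice gap t.
    apply: mulr_ge0; first by rewrite divr_ge0 ?ltW.
    apply: Rintegral_ge0 => t _; apply: Rintegral_ge0 => x _; exact: sqr_ge0.
  move: h p1 G0; rewrite /F.
  move: (mu / 2 * \int[leb]_(t in `[0, tau]) slice gap t) (Kd * \int[leb]_(t in `[0, tau]) defect_rate t) (\int[leb]_(t in `[0, tau]) _) (\int[leb]_(t in `[0, tau]) _) (energy_gap tau) (D tau) initial_energy => *; lra.
have G := gronwall T0 Ig g0 mF FB initial_energy_ge0 HF hn.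
apply: (ae_S3 G integral_inequality (ae_S2 HM (defect_ge0 dmv) (fun t a b => conj a b))) => tau h1 h2 [h3 h4] tt.
have [_ {}h1] := h1 tt; have {}h2 := h2 tt; have /andP[{}h3 _] := h3 tt; have {}h4 := h4 tt.
have p1 := pw _ tt; split => //.
(* X bounds E + mu/2 I + D/2, so E + D is at most 3 X and I at most (2/mu) X. *)
set X := (1 + 2 ^+ n) * initial_energy; set I := \int[leb]_(t in `[0, tau]) slice gap t.
have I0 : 0 <= I by apply: Rintegral_ge0 => t _; apply: Rintegral_ge0 => x _; exact: sqr_ge0.
have J0 : 0 <= mu / 2 * I by apply: mulr_ge0 => //; rewrite divr_ge0 ?ltW.
have hX : energy_gap tau + mu / 2 * I + 2^-1 * D tau <= X.
  move: h1 h2 p1; rewrite -/I /X [(1 + _) * _]mulrDl mul1r.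
  move: (2 ^+ n * initial_energy) (mu / 2 * I) (Kd * \int[leb]_(t in `[0, tau]) defect_rate t) (\int[leb]_(t in `[0, tau]) _) (\int[leb]_(t in `[0, tau]) _) (energy_gap tau) (D tau) initial_energy => *; lra.
have hI : I <= 2 / mu * X.
  rewrite -(ler_pM2l (_ : 0 < mu / 2)) ?divr_gt0// mulrA (_ : mu / 2 * (2 / mu) = 1).
    by rewrite mul1r; move: hX h3 h4 J0; move: (mu / 2 * I) (energy_gap tau) (D tau) X => *; lra.
  by field; rewrite gt_eqF.
rewrite -mulrA -/X mulrDl; move: hX h3 h4 J0 hI.
by clearbody X I; move: (mu / 2 * I) (2 / mu * X) (energy_gap tau) (D tau) => *; lra.
Qed.

Theorem stability (n : nat) : 2 * \int[leb]_(t in `[0, T]) (growth_rate t) <= n%:R ->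
  {ae leb, forall tau, 0 < tau < T ->
    (relative_energy p Omega (fun x => nu (tau, x)) (r tau) (U tau) +
     \int[leb]_(t in `[0%R, tau]) \int[lebN]_(x in Omega) (enorm (gu t x - gU t x) ^+ 2)%:E +
     (D tau)%:E <=
     ((3 + 2 / mu) * (1 + 2 ^+ n))%:E * relative_energy p Omega nu0 (r 0%R) (U 0%R))%E} /\
  ({ae lebN, forall x, Omega x -> is_dirac (nu0 x) (r 0 x, U 0 x)} ->
   {ae leb, forall tau, 0 < tau < T -> D tau = 0} /\
   {ae lam, forall z, Q z -> is_dirac (nu z) (r z.1 z.2, U z.1 z.2)}).
Proof.
move=> hn.
have RB := relative_energy_bound hn.
have tT0 : 0 <= (0 : R) <= T by rewrite lexx ltW.
have E0E : relative_energy p Omega nu0 (r 0) (U 0) = initial_energy%:E.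
  apply: relative_energyE; first by move=> x Ox; apply: rpos => //; exact: OcO.
    exact: br_initial.
  exact: I_initial.
have Igap := I_gap.
have gap0 t : 0 <= slice gap t by apply: Rintegral_ge0 => x _; exact: sqr_ge0.
split.
  rewrite E0E; apply: (ae_S3 RB ireg (ae_slice Irel)) => tau h1 h2 h3 tt.
  have [e1 e2 e3] := h1 tt; have {}h3 := h3 tt; have /andP[t0 tT] := tt.
  have tT' : 0 <= tau <= T by rewrite !ltW.
  have -> : relative_energy p Omega (fun x => nu (tau, x)) (r tau) (U tau) = (energy_gap tau)%:E.
    apply: relative_energyE => //; first by move=> x Ox; apply: rpos => //; exact: OcO.
    apply: (ae_S h2) => x hx Ox; apply: regular_rel.
      by apply: hx; split => //=; rewrite in_itv.
    by apply: rpos => //; exact: OcO.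
  have iG := slice_intg_cc Igap t0 (ltW tT).
  have hG : (\int[leb]_(t in `[0%R, tau]) \int[lebN]_(x in Omega) (enorm (gu t x - gU t x) ^+ 2)%:E <=
      (\int[leb]_(t in `[0, tau]) slice gap t)%:E)%E.
    rewrite -Rint_fin//; apply: ae_nnint_le.
    - by move=> t _; apply: integral_ge0 => x _; rewrite lee_fin sqr_ge0.
    - by move=> t _; rewrite lee_fin.
    - apply: (ae_S2 (ae_slice Igap) (ae_neq 0)) => t ht tn; rewrite /= in_itv /= => ti.
      have t0T : 0 < t < T.
        case/andP: ti => a b; rewrite lt_neqAle a andbT (le_lt_trans b tT) andbT.
        by apply/eqP => e; exact: tn (esym e).
      by rewrite (Rint_fin mO (ht t0T)).
  rewrite -EFinM; apply: le_trans (leeD (leeD (lexx _) hG) (lexx _)) _.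
  by rewrite -!EFinD lee_fin.
move=> hd.
have E00 : initial_energy = 0.
  have /eqP := relative_energy_dirac (fun x Ox => rpos tT0 (OcO Ox)) hd.
  by rewrite E0E eqe => /eqP.
have Z : {ae leb, forall tau, 0 < tau < T -> energy_gap tau <= 0 /\ D tau = 0}.
  apply: (ae_S RB) => tau h tt; have [e1 e2] := h tt; rewrite E00 mulr0 => e3.
  have e4 : 0 <= \int[leb]_(t in `[0, tau]) slice gap t by apply: Rintegral_ge0 => t _; exact: gap0.
  split; last apply: le_anti; last rewrite e2 andbT;
    by move: e1 e2 e3 e4; move: (energy_gap tau) (D tau) (\int[leb]_(t in `[0, tau]) _) => *; lra.
split; first by apply: (ae_S Z) => tau h tt; have [] := h tt.
have rel0 : {ae lam, forall z, Q z -> 0 <= relative_energy_at z}.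
  apply: (ae_S ae_regular) => -[t x] h Qz; apply: (rel_ge0 _ (h Qz)).
  by case: Qz => /=; rewrite in_itv /= => /andP[a b] Ox; apply: rpos; [rewrite !ltW|exact: OcO].
(* A nonnegative function with vanishing integral over the whole cylinder is 0 for almost every (t,
   x) at once, as the Dirac property is stated on the product. *)
have le0 : \int[lam]_(z in Q) relative_energy_at z <= 0.
  have <- : \int[leb]_(t in `]0, T[) energy_gap t = \int[lam]_(z in Q) relative_energy_at z by exact: fub_Rint.
  have z0 : \int[leb]_(t in `]0, T[) (fun=> 0 : R) t = 0 by rewrite /Rintegral integral0.
  rewrite -[leRHS]z0; apply: ae_le_Rint => //; [exact: (slice_intg Irel)|exact: intg0|].
  by apply: (ae_S Z) => t h; rewrite /= in_itv /= => tt; have [] := h tt.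
have EZ : {ae lam, forall z, Q z -> relative_energy_at z = 0}.
  by apply: (@ge0_Rint_eq0 _ _ _ lam Q relative_energy_at); [exact: mQ|exact: Irel|exact: rel0|exact: le0].
apply: (ae_S3 EZ ae_regular (mv_carried dmv)) => -[t x] h1 h2 h3 Qz.
have /= [+ Ox] := Qz; rewrite in_itv /= => /andP[a b].
have tT : 0 <= t <= T by rewrite !ltW.
apply: (@rel_energy_eq0_dirac (fun y => nu (t, y)) (r t) (U t)) => //.
- by move=> y Oy; apply: rpos => //; exact: OcO.
- exact: prob_kernel.
- exact: h3.
- have := regular_rel (U t x) (h2 Qz) (rpos tT (OcO Ox)).
  by have := h1 Qz; rewrite /relative_energy_at /= => ->.
Qed.

End relative_energy_estimate.

(** * Dependence of the constant *)

Section constants.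
Context {R : realType}.

Lemma bounded_set_coord {N : nat} (Omega : set 'rV[R]_N) : bounded_set Omega ->
  exists bd : nat, forall x l, Omega x -> `|x ord0 l| <= bd%:R.
Proof.
move=> [M [_ HM]]; have [M' MM'] : exists M', M < M' by exists (M + 1); rewrite ltrDl.
exists (Num.bound `|M'|) => x l Ox; have h := HM M' MM' x Ox.
apply: (@le_trans _ _ `|x|).
  by rewrite [leRHS]/Num.Def.normr/= mx_normrE; exact: (le_bigmax _ _ (ord0, l)).
apply: (le_trans h); apply: (le_trans (ler_norm _)); apply: ltW; exact: archi_boundP.
Qed.

Lemma le_cylinder_normr {N : nat} T (Omega : set 'rV[R]_N) (f : R -> 'rV[R]_N -> R) t x :
  compact (closure Omega) -> continuous_cylinder T Omega f ->
  0 <= t <= T -> closure Omega x -> `|f t x| <= cylinder_normr T Omega f.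
Proof.
move=> cO cf tT cx; have [C _ hC] := cyl_bounded cO cf.
apply: (@le_sup_on _ _ (closed_cylinder T Omega) (fun z => `|f z.1 z.2|) (t, x) C).
  by move=> z [/= + z2]; rewrite in_itv /= => z1; exact: hC.
by split => //=; rewrite in_itv.
Qed.

Lemma le_cylinder_norm {N m n : nat} T (Omega : set 'rV[R]_N) (f : R -> 'rV[R]_N -> 'M[R]_(m, n)) t x i j :
  compact (closure Omega) -> (forall i j, continuous_cylinder T Omega (fun t x => f t x i j)) ->
  0 <= t <= T -> closure Omega x -> `|f t x i j| <= cylinder_norm T Omega f.
Proof.
move=> cO cf tT cx; apply: le_trans (entry_le_enorm (f t x) i j) _.
have hij (ij : 'I_m * 'I_n) : exists C : R, forall t x, 0 <= t <= T -> closure Omega x -> `|f t x ij.1 ij.2| <= C.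
  by have [C _ hC] := cyl_bounded cO (cf ij.1 ij.2); exists C.
have [C HC] := choice hij.
pose M := \sum_ij `|C ij|.
have M0 : 0 <= M by apply: sumr_ge0.
apply: (@le_sup_on _ _ (closed_cylinder T Omega) (fun z => enorm (f z.1 z.2)) (t, x) (m%:R * n%:R * M + M)).
  move=> z [/= + z2]; rewrite in_itv /= => z1; apply: enorm_le => // k l.
  apply: le_trans (HC (k, l) _ _ z1 z2) _; apply: le_trans (ler_norm _) _.
  by rewrite /M (bigD1 (k, l))//= lerDl; exact: sumr_ge0.
by split => //=; rewrite in_itv.
Qed.

End constants.

(** * The constant as a function of the norms alone *)

Theorem stability_constant (R : realType) (N : nat) (T : R) (T_gt0 : 0 < T)
  (Omega : set 'rV[R]_N) (Omega_domain : bounded_smooth_domain Omega)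
  (mu eta : R) (mu_gt0 : 0 < mu) (eta_ge0 : 0 <= eta)
  (p : R -> R) (p_law : pressure_law p) (cP : R) (a1 a2 a3 a4 a5 a6 a7 a8 : R) :
  exists C : R,
  forall (nu : R.-pker (R * 'rV[R]_N) ~> (R * 'rV[R]_N)%type)
    (nu0 : R.-pker 'rV[R]_N ~> (R * 'rV[R]_N)%type)
    (D : R -> R) (gu : R -> 'rV[R]_N -> 'M[R]_N)
    (rC : R -> 'I_1 -> 'I_N -> {charge set 'rV[R]_N -> \bar R}) (chi : R -> R)
    (rM : R -> 'I_N -> 'I_N -> {charge set 'rV[R]_N -> \bar R}) (xi : R -> R)
    (r : R -> 'rV[R]_N -> R) (U : R -> 'rV[R]_N -> 'rV[R]_N)
    (gr : R -> 'rV[R]_N -> 'rV[R]_N) (gU : R -> 'rV[R]_N -> 'M[R]_N)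
    (Ut : R -> 'rV[R]_N -> 'rV[R]_N),
  dissipative_mv_solution T Omega mu eta p cP nu nu0 D gu rC chi rM xi ->
  strong_solution T Omega mu eta p r U gr gU Ut ->
  cylinder_normr T Omega r = a1 -> cylinder_norm T Omega gr = a2 ->
  cylinder_normr T Omega (fun t x => (r t x)^-1) = a3 ->
  cylinder_norm T Omega U = a4 -> cylinder_norm T Omega gU = a5 -> L2C_norm T Omega Ut = a6 ->
  L1_norm T chi = a7 -> L1_norm T xi = a8 ->
  {ae lebesgue_measure, forall tau, 0 < tau < T ->
    (relative_energy p Omega (fun x => nu (tau, x)) (r tau) (U tau) +
     \int[lebesgue_measure]_(t in `[0%R, tau])
       \int[lebesgue_rV R N]_(x in Omega)
         (enorm (gu t x - gU t x) ^+ 2)%:E +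
     (D tau)%:E <=
     C%:E * relative_energy p Omega nu0 (r 0%R) (U 0%R))%E} /\
  ({ae lebesgue_rV R N, forall x, Omega x -> is_dirac (nu0 x) (r 0 x, U 0 x)} ->
   {ae lebesgue_measure, forall tau, 0 < tau < T -> D tau = 0} /\
   {ae (lebesgue_measure \x lebesgue_rV R N)%E, forall z,
     (`]0, T[%classic `*` Omega) z ->
     is_dirac (nu z) (r z.1 z.2, U z.1 z.2)}).
Proof.
have [ne oO _ bO _] := Omega_domain; have [bd OA] := bounded_set_coord bO.
have cO := compact_closure_bounded OA.
have TA : T <= (Num.bound T)%:R by apply/ltW/archi_boundP/ltW.
(* [a1] and 1/[a3] must bound r from above and below; if they are inconsistent, no strong solution
   has these norms and any constant will do. *)
have [/andP[a30 a31]|bad] := boolP ((0 < a3) && (a3^-1 <= a1)); last first.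
  exists 0 => nu nu0 D gu rC chi rM xi r U gr gU Ut dmv str e1 _ e3; exfalso; move/negP: bad; apply.
  have [x Ox] := ne; have cx : closure Omega x by exact: subset_closure.
  have tT0 : 0 <= (0 : R) <= T by rewrite lexx ltW.
  have r0 := strong_r_gt0 str tT0 cx.
  have cr : continuous_cylinder T Omega r by exact: (str_cr str).
  have cri : continuous_cylinder T Omega (fun t x => (r t x)^-1).
    apply: (cyl_comp cr (h := fun s : R => s^-1)) => t y tT cy; apply: (@continuousV _ _ id) => //.
    by rewrite gt_eqF//; exact: strong_r_gt0 str _ _ tT cy.
  have h1 := le_cylinder_normr cO cr tT0 cx; have h3 := le_cylinder_normr cO cri tT0 cx.
  rewrite e1 gtr0_norm// in h1; rewrite e3 gtr0_norm ?invr_gt0// in h3.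
  have a30 : 0 < a3 by apply: lt_le_trans h3; rewrite invr_gt0.
  by rewrite a30/=; apply: le_trans h1; rewrite invf_ple.
pose r1 := a3^-1; have r10 : 0 < r1 by rewrite invr_gt0.
have [c c0 [C C0 cC]] := pressure_bounds p_law r10 a31.
have rpos x : r1 <= x <= a1 -> 0 < x by move=> /andP[h _]; exact: lt_le_trans h.
have [m1 m10 hm1] : exists2 m : R, 0 <= m & forall x, r1 <= x <= a1 -> `|P1 p x| <= m.
  by apply: (bounded_segment a31) => x /rpos x0; apply: is_derive1_cont; exact: (dP1 p_law).
have [m2 m20 hm2] : exists2 m : R, 0 <= m & forall x, r1 <= x <= a1 -> `|derive1 p x| <= m.
  by apply: (bounded_segment a31) => x /rpos x0; exact: (p'_cont p_law).
pose B := `|a4| + `|a5|; pose Br := m1 + m2 * a3 * `|a2|; pose Bf := m2 * `|a2|.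
(* Each of the first two summands is one of the two smallness conditions on [d]; the summand 1 keeps
   the inverse positive. *)
pose d := (4 * `|cP| + 64 * bd%:R ^+ 2 / mu + 1)^-1.
have d0 : 0 < d by rewrite invr_gt0 ltr_wpDl// addr_ge0// ?mulr_ge0 ?exprn_ge0// ltW// invr_gt0.
have dE : d * (4 * `|cP| + 64 * bd%:R ^+ 2 / mu + 1) = 1 by rewrite mulVf// gt_eqF// -invr_gt0.
pose q := a1 * (N%:R * (B * B)) + Bf.
pose ab := absorb_const r1 c d.
(* The bound for div S is (N + 1)(a1 S + q); its square is at most 2 (N + 1)^2 (a1^2 S^2 + q^2),
   which defines [k1] and the last summand of [k0]. *)
pose n1 := (N%:R + 1) ^+ 2 : R.
pose k1 := 2 * n1 * a1 ^+ 2 * ab.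
pose k0 := 2 * (N%:R * B) + C * (N%:R * B) + r1^-1 + 2 * n1 * q ^+ 2 * ab.
(* An upper bound for the integral of the Gronwall rate over [0, T], in terms of the eight norms;
   twice this number, rounded up, counts the doublings. *)
pose rate := T * k0 + k1 * a6 ^+ 2 + 2 * @defect_const R N B Br * (a7 + a8).
exists ((3 + 2 / mu) * (1 + 2 ^+ (Num.bound (2 * `|rate|)))).
move=> nu nu0 D gu rC chi rM xi r U gr gU Ut dmv str e1 e2 e3 e4 e5 e6 e7 e8.
have cr : continuous_cylinder T Omega r by exact: (str_cr str).
have rp t x : 0 <= t <= T -> closure Omega x -> 0 < r t x by move=> tT cx; exact: strong_r_gt0 str _ _ tT cx.
have cri : continuous_cylinder T Omega (fun t x => (r t x)^-1).
  apply: (cyl_comp cr (h := fun s : R => s^-1)) => t y tT cy; apply: (@continuousV _ _ id) => //.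
  by rewrite gt_eqF//; exact: rp.
have rr2 t x : 0 <= t <= T -> closure Omega x -> r t x <= a1.
  by move=> tT cx; rewrite -e1; apply: le_trans (ler_norm _) _; exact: le_cylinder_normr.
have rr1 t x : 0 <= t <= T -> closure Omega x -> r1 <= r t x.
  move=> tT cx; rewrite /r1 invf_ple ?posrE// ?rp// -e3; apply: le_trans (ler_norm _) _.
  exact: (le_cylinder_normr cO cri).
have UB t x i : 0 <= t <= T -> closure Omega x -> `|U t x ord0 i| <= B.
  move=> tT cx; apply: (@le_trans _ _ a4); last by apply: le_trans (ler_norm _) _; rewrite lerDl.
  rewrite -e4; apply: le_cylinder_norm => // k l; rewrite ord1; exact: (str_cU str).
have gUB t x i j : 0 <= t <= T -> closure Omega x -> `|gU t x i j| <= B.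
  move=> tT cx; apply: (@le_trans _ _ a5); last by apply: le_trans (ler_norm _) _; rewrite lerDr.
  rewrite -e5; apply: le_cylinder_norm => // k l; exact: (str_cgU str).
have grB t x i : 0 <= t <= T -> closure Omega x -> `|gr t x ord0 i| <= `|a2|.
  move=> tT cx; apply: (@le_trans _ _ a2); last exact: ler_norm.
  rewrite -e2; apply: le_cylinder_norm => // k l; rewrite ord1; exact: (str_cgr str).
have rin t x : 0 <= t <= T -> closure Omega x -> r1 <= r t x <= a1 by move=> tT cx; rewrite rr1 ?rr2.
have B0 : 0 <= B by rewrite addr_ge0.
have Br0 : 0 <= Br by rewrite addr_ge0// !mulr_ge0// ltW.
have Bf0 : 0 <= Bf by rewrite mulr_ge0.
have rBr t x : 0 <= t <= T -> closure Omega x -> `|psir p r t x| <= Br.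
  by move=> tT cx; apply: le_trans (hm1 _ (rin _ _ tT cx)) _; rewrite lerDl !mulr_ge0// ltW.
have grBr t x j : 0 <= t <= T -> closure Omega x -> `|gpsir p r gr t x ord0 j| <= Br.
  move=> tT cx; rewrite mxE; apply: (@le_trans _ _ (m2 * a3 * `|a2|)); last by rewrite lerDr.
  rewrite !normrM; apply: ler_pM; [by rewrite mulr_ge0|by []| |exact: grB].
  apply: ler_pM; [by []|by []|by apply: hm2; exact: rin|].
  by rewrite -e3; exact: (le_cylinder_normr cO cri).
have fB t x i : 0 <= t <= T -> closure Omega x -> `|derive1 p (r t x) * gr t x ord0 i| <= Bf.
  by move=> tT cx; rewrite normrM; apply: ler_pM => //; [apply: hm2; exact: rin|exact: grB].
have [S [IS S0 IS2 SL US]] := time_majorant oO ne OA (strong_Ut_continuous str)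
  (strong_Ut_measurable str) (strong_Ut_L2 str).
have a10 : 0 <= a1 by apply: le_trans a31; exact: ltW.
have ab0 : 0 <= ab by rewrite !addr_ge0// invr_ge0 ?mulr_ge0// ?ltW// ?exprn_ge0// ltW.
have q0 : 0 <= q by rewrite addr_ge0// !mulr_ge0.
have n10 : 0 <= n1 by exact: sqr_ge0.
have u0 : 0 <= 4 * `|cP| by rewrite mulr_ge0.
have v0 : 0 <= 64 * bd%:R ^+ 2 / mu by rewrite divr_ge0 ?mulr_ge0 ?exprn_ge0// ltW.
have d1 : 32 * d * bd%:R ^+ 2 <= mu / 2.
  have h : d * (64 * bd%:R ^+ 2 / mu) <= 1.
    by apply: (@le_trans _ _ (d * (4 * `|cP| + 64 * bd%:R ^+ 2 / mu + 1))); last (by rewrite dE); rewrite ler_pM2l// addrAC lerDr addr_ge0.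
  rewrite -(ler_pM2l (_ : 0 < 2 / mu)) ?divr_gt0//.
  rewrite (_ : 2 / mu * (mu / 2) = 1); last by field; rewrite gt_eqF.
  by rewrite (_ : 2 / mu * _ = d * (64 * bd%:R ^+ 2 / mu))//; field; rewrite gt_eqF.
have d2 : 2 * d * cP <= 2^-1.
  have h : d * (4 * `|cP|) <= 1.
    by apply: (@le_trans _ _ (d * (4 * `|cP| + 64 * bd%:R ^+ 2 / mu + 1))); last (by rewrite dE); rewrite ler_pM2l// -addrA lerDl addr_ge0.
  have h' : d * cP <= d * `|cP| by rewrite ler_pM2l// ler_norm.
  by move: h h'; rewrite mulrCA -mulrA; move: (d * cP) (d * `|cP|) => *; lra.
have k10 : 0 <= k1 by rewrite !mulr_ge0// sqr_ge0.
have k00 : 0 <= k0 by rewrite !addr_ge0 ?mulr_ge0 ?sqr_ge0// ltW// invr_gt0.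
have kle t : 2 * (N%:R * B) + C * (N%:R * B) + r1^-1 + @force_bound R N B S a1 Bf t ^+ 2 * absorb_const r1 c d <=
    k0 + k1 * S t ^+ 2.
  rewrite /k0 -[leRHS]addrA lerD2l /k1 -/ab.
  rewrite (_ : 2 * n1 * q ^+ 2 * ab + _ = (2 * n1 * q ^+ 2 + 2 * n1 * a1 ^+ 2 * S t ^+ 2) * ab); last by ring.
  rewrite ler_wpM2r// /force_bound -/q (_ : N%:R * _ + _ = (N%:R + 1) * (a1 * S t + q)); last by ring.
  rewrite exprMn -/n1 (_ : 2 * n1 * q ^+ 2 + _ = n1 * (2 * q ^+ 2 + 2 * (a1 * S t) ^+ 2)); last by ring.
  rewrite ler_wpM2l//; have := sqr_ge0 (a1 * S t - q); move: (a1 * S t) => y h.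
  rewrite -subr_ge0 (_ : _ - _ = (y - q) ^+ 2)//; ring.
have Ichi : intg lebesgue_measure `[0, T] (fun t => `|chi t|).
  by apply: intg_norm; apply: intg_cc => //; exact: mv_chi dmv.
have Ixi : intg lebesgue_measure `[0, T] (fun t => `|xi t|).
  by apply: intg_norm; apply: intg_cc => //; exact: mv_xi dmv.
have Kd0 : 0 <= @defect_const R N B Br.
  by rewrite /defect_const; do ?[exact: ler0n|exact: B0|exact: Br0|apply: addr_ge0|apply: mulr_ge0].
have hn : 2 * \int[lebesgue_measure]_(t in `[0, T]) (@growth_rate R N B chi xi Br S k0 k1 t) <=
    (Num.bound (2 * `|rate|))%:R.
  apply: le_trans (ltW (archi_boundP _)); last by rewrite mulr_ge0.
  rewrite ler_pM2l//; apply: le_trans (ler_norm _); rewrite /growth_rate.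
  have mI : measurable (`[0, T]%classic : set R) by [].
  have i0 : intg (@lebesgue_measure R) `[0, T] (fun=> k0).
    by apply: continuous_compact_integrable; [exact: segment_compact|apply: cont_within => x; exact: cvg_cst].
  have i1 : intg (@lebesgue_measure R) `[0, T] (fun t => k1 * S t ^+ 2) by exact: intgZ.
  have i2 : intg (@lebesgue_measure R) `[0, T] (fun t => k0 + k1 * S t ^+ 2) by exact: intgD.
  have i3 : intg (@lebesgue_measure R) `[0, T] (fun t => `|chi t| + `|xi t|) by exact: intgD.
  have i4 : intg (@lebesgue_measure R) `[0, T] (fun t => 2 * @defect_const R N B Br * (`|chi t| + `|xi t|)) by exact: intgZ.
  have E1 : \int[lebesgue_measure]_(t in `[0, T]) (k0 + k1 * S t ^+ 2 + 2 * @defect_const R N B Br * (`|chi t| + `|xi t|)) =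
      \int[lebesgue_measure]_(t in `[0, T]) (k0 + k1 * S t ^+ 2) +
      \int[lebesgue_measure]_(t in `[0, T]) (2 * @defect_const R N B Br * (`|chi t| + `|xi t|)) by exact: RintD.
  have E2 : \int[lebesgue_measure]_(t in `[0, T]) (k0 + k1 * S t ^+ 2) =
      \int[lebesgue_measure]_(t in `[0, T]) k0 + \int[lebesgue_measure]_(t in `[0, T]) (k1 * S t ^+ 2) by exact: RintD.
  have E3 : \int[lebesgue_measure]_(t in `[0, T]) (2 * @defect_const R N B Br * (`|chi t| + `|xi t|)) =
      2 * @defect_const R N B Br * \int[lebesgue_measure]_(t in `[0, T]) (`|chi t| + `|xi t|) by exact: RintZ.
  have E4 : \int[lebesgue_measure]_(t in `[0, T]) (`|chi t| + `|xi t|) = a7 + a8 by rewrite -e7 -e8; exact: RintD.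
  have E5 : \int[lebesgue_measure]_(t in `[0, T]) (k1 * S t ^+ 2) = k1 * \int[lebesgue_measure]_(t in `[0, T]) (S t ^+ 2) by exact: RintZ.
  have E6 : \int[lebesgue_measure]_(t in `[0, T]) k0 = T * k0.
    rewrite Rintegral_cst//= lebesgue_measure_itv/= lte_fin T_gt0 /=.
    by rewrite subr0 mulrC.
  by rewrite E1 E2 E3 E4 E5 E6 /rate lerD2r lerD2l ler_wpM2l// -e6.
exact: (stability T_gt0 TA oO OA p_law str UB gUB mu_gt0 eta_ge0 dmv ne B0 Br0 rBr grBr IS S0 US
  r10 rr1 rr2 c0 C0 cC Bf0 fB d0 d1 kle d2 k00 k10 IS2 hn).
Qed.

Theorem theorem4p1 (R : realType) (N : nat) (N23 : N = 2%N \/ N = 3%N)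
  (T : R) (T_gt0 : 0 < T)
  (Omega : set 'rV[R]_N) (Omega_domain : bounded_smooth_domain Omega)
  (mu eta : R) (mu_gt0 : 0 < mu) (eta_ge0 : 0 <= eta)
  (p : R -> R) (p_law : pressure_law p) (cP : R) :
  exists Lambda : R -> R -> R -> R -> R -> R -> R -> R -> R,
  forall (nu : R.-pker (R * 'rV[R]_N) ~> (R * 'rV[R]_N)%type)
    (nu0 : R.-pker 'rV[R]_N ~> (R * 'rV[R]_N)%type)
    (D : R -> R) (gu : R -> 'rV[R]_N -> 'M[R]_N)
    (rC : R -> 'I_1 -> 'I_N -> {charge set 'rV[R]_N -> \bar R}) (chi : R -> R)
    (rM : R -> 'I_N -> 'I_N -> {charge set 'rV[R]_N -> \bar R}) (xi : R -> R)
    (r : R -> 'rV[R]_N -> R) (U : R -> 'rV[R]_N -> 'rV[R]_N)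
    (gr : R -> 'rV[R]_N -> 'rV[R]_N) (gU : R -> 'rV[R]_N -> 'M[R]_N)
    (Ut : R -> 'rV[R]_N -> 'rV[R]_N),
  dissipative_mv_solution T Omega mu eta p cP nu nu0 D gu rC chi rM xi ->
  strong_solution T Omega mu eta p r U gr gU Ut ->
  let C := Lambda
    (cylinder_normr T Omega r) (cylinder_norm T Omega gr)
    (cylinder_normr T Omega (fun t x => (r t x)^-1))
    (cylinder_norm T Omega U) (cylinder_norm T Omega gU) (L2C_norm T Omega Ut)
    (L1_norm T chi) (L1_norm T xi) in
  {ae lebesgue_measure, forall tau, 0 < tau < T ->
    (relative_energy p Omega (fun x => nu (tau, x)) (r tau) (U tau) +
     \int[lebesgue_measure]_(t in `[0%R, tau])
       \int[lebesgue_rV R N]_(x in Omega)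
         (enorm (gu t x - gU t x) ^+ 2)%:E +
     (D tau)%:E <=
     C%:E * relative_energy p Omega nu0 (r 0%R) (U 0%R))%E} /\
  ({ae lebesgue_rV R N, forall x, Omega x -> is_dirac (nu0 x) (r 0 x, U 0 x)} ->
   {ae lebesgue_measure, forall tau, 0 < tau < T -> D tau = 0} /\
   {ae (lebesgue_measure \x lebesgue_rV R N)%E, forall z,
     (`]0, T[%classic `*` Omega) z ->
     is_dirac (nu z) (r z.1 z.2, U z.1 z.2)}).
Proof.
(* The constant exists for each octuple of norms before any solution is given, so a choice function
   of the norms serves as [Lambda]. *)
pose W a1 a2 a3 a4 a5 a6 a7 a8 := cid (stability_constant T_gt0 Omega_domain mu_gt0 eta_ge0
  p_law cP a1 a2 a3 a4 a5 a6 a7 a8).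
exists (fun a1 a2 a3 a4 a5 a6 a7 a8 => sval (W a1 a2 a3 a4 a5 a6 a7 a8)).
move=> nu nu0 D gu rC chi rM xi r U gr gU Ut dmv str.
exact: (svalP (W _ _ _ _ _ _ _ _) _ _ _ _ _ _ _ _ _ _ _ _ _ dmv str erefl erefl erefl erefl
  erefl erefl erefl erefl).
Qed.
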